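(* Let $k\ge1$ be an integer and let $(X^{(n)}_i)_{i\in T_n}$ be a sequence of mean-zero random fields as in the context, with $\alpha$-mixing coefficients $(\alpha_{\ell,n})$ (of order $k+1$). Suppose that there exists $r\in[k+2,\infty]$ such that $$\liminf_{n\to\infty}\frac{\sigma_n^2}{|T_n|}>0,\qquad\sup_{n,\,i\in T_n}\|X_i^{(n)}\|_r<\infty.$$ Then for any $f\in\mathcal C^{k-1,1}(\mathbb R)\cap\mathcal C^{k,1}(\mathbb R)$, $m\in\mathbb N_+$ and real $\delta\in[0,1]\cap[0,r-1-k)$, with $L:=m+1+\lfloor|T_n|^{1/d}/2\rfloor$, $$\mathbb E[W_nf(W_n)]=\sum_{j=1}^{k-1}\frac{\kappa_{j+1}(W_n)}{j!}\mathbb E[\partial^jf(W_n)]+\frac{\widetilde\kappa_{k+1}}{k!}\mathbb E[\partial^kf(W_n)]+\mathcal O\Bigl(|f|_{k,1}|T_n|^{-k/2}m^{d(k+1)}$$ $$\qquad+|f|_{k-1,1}^{1-\delta}|f|_{k,1}^{\delta}|T_n|^{-(k-1+\delta)/2}m^{dk}\sum_{\ell=m+1}^{L}\ell^{d\delta-\delta}\alpha_{\ell,n}^{(r-k-1-\delta)/r}+|f|_{k-1,1}|T_n|^{-(k-1)/2}\sum_{\ell=m+1}^{L}\ell^{dk-1}\alpha_{\ell,n}^{(r-k-1)/r}\Bigr),$$ where $$\widetilde\kappa_{k+1}:=\kappa_{k+1}(W_n)+\sum_{H\in\mathcal G_0(k+1)}\frac{k!\,b_H}{k+2-u(k+1,H)}\,\mathcal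 S(H)$$ is defined in terms of genograms as in the context (with $T=T_n$, $X_i=X_i^{(n)}$ and neighborhood radius $m$). The quantity $\widetilde\kappa_{k+1}$ depends on the indexed joint distribution of $(X^{(n)}_i)_{i\in T_n}$ and on $m$, but not on $f$ or $\delta$, and it satisfies $$\bigl|\widetilde\kappa_{k+1}-\kappa_{k+1}(W_n)\bigr|\lesssim|T_n|^{-(k-1)/2}\sum_{\ell=m+1}^{L}\ell^{dk-1}\alpha_{\ell,n}^{(r-k-1)/r}.$$ The implied constants do not depend on $n$, $f$ or $m$.
   Context: Setting. Fix $d\in\mathbb N_+$. $T_1\subseteq T_2\subseteq\cdots$ are finite nonempty subsets of $\mathbb Z^d$ with $|T_n|\to\infty$. For each $n$, $(X^{(n)}_i)_{i\in T_n}$ is a family of real random variables with mean zero and finite second moments (no stationarity is assumed). Put $\sigma_n^2:=\operatorname{Var}(\sum_{i\in T_n}X^{(n)}_i)$ and $W_n:=\sigma_n^{-1}\sum_{i\in T_n}X^{(n)}_i$ (defined when $\sigma_n>0$; the estimates are for all sufficiently large $n$). $\|X\|_r:=(\mathbb E|X|^r)^{1/r}$ for $r<\infty$, and $\|X\|_\infty$ is the essential supremum norm. When $r=\infty$, ratios $(r-a)/r$ with finite $a$ are read as $1$. $\kappa_j(W_n)$ is the $j$-th cumulant; $\partial$ is differentiation. A factor with exponent zero is read as $1$. Mixing coefficients. For sub-$\sigma$-algebras $\mathcal A,\mathcal B$, $\alpha(\mathcal A,\mathcal B):=\sup_{A\in\mathcal A,B\in\mathcal B}|\mathbb P(A\cap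 B)-\mathbb P(A)\mathbb P(B)|$. For positive integers $\ell,q$, $\alpha^{[q]}_{\ell,n}:=0\vee\sup\{\alpha(\sigma(X^{(n)}_i:i\in U_1),\sigma(X^{(n)}_i:i\in U_2)):U_1,U_2\subseteq T_n,\ |U_1|\le q,\ d(U_1,U_2)\ge\ell\}$, where $d(U_1,U_2)=\min\{\|i_1-i_2\|:i_1\in U_1,i_2\in U_2\}$ and $\|\cdot\|$ is the maximum norm. Throughout, $\alpha_{\ell,n}:=\alpha_{\ell,n}^{[k+1]}$. Hölder spaces. $f\in\mathcal C^{k,\omega}(\mathbb R)$ means $f\in\mathcal C^k(\mathbb R)$ and $|f|_{k,\omega}:=\sup_{x\ne y}|f^{(k)}(x)-f^{(k)}(y)|/|x-y|^\omega<\infty$. Genograms. An order-$k$ genogram $G=(V,E,(s_v)_{v\in V})$ is a rooted tree $(V,E)$ with $|G|:=|V|=k$ vertices and integer identifiers $s_v$ such that: (i) $s_v=0$ for the root and $s_v\ge-1$ for every other vertex; (ii) $s_v\ge0$ if $v$ is a child of the root; (iii) if a vertex has more than one child, the identifiers of its children are nonnegative and mutually different. Each genogram carries its unique compatible labeling $V=\{v[1],\dots,v[k]\}$: $v[1]$ is the root; for $1\le j\le k-1$, $v[j+1]$ is a child of the vertex with the largest label $\ell\le j$ having an as-yet unlabeled child; among siblings, a larger identifier gets a smaller label. Write $s_j$ for the identifier of $v[j]$. Two genograms are identified if their labeled trees and identifiers coincide; $\mathcal G(k)$ is the set of order-$k$ genograms and $\mathcal G_0(k)$ is the set of those with at least one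 identifier $\ge1$. For $2\le j\le k$, $p(j)$ is the label of the parent of $v[j]$; $A(j)$ is the set of labels of the ancestors of $v[j]$ (excluding $j$). Put $g(j):=\sup\{\ell:\ell=1\text{ or }(\ell\in A(j)\text{ and }s_\ell\ge1)\}$ and $u(j)=u(j,G):=\sup\{\ell\in\{j\}\cup A(j):s_\ell\ge0\}$. $G[j]$ is the order-$j$ genogram induced on $v[1],\dots,v[j]$. For a genogram $H$, $\gamma_H$ is its number of leaves (vertices with no children), $\tau_H$ its number of vertices with identifier $-1$, and $b_H:=(-1)^{\gamma_H+\tau_H}$ if $|H|=2$, $b_H:=(-1)^{\gamma_H+\tau_H}\prod_{j=2}^{|H|-1}\frac1{j+1-u(j,H)}$ if $|H|\ge3$. Constraint sets (for finite $T\subset\mathbb Z^d$, variables $(X_i)_{i\in T}$, $\sigma^2=\operatorname{Var}(\sum_{i\in T}X_i)>0$, positive integer $m$, and a fixed strict total order $\prec$ on $\mathbb Z^d$). For nonempty $J\subseteq T$ let $d(i,J):=\min_{j\in J}\|i-j\|$, $N(J):=\{i\in T:d(i,J)\le m\}$. Order the elements of $T\setminus N(J)$ increasingly first by $d(i,J)$ and then by $\prec$; $\operatorname{rk}(i,J)\in\{1,\dots,|T\setminus N(J)|\}$ is the position of $i$. For $s\ge0$, $N^{(s)}(J):=N(J)\cup\{i\in T\setminus N(J):\operatorname{rk}(i,J)\le s\}$. Put $B_1:=T$, $D_1:=\varnothing$, and recursively, for $j\ge2$ and given $i_1\in B_1\setminus D_1,\dots,i_{j-1}\in B_{j-1}\setminus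 D_{j-1}$: $B_j:=N^{(s_j)}(\{i_\ell:\ell\in A(j)\})\cup D_{g(j)}$ if $s_j\ge0$, $B_j:=B_{u(j)}$ if $s_j=-1$; $D_j:=N^{(s_j-1)}(\{i_\ell:\ell\in A(j)\})\cup D_{g(j)}$ if $s_j\ge1$, $D_j:=D_{g(j)}$ if $s_j\le0$. Operators and $\mathcal S$. $\mathcal D^*(Y):=\mathbb E[Y]$, $\mathcal D(Y):=Y-\mathbb E[Y]$, and for $t\ge2$, $\mathcal D^*(Y_1,\dots,Y_t):=\mathbb E[Y_1\mathcal D(Y_2,\dots,Y_t)]$, $\mathcal D(Y_1,\dots,Y_t):=Y_1\mathcal D(Y_2,\dots,Y_t)-\mathbb E[Y_1\mathcal D(Y_2,\dots,Y_t)]$. For an order-$k$ genogram $G$, $\mathcal E_G(Y_1,\dots,Y_k)$ is defined recursively: $\mathcal E_G(Y):=\mathbb E[Y]$ if $k=1$; in general let $q_0:=\sup\{j:j=1\text{ or }(2\le j\le k\text{ and }p(j)\ne j-1)\}$, let $q_1<\dots<q_w$ be the elements of $\{t:q_0+1\le t\le k,\ s_t\ge0\}$ (possibly $w=0$), and $\mathcal D^*_{\mathrm{last}}:=\mathcal D^*(Y_{q_0}\cdots Y_{q_1-1},\,Y_{q_1}\cdots Y_{q_2-1},\,\dots,\,Y_{q_w}\cdots Y_k)$ (read as $\mathcal D^*(Y_{q_0}\cdots Y_k)$ when $w=0$); then $\mathcal E_G:=\mathcal D^*_{\mathrm{last}}$ if $q_0=1$ and $\mathcal E_G:=\mathcal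 E_{G[q_0-1]}(Y_1,\dots,Y_{q_0-1})\cdot\mathcal D^*_{\mathrm{last}}$ if $q_0\ge2$. For $G\in\mathcal G(k)$, $\mathcal S(G):=\sigma^{-k}\sum_{i_1\in B_1\setminus D_1}\cdots\sum_{i_k\in B_k\setminus D_k}\mathcal E_G(X_{i_1},\dots,X_{i_k})$. Only finitely many genograms of a given order have $\mathcal S(G)\ne0$. *)

(* Defs.v *)
From HB Require Import structures.
From mathcomp Require Import all_boot all_order all_algebra finmap.
From mathcomp Require Import all_classical all_reals all_analysis.

Set Implicit Arguments.
Unset Strict Implicit.
Unset Printing Implicit Defensive.

Import Order.TTheory GRing.Theory Num.Theory.
Import numFieldNormedType.Exports.

Local Open Scope classical_set_scope.
Local Open Scope ring_scope.

Notation lattice d := 'rV[int]_d.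

Definition strict_total_order (I : eqType) (prec : rel I) : Prop :=
  [/\ irreflexive prec, transitive prec &
      forall x y, x != y -> prec x y || prec y x].

Definition maxnorm d (i : lattice d) : nat := (\max_(j < d) `|i ord0 j|)%N.

(* The minimum distance between two nonempty sets. The seed of the minimum is
   the distance between two actual members, so it does not affect the value;
   the distance to an empty set is a dummy value. *)
Definition dist d (I J : {fset lattice d}) : nat :=
  let seed := maxnorm (head 0 I - head 0 J) in
  \big[minn/seed]_(i <- I) \big[minn/seed]_(j <- J) maxnorm (i - j).

(* Every expectation in this file is that of an integrable variable under the
   moment assumptions of the theorem, so that no information is lost by [fine]. *)
Definition Ex dO (Omega : measurableType dO) (R : realType)
  (P : probability Omega R) (Y : Omega -> R) : R := fine ('E_P[Y])%E.

(* j! times the coefficient of t^j in the formal power series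
   log (sum_q E[W^q] t^q / q!); only the moments of order at most j matter, so
   both series are truncated at order j. *)
Definition cumulant dO (Omega : measurableType dO) (R : realType)
    (P : probability Omega R) (W : Omega -> R) (j : nat) : R :=
  let M : {poly R} :=
    \sum_(1 <= q < j.+1) (Ex P (fun w => W w ^+ q) / q`!%:R) *: 'X^q in
  j`!%:R * (\sum_(1 <= p < j.+1) ((-1) ^+ p.+1 / p%:R) *: M ^+ p)`_j.

Definition alpha_coef dO (Omega : measurableType dO) (R : realType)
    (P : probability Omega R) (A B : set (set Omega)) : R :=
  sup [set x | exists a b, [/\ A a, B b &
    x = `|fine (P (a `&` b)) - fine (P a) * fine (P b)|]].

Section Field.
Context (d : nat) (dO : measure_display) (Omega : measurableType dO)
  (R : realType) (P : probability Omega R) (X : lattice d -> {RV P >-> R}).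

(* The fields are defined on the whole lattice for convenience; the following
   notions only involve their restriction to T. *)
Definition sigma_field (U : {fset lattice d}) : set (set Omega) :=
  <<s \bigcup_(i in [set` U])
        preimage_set_system [set: Omega] (X i) measurable >>.

(* Only nonempty index sets are considered: the distance to an empty set is
   not defined, and its sigma-algebra is trivial. *)
Definition alpha_mixing (T : {fset lattice d}) (q l : nat) : R :=
  Num.max 0 (sup [set x | exists U1 U2 : {fset lattice d},
    [/\ (U1 != fset0) && (U2 != fset0),
        (U1 `<=` T)%fset && (U2 `<=` T)%fset,
        (#|` U1| <= q)%N,
        (l <= dist U1 U2)%N &
        x = alpha_coef P (sigma_field U1) (sigma_field U2)]]).

Definition field_sum (T : {fset lattice d}) (w : Omega) : R :=
  \sum_(i <- T) X i w.

Definition sigma2 (T : {fset lattice d}) : R := fine (variance P (field_sum T)).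

Definition sigma (T : {fset lattice d}) : R := Num.sqrt (sigma2 T).

Definition normalized_sum (T : {fset lattice d}) (w : Omega) : R :=
  (sigma T)^-1 * field_sum T w.

(* The law of the field as a function of sets of configurations; the law of
   (X_i)_{i in T} is its restriction to [coordinate_sigma_field T]. *)
Definition joint_law (B : set (lattice d -> R)) := P [set w | B (fun i => X i w)].

End Field.

Definition coordinate_sigma_field (d : nat) (R : realType)
    (T : {fset lattice d}) : set (set (lattice d -> R)) :=
  <<s \bigcup_(i in [set` T])
        preimage_set_system [set: lattice d -> R] (fun x => x i) measurable >>.

Definition is_Ck (R : realType) (k : nat) (f : R -> R) : Prop :=
  (forall j, (j < k)%N -> forall x, derivable (derive1n j f) x 1) /\
  continuous (derive1n k f).

Definition holder_ereal (R : realType) (k : nat) (om : R) (f : R -> R) : \bar R :=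
  ereal_sup [set z | exists x y, x != y /\
    z = (`|derive1n k f x - derive1n k f y| / `|x - y| `^ om)%:E].

Definition holder_space (R : realType) (k : nat) (om : R) (f : R -> R) : Prop :=
  is_Ck k f /\ (holder_ereal k om f < +oo)%E.

Definition holder (R : realType) (k : nat) (om : R) (f : R -> R) : R :=
  fine (holder_ereal k om f).

(* A genogram is represented by its compatible labeling: entry j - 1 of the
   list is the pair (p(j), s_j) of the label of the parent and the identifier
   of v[j], with the convention p(1) = 0. Two genograms are identified exactly
   when these lists are equal. The order is the size of the list, and G[j]
   is [take j G]. *)
Definition genodata := seq (nat * int).

Definition par (G : genodata) (j : nat) : nat := (nth (0%N, 0) G j.-1).1.
Definition sid (G : genodata) (j : nat) : int := (nth (0%N, 0) G j.-1).2.

Definition is_genogram (G : genodata) : Prop :=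
  let k := size G in
  [/\ (0 < k)%N,
      par G 1 = 0%N /\
      (forall j, (2 <= j <= k)%N -> (1 <= par G j < j)%N),
      [/\ sid G 1 = 0,
          forall j, (2 <= j <= k)%N -> -1 <= sid G j,
          forall j, (2 <= j <= k)%N -> par G j = 1%N -> 0 <= sid G j &
          forall a b, (2 <= a <= k)%N -> (2 <= b <= k)%N -> a != b ->
            par G a = par G b ->
            [/\ 0 <= sid G a, 0 <= sid G b & sid G a != sid G b]],
     (* v[j+1] is a child of the vertex with the largest label l <= j that
        still has a child with label > j *)
      forall j, (1 <= j < k)%N -> par G j.+1 =
        (\max_(1 <= l < j.+1 | has (fun c => par G c == l) (iota j.+1 (k - j)))
           l)%N &
      forall a b, (2 <= a <= k)%N -> (2 <= b <= k)%N ->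
        par G a = par G b -> sid G b < sid G a -> (a < b)%N].

Definition genograms (k : nat) : set genodata :=
  [set G | is_genogram G /\ size G = k].

Definition genograms0 (k : nat) : set genodata :=
  [set G | genograms k G /\ exists2 j, (1 <= j <= k)%N & 1 <= sid G j].

(* The ancestors of v[j] are the iterated parents of j; the dummy parent 0 of
   the root is filtered out. *)
Definition ancestors (G : genodata) (j : nat) : seq nat :=
  [seq l <- iota 1 j.-1 | l \in traject (par G) (par G j) j].

Definition gidx (G : genodata) (j : nat) : nat :=
  maxn 1 (\max_(l <- ancestors G j | (1 <= sid G l)%R) l)%N.

Definition uidx (G : genodata) (j : nat) : nat :=
  (\max_(l <- j :: ancestors G j | (0 <= sid G l)%R) l)%N.

Definition nleaves (G : genodata) : nat :=
  count (fun j => ~~ has (fun c => par G c == j) (iota 1 (size G)))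
        (iota 1 (size G)).

Definition nneg (G : genodata) : nat :=
  count (fun j => sid G j == -1) (iota 1 (size G)).

Definition bcoef (R : realType) (G : genodata) : R :=
  (-1) ^+ (nleaves G + nneg G) *
  \prod_(2 <= j < size G) ((j.+1 - uidx G j)%N%:R)^-1.

Section Constraint.
Context (d : nat) (prec : rel (lattice d)) (T : {fset lattice d}) (m : nat).

Definition dist1 (i : lattice d) (J : {fset lattice d}) : nat :=
  dist [fset i]%fset J.

Definition nbhd (J : {fset lattice d}) : {fset lattice d} :=
  [fset i in T | (dist1 i J <= m)%N]%fset.

Definition rk (i : lattice d) (J : {fset lattice d}) : nat :=
  (#|` [fset i' in (T `\` nbhd J)%fset |
         (dist1 i' J < dist1 i J)%N ||
         ((dist1 i' J == dist1 i J) && prec i' i)]%fset|).+1.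

Definition nbhd_s (s : nat) (J : {fset lattice d}) : {fset lattice d} :=
  (nbhd J `|` [fset i in (T `\` nbhd J)%fset | (rk i J <= s)%N])%fset.

(* In the following, [ix] is the list i_1, ..., i_(j-1), so that i_l has
   position l - 1. The argument [n] is a recursion bound; since g(j) < j, and
   u(j) < j when s_j = -1, the bound n = j is never exhausted. *)
Definition anc_points (G : genodata) (ix : seq (lattice d)) (j : nat) :
    {fset lattice d} :=
  [fset i in [seq nth 0 ix l.-1 | l <- ancestors G j]]%fset.

Fixpoint Drec (G : genodata) (ix : seq (lattice d)) (n j : nat) :
    {fset lattice d} :=
  if n is n'.+1 then
    if (j <= 1)%N then fset0
    else if 1 <= sid G j then
      (nbhd_s `|sid G j - 1|%N (anc_points G ix j)
        `|` Drec G ix n' (gidx G j))%fset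
    else Drec G ix n' (gidx G j)
  else fset0.

Definition Dset G ix j := Drec G ix j j.

Fixpoint Brec (G : genodata) (ix : seq (lattice d)) (n j : nat) :
    {fset lattice d} :=
  if n is n'.+1 then
    if (j <= 1)%N then T
    else if 0 <= sid G j then
      (nbhd_s `|sid G j|%N (anc_points G ix j) `|` Dset G ix (gidx G j))%fset
    else Brec G ix n' (uidx G j)
  else T.

Definition Bset G ix j := Brec G ix j j.

End Constraint.

Section Operators.
Context (dO : measure_display) (Omega : measurableType dO)
  (R : realType) (P : probability Omega R).
Implicit Types (Y : Omega -> R) (Ys : seq (Omega -> R)).

(* [Dop Y Ys] and [Dstar Y Ys] apply the operators to the nonempty list
   Y :: Ys of arguments. *)
Fixpoint Dop Y Ys : Omega -> R :=
  if Ys is Y' :: Ys' then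
    let Z := fun w => Y w * Dop Y' Ys' w in fun w => Z w - Ex P Z
  else fun w => Y w - Ex P Y.

Definition Dstar Y Ys : R :=
  if Ys is Y' :: Ys' then Ex P (fun w => Y w * Dop Y' Ys' w) else Ex P Y.

Definition q0 (G : genodata) : nat :=
  maxn 1 (\max_(2 <= j < (size G).+1 | par G j != j.-1) j)%N.

Definition qs (G : genodata) : seq nat :=
  [seq t <- iota (q0 G).+1 (size G - q0 G) | 0 <= sid G t].

(* Y_a Y_(a+1) ... Y_(b-1), with labels starting from 1 *)
Definition block Ys (a b : nat) : Omega -> R :=
  fun w => \prod_(a <= t < b) nth (fun=> 0) Ys t.-1 w.

(* The starting points of the blocks are q_0, ..., q_w and their (excluded)
   end points are q_1, ..., q_w, |G| + 1. *)
Definition Dstar_last (G : genodata) Ys : R :=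
  let k := size G in
  Dstar (block Ys (q0 G) (head k.+1 (qs G)))
    [seq block Ys ab.1 ab.2 | ab <- zip (qs G) (rcons (behead (qs G)) k.+1)].

(* The recursion bound n = |G| is never exhausted. *)
Fixpoint EGrec (n : nat) (G : genodata) Ys : R :=
  if n is n'.+1 then
    if q0 G == 1%N then Dstar_last G Ys
    else EGrec n' (take (q0 G).-1 G) (take (q0 G).-1 Ys) * Dstar_last G Ys
  else 1.

Definition EG (G : genodata) Ys : R := EGrec (size G) G Ys.

End Operators.

Section GenogramSums.
Context (d : nat) (prec : rel (lattice d)) (dO : measure_display)
  (Omega : measurableType dO) (R : realType) (P : probability Omega R)
  (X : lattice d -> {RV P >-> R}) (T : {fset lattice d}) (m : nat).

(* The last n of the |G| nested sums, given the values [ix] of the indices of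
   the preceding ones. *)
Fixpoint nested_sum (G : genodata) (n : nat) (ix : seq (lattice d)) : R :=
  if n is n'.+1 then
    let j := (size ix).+1 in
    \sum_(i <- (Bset prec T m G ix j `\` Dset prec T m G ix j)%fset)
      nested_sum G n' (rcons ix i)
  else EG P G [seq (X i : Omega -> R) | i <- ix].

Definition Ssum (G : genodata) : R :=
  (sigma X T ^+ size G)^-1 * nested_sum G (size G) [::].

(* The argument is the order k + 1 of the modified cumulant. The sum over
   genograms is over an infinite set, but has finite support. *)
Definition kappa_tilde (k1 : nat) : R :=
  cumulant P (normalized_sum X T) k1 +
  \sum_(H \in genograms0 k1)
    ((k1.-1)`!%:R * bcoef R H / (k1.+1 - uidx H k1)%N%:R * Ssum H).

End GenogramSums.

(* (r - a) / r, read as 1 when r is infinite *)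
Definition rexp (R : realType) (r : \bar R) (a : R) : R :=
  if r is r'%:E%E then (r' - a) / r' else 1.

Definition Lcut (R : realType) (d m N : nat) : nat :=
  (m + 1 + Num.truncn ((N%:R : R) `^ (d%:R^-1) / 2))%N.

(* Main.v *)
(** It suffices to prove the expansion with [kappa_(k+1)(W)] in place of the modified
cumulant, and to bound the difference of the two: as |f^(k)| <= |f|_(k-1,1), replacing
one by the other costs a multiple of the last error term.

For the expansion, the genogram expansion is replaced by an induction. Let [Y] be a
function of the [X_j] with [j] in a small set [J], and let [S] be the scaled sum over the
sites that have not been deleted yet. To compare E[Y f^(o)(S)] with E[Y] E[f^(o)(W)],
the covariance of [Y] and f^(o)(S) is telescoped by deleting the sites in increasing
order of their distance to [J]. Each increment is Taylor expanded in the deleted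
variable, which gives terms of the same form with a larger [o]. If the deleted site is
at distance [l > m] from [J], the resulting product is almost centered given the
remaining sites, by Davydov's covariance inequality, and there are O(l^(d-1)) such
sites. Thus E[W f(W)] is a combination of the E[f^(j)(W)], [j <= k], up to the error, with
coefficients that do not depend on [f]. These are found by testing on [f = x^p]: the
error vanishes for [p < k], which gives [kappa_(j+1)/j!] for [j < k], and for [p = k] it
gives the last coefficient up to an admissible error.

For the modified cumulant, the sum over genograms and the sum over tuples of sites are
exchanged. A tuple occurs for boundedly many genograms, as it determines the positive
identifiers, which are ranks. If some identifier is positive, consider the vertex, among
those with a positive identifier, whose site is farthest from the sites of its ancestors,
at distance [l > m]. It splits one of the chains in the definition of [E_H] into two
groups at distance at least [l], so that [E_H] is bounded by a power of [alpha_l],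
whereas every site is within distance [l] of an earlier one. *)

Require Import Defs.
From mathcomp Require Import all_boot all_order all_algebra finmap.
From mathcomp Require Import all_classical all_reals all_analysis.
From mathcomp Require Import measurable_realfun ess_sup_inf.
From mathcomp Require Import ring lra zify.

Set Implicit Arguments.
Unset Strict Implicit.
Unset Printing Implicit Defensive.

Import Order.TTheory GRing.Theory Num.Theory.
Import numFieldNormedType.Exports.

Local Open Scope classical_set_scope.
Local Open Scope ring_scope.

(** * Functions with Hoelder derivatives *)

Section Taylor.
Variable R : realType.

(** The induction keeps track of a scale l, at first m, which grows to the distance of the deleted
    site from J when that is larger. At scale m only the size of Y is known, and the Taylor
    remainder is bounded through |f|_(k,1) with a gain of one factor 1/sigma. At a scale l > m it is
    bounded through |f|_(k-1,1), and the smallness is a power of alpha_l that all later terms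
    inherit; every covariance there involves at most k+1 factors X_i, whence the exponent (r-k-1)/r.
    Only f^(k) at scale m needs another argument, as there is no further derivative: whole shells of
    sites are removed at once and the increment of f^(k) is interpolated between its two bounds,
    which adds delta to the number of factors. The errors satisfy a recursion in which a further
    site costs l^d at the same scale, or a sum over the larger scales. Distances are cut off at L,
    where |T_n| <= (2(L-m))^d: all sites farther away form one last shell, whose size is absorbed by
    the terms with 2l >= L, since the mixing coefficients decrease in l. *)

Lemma mean_value_bound (f df : R -> R) (x c : R) :
  (forall y : R, is_derive y 1 f (df y)) ->
  (forall y, `|y| <= `|x| -> `|df y| <= c) -> `|f x - f 0| <= c * `|x|.
Proof.
move=> fdf dfc.
have cf (a b : R) : {within `[a, b], continuous f}.
  apply: continuous_subspaceT => y; apply/differentiable_continuous/derivable1_diffP.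
  exact: (@ex_derive _ _ _ _ _ _ _ (fdf y)).
have [x0|x0] := leP 0 x.
  have [y yx ->] := MVT_segment x0 (fun y _ => fdf y) (cf 0 x).
  rewrite subr0 normrM ler_wpM2r// dfc//.
  by move: yx; rewrite in_itv/= => /andP[y0 yx]; rewrite !ger0_norm.
have [y yx] := MVT_segment (ltW x0) (fun y _ => fdf y) (cf x 0).
rewrite distrC => ->; rewrite sub0r normrM normrN ler_wpM2r// dfc//.
by move: yx; rewrite in_itv/= => /andP[xy y0]; rewrite !ler0_norm ?lerN2// ltW.
Qed.

Definition taylor_poly (g : nat -> R -> R) (n : nat) (a : R) : {poly R} :=
  \poly_(q < n.+1) (g q a / q`!%:R).

Lemma taylor_polyE g n a x :
  (taylor_poly g n a).[x] = \sum_(q < n.+1) x ^+ q / q`!%:R * g q a.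
Proof. by rewrite horner_poly; apply: eq_bigr => q _; rewrite mulrC mulrA mulrAC. Qed.

Lemma deriv_taylor_poly g n a :
  (taylor_poly g n.+1 a)^`() = taylor_poly (fun q => g q.+1) n a.
Proof.
apply/polyP => i; rewrite coef_deriv !coef_poly ltnS; case: ltnP => // _; last by rewrite mul0rn.
rewrite factS natrM invfM -[LHS]mulr_natr -!mulrA; congr (_ * _).
by rewrite mulrCA mulVf ?mulr1// pnatr_eq0.
Qed.

(** Induction on [n]: the derivative of the remainder of order [n.+1] is the remainder of order [n]
    for the shifted sequence, and the mean value bound costs one factor |x|. The modulus [beta] of
    the last derivative is kept abstract, so that a minimum of two bounds can be inserted. *)
Lemma taylor_bound (n : nat) (g : nat -> R -> R) (beta : R -> R) :
  (forall s t : R, 0 <= s -> s <= t -> beta s <= beta t) ->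
  (forall s : R, 0 <= s -> 0 <= beta s) ->
  (forall j (x : R), (j < n)%N -> is_derive x 1 (g j) (g j.+1 x)) ->
  (forall a x, `|g n (a + x) - g n a| <= beta `|x|) ->
  forall a x, `|g 0%N (a + x) - \sum_(q < n.+1) x ^+ q / q`!%:R * g q a|
    <= `|x| ^+ n * beta `|x|.
Proof.
move=> betam beta0; elim: n g => [|n IH] g dg gn a x.
  by rewrite big_ord1 expr0 fact0 divr1 !mul1r.
rewrite -taylor_polyE.
pose phi := fun y => g 0%N (a + y) - (taylor_poly g n.+1 a).[y].
pose dphi := fun y => g 1%N (a + y) - (taylor_poly (fun q => g q.+1) n a).[y].
have dph (y : R) : is_derive y 1 phi (dphi y).
  apply: is_deriveB.
    have dga := dg 0%N (a + y) isT.
    have := @is_derive1_comp R (g 0%N) (fun z => a + z) y (g 1%N (a + y)) 1 dga.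
    rewrite mulr1; apply.
    by have := @is_deriveD _ _ _ (cst a) id y 1 0 1 _ _; rewrite add0r; apply.
  by rewrite -deriv_taylor_poly; exact: is_derive_poly.
have phi0 : phi 0 = 0.
  rewrite /phi addr0 taylor_polyE big_ord_recl expr0 fact0 divr1 mul1r big1 ?addr0 ?subrr//.
  by move=> i _; rewrite expr0n/= !mul0r.
have := @mean_value_bound phi dphi x (`|x| ^+ n * beta `|x|) dph.
rewrite phi0 subr0 => H; rewrite exprSr mulrAC; apply: H => y yx.
rewrite /dphi taylor_polyE; apply: le_trans (IH (fun q => g q.+1) _ gn a y) _.
  by move=> j z jn; exact: dg.
by apply: ler_pM => //; [exact: beta0|exact: lerXn2r|exact: betam].
Qed.

End Taylor.

Section HolderClass.
Variable R : realType.
Implicit Types (f : R -> R) (k : nat).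

Definition smooth_class k f := holder_space k.-1 1 f /\ holder_space k 1 f.

Lemma holder_ereal_ge0 k f : (0 <= holder_ereal k 1 f)%E.
Proof.
have : (0 <= (`|derive1n k f 0 - derive1n k f 1| / `|0 - 1| `^ 1)%:E)%E.
  by rewrite lee_fin divr_ge0// powR_ge0.
move=> /le_trans; apply; apply: ereal_sup_ubound.
by exists 0, 1; split => //; rewrite eq_sym oner_neq0.
Qed.

Lemma holder_ge0 k f : 0 <= holder k 1 f.
Proof. by rewrite /holder fine_ge0// holder_ereal_ge0. Qed.

Lemma holder_lip k f x y : holder_space k 1 f ->
  `|derive1n k f x - derive1n k f y| <= holder k 1 f * `|x - y|.
Proof.
move=> [_ fin]; have [->|xy] := eqVneq x y; first by rewrite !subrr normr0 mulr0.
rewrite -ler_pdivrMr; last by rewrite normr_gt0 subr_eq0.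
have fn : holder_ereal k 1 f \is a fin_num by rewrite ge0_fin_numE ?holder_ereal_ge0.
rewrite -lee_fin /holder fineK//; apply: ereal_sup_ubound; exists x, y; split => //.
by rewrite powRr1.
Qed.

Lemma holder_le k f c : 0 <= c ->
  (forall x y, `|derive1n k f x - derive1n k f y| <= c * `|x - y|) ->
  holder k 1 f <= c /\ (holder_ereal k 1 f < +oo)%E.
Proof.
move=> c0 H.
have le : (holder_ereal k 1 f <= c%:E)%E.
  apply: ub_ereal_sup => _ [x [y [xy ->]]]; rewrite lee_fin ler_pdivrMr.
    by rewrite powRr1.
  by rewrite powR_gt0// normr_gt0 subr_eq0.
have fn : (holder_ereal k 1 f < +oo)%E by rewrite (le_lt_trans le)// ltry.
by split => //; rewrite /holder -lee_fin fineK// ge0_fin_numE// holder_ereal_ge0.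
Qed.

Lemma smooth_is_derive k f j (x : R) : smooth_class k f -> (j < k)%N ->
  is_derive x 1 (derive1n j f) (derive1n j.+1 f x).
Proof.
move=> [_ [[df _] _]] jk; rewrite derive1nS derive1E; exact/derivableP/df.
Qed.

Lemma smooth_continuous k f j : smooth_class k f -> (j <= k)%N -> continuous (derive1n j f).
Proof.
move=> fk; rewrite leq_eqVlt => /orP[/eqP ->|jk]; first by case: fk => _ [[]].
move=> x; apply/differentiable_continuous/derivable1_diffP.
exact: (@ex_derive _ _ _ _ _ _ _ (smooth_is_derive x fk jk)).
Qed.

Lemma derivative_le_lip (g : R -> R) (dg c x : R) : is_derive x 1 g dg ->
  (forall x y, `|g x - g y| <= c * `|x - y|) -> `|dg| <= c.
Proof.
move=> gx lip; have dgx := @ex_derive _ _ _ _ _ _ _ gx.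
have <- := @derive_val _ _ _ _ _ _ _ gx.
have H : `|(h^-1 *: ((g \o shift x) (h *: (1 : R)) - g x))| @[h --> 0^'] --> `|'D_1 g x|.
  by apply: cvg_norm; exact: dgx.
rewrite -(cvg_lim _ H)//; apply: limr_le; first by apply/cvg_ex; eexists; exact: H.
near=> h; have h0 : h != 0 by near: h; exact: nbhs_dnbhs_neq.
rewrite normrZ normfV mulrC ler_pdivrMr ?normr_gt0//.
by apply: le_trans (lip _ _) _; rewrite /= addrK [_ *: _]mulr1.
Unshelve. all: by end_near.
Qed.

Lemma smooth_bounded k f x : (0 < k)%N -> smooth_class k f ->
  `|derive1n k f x| <= holder k.-1 1 f.
Proof.
move=> k0 fk; have dk : (k.-1 < k)%N by rewrite prednK.
have := smooth_is_derive x fk dk; rewrite prednK// => H.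
apply: (derivative_le_lip H) => y z; apply: holder_lip.
by case: fk.
Qed.

(** Descent from the bounded derivative of order [k]: each step raises the power of 1 + |x| by one.
    The bound serves only to obtain integrability. *)
Lemma smooth_growth k f : (0 < k)%N -> smooth_class k f -> forall j, (j <= k)%N ->
  exists C, forall x, `|derive1n j f x| <= C * (1 + `|x|) ^+ (k - j).
Proof.
move=> k0 fk; suff H i : (i <= k)%N ->
    exists2 C, 0 <= C & forall x, `|derive1n (k - i) f x| <= C * (1 + `|x|) ^+ i.
  move=> j jk; have [C _ HC] := H (k - j)%N (leq_subr _ _).
  by exists C => x; have := HC x; rewrite subKn.
elim: i => [_|i IH ik].
  exists (holder k.-1 1 f); first exact: holder_ge0.
  by move=> x; rewrite subn0 expr0 mulr1; exact: smooth_bounded.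
have [C C0 HC] := IH (ltnW ik).
exists (`|derive1n (k - i.+1) f 0| + C) => [|x]; first by rewrite addr_ge0.
have kE : ((k - i.+1).+1 = k - i)%N by rewrite subnSK.
have klt : (k - i.+1 < k)%N by rewrite ltn_subrL.
have := @mean_value_bound R (derive1n (k - i.+1) f) (derive1n (k - i) f) x
  (C * (1 + `|x|) ^+ i).
rewrite -kE => /(_ _ _)-/(_ (fun y => smooth_is_derive y fk klt)) /=.
rewrite -derive1nS kE => H.
have {}H : `|derive1n (k - i.+1) f x - derive1n (k - i.+1) f 0| <= C * (1 + `|x|) ^+ i * `|x|.
  apply: H => y yx; apply: le_trans (HC y) _; rewrite ler_wpM2l// lerXn2r ?nnegrE ?addr_ge0//.
  by rewrite lerD2l.
rewrite -[derive1n (k - i.+1) f x](subrK (derive1n (k - i.+1) f 0)).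
apply: le_trans (ler_normD _ _) _; rewrite addrC mulrDl; apply: lerD.
  by rewrite ler_peMr// exprn_ege1// lerDl.
apply: le_trans H _; rewrite exprSr mulrA ler_wpM2l ?lerDr//.
by rewrite mulr_ge0// exprn_ge0// addr_ge0.
Qed.

(** Both bounds for an increment of the derivative of order [k] are kept. The one by
    [holder k.-1 1 f] is used where mixing provides the smallness, the Lipschitz one where it does
    not. *)
Lemma smooth_taylor k f p (a x : R) : (0 < k)%N -> smooth_class k f -> (p <= k)%N ->
  `|derive1n p f (a + x) - \sum_(q < (k - p).+1) x ^+ q / q`!%:R * derive1n (p + q) f a|
    <= `|x| ^+ (k - p) * Num.min (2 * holder k.-1 1 f) (holder k 1 f * `|x|).
Proof.
move=> k0 fk pk.
have := @taylor_bound R (k - p) (fun j => derive1n (p + j) f)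
  (fun s => Num.min (2 * holder k.-1 1 f) (holder k 1 f * s)).
rewrite /= addn0; apply.
- move=> s t s0 st; rewrite le_min ge_min lexx/= ge_min; apply/orP; right.
  by rewrite ler_wpM2l// holder_ge0.
- by move=> s s0; rewrite le_min !mulr_ge0 ?holder_ge0.
- by move=> j y jk; rewrite addnS; apply: (smooth_is_derive _ fk); rewrite -ltn_subRL.
move=> b y; rewrite subnKC// le_min; apply/andP; split.
  apply: le_trans (ler_normB _ _) _; rewrite mulr2n mulrDl mul1r.
  by apply: lerD; exact: smooth_bounded.
have := @holder_lip k f (b + y) b; rewrite [b + y - b]addrC addKr; apply; by case: fk.
Qed.

Lemma derive1n_horner (p : {poly R}) j : derive1n j (horner p) = horner p^`(j).
Proof.
elim: j => [|j IH]; first by rewrite derive1n0 derivn0.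
rewrite derive1nS IH derivnS; apply/funext => x; rewrite derive1E.
exact: (@derive_val _ _ _ _ _ _ _ (is_derive_poly _ _)).
Qed.

Lemma derive1n_exp p j :
  derive1n j (fun x : R => x ^+ p) = fun x => (p ^_ j)%:R * x ^+ (p - j).
Proof.
have -> : (fun x : R => x ^+ p) = horner 'X^p by apply/funext => x; rewrite hornerXn.
rewrite derive1n_horner derivnXn; apply/funext => x.
by rewrite hornerMn hornerXn mulr_natl.
Qed.

Lemma is_Ck_exp p k : is_Ck k (fun x : R => x ^+ p).
Proof.
have E : (fun x : R => x ^+ p) = horner 'X^p by apply/funext => x; rewrite hornerXn.
have D j (x : R) : derivable (derive1n j (fun x : R => x ^+ p)) x 1.
  rewrite E derive1n_horner; exact: (@ex_derive _ _ _ _ _ _ _ (is_derive_poly _ _)).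
by split=> [j _ x|x]; [exact: D|apply/differentiable_continuous/derivable1_diffP].
Qed.

(** The derivative of order [k] of x^p is constant for p <= k: monomials are test functions with
    vanishing seminorm. *)
Lemma holder_exp p k : (p <= k)%N ->
  holder k 1 (fun x : R => x ^+ p) = 0 /\ holder_space k 1 (fun x : R => x ^+ p).
Proof.
move=> pk; have [] := @holder_le k (fun x : R => x ^+ p) 0 (lexx _).
  move=> x y; rewrite derive1n_exp; have -> : (p - k = 0)%N by apply/eqP; rewrite subn_eq0.
  by rewrite !expr0 subrr normr0 mul0r.
by move=> h0 hf; split; [apply/le_anti; rewrite h0 holder_ge0|split => //; exact: is_Ck_exp].
Qed.

Lemma holder_exp_pred k : (0 < k)%N ->
  holder k.-1 1 (fun x : R => x ^+ k) <= k`!%:R /\ holder_space k.-1 1 (fun x : R => x ^+ k).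
Proof.
move=> k0; have [] : holder k.-1 1 (fun x : R => x ^+ k) <= k`!%:R /\ (holder_ereal k.-1 1 (fun x : R => (x ^+ k)%R) < +oo)%E.
  apply: holder_le => //; case: k k0 => // k _ /= x y; rewrite derive1n_exp subSnn !expr1 -mulrBr normrM.
  by rewrite ler_wpM2r// normr_nat ler_nat -(ffact_fact (leqnSn k)) leq_pmulr ?fact_gt0.
by move=> h0 hf; split => //; split => //; exact: is_Ck_exp.
Qed.

Lemma smooth_exp p k : (0 < k)%N -> (p <= k)%N -> smooth_class k (fun x : R => x ^+ p).
Proof.
move=> k0 pk; split; last by case: (holder_exp pk).
have [pk'|kp] := leqP p k.-1; first by case: (holder_exp pk').
have -> : p = k by apply/eqP; rewrite eqn_leq pk -(prednK k0).
by case: (holder_exp_pred k0).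
Qed.

End HolderClass.

(** * Moments and cumulants *)

Section Cumulants.
Variable R : realType.
Implicit Types (p q : {poly R}) (mu : nat -> R).

Definition eq_below n p q := forall j, (j < n)%N -> p`_j = q`_j.

Lemma eq_belowM n p p' q q' :
  eq_below n p p' -> eq_below n q q' -> eq_below n (p * q) (p' * q').
Proof.
move=> pp qq j jn; rewrite !coefM; apply: eq_bigr => i _.
by rewrite pp ?qq// (leq_ltn_trans _ jn)// ?leq_subr// -ltnS.
Qed.

Lemma eq_belowX n p q i : eq_below n p q -> eq_below n (p ^+ i) (q ^+ i).
Proof. by move=> pq; elim: i => // i IH; rewrite !exprS; exact: eq_belowM. Qed.

Lemma coef_pow_below p i j : p`_0 = 0 -> (j < i)%N -> (p ^+ i)`_j = 0.
Proof.
move=> p0; elim: i j => // i IH j ji; rewrite exprS coefM big_ord_recl p0 mul0r add0r.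
rewrite big1// => l _; rewrite IH ?mulr0// lift0; have := ltn_ord l; lia.
Qed.

Definition moment_poly mu n : {poly R} :=
  \sum_(1 <= q < n.+1) (mu q / q`!%:R) *: 'X^q.

Definition cumulant_of mu j : R :=
  j`!%:R * (\sum_(1 <= p < j.+1) ((-1) ^+ p.+1 / p%:R) *: moment_poly mu j ^+ p)`_j.

Lemma coef_moment_poly mu n j :
  (moment_poly mu n)`_j = if (0 < j <= n)%N then mu j / j`!%:R else 0.
Proof.
rewrite /moment_poly coef_sum.
case: ifPn => [/andP[j0 jn]|h].
  rewrite (bigD1_seq j) ?mem_index_iota ?iota_uniq ?j0 ?ltnS//= coefZ coefXn eqxx mulr1.
  by rewrite big1 ?addr0// => q qj; rewrite coefZ coefXn eq_sym (negbTE qj) mulr0.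
rewrite big_nat big1// => q /andP[q0 qn]; rewrite coefZ coefXn.
by case: eqP => [jq|]; rewrite ?mulr0//; move: h; rewrite jq q0 -ltnS qn.
Qed.

(** Unlike in [cumulant_of], the order of truncation is fixed: one polynomial carries all cumulants
    of order at most [n], and can be differentiated. *)
Definition log_poly mu n : {poly R} :=
  \sum_(1 <= p < n.+1) ((-1) ^+ p.+1 / p%:R) *: moment_poly mu n ^+ p.

Lemma coef_log_poly mu n j : (j <= n)%N -> j`!%:R * (log_poly mu n)`_j = cumulant_of mu j.
Proof.
move=> jn; congr (_ * _); rewrite /log_poly !coef_sum.
rewrite (@big_cat_nat _ _ _ j.+1)//= [X in _ + X]big_nat [X in _ + X]big1 ?addr0 => [|q /andP[jq _]].
  apply: eq_bigr => q _; rewrite !coefZ; congr (_ * _).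
  apply: (@eq_belowX j.+1) => // l; rewrite ltnS => lj; rewrite !coef_moment_poly lj.
  by rewrite (leq_trans lj jn).
by rewrite coefZ coef_pow_below ?mulr0// coef_moment_poly.
Qed.

(** This is the derivative of log (1 + M), with a truncated geometric series in place of the inverse
    of 1 + M. *)
Lemma deriv_log_poly mu n :
  (log_poly mu n)^`() =
  (moment_poly mu n)^`() * \sum_(i < n) (- moment_poly mu n) ^+ i.
Proof.
rewrite /log_poly linear_sum mulr_sumr big_add1 big_mkord; apply: eq_bigr => i _.
rewrite /= derivZ deriv_exp /= -[_^`() * _ *+ _]mulr_natl (exprNn (moment_poly mu n)) mulrCA.
have -> : (-1) ^+ i = ((-1) ^+ i)%:P :> {poly R} by rewrite rmorphXn rmorphN1.
rewrite mulrCA mulr_natl -[_ * _ *+ i.+1]scaler_nat mul_polyC scalerA -scalerAr; congr (_ *: _).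
by rewrite divfK ?pnatr_eq0// !exprS !mulN1r opprK.
Qed.

(** Comparison of the coefficients of degree [n] in (log (1 + M))' (1 + M) = M'. The coefficients of
    the expansion are later recognized as cumulants because they satisfy the same recursion. *)
Lemma cumulant_of_recursion mu : mu 0%N = 1 -> forall n : nat,
  mu n.+1 = \sum_(j < n.+1) 'C(n, j)%:R * cumulant_of mu j.+1 * mu (n - j)%N.
Proof.
move=> mu0 n; set M := moment_poly mu n.+1.
have M0 : M`_0 = 0 by rewrite coef_moment_poly.
have key : ((log_poly mu n.+1)^`() * (1 + M))`_n = (M^`())`_n.
  rewrite deriv_log_poly -/M -mulrA [_ * (1 + M)]mulrC.
  (* The geometric sum inverts 1 + M up to (-M)^(n+1), which has no coefficient of degree at most
     [n] because M has no constant term. *)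
  have -> : (1 + M) * \sum_(i < n.+1) (- M) ^+ i = 1 - (- M) ^+ n.+1.
    by rewrite -[RHS]opprB subrX1 -mulNr opprB opprK.
  rewrite mulrBr mulr1 coefB [X in _ - X]coefM big1 ?subr0// => i _.
  by rewrite [((- M) ^+ _)`_ _]coef_pow_below ?mulr0// ?coefN ?M0 ?oppr0// ltnS leq_subr.
have nf j : (j`!%:R : R) != 0 by rewrite pnatr_eq0 -lt0n fact_gt0.
move: key; rewrite coefM coef_deriv coef_moment_poly /= ltnSn => key.
have -> : mu n.+1 = n`!%:R * (mu n.+1 / (n.+1)`!%:R *+ n.+1).
  rewrite factS natrM invfM -[X in _ * X]mulr_natr.
  have n1 : (n.+1%:R : R) != 0 by rewrite pnatr_eq0.
  have fld (a b x : R) : a != 0 -> b != 0 -> x = a * (x * (b^-1 / a) * b).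
    by move=> a0 b0; field; apply/andP.
  exact: fld.
rewrite -key mulr_sumr; apply: eq_bigr => i _; have il : (i <= n)%N by rewrite -ltnS.
rewrite coef_deriv coefD coef1 coef_moment_poly -(@coef_log_poly mu n.+1)//.
have -> : ((n - i == 0)%N%:R + (if (0 < n - i <= n.+1)%N then mu (n - i)%N / (n - i)`!%:R else 0)
   = mu (n - i)%N / (n - i)`!%:R :> R).
  have [->|h] := eqVneq (n - i)%N 0%N; first by rewrite mu0 fact0 divr1 addr0.
  by rewrite add0r lt0n h (leq_trans (leq_subr _ _)).
have -> : (n`!%:R : R) = 'C(n, i)%:R * (i`!%:R * (n - i)`!%:R) by rewrite -!natrM bin_fact.
rewrite factS natrM -[_ *+ i.+1]mulr_natr.
have fld (a b c l t m : R) : b != 0 -> c * (a * b) * (l * t * (m / b)) = c * (t * a * l) * m.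
  by move=> b0; field.
exact: fld.
Qed.

End Cumulants.

Section MomentCumulant.
Context (dO : measure_display) (Omega : measurableType dO) (R : realType)
  (P : probability Omega R) (W : Omega -> R).

Lemma cumulantE j : cumulant P W j = cumulant_of (fun q => Ex P (fun w => W w ^+ q)) j.
Proof. by []. Qed.

End MomentCumulant.

(** * Counting in the lattice *)

Section Lattice.
Variable d : nat.
Implicit Types (i j : lattice d) (J s : seq (lattice d)).

Lemma maxnormN i : maxnorm (- i) = maxnorm i.
Proof. by rewrite /maxnorm; apply: eq_bigr => c _; rewrite mxE abszN. Qed.

Lemma maxnorm_sym i j : maxnorm (i - j) = maxnorm (j - i).
Proof. by rewrite -maxnormN opprB. Qed.

Lemma maxnorm_leP i l : reflect (forall c, (`|i ord0 c| <= l)%N) (maxnorm i <= l)%N.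
Proof. by rewrite /maxnorm; apply: (iffP (bigmax_leqP _ _ _)) => [h c|h c _]; exact: h. Qed.

Lemma maxnorm_attained i : (0 < maxnorm i)%N -> exists c, maxnorm i = absz (i ord0 c).
Proof.
case: d i => [|d'] i; first by rewrite /maxnorm big_ord0.
have [|c _ h] := @eq_bigmax_cond _ predT (fun c : 'I_d'.+1 => absz (i ord0 c)).
  by rewrite card_ord.
by exists c.
Qed.

(** Coordinates relative to the centre [j], shifted by [l] to become nonnegative. The code is
    injective on the ball, so that counting lattice points reduces to the cardinality of a finite
    function type. *)
Definition ball_code (l : nat) j i : {ffun 'I_d -> 'I_(2 * l).+1} :=
  [ffun c : 'I_d => inord (absz ((i - j) ord0 c + l%:Z))].

Lemma ball_code_val l j i c : (maxnorm (i - j) <= l)%N ->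
  (ball_code l j i c)%:Z = (i - j) ord0 c + l%:Z.
Proof.
move=> /maxnorm_leP/(_ c); rewrite ffunE; move: ((i - j) ord0 c) => z h.
rewrite inordK; lia.
Qed.

Lemma ball_code_inj l j : {in [pred i | (maxnorm (i - j) <= l)%N] &, injective (ball_code l j)}.
Proof.
move=> x y; rewrite !inE => hx hy xy; apply/rowP => c.
have := ball_code_val c hx; rewrite xy (ball_code_val c hy) !mxE => /addIr/addIr ->//.
Qed.

Lemma count_le_card (T : finType) (f : lattice d -> T) (A : {pred T}) (a : pred (lattice d)) s :
  uniq s -> {in [pred i | a i] &, injective f} -> (forall i, a i -> f i \in A) ->
  (count a s <= #|A|)%N.
Proof.
move=> us fi fA; rewrite -size_filter -(size_map f) -(card_uniqP _); last first.
  rewrite map_inj_in_uniq ?filter_uniq// => x y; rewrite !mem_filter => /andP[ax _] /andP[ay _].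
  exact: fi.
apply: subset_leq_card; apply/fintype.subsetP => _ /mapP[i + ->]; rewrite mem_filter => /andP[ai _].
exact: fA.
Qed.

Lemma count_ball s j l : uniq s ->
  (count (fun i => (maxnorm (i - j)%R <= l)%N) s <= (2 * l).+1 ^ d)%N.
Proof.
move=> us; have := @count_le_card _ (ball_code l j) predT (fun i => (maxnorm (i - j)%R <= l)%N) s us.
by rewrite (@card_ffun 'I_d 'I_(2 * l).+1) !card_ord; apply => // x y; exact: ball_code_inj.
Qed.

Lemma count_face s j l (c : 'I_d) (v : int) : uniq s ->
  (count (fun i => (maxnorm (i - j)%R <= l)%N && ((i - j)%R ord0 c == v)) s <= (2 * l).+1 ^ d.-1)%N.
Proof.
move=> us; pose F c' := if c' == c then pred1 (inord (absz (v + l%:Z))) : pred 'I_(2 * l).+1 else predT.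
have -> : ((2 * l).+1 ^ d.-1 = #|(family F : simpl_pred {ffun 'I_d -> 'I_(2 * l).+1})|)%N.
  rewrite card_family foldrE big_map big_enum /= (bigD1 c)//= /F eqxx card1 mul1n.
  rewrite (eq_bigr (fun=> (2 * l).+1)) => [|c' /negbTE ->]; last by rewrite card_ord.
  by rewrite prod_nat_const cardC1 card_ord.
apply: (@count_le_card _ (ball_code l j)) => //.
  by move=> x y; rewrite !inE => /andP[hx _] /andP[hy _]; exact: ball_code_inj.
move=> i /andP[hi /eqP hv]; apply/familyP => c'; rewrite /F; case: eqP => // ->.
by rewrite !inE ffunE hv.
Qed.

(** A point at distance exactly [l] lies on one of the 2d faces on which some coordinate of the
    difference is l or -l. *)
Lemma count_sphere s j l : (0 < l)%N -> uniq s ->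
  (count (fun i => maxnorm (i - j)%R == l) s <= 2 * d * (2 * l).+1 ^ d.-1)%N.
Proof.
move=> l0 us; apply: (@leq_trans (\sum_(c < d) \sum_(b : bool)
   count (fun i => (maxnorm (i - j)%R <= l)%N && (((i - j) ord0 c == (-1) ^+ b * l%:Z)%R)) s)).
  elim: s {us} => [|i s IH]; first by [].
  rewrite /= (eq_bigr (fun c => \sum_(b : bool) ((maxnorm (i - j)%R <= l)%N && (((i - j) ord0 c == (-1) ^+ b * l%:Z)%R) : nat)
     + \sum_(b : bool) count (fun i => (maxnorm (i - j)%R <= l)%N && (((i - j) ord0 c == (-1) ^+ b * l%:Z)%R)) s)%N); last first.
    by move=> c _; rewrite -big_split.
  rewrite big_split/= leq_add//; case: eqP => //= il.
  have [c hc] : exists c : 'I_d, maxnorm (i - j) = absz ((i - j)%R ord0 c) by apply: maxnorm_attained; rewrite il.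
  rewrite (bigD1 c)//= (bigD1 ((i - j) ord0 c < 0))//= -addnA (leq_trans _ (leq_addr _ _))//.
  by rewrite lt0b il leqnn/=; move: hc; rewrite il; case: ltP => /= ? ->; lia.
rewrite mulnC mulnA; apply: (@leq_trans (\sum_(c < d) \sum_(b : bool) (2 * l).+1 ^ d.-1)).
  by apply: leq_sum => c _; apply: leq_sum => b _; exact: count_face.
by rewrite !sum_nat_const card_ord card_bool; lia.
Qed.

End Lattice.

Section Distance.
Implicit Types (s : seq nat).

Lemma bigminn_le (I : eqType) (s : seq I) (F : I -> nat) x0 j :
  j \in s -> (\big[minn/x0]_(i <- s) F i <= F j)%N.
Proof.
elim: s => // i s IH; rewrite inE big_cons geq_min => /orP[/eqP ->|/IH ->].
  by rewrite leqnn.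
by rewrite orbT.
Qed.

Lemma bigminn_attained (I : eqType) (s : seq I) (F : I -> nat) x0 :
  \big[minn/x0]_(i <- s) F i = x0 \/
  exists2 j, j \in s & \big[minn/x0]_(i <- s) F i = F j.
Proof.
elim: s => [|i s IH]; first by rewrite big_nil; left.
rewrite big_cons; have [h|h] := leqP (F i) (\big[minn/x0]_(i <- s) F i).
  by right; exists i; rewrite ?mem_head//; exact/minn_idPl.
case: IH => [->|[j js ->]]; [by left|right].
by exists j => //; rewrite inE js orbT.
Qed.

Variable d : nat.
Implicit Types (I J : {fset lattice d}).

Lemma dist_le I J i j : i \in I -> j \in J -> (dist I J <= maxnorm (i - j))%N.
Proof.
by move=> iI jJ; apply: leq_trans (bigminn_le _ _ iI) _; exact: bigminn_le.
Qed.

Lemma dist_attained I J : I != fset0 -> J != fset0 ->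
  exists i j, [/\ i \in I, j \in J & dist I J = maxnorm (i - j)].
Proof.
move=> I0 J0.
have hI : head 0 I \in I.
  suff : head 0 (enum_fset I) \in enum_fset I by [].
  have [i] := fset0Pn _ I0; have -> : (i \in I) = (i \in enum_fset I) by [].
  by case: (enum_fset I) => //= x s _; rewrite mem_head.
have hJ : head 0 J \in J.
  suff : head 0 (enum_fset J) \in enum_fset J by [].
  have [i] := fset0Pn _ J0; have -> : (i \in J) = (i \in enum_fset J) by [].
  by case: (enum_fset J) => //= x s _; rewrite mem_head.
rewrite /dist; case: (bigminn_attained I (fun i => \big[minn/maxnorm (head 0 I - head 0 J)]_(j <- J)
   maxnorm (i - j)) (maxnorm (head 0 I - head 0 J))) => [->|[i iI ->]].
  by exists (head 0 I), (head 0 J).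
case: (bigminn_attained J (fun j => maxnorm (i - j)) (maxnorm (head 0 I - head 0 J)))
  => [->|[j jJ ->]]; first by exists (head 0 I), (head 0 J).
by exists i, j.
Qed.

Lemma dist1_le i J j : j \in J -> (dist1 i J <= maxnorm (i - j))%N.
Proof. by apply: dist_le; rewrite inE. Qed.

Lemma dist1_attained i J : J != fset0 -> exists2 j, j \in J & dist1 i J = maxnorm (i - j).
Proof.
rewrite /dist1 => J0; have [|i' [j [+ jJ ->]]] := @dist_attained [fset i]%fset J _ J0.
  by apply/fset0Pn; exists i; rewrite inE.
by rewrite inE => /eqP ->; exists j.
Qed.

Definition seq_dist (i : lattice d) (J : seq (lattice d)) := dist1 i [fset x in J]%fset.

Lemma seq_dist_le i (J : seq (lattice d)) j : j \in J -> (seq_dist i J <= maxnorm (i - j))%N.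
Proof. by move=> jJ; apply: dist1_le; rewrite inE. Qed.

Lemma seq_dist_attained i (J : seq (lattice d)) : (0 < size J)%N ->
  exists2 j, j \in J & seq_dist i J = maxnorm (i - j).
Proof.
case: J => // j J _; have [|x + xE] := @dist1_attained i [fset x in j :: J]%fset.
  by apply/fset0Pn; exists j; rewrite !inE eqxx.
by rewrite !inE => h; exists x => //; rewrite inE.
Qed.

Lemma count_seq_dist_le (s J : seq (lattice d)) l : (0 < size J)%N -> uniq s ->
  (count (fun i => seq_dist i J <= l) s <= size J * (2 * l).+1 ^ d)%N.
Proof.
move=> J0 us; apply: (@leq_trans (\sum_(j <- J) count (fun i => (maxnorm (i - j)%R <= l)%N) s)).
  elim: s {us} => [|i s IH] //=.
  rewrite big_split/= leq_add//; case: (leqP (seq_dist i J) l) => //= il.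
  have [j jJ ij] := seq_dist_attained i J0.
  by rewrite (big_rem j)//= -ij il.
apply: (@leq_trans (\sum_(j <- J) (2 * l).+1 ^ d)).
  by apply: leq_sum => j _; exact: count_ball.
by rewrite big_const_seq count_predT iter_addn_0 mulnC.
Qed.

Lemma count_seq_dist_eq (s J : seq (lattice d)) l : (0 < size J)%N -> (0 < l)%N -> uniq s ->
  (count (fun i => seq_dist i J == l) s <= size J * (2 * d * (2 * l).+1 ^ d.-1))%N.
Proof.
move=> J0 l0 us; apply: (@leq_trans (\sum_(j <- J) count (fun i => maxnorm (i - j)%R == l) s)).
  elim: s {us} => [|i s IH] //=.
  rewrite big_split/= leq_add//; case: eqP => //= il.
  have [j jJ ij] := seq_dist_attained i J0.
  by rewrite (big_rem j)//= -ij il eqxx.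
apply: (@leq_trans (\sum_(j <- J) (2 * d * (2 * l).+1 ^ d.-1))).
  by apply: leq_sum => j _; exact: count_sphere.
by rewrite big_const_seq count_predT iter_addn_0 mulnC.
Qed.

End Distance.

(** * Covariance inequalities *)

Section Expectation.
Context (dO : measure_display) (Omega : measurableType dO) (R : realType)
  (P : probability Omega R).
Implicit Types (Y Z : Omega -> R).

Definition integrableR Y := P.-integrable setT (EFin \o Y).
Definition measR Y := measurable_fun [set: Omega] Y.

Lemma ExE Y : Ex P Y = \int[P]_w Y w.
Proof. by rewrite /Ex unlock. Qed.

Lemma eq_Ex Y Z : Y =1 Z -> Ex P Y = Ex P Z.
Proof. by move=> /funext ->. Qed.

Lemma integrable_measR Y : integrableR Y -> measR Y.
Proof. by move=> /measurable_int/measurable_EFinP. Qed.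

Lemma eq_integrableR Y Z : Y =1 Z -> integrableR Y -> integrableR Z.
Proof. by move=> /funext ->. Qed.

Lemma integrableR_le Y Z : measR Y -> (forall w, `|Y w| <= Z w) -> integrableR Z -> integrableR Y.
Proof.
move=> mY YZ; apply: le_integrable => //; first exact/measurable_EFinP.
by move=> w _ /=; rewrite lee_fin (le_trans (YZ w))// ler_norm.
Qed.

Lemma integrableR_cst c : integrableR (fun=> c).
Proof. by apply: finite_measure_integrable_cst. Qed.

Lemma integrableR_bounded Y c : measR Y -> (forall w, `|Y w| <= c) -> integrableR Y.
Proof. by move=> mY Yc; apply: integrableR_le (integrableR_cst c). Qed.

Lemma integrableRD Y Z : integrableR Y -> integrableR Z -> integrableR (fun w => Y w + Z w).
Proof. by move=> iY iZ; exact: (integrableD _ iY iZ). Qed.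

Lemma integrableRZ c Y : integrableR Y -> integrableR (fun w => c * Y w).
Proof. by move=> iY; exact: (integrableZl _ c iY). Qed.

Lemma integrableRB Y Z : integrableR Y -> integrableR Z -> integrableR (fun w => Y w - Z w).
Proof. by move=> iY iZ; exact: (integrableB _ iY iZ). Qed.

Lemma integrableR_sum (I : Type) (s : seq I) (F : I -> Omega -> R) :
  (forall i, integrableR (F i)) -> integrableR (fun w => \sum_(i <- s) F i w).
Proof.
move=> iF; elim: s => [|i s IH].
  by under eq_fun do rewrite big_nil; exact: integrableR_cst.
by under eq_fun do rewrite big_cons; exact: integrableRD.
Qed.

Lemma ExD Y Z : integrableR Y -> integrableR Z ->
  Ex P (fun w => Y w + Z w) = Ex P Y + Ex P Z.
Proof. by move=> iY iZ; rewrite !ExE RintegralD. Qed.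

Lemma ExB Y Z : integrableR Y -> integrableR Z ->
  Ex P (fun w => Y w - Z w) = Ex P Y - Ex P Z.
Proof. by move=> iY iZ; rewrite !ExE RintegralB. Qed.

Lemma ExZ c Y : integrableR Y -> Ex P (fun w => c * Y w) = c * Ex P Y.
Proof. by move=> iY; rewrite !ExE RintegralZl. Qed.

Lemma Ex_cst c : Ex P (fun=> c) = c.
Proof. by rewrite ExE Rintegral_cst//= probability_setT mulr1. Qed.

Lemma Ex_sum (I : Type) (s : seq I) (F : I -> Omega -> R) :
  (forall i, integrableR (F i)) ->
  Ex P (fun w => \sum_(i <- s) F i w) = \sum_(i <- s) Ex P (F i).
Proof.
move=> iF; elim: s => [|i s IH].
  by rewrite big_nil -[RHS](Ex_cst 0); apply: eq_Ex => w; rewrite big_nil.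
rewrite big_cons -IH -ExD//; last exact: integrableR_sum.
by apply: eq_Ex => w; rewrite big_cons.
Qed.

Lemma Ex_le Y Z : integrableR Y -> integrableR Z -> (forall w, Y w <= Z w) -> Ex P Y <= Ex P Z.
Proof. by move=> iY iZ YZ; rewrite !ExE le_Rintegral. Qed.

Lemma Ex_normr_le Y Z : measR Y -> (forall w, `|Y w| <= Z w) -> integrableR Z ->
  `|Ex P Y| <= Ex P Z.
Proof.
move=> mY YZ iZ; have iY := integrableR_le mY YZ iZ; rewrite !ExE.
apply: (le_trans (le_normr_Rintegral _ iY)) => //.
have inY : integrableR (fun w => `|Y w|).
  by apply: (integrableR_le _ _ iZ) => [|w]; [exact: measurableT_comp|rewrite normr_id].
by apply: le_Rintegral => // w _; exact: YZ.
Qed.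

Lemma Ex_indic (A : set Omega) : measurable A -> Ex P \1_A = fine (P A).
Proof. by move=> mA; rewrite /Ex expectation_indic. Qed.

Lemma Ex_ae0 Y : measR Y -> (\forall w \ae P, Y w = 0) -> Ex P Y = 0.
Proof.
move=> mY Y0; rewrite ExE /Rintegral (ae_eq_integral (cst 0%E))//.
- by rewrite integral_cst// mul0e.
- exact/measurable_EFinP.
- by apply: filterS Y0 => w /= -> _.
Qed.

Lemma measR_powR Y p : measR Y -> measR (fun w => Y w `^ p).
Proof. by move=> mY; apply: (@measurableT_comp _ _ _ _ _ _ (@powR R ^~ p)) => //; exact: measurable_powR. Qed.

End Expectation.

Section Separation.
Context (dO : measure_display) (Omega : measurableType dO) (R : realType)
  (P : probability Omega R).
Implicit Types (Y V : Omega -> R).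

(** A bound on the mixing coefficient of the sigma-algebras generated by the two variables, stated
    on preimages so that it passes to measurable functions of each of them. *)
Definition separated (a : R) Y V := forall A B : set R, measurable A -> measurable B ->
  `|fine (P (Y @^-1` A `&` V @^-1` B)) - fine (P (Y @^-1` A)) * fine (P (V @^-1` B))| <= a.

Definition cov Y V := Ex P (fun w => Y w * V w) - Ex P Y * Ex P V.

Lemma separated_comp a Y V (phi psi : R -> R) :
  measurable_fun setT phi -> measurable_fun setT psi ->
  separated a Y V -> separated a (phi \o Y) (psi \o V).
Proof.
move=> mphi mpsi sep A B mA mB.
apply: (sep (phi @^-1` A) (psi @^-1` B)).
  by rewrite -[X in measurable X]setTI; exact: mphi.
by rewrite -[X in measurable X]setTI; exact: mpsi.
Qed.

(* A layer-cake sum: the covariance of two quantized variables is an average of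
   [P (A `&` B) - P A * P B] over superlevel sets. *)
Definition quantize (n : nat) (y : R) : R := n%:R^-1 * \sum_(i < n) ((i.+1%:R <= n%:R * y)%R)%:R.

Lemma quantize_close n y : (0 < n)%N -> 0 <= y <= 1 -> `|y - quantize n y| <= n%:R^-1.
Proof.
move=> n0 /andP[y0 y1].
have n0' : (0 : R) < n%:R by rewrite ltr0n.
have H m (z : R) : 0 <= z -> z <= m%:R ->
    z - 1 <= \sum_(i < m) ((i.+1%:R <= z)%R)%:R <= z.
  elim: m z => [|m IH] z z0 zm; first by rewrite big_ord0 z0 andbT; lra.
  rewrite big_ord_recr/=; have [zlt|zge] := ltP z m.+1%:R; last first.
    have -> : z = m.+1%:R by apply/eqP; rewrite eq_le zm.
    rewrite (eq_bigr (fun=> 1)) => [|i _]; last first.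
      by rewrite ler_nat (leq_trans (ltn_ord i)) ?leqnSn// ltnW.
    have -> : (true%:R : R) = 1 by [].
    by rewrite sumr_const card_ord -natr1; lra.
  rewrite addr0; have [zm'|zm'] := leP z m%:R; first exact: IH.
  rewrite (eq_bigr (fun=> 1)) => [|i _].
    by rewrite sumr_const card_ord; rewrite -natr1 in zlt; lra.
  by rewrite (le_trans _ (ltW zm'))// ler_nat ltn_ord.
have /andP[h1 h2] := H n (n%:R * y) (mulr_ge0 (ltW n0') y0) (ler_piMr (ltW n0') y1).
have -> : y - quantize n y = n%:R^-1 * (n%:R * y - \sum_(i < n) ((i.+1%:R <= n%:R * y)%R)%:R).
  by rewrite /quantize mulrBr mulrA mulVf ?mul1r// gt_eqF.
rewrite normrM ger0_norm ?invr_ge0 ?ler0n// ler_piMr ?invr_ge0 ?ler0n//.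
by rewrite ger0_norm; lra.
Qed.

Lemma quantize_itv n y : (0 < n)%N -> 0 <= quantize n y <= 1.
Proof.
move=> n0; rewrite /quantize mulr_ge0 ?invr_ge0 ?sumr_ge0//= mulrC ler_pdivrMr ?ltr0n// mul1r.
rewrite -[X in _ <= X%:R]card_ord -sumr_const ler_sum// => i _.
by rewrite lern1 leq_b1.
Qed.

Lemma cov_unit_itv a Y V : measR Y -> measR V ->
  (forall w, 0 <= Y w <= 1) -> (forall w, 0 <= V w <= 1) ->
  separated a Y V -> `|cov Y V| <= a.
Proof.
move=> mY mV Y01 V01 sep.
pose S (Z : Omega -> R) n (i : 'I_n) := Z @^-1` [set z | i.+1%:R <= n%:R * z].
have mB n (i : 'I_n) : measurable [set z : R | i.+1%:R <= n%:R * z].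
  have := @measurable_fun_le _ (measurableTypeR R) R setT (cst (i.+1%:R)) (fun z : R => n%:R * z).
  by rewrite setTI; apply => //; exact: measurable_funM.
have mS (Z : Omega -> R) n (i : 'I_n) : measR Z -> measurable (S Z n i).
  by move=> mZ; rewrite -[X in measurable X]setTI; exact: mZ.
have qE (Z : Omega -> R) n w : quantize n (Z w) = n%:R^-1 * \sum_(i < n) \1_(S Z n i) w.
  congr (_ * _); apply: eq_bigr => i _; rewrite indicE; congr (_%:R).
  by congr nat_of_bool; apply/idP/idP; rewrite inE.
have mq (Z : Omega -> R) n : measR Z -> measR (quantize n \o Z).
  move=> mZ; rewrite /comp; under eq_fun => w do rewrite (qE Z n w).
  apply: measurable_funM => //; apply: measurable_sum => i.
  by apply: measurable_indic; exact: mS.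
have iq (Z : Omega -> R) n : (0 < n)%N -> measR Z -> integrableR P (quantize n \o Z).
  move=> n0 mZ; apply: (@integrableR_bounded _ _ _ _ _ 1); first exact: mq.
  by move=> w; have /andP[? ?] := quantize_itv (Z w) n0; rewrite ger0_norm.
have iu (Z : Omega -> R) : measR Z -> (forall w, 0 <= Z w <= 1) -> integrableR P Z.
  move=> mZ Z01; apply: (@integrableR_bounded _ _ _ _ _ 1) => // w.
  by have /andP[? ?] := Z01 w; rewrite ger0_norm.
have ind A : measurable A -> integrableR P (\1_A : Omega -> R).
  move=> mA; apply: (@integrableR_bounded _ _ _ _ _ 1); first exact: measurable_indic.
  by move=> w; rewrite indicE normr_nat lern1 leq_b1.
have covq n : (0 < n)%N -> `|cov (quantize n \o Y) (quantize n \o V)| <= a.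
  move=> n0; rewrite /cov.
  have EqE (Z : Omega -> R) : measR Z -> Ex P (quantize n \o Z) = n%:R^-1 * \sum_(i < n) fine (P (S Z n i)).
    move=> mZ; rewrite (@eq_Ex _ _ _ _ _ (fun w => n%:R^-1 * \sum_(i < n) \1_(S Z n i) w)).
      rewrite ExZ; last by apply: integrableR_sum => i; apply: ind; exact: mS.
      rewrite Ex_sum => [|i]; last by apply: ind; exact: mS.
      by congr (_ * _); apply: eq_bigr => i _; rewrite Ex_indic//; exact: mS.
    by move=> w; exact: qE.
  rewrite (@eq_Ex _ _ _ _ _ (fun w => (n%:R^-1 * n%:R^-1) *
      \sum_(i < n) \sum_(j < n) \1_(S Y n i `&` S V n j) w)); last first.
    move=> w; rewrite /= !qE mulrACA; congr (_ * _); rewrite mulr_suml; apply: eq_bigr => i _.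
    by rewrite mulr_sumr; apply: eq_bigr => j _; rewrite indicI.
  have iI i j : integrableR P (\1_(S Y n i `&` S V n j) : Omega -> R).
    by apply: ind; apply: measurableI; exact: mS.
  rewrite ExZ; last by apply: integrableR_sum => i; exact: integrableR_sum.
  rewrite Ex_sum => [|i]; last exact: integrableR_sum.
  rewrite !EqE// mulrACA mulr_suml -mulrBr -sumrB.
  have n0' : (0 : R) < n%:R by rewrite ltr0n.
  rewrite normrM ger0_norm ?mulr_ge0 ?invr_ge0 ?ler0n// -invfM mulrC ler_pdivrMr ?mulr_gt0//.
  apply: (le_trans (ler_norm_sum _ _ _)).
  apply: (@le_trans _ _ (\sum_(i < n) \sum_(j < n) a)); last first.
    by rewrite !sumr_const !card_ord -mulrnA -[leLHS]mulr_natr natrM.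
  apply: ler_sum => i _; rewrite Ex_sum// mulr_sumr -sumrB.
  apply: (le_trans (ler_norm_sum _ _ _)); apply: ler_sum => j _.
  by rewrite Ex_indic; [exact: sep|apply: measurableI; exact: mS].
apply/ler_addgt0Pl => e e0.
(* Quantization at step 1/n changes E[YV] by at most 2/n and E[Y]E[V] by at most 2/n; this [n] makes
   the total at most [e]. *)
pose n := (Num.truncn (4 / e)).+1.
have n0 : (0 < n)%N by [].
have n0' : (0 : R) < n%:R by rewrite ltr0n.
have n4 : 4 / n%:R <= e.
  rewrite ler_pdivrMr// mulrC -ler_pdivrMr//; apply: ltW.
  by rewrite /n; have /andP[] := truncn_itv (divr_ge0 (ler0n R 4) (ltW e0)).
pose q Z : Omega -> R := quantize n \o Z.
have clos (Z : Omega -> R) : (forall w, 0 <= Z w <= 1) -> forall w, `|Z w - q Z w| <= n%:R^-1.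
  by move=> Z01 w; exact: quantize_close.
have dE (Z : Omega -> R) : measR Z -> (forall w, 0 <= Z w <= 1) -> `|Ex P Z - Ex P (q Z)| <= n%:R^-1.
  move=> mZ Z01; rewrite -ExB; [|exact: iu|exact: iq].
  rewrite -[leRHS](Ex_cst P); apply: Ex_normr_le; [|exact: clos|exact: integrableR_cst].
  by apply: measurable_funB => //; exact: mq.
have E1 (Z : Omega -> R) : measR Z -> (forall w, 0 <= Z w <= 1) -> `|Ex P Z| <= 1.
  move=> mZ Z01; rewrite -[leRHS](Ex_cst P); apply: Ex_normr_le => //; last exact: integrableR_cst.
  by move=> w; have /andP[? ?] := Z01 w; rewrite ger0_norm.
have q01 Z w : 0 <= q Z w <= 1 by exact: quantize_itv.
have prod01 (x y : R) : 0 <= x <= 1 -> 0 <= y <= 1 -> 0 <= x * y <= 1 by nra.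
have mqV := mq _ n mV; have mqY := mq _ n mY.
have H : `|cov Y V - cov (q Y) (q V)| <= 4 / n%:R.
  rewrite /cov; set A := Ex P _; set B := Ex P (fun w => q Y w * _).
  have -> : A - Ex P Y * Ex P V - (B - Ex P (q Y) * Ex P (q V)) =
    (A - B) - ((Ex P Y - Ex P (q Y)) * Ex P V + Ex P (q Y) * (Ex P V - Ex P (q V))) by ring.
  apply: (le_trans (ler_normB _ _)).
  have -> : (4 / n%:R : R) = 2 / n%:R + (n%:R^-1 + n%:R^-1) by lra.
  apply: lerD.
    rewrite /A /B -ExB; first last.
    - by apply: iu; [exact: measurable_funM|move=> w; exact: prod01].
    - by apply: iu; [exact: measurable_funM|move=> w; exact: prod01].
    rewrite -[leRHS](Ex_cst P); apply: Ex_normr_le; last exact: integrableR_cst.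
      by apply: measurable_funB; exact: measurable_funM.
    move=> w; have -> : Y w * V w - q Y w * q V w = Y w * (V w - q V w) + (Y w - q Y w) * q V w by ring.
    apply: (le_trans (ler_normD _ _)); rewrite (normrM (Y w)) (normrM (Y w - q Y w)).
    have := clos _ Y01 w; have := clos _ V01 w; have := Y01 w; have := q01 V w.
    move=> /andP[qV0 qV1] /andP[Y0 Y1] c1 c2.
    rewrite (ger0_norm Y0) (ger0_norm qV0).
    have : Y w * `|V w - q V w| <= 1 * n%:R^-1 by apply: ler_pM.
    have : `|Y w - q Y w| * q V w <= n%:R^-1 * 1 by apply: ler_pM.
    by lra.
  apply: (le_trans (ler_normD _ _)); rewrite !normrM; apply: lerD.
    by rewrite -[leRHS]mulr1; apply: ler_pM => //; [exact: dE|exact: E1].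
  by rewrite -[leRHS]mul1r; apply: ler_pM => //; [exact: E1|exact: dE].
have := covq n n0; rewrite -/(q Y) -/(q V) => H'.
rewrite -(subrK (cov (q Y) (q V)) (cov Y V)); apply: (le_trans (ler_normD _ _)).
by apply: lerD => //; exact: le_trans H n4.
Qed.

Lemma covC Y V : cov Y V = cov V Y.
Proof. by rewrite /cov mulrC; congr (_ - _); apply: eq_Ex => w; rewrite mulrC. Qed.

Lemma cov_affine c e Y V : integrableR P Y -> integrableR P V ->
  integrableR P (fun w => Y w * V w) -> cov (fun w => c * Y w + e) V = c * cov Y V.
Proof.
move=> iY iV iYV; rewrite /cov.
rewrite (@eq_Ex _ _ _ P (fun w => (c * Y w + e) * V w) (fun w => c * (Y w * V w) + e * V w)); last first.
  by move=> w; ring.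
rewrite !ExD ?Ex_cst ?ExZ//; try exact: integrableRZ; try exact: integrableR_cst.
by ring.
Qed.

(** Mapping [-y, y] and [-v, v] affinely onto the unit interval divides the covariance by (2y)(2v),
    which is the origin of the factor 4. *)
Lemma cov_bounded a y v Y V : 0 < y -> 0 < v -> measR Y -> measR V ->
  (forall w, `|Y w| <= y) -> (forall w, `|V w| <= v) ->
  separated a Y V -> `|cov Y V| <= 4 * a * (y * v).
Proof.
move=> y0 v0 mY mV Yy Vv sep.
pose n (t x : R) := (2 * t)^-1 * x + 2^-1.
have mn t : measurable_fun setT (n t).
  by apply: measurable_funD => //; exact: measurable_funM.
have n01 t x : 0 < t -> `|x| <= t -> 0 <= n t x <= 1.
  move=> t0; rewrite ler_norml => /andP[h1 h2].
  have h3 : `|x / t| <= 1 by rewrite normrM normfV (gtr0_norm t0) ler_pdivrMr// mul1r ler_norml h1.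
  have -> : n t x = (x / t + 1) / 2 by rewrite /n invfM; ring.
  by move: h3; rewrite ler_norml => /andP[h4 h5]; apply/andP; split; lra.
have nK t x : 0 < t -> x = 2 * t * n t x + - t.
  by move=> t0; rewrite /n mulrDr mulrA divff ?mul1r ?gt_eqF ?mulr_gt0//; lra.
have iu Z : measR Z -> (forall w, 0 <= Z w <= 1) -> integrableR P Z.
  move=> mZ Z01; apply: (@integrableR_bounded _ _ _ _ _ 1) => // w.
  by have /andP[? ?] := Z01 w; rewrite ger0_norm.
have mY' : measR (n y \o Y) by exact: measurableT_comp.
have mV' : measR (n v \o V) by exact: measurableT_comp.
have Y01 w : 0 <= (n y \o Y) w <= 1 by exact: n01.
have V01 w : 0 <= (n v \o V) w <= 1 by exact: n01.
have := cov_unit_itv mY' mV' Y01 V01 (separated_comp (mn y) (mn v) sep).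
have iV : integrableR P V by exact: integrableR_bounded Vv.
have iYV' : integrableR P (fun w => (n y \o Y) w * V w).
  apply: (@integrableR_bounded _ _ _ _ _ (1 * v)); first exact: measurable_funM.
  move=> w; rewrite normrM; apply: ler_pM => //.
  by have /andP[? ?] := Y01 w; rewrite ger0_norm.
have YE : Y = (fun w => 2 * y * (n y \o Y) w + - y) by apply/funext => w; exact: nK.
have VE : V = (fun w => 2 * v * (n v \o V) w + - v) by apply/funext => w; exact: nK.
have -> : cov Y V = 2 * y * (2 * v * cov (n y \o Y) (n v \o V)).
  rewrite [in LHS]YE cov_affine//; last exact: iu.
  congr (_ * _); rewrite covC [in LHS]VE cov_affine; first by rewrite covC.
  - exact: iu.
  - exact: iu.
  - by apply: iu; [exact: measurable_funM|move=> w; have := Y01 w; have := V01 w; nra].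
move=> H; rewrite (normrM (2 * y)) (normrM (2 * v)) (@gtr0_norm _ (2 * y)) ?mulr_gt0// (@gtr0_norm _ (2 * v)) ?mulr_gt0//.
have -> : 4 * a * (y * v) = 2 * y * (2 * v * a) by ring.
by rewrite ler_pM2l ?mulr_gt0// ler_pM2l ?mulr_gt0.
Qed.

Definition truncate (t x : R) : R := if `|x| <= t then x else 0.

Lemma measurable_truncate t : measurable_fun [set: R] (truncate t).
Proof.
apply: measurable_fun_ifT => //.
by apply: measurable_fun_ler => //; exact: normr_measurable.
Qed.

Lemma truncate_le t x : 0 <= t -> `|truncate t x| <= t.
Proof. by move=> t0; rewrite /truncate; case: ifP => // _; rewrite normr0. Qed.

Lemma truncate_norm t x : `|truncate t x| <= `|x|.
Proof. by rewrite /truncate; case: ifP => // _; rewrite normr0. Qed.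

(** Y and V are truncated at tau^p and tau^q. The truncated variables are bounded, which gives the
    first term. A truncation acts only where tau < xi, so each replacement costs at most the tail of
    xi^(p+q), of mean at most [eta]: once in E[YV], and twice, next to a factor bounded by K, in
    E[Y]E[V]. *)
Lemma cov_tail a K eta tau p q xi Y V :
  0 <= a -> 0 <= p -> 0 <= q -> 1 <= tau -> 0 <= K -> measR Y -> measR V -> measR xi ->
  (forall w, 1 <= xi w) ->
  (forall w, `|Y w| <= xi w `^ p) -> (forall w, `|V w| <= xi w `^ q) ->
  integrableR P (fun w => xi w `^ (p + q)) -> Ex P (fun w => xi w `^ (p + q)) <= K ->
  Ex P (fun w => xi w `^ (p + q) * ((tau < xi w)%R)%:R) <= eta ->
  separated a Y V -> `|cov Y V| <= 4 * a * tau `^ (p + q) + eta * (1 + 2 * K).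
Proof.
move=> a0 p0 q0 tau1 K0 mY mV mxi xi1 Yxi Vxi ixi EK Eeta sep.
have tau0 : 0 < tau by exact: lt_le_trans tau1.
have xi0 w : 0 < xi w by exact: lt_le_trans (xi1 w).
have Dpq x : 0 < x -> x `^ (p + q) = x `^ p * x `^ q.
  by move=> x0; rewrite powRD//; apply/implyP => _; rewrite gt_eqF.
have xp w : xi w `^ p <= xi w `^ (p + q) by rewrite ler_powR// lerDl.
have xq w : xi w `^ q <= xi w `^ (p + q) by rewrite ler_powR// lerDr.
pose H w := xi w `^ (p + q) * ((tau < xi w)%R)%:R.
have mB : measR (fun w => ((tau < xi w)%R)%:R : R).
  apply: (@measurableT_comp _ _ _ _ _ _ (fun b : bool => b%:R : R)) => //.
  exact: measurable_fun_ltr.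
have mH : measR H by apply: measurable_funM => //; exact: measR_powR.
have H0 w : 0 <= H w by rewrite mulr_ge0// powR_ge0.
have iH : integrableR P H.
  apply: integrableR_le ixi => // w; rewrite ger0_norm// ler_piMr ?powR_ge0//.
  by rewrite lern1 leq_b1.
have big s (x : R) w : 0 <= s -> tau `^ s < `|x| -> `|x| <= xi w `^ s -> tau < xi w.
  move=> s0 h1 h2; rewrite ltNge; apply/negP => h3.
  have := ge0_ler_powR s0 _ _ h3; rewrite !nnegrE (ltW tau0) (ltW (xi0 w)) => /(_ isT isT).
  by move=> h4; have := lt_le_trans h1 (le_trans h2 h4); rewrite ltxx.
have ipow s : 0 <= s -> s <= p + q -> integrableR P (fun w => xi w `^ s).
  move=> s0 sp; apply: integrableR_le ixi; first exact: measR_powR.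
  by move=> w; rewrite ger0_norm ?powR_ge0// ler_powR.
have iY : integrableR P Y by apply: integrableR_le (ipow _ p0 _) => //; rewrite lerDl.
have iV : integrableR P V by apply: integrableR_le (ipow _ q0 _) => //; rewrite lerDr.
pose Y' := truncate (tau `^ p) \o Y; pose V' := truncate (tau `^ q) \o V.
have mY' : measR Y' by apply: measurableT_comp => //; exact: measurable_truncate.
have mV' : measR V' by apply: measurableT_comp => //; exact: measurable_truncate.
have Y'Y w : `|Y' w| <= `|Y w| by exact: truncate_norm.
have V'V w : `|V' w| <= `|V w| by exact: truncate_norm.
have iYV (F G : Omega -> R) : measR F -> measR G -> (forall w, `|F w| <= `|Y w|) ->
    (forall w, `|G w| <= `|V w|) -> integrableR P (fun w => F w * G w).
  move=> mF mG FY GV; apply: integrableR_le ixi; first exact: measurable_funM.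
  move=> w; rewrite normrM Dpq//; apply: ler_pM => //.
    exact: le_trans (FY w) (Yxi w).
  exact: le_trans (GV w) (Vxi w).
have iY' : integrableR P Y'.
  by apply: integrableR_le (ipow _ p0 _) => [//|w|]; [exact: le_trans (Y'Y w) _|rewrite lerDl].
have iV' : integrableR P V'.
  by apply: integrableR_le (ipow _ q0 _) => [//|w|]; [exact: le_trans (V'V w) _|rewrite lerDr].
have dY w : `|Y w - Y' w| <= H w.
  rewrite /Y' /= /truncate; case: (leP `|Y w| (tau `^ p)) => h; first by rewrite subrr normr0.
  by rewrite subr0 /H (big p (Y w))//= mulr1; exact: le_trans (Yxi w) (xp w).
have dV w : `|V w - V' w| <= H w.
  rewrite /V' /= /truncate; case: (leP `|V w| (tau `^ q)) => h; first by rewrite subrr normr0.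
  by rewrite subr0 /H (big q (V w))//= mulr1; exact: le_trans (Vxi w) (xq w).
have dYV w : `|Y w * V w - Y' w * V' w| <= H w.
  have h3 : `|Y w * V w| <= xi w `^ (p + q) by rewrite normrM Dpq//; exact: ler_pM.
  rewrite /Y' /V' /= /truncate; case: (leP `|Y w| (tau `^ p)) => h1; last first.
    by rewrite mul0r subr0 /H (big p (Y w))//= mulr1.
  case: (leP `|V w| (tau `^ q)) => h2; first by rewrite subrr normr0.
  by rewrite mulr0 subr0 /H (big q (V w))//= mulr1.
have Ele F G : integrableR P F -> integrableR P G -> (forall w, `|F w - G w| <= H w) ->
    `|Ex P F - Ex P G| <= eta.
  move=> iF iG FG; rewrite -ExB//; apply: le_trans Eeta; apply: Ex_normr_le => //.
  by apply: measurable_funB; [exact: (integrable_measR iF)|exact: (integrable_measR iG)].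
have EleK F s : 0 <= s -> s <= p + q -> measR F -> (forall w, `|F w| <= xi w `^ s) -> `|Ex P F| <= K.
  move=> s0 sp mF Fx; apply: le_trans EK; apply: Ex_normr_le => // w.
  by apply: (le_trans (Fx w)); rewrite ler_powR.
have C1 : `|cov Y' V'| <= 4 * a * tau `^ (p + q).
  rewrite Dpq//; apply: cov_bounded; rewrite ?powR_gt0//.
  - by move=> w; apply: truncate_le; exact: powR_ge0.
  - by move=> w; apply: truncate_le; exact: powR_ge0.
  - by apply: separated_comp sep; exact: measurable_truncate.
have C2 : `|cov Y V - cov Y' V'| <= eta * (1 + 2 * K).
  rewrite /cov; set A := Ex P _; set B := Ex P (fun w => Y' w * _).
  have -> : A - Ex P Y * Ex P V - (B - Ex P Y' * Ex P V') =
    (A - B) - ((Ex P Y - Ex P Y') * Ex P V + Ex P Y' * (Ex P V - Ex P V')) by ring.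
  have h1 : `|A - B| <= eta by apply: Ele => //; exact: iYV.
  have h2 : `|(Ex P Y - Ex P Y') * Ex P V| <= eta * K.
    rewrite normrM; apply: ler_pM => //; first exact: Ele.
    by apply: (EleK _ q) => //; rewrite lerDr.
  have h3 : `|Ex P Y' * (Ex P V - Ex P V')| <= K * eta.
    rewrite normrM; apply: ler_pM => //; last exact: Ele.
    apply: (EleK _ p) => //; first by rewrite lerDl.
    by move=> w; exact: le_trans (Y'Y w) _.
  apply: (le_trans (ler_normB _ _)); apply: (le_trans (lerD h1 (ler_normD _ _))).
  by apply: (le_trans (lerD (lexx _) (lerD h2 h3))); lra.
rewrite -(subrK (cov Y' V') (cov Y V)) addrC.
by apply: (le_trans (ler_normD _ _)); exact: lerD.
Qed.

End Separation.

(** * Majorants and Davydov's inequality *)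

Section Majorants.
Context (dO : measure_display) (Omega : measurableType dO) (R : realType)
  (P : probability Omega R) (r : \bar R) (r1 : (1%:E <= r)%E).
Implicit Types (Y V xi : Omega -> R) (K : R).

(* A single variable dominating all the |X_i| of interest turns the powers
   |X_i|^p into powers of one [xi], so that no Hoelder inequality is needed. *)
Definition majorant K xi := [/\ measR xi, forall w, 1 <= xi w &
  match r with
  | r'%:E%E => integrableR P (fun w => xi w `^ r') /\ Ex P (fun w => xi w `^ r') <= K
  | _ => \forall w \ae P, xi w <= K
  end].

Lemma Ex_ae_le Y c : measR Y -> (forall w, 0 <= Y w) -> 0 <= c ->
  (\forall w \ae P, Y w <= c) -> integrableR P Y /\ Ex P Y <= c.
Proof.
move=> mY Y0 c0 Yc.
have H : (\int[P]_w `|(Y w)%:E| <= c%:E)%E.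
  apply: (@le_trans _ _ (\int[P]_w (cst c%:E) w)%E); last first.
    by rewrite integral_cst//= probability_setT mule1.
  apply: ae_ge0_le_integral => //.
  - by apply/measurable_EFinP; exact: measurableT_comp.
  - by apply: filterS Yc => w Yw _; rewrite lee_fin ger0_norm.
have iY : integrableR P Y.
  by apply/integrableP; split; [exact/measurable_EFinP|exact: le_lt_trans H (ltry _)].
split => //; rewrite /Ex unlock -lee_fin fineK; last exact: integrable_fin_num.
by apply: le_trans H; apply: le_integral => //; [exact: integrable_abse|move=> w _; rewrite lee_fin ler_norm].
Qed.

(** For finite r the moment is at most K, for infinite r at most K^p; as K >= 1, the power K^(1+p)
    covers both. *)
Lemma majorant_pow K xi p : 1 <= K -> 0 <= p -> (p%:E <= r)%E -> majorant K xi ->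
  integrableR P (fun w => xi w `^ p) /\ Ex P (fun w => xi w `^ p) <= K `^ (1 + p).
Proof.
move=> K1 p0 pr [mxi xi1].
have KK : K <= K `^ (1 + p) by rewrite -{1}[K]powRr1 ?(le_trans ler01)// ler_powR// lerDl.
case: r pr => [r'| |]//; last 1 first.
- move=> _ xiK.
  have [|//|//||i1 i2] := @Ex_ae_le (fun w => xi w `^ p) (K `^ p).
  + exact: measR_powR.
  + by move=> w; exact: powR_ge0.
  + exact: powR_ge0.
  + apply: filterS xiK => w xw; apply: ge0_ler_powR => //; rewrite nnegrE.
      exact: le_trans (xi1 w).
    exact: le_trans K1.
  + by split => //; apply: le_trans i2 _; rewrite ler_powR// lerDr.
rewrite lee_fin => pr [ixi Exi].
have ip : integrableR P (fun w => xi w `^ p).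
  apply: integrableR_le ixi; first exact: measR_powR.
  by move=> w; rewrite ger0_norm ?powR_ge0// ler_powR.
split => //; apply: le_trans KK; apply: le_trans Exi; apply: Ex_le => // w.
by rewrite ler_powR.
Qed.

Lemma cov_scale c1 c2 Y V : integrableR P Y -> integrableR P V ->
  integrableR P (fun w => Y w * V w) ->
  cov P (fun w => c1 * Y w) (fun w => c2 * V w) = c1 * c2 * cov P Y V.
Proof.
move=> iY iV iYV; rewrite /cov (@eq_Ex _ _ _ P _ (fun w => (c1 * c2) * (Y w * V w))).
  by rewrite !ExZ//; ring.
by move=> w; ring.
Qed.

(** Passage to the limit b -> 0, with 0^0 = 1 when e = 0. *)
Lemma le_powR_limit (x C e : R) : 0 <= C -> 0 <= e ->
  (forall b, 0 < b <= 1 -> x <= C * b `^ e) -> x <= C * 0 `^ e.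
Proof.
move=> C0 e0 H; have [e00|en0] := eqVneq e 0.
  by have := H 1; rewrite e00 !powRr0 ltr01 lexx => /(_ isT).
rewrite powR0// mulr0 leNgt; apply/negP => x0.
have {}e0 : 0 < e by rewrite lt0r en0.
have {}C0 : 0 < C.
  rewrite lt0r C0 andbT; apply/eqP => CE; have := H 1; rewrite CE mul0r ltr01 lexx => /(_ isT).
  by rewrite leNgt x0.
have y0 : 0 < x / (2 * C) by rewrite divr_gt0// mulr_gt0.
have := H (Num.min 1 ((x / (2 * C)) `^ e^-1)).
rewrite lt_min ltr01 powR_gt0//= ge_min lexx/= => /(_ isT) H1.
suff : x <= x / 2 by lra.
apply: (le_trans H1); rewrite -ler_pdivlMl// [leRHS]mulrC.
have -> : x / 2 / C = (x / (2 * C)) `^ e^-1 `^ e.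
  by rewrite -powRrM mulVf// powRr1 ?ltW// invfM mulrA.
apply: ge0_ler_powR; first exact: ltW.
- by rewrite nnegrE le_min ler01 powR_ge0.
- by rewrite nnegrE powR_ge0.
- by rewrite ge_min lexx orbT.
Qed.

Definition davydov_const K p := 4 * K `^ (1 + p) + K * (1 + 2 * K).

Lemma davydov_unit a K p q xi Y V : 1 <= K -> 0 <= p -> 0 <= q ->
  ((p + q)%:E <= r)%E -> majorant K xi -> 0 <= a <= 1 -> measR Y -> measR V ->
  (forall w, `|Y w| <= xi w `^ p) -> (forall w, `|V w| <= xi w `^ q) ->
  separated P a Y V -> `|cov P Y V| <= davydov_const K (p + q) * a `^ rexp r (p + q).
Proof.
move=> K1 p0 q0 pqr maj /andP[a0 a1] mY mV Yxi Vxi sep.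
have pq0 : 0 <= p + q by rewrite addr_ge0.
have K0 : 0 <= K by exact: le_trans K1.
have [ixi _] := majorant_pow K1 pq0 pqr maj.
have KK : 1 <= K `^ (1 + (p + q)).
  by rewrite -[leLHS](powRr0 K) ler_powR// addr_ge0.
move: maj => [mxi xi1]; case: r r1 pqr => [r'| |]//; last first.
  move=> _ _ xiK; rewrite /rexp powRr1//.
  have [|//|//||_ i2] := @Ex_ae_le (fun w => xi w `^ (p + q)) (K `^ (p + q)).
  - exact: measR_powR.
  - by move=> w; exact: powR_ge0.
  - exact: powR_ge0.
  - apply: filterS xiK => w xw; apply: ge0_ler_powR => //; rewrite nnegrE//.
    exact: le_trans (xi1 w).
  (* With tau = K the tail event is null, so that eta = 0. *)
  have := @cov_tail _ _ _ P a (K `^ (p + q)) 0 K p q xi Y V a0 p0 q0 K1 (powR_ge0 _ _) mY mV mxi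
    xi1 Yxi Vxi ixi i2.
  have -> : Ex P (fun w => xi w `^ (p + q) * ((K < xi w)%R)%:R) = 0.
    apply: Ex_ae0.
      apply: measurable_funM; first exact: measR_powR.
      apply: (@measurableT_comp _ _ _ _ _ _ (fun b : bool => b%:R : R)) => //.
      exact: measurable_fun_ltr.
    by apply: filterS xiK => w xw; rewrite ltNge xw mulr0.
  move=> /(_ (lexx _) sep) H; apply: (le_trans H); rewrite mul0r /davydov_const [leRHS]mulrDl.
  apply: lerD; last by rewrite !mulr_ge0// addr_ge0// mulr_ge0.
  by rewrite mulrAC ler_wpM2r// ler_wpM2l// ler_powR// lerDr.
rewrite !lee_fin => r1' pqr [ixr Er].
have r0 : 0 < r' by exact: lt_le_trans r1'.
set e := rexp _ _; have eE : e = (r' - (p + q)) / r' by [].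
have e0 : 0 <= e by rewrite eE divr_ge0 ?subr_ge0// ltW.
have C0 : 0 <= davydov_const K (p + q).
  by rewrite addr_ge0// mulr_ge0// ?powR_ge0// addr_ge0// mulr_ge0.
(* The truncation level is a negative power of the mixing bound. Since [a] may vanish, it is
   replaced by a positive b >= a, and b tends to 0 in that case. *)
suff H b : 0 < b <= 1 -> a <= b -> `|cov P Y V| <= davydov_const K (p + q) * b `^ e.
  have [a00|an0] := eqVneq a 0.
    rewrite a00; apply: le_powR_limit => // b b01; apply: H => //.
    by rewrite a00; case/andP: b01 => /ltW.
  by apply: H => //; rewrite lt0r an0 a0.
move=> /andP[b0 b1] ab.
(* This level balances the two terms of [cov_tail]: b tau^(p+q) and tau^(p+q-r) are both
   b^((r-p-q)/r). *)
pose tau := b `^ (- r'^-1).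
have tau1 : 1 <= tau.
  rewrite /tau powRN -powR_inv1 ?powR_ge0// -powRrM mulrN1 -[leLHS](powRr0 b).
  by rewrite ger_powR ?b0// oppr_le0 invr_ge0 ltW.
have tau0 : 0 < tau by exact: lt_le_trans tau1.
have Epq : Ex P (fun w => xi w `^ (p + q)) <= K.
  apply: le_trans Er; apply: Ex_le => // w; exact: ler_powR.
have tE : tau `^ (p + q - r') = b `^ e.
  by rewrite /tau -powRrM; congr (_ `^ _); rewrite eE -opprB; ring.
have bt : b * tau `^ (p + q) = b `^ e.
  rewrite /tau -powRrM -{1}[b]powRr1 ?ltW// -powRD; last by apply/implyP => _; rewrite gt_eqF.
  by congr (_ `^ _); rewrite eE; field; rewrite gt_eqF.
have := @cov_tail _ _ _ P a K (K * b `^ e) tau p q xi Y V a0 p0 q0 tau1 K0 mY mV mxi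
  xi1 Yxi Vxi ixi Epq.
have xi0 w : 0 < xi w by exact: lt_le_trans (xi1 w).
have Etail : Ex P (fun w => xi w `^ (p + q) * ((tau < xi w)%R)%:R) <= K * b `^ e.
  apply: (@le_trans _ _ (Ex P (fun w => b `^ e * xi w `^ r'))); last first.
    by rewrite ExZ// mulrC ler_wpM2r// powR_ge0.
  apply: Ex_le; last first.
  - move=> w; case: ltP => tx; last by rewrite mulr0 mulr_ge0 ?powR_ge0.
    rewrite mulr1 -tE.
    have -> : p + q = (p + q - r') + r' by ring.
    rewrite powRD; last by apply/implyP => _; rewrite gt_eqF.
    rewrite subrK ler_wpM2r ?powR_ge0//.
    rewrite -opprB !powRN lef_pV2 ?posrE ?powR_gt0//.
    by apply: ge0_ler_powR; rewrite ?subr_ge0 ?nnegrE ?(ltW tau0) ?(ltW (xi0 w)) ?(ltW tx).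
  - exact: integrableRZ.
  - apply: integrableR_le ixi.
      apply: measurable_funM; first exact: measR_powR.
      apply: (@measurableT_comp _ _ _ _ _ _ (fun b : bool => b%:R : R)) => //.
      exact: measurable_fun_ltr.
    move=> w; rewrite ger0_norm ?mulr_ge0 ?powR_ge0// ler_piMr ?powR_ge0//.
    by rewrite lern1 leq_b1.
move=> /(_ Etail sep) H; apply: (le_trans H).
have -> : davydov_const K (p + q) * b `^ e =
  4 * (K `^ (1 + (p + q)) * b `^ e) + K * b `^ e * (1 + 2 * K) by rewrite /davydov_const; ring.
apply: lerD => //; rewrite -mulrA ler_wpM2l//; apply: (@le_trans _ _ (b `^ e)).
  by rewrite -bt ler_wpM2r// powR_ge0.
by rewrite ler_peMl// powR_ge0.
Qed.

Lemma davydov a K p q c1 c2 xi Y V : 1 <= K -> 0 <= p -> 0 <= q -> 0 <= c1 -> 0 <= c2 ->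
  ((p + q)%:E <= r)%E -> majorant K xi -> 0 <= a <= 1 -> measR Y -> measR V ->
  (forall w, `|Y w| <= c1 * xi w `^ p) -> (forall w, `|V w| <= c2 * xi w `^ q) ->
  separated P a Y V ->
  `|cov P Y V| <= c1 * c2 * (davydov_const K (p + q) * a `^ rexp r (p + q)).
Proof.
move=> K1 p0 q0 c10 c20 pqr maj a01 mY mV Yxi Vxi sep.
have [mxi xi1 _] := maj.
have pq0 : 0 <= p + q by rewrite addr_ge0.
have [ixi _] := majorant_pow K1 pq0 pqr maj.
have norm c s (Z : Omega -> R) : 0 <= c -> (forall w, `|Z w| <= c * xi w `^ s) ->
    (forall w, `|c^-1 * Z w| <= xi w `^ s) /\ Z = (fun w => c * (c^-1 * Z w)).
  move=> c0 Zc; have [cE|cn] := eqVneq c 0.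
    have Z0 w : Z w = 0 by apply/eqP; rewrite -normr_le0; have := Zc w; rewrite cE mul0r.
    split=> [w|]; first by rewrite Z0 mulr0 normr0 powR_ge0.
    by apply/funext => w; rewrite Z0 cE mul0r.
  have c0' : 0 < c by rewrite lt0r cn.
  split=> [w|]; last by apply/funext => w; rewrite mulrA divff// mul1r.
  by rewrite normrM normfV (ger0_norm c0) mulrC ler_pdivrMr// mulrC.
have [hY YE] := norm c1 p Y c10 Yxi; have [hV VE] := norm c2 q V c20 Vxi.
have ipow s : 0 <= s -> s <= p + q -> integrableR P (fun w => xi w `^ s).
  move=> s0 sp; apply: integrableR_le ixi; first exact: measR_powR.
  by move=> w; rewrite ger0_norm ?powR_ge0// ler_powR.
have mY' : measR (fun w => c1^-1 * Y w) by exact: measurable_funM.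
have mV' : measR (fun w => c2^-1 * V w) by exact: measurable_funM.
rewrite [in X in cov _ X]YE [in X in cov _ _ X]VE cov_scale; last 3 first.
- by apply: integrableR_le (ipow p _ _) => //; rewrite lerDl.
- by apply: integrableR_le (ipow q _ _) => //; rewrite lerDr.
- apply: integrableR_le ixi; first exact: measurable_funM.
  move=> w; rewrite normrM powRD; last by apply/implyP => _; rewrite gt_eqF// (lt_le_trans _ (xi1 w)).
  exact: ler_pM.
rewrite normrM ger0_norm ?mulr_ge0// ler_wpM2l ?mulr_ge0//.
apply: (@davydov_unit _ _ _ _ xi) => //.
apply: (@separated_comp _ _ _ _ _ _ _ (fun x => c1^-1 * x) (fun x => c2^-1 * x)) sep;
  exact: mulrl_measurable.
Qed.

(** Young's inequality for each x / m, where m is the mean, summed over the list. *)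
Lemma power_mean (s : seq R) (p : R) : 1 <= p -> (0 < size s)%N -> (forall x, x \in s -> 0 <= x) ->
  ((size s)%:R^-1 * \sum_(x <- s) x) `^ p <= (size s)%:R^-1 * \sum_(x <- s) x `^ p.
Proof.
move=> p1 s0 s_ge0; have n0 : (0 : R) < (size s)%:R by rewrite ltr0n.
set m := (size s)%:R^-1 * _.
have p0 : 0 < p by exact: lt_le_trans p1.
have S0 : 0 <= \sum_(x <- s) x `^ p by apply: sumr_ge0 => x _; exact: powR_ge0.
have [m0|mn0] := eqVneq m 0.
  by rewrite m0 powR0 ?gt_eqF// mulr_ge0// invr_ge0 ltW.
have {mn0} m0 : 0 < m.
  have S1 : 0 <= \sum_(x <- s) x by rewrite big_seq; apply: sumr_ge0.
  by rewrite lt0r mn0 /m mulr_ge0// invr_ge0 ltW.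
have [pE|pn1] := eqVneq p 1.
  have -> : \sum_(x <- s) x `^ p = \sum_(x <- s) x.
    by rewrite pE big_seq [RHS]big_seq; apply: eq_bigr => x xs; rewrite powRr1// s_ge0.
  by rewrite pE powRr1 ?(ltW m0).
have p1' : 1 < p by rewrite lt_neqAle eq_sym pn1.
pose q := p / (p - 1); have q0 : 0 < q by rewrite divr_gt0// subr_gt0.
have pq : p^-1 + q^-1 = 1.
  by rewrite /q invf_div -{1}(div1r p) -mulrDl subrKC mulfV// gt_eqF.
have Young x : x \in s -> x / m <= (x / m) `^ p / p + q^-1.
  move=> xs; have := conjugate_powR (divr_ge0 (s_ge0 _ xs) (ltW m0)) ler01 p0 q0 pq.
  by rewrite mulr1 powR1 mul1r.
have : \sum_(x <- s) x / m <= \sum_(x <- s) ((x / m) `^ p / p + q^-1).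
  by rewrite !big_seq; apply: ler_sum => x; exact: Young.
rewrite big_split/= -!mulr_suml big_const_seq count_predT iter_addr_0 -[q^-1 *+ _]mulr_natl.
have -> : \sum_(x <- s) x = (size s)%:R * m by rewrite /m mulrA mulfV ?mul1r// gt_eqF.
have -> : \sum_(x <- s) (x / m) `^ p = (\sum_(x <- s) x `^ p) / m `^ p.
  rewrite mulr_suml !big_seq; apply: eq_bigr => x xs.
  have -> : (x / m) `^ p = x `^ p * m^-1 `^ p.
    by apply: powRM; [exact: s_ge0|rewrite invr_ge0; exact: ltW].
  by congr (_ * _); rewrite -(powR_inv1 (ltW m0)) -powRrM mulN1r powRN.
rewrite mulfK ?gt_eqF//.
have -> : q^-1 = 1 - p^-1 by rewrite -pq; ring.
rewrite mulrBr mulr1 => H.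
have : (size s)%:R / p <= (\sum_(x <- s) x `^ p) / m `^ p / p by lra.
rewrite ler_pM2r ?invr_gt0// ler_pdivlMr ?powR_gt0// => H'.
by rewrite mulrC ler_pdivlMr// mulrC.
Qed.

Lemma majorant_le K K' xi : K <= K' -> majorant K xi -> majorant K' xi.
Proof.
rewrite /majorant => KK [mxi xi1]; case: r => [r'| |].
- by move=> [ixi Ex]; split => //; split => //; exact: le_trans KK.
- by move=> xiK; split => //; apply: filterS xiK => w xw; exact: le_trans KK.
- by move=> xiK; split => //; apply: filterS xiK => w xw; exact: le_trans KK.
Qed.

Definition scale_const (c K : R) := if r is r'%:E%E then c `^ r' * K else c * K.

Lemma majorant_scale c K xi : 1 <= c -> majorant K xi ->
  majorant (scale_const c K) (fun w => c * xi w).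
Proof.
move=> c1 [mxi xi1 H]; rewrite /scale_const.
have c0 : 0 <= c by exact: le_trans c1.
split => [|w|]; first exact: measurable_funM.
  by rewrite -[leLHS]mulr1; apply: ler_pM.
move: H; case: r => [r'| |].
- move=> [ixi Ex].
  have E w : (c * xi w) `^ r' = c `^ r' * xi w `^ r' by rewrite powRM// (le_trans _ (xi1 w)).
  split; first by apply: (eq_integrableR (fun w => esym (E w))); exact: integrableRZ.
  by rewrite (eq_Ex _ E) ExZ// ler_wpM2l// powR_ge0.
- by apply: filterS => w xw; rewrite ler_wpM2l.
- by apply: filterS => w xw; rewrite ler_wpM2l.
Qed.

(** By convexity the constant K does not depend on the number of variables. This allows a mean over
    a whole shell of sites to be treated like a single variable. *)
Lemma majorant_mean (I : eqType) (s : seq I) K (xi : I -> Omega -> R) : (0 < size s)%N ->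
  (forall i, i \in s -> majorant K (xi i)) ->
  majorant K (fun w => (size s)%:R^-1 * \sum_(i <- s) xi i w).
Proof.
move=> s0 H; have n0 : (0 : R) < (size s)%:R by rewrite ltr0n.
have H1 i w : i \in s -> 1 <= xi i w by move=> /H[].
have const c : \sum_(i <- s) c = (size s)%:R * c :> R.
  by rewrite big_const_seq count_predT iter_addr_0 mulr_natl.
have meas (f : I -> Omega -> R) : (forall i, i \in s -> measR (f i)) ->
    measR (fun w => \sum_(i <- s) f i w).
  elim: (s) => [|i t IH] mf; first by under eq_fun do rewrite big_nil; exact: measurable_cst.
  under eq_fun do rewrite big_cons; apply: measurable_funD; first by apply: mf; rewrite mem_head.
  by apply: IH => j jt; apply: mf; rewrite inE jt orbT.
split.
- by apply: measurable_funM => //; apply: meas => i /H[].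
- move=> w; rewrite -[leLHS](mulKf (x := (size s)%:R)) ?gt_eqF// ler_wpM2l ?invr_ge0 ?(ltW n0)//.
  by rewrite -const !big_seq; apply: ler_sum => i; exact: H1.
have ae (c : R) : (forall i, i \in s -> \forall w \ae P, xi i w <= c) ->
    \forall w \ae P, (size s)%:R^-1 * \sum_(i <- s) xi i w <= c.
  move=> h; have : \forall w \ae P, forall i, i \in s -> xi i w <= c.
    elim: (s) h => [|i t IH] h; first exact: nearW.
    have h1 := h i (mem_head _ _).
    have h2 : \forall w \ae P, forall i, i \in t -> xi i w <= c.
      by apply: IH => j jt; apply: h; rewrite inE jt orbT.
    by apply: filterS2 h1 h2 => w ? ? j; rewrite inE => /orP[/eqP ->|]; auto.
  apply: filterS => w hw; rewrite mulrC ler_pdivrMr// mulrC -const !big_seq.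
  by apply: ler_sum => i; exact: hw.
move: H; rewrite /majorant; case: r r1 => [r'| |]//; last by move=> _ H; apply: ae => i /H[].
rewrite lee_fin => r1' H.
have B w : ((size s)%:R^-1 * \sum_(i <- s) xi i w) `^ r' <=
    (size s)%:R^-1 * \sum_(i <- s) xi i w `^ r'.
  have := @power_mean [seq xi i w | i <- s] r' r1'; rewrite size_map !big_map; apply => //.
  by move=> x /mapP[i si ->]; exact: le_trans (H1 i w si).
have [isum Esum] : integrableR P (fun w => \sum_(i <- s) xi i w `^ r') /\
    Ex P (fun w => \sum_(i <- s) xi i w `^ r') <= \sum_(i <- s) K.
  elim: (s) H => [|i t IH] H.
    under eq_fun do rewrite big_nil; split; first exact: integrableR_cst.
    by rewrite big_nil Ex_cst.
  have [_ _ [i1 E1]] := H i (mem_head _ _).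
  have [|i2 E2] := IH; first by move=> j jt; apply: H; rewrite inE jt orbT.
  under eq_fun do rewrite big_cons.
  by split; [exact: integrableRD|rewrite ExD// big_cons lerD].
split.
  apply: (integrableR_le _ _ (integrableRZ (size s)%:R^-1 isum)).
    apply: measR_powR; apply: measurable_funM => //; apply: meas => i /H[] //.
  by move=> w; rewrite ger0_norm ?powR_ge0.
apply: (@le_trans _ _ (Ex P (fun w => (size s)%:R^-1 * \sum_(i <- s) xi i w `^ r'))).
  apply: Ex_le => //; last exact: integrableRZ.
  apply: (integrableR_le _ _ (integrableRZ (size s)%:R^-1 isum)).
    apply: measR_powR; apply: measurable_funM => //; apply: meas => i /H[] //.
  by move=> w; rewrite ger0_norm ?powR_ge0.
by rewrite ExZ// mulrC ler_pdivrMr// mulrC -const.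
Qed.

(** From (1 + x)^r <= 2^r (1 + x^r). *)
Definition norm_const (M : R) := if r is r'%:E%E then 2 `^ r' * (1 + M `^ r') else 1 + M.

Lemma majorant_of_norm (X : {RV P >-> R}) M : 0 <= M -> ('N[P]_r[EFin \o X] <= M%:E)%E ->
  majorant (norm_const M) (fun w => 1 + `|X w|).
Proof.
move=> M0; have mX : measR X by exact: measurable_funPT.
have mN : measR (fun w => `|X w|) by exact: measurableT_comp.
rewrite /majorant /norm_const; case: r r1 => [r'| |]//; rewrite unlock; last first.
  rewrite /= probability_setT lte01 => _ /ess_supP H.
  split=> [|w|]; [exact: measurable_funD|by rewrite lerDl|].
  by apply: filterS H => w /=; rewrite lee_fin lerD2l.
rewrite lee_fin => r1' H; have r0 : 0 < r' by exact: lt_le_trans r1'.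
have mP : measR (fun w => `|X w| `^ r') by exact: measR_powR.
have I : (\int[P]_w (`|X w| `^ r')%:E <= (M `^ r')%:E)%E.
  move: H; set J := (\int[P]_x _)%E.
  have -> : J = (\int[P]_w (`|X w| `^ r')%:E)%E by [].
  have J0 : (0 <= \int[P]_w (`|X w| `^ r')%:E)%E.
    by apply: integral_ge0 => w _; rewrite lee_fin powR_ge0.
  move=> /(@gt0_ler_poweR _ _ (ltW r0)).
  rewrite -poweRrM mulVf ?gt_eqF// poweRe1// => H; apply: (le_trans (H _ _)).
  - by rewrite in_itv/= poweR_ge0 leey.
  - by rewrite in_itv/= lee_fin M0 leey.
  - by rewrite poweR_EFin.
have iP : integrableR P (fun w => `|X w| `^ r').
  apply/integrableP; split; first exact/measurable_EFinP.
  apply: le_lt_trans (ltry (M `^ r')); apply: le_trans I.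
  by under eq_integral do rewrite /= ger0_norm ?powR_ge0//.
have EP : Ex P (fun w => `|X w| `^ r') <= M `^ r'.
  by rewrite /Ex unlock -lee_fin fineK//; exact: integrable_fin_num.
have B w : (1 + `|X w|) `^ r' <= 2 `^ r' * (1 + `|X w| `^ r').
  apply: (@le_trans _ _ ((2 * Num.max 1 `|X w|) `^ r')).
    apply: ge0_ler_powR; rewrite ?nnegrE ?addr_ge0 ?mulr_ge0 ?le_max ?ler01//; first exact: ltW.
    have [h1 h2] : 1 <= Num.max 1 `|X w| /\ `|X w| <= Num.max 1 `|X w|.
      by rewrite !le_max !lexx orbT.
    by rewrite mulr2n mulrDl mul1r lerD.
  rewrite powRM ?le_max ?ler01// ler_wpM2l ?powR_ge0//.
  by case: (leP 1 `|X w|) => _; [rewrite lerDr|rewrite powR1 lerDl powR_ge0].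
have iB : integrableR P (fun w => 2 `^ r' * (1 + `|X w| `^ r')).
  by apply: integrableRZ; apply: integrableRD => //; exact: integrableR_cst.
have i1 : integrableR P (fun w => (1 + `|X w|) `^ r').
  apply: integrableR_le iB; first by apply: measR_powR; exact: measurable_funD.
  by move=> w; rewrite ger0_norm ?powR_ge0.
split=> [|w|]; [exact: measurable_funD|by rewrite lerDl|split => //].
apply: (le_trans (Ex_le i1 iB B)); rewrite ExZ; last first.
  by apply: integrableRD => //; exact: integrableR_cst.
by rewrite ler_wpM2l ?powR_ge0// ExD ?Ex_cst ?lerD2l//; exact: integrableR_cst.
Qed.

End Majorants.

(** * Mixing fields *)

Section FieldMeasurability.
Context (d : nat) (dO : measure_display) (Omega : measurableType dO)
  (R : realType) (P : probability Omega R) (X : lattice d -> {RV P >-> R}).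
Implicit Types (s : seq (lattice d)) (Y V : Omega -> R).

Definition generators s : set (set Omega) :=
  \bigcup_(i in [set` [fset x in s]%fset])
    preimage_set_system [set: Omega] (X i) measurable.

(** Measurability with respect to the variables indexed by [s] is expressed by re-equipping Omega
    with the sigma-algebra they generate; the closure properties are then those of measurable
    functions. *)
Definition field_measurable s Y :=
  measurable_fun [set: g_sigma_algebraType (generators s)]
    (Y : g_sigma_algebraType (generators s) -> R).

Lemma generators_measurable s : generators s `<=` @measurable dO Omega.
Proof. by move=> _ [i _ [B mB <-]]; exact: (measurable_funPT (X i)). Qed.

Lemma sigma_field_preimage s Y B : field_measurable s Y -> measurable B ->
  sigma_field X [fset x in s]%fset (Y @^-1` B).
Proof. by move=> mY mB; have := mY measurableT B mB; rewrite setTI. Qed.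

Lemma sigma_field_measurable s : sigma_field X [fset x in s]%fset `<=` @measurable dO Omega.
Proof.
apply: smallest_sub; last exact: generators_measurable.
exact: sigma_algebra_measurable.
Qed.

Lemma field_measurable_measR s Y : field_measurable s Y -> measR Y.
Proof.
by move=> mY _ B mB; rewrite setTI; apply: (@sigma_field_measurable s); exact: sigma_field_preimage.
Qed.

Lemma field_measurable_sub s t Y : {subset s <= t} -> field_measurable s Y -> field_measurable t Y.
Proof.
move=> st mY _ B mB; have := mY measurableT B mB.
apply: sub_sigma_algebra2 => _ [i /= si [C mC <-]].
by exists i; [move: si; rewrite /= !inE; exact: st|exists C].
Qed.

Lemma field_measurable_X s i : i \in s -> field_measurable s (X i).
Proof.
move=> si _ B mB; apply: sub_gen_smallest; exists i; first by rewrite /= inE.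
by exists B.
Qed.

Lemma field_measurable_cst s c : field_measurable s (fun=> c).
Proof. exact: measurable_cst. Qed.

Lemma field_measurableM s Y V : field_measurable s Y -> field_measurable s V ->
  field_measurable s (fun w => Y w * V w).
Proof. exact: measurable_funM. Qed.

Lemma field_measurableD s Y V : field_measurable s Y -> field_measurable s V ->
  field_measurable s (fun w => Y w + V w).
Proof. exact: measurable_funD. Qed.

Lemma field_measurableB s Y V : field_measurable s Y -> field_measurable s V ->
  field_measurable s (fun w => Y w - V w).
Proof. exact: measurable_funB. Qed.

Lemma field_measurable_exp s Y n : field_measurable s Y -> field_measurable s (fun w => Y w ^+ n).
Proof. exact: measurable_funX. Qed.

Lemma field_measurable_sum s t (F : lattice d -> Omega -> R) :
  (forall i, i \in t -> field_measurable s (F i)) ->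
  field_measurable s (fun w => \sum_(i <- t) F i w).
Proof.
elim: t => [|i t IH] mF; first by under eq_fun do rewrite big_nil; exact: field_measurable_cst.
under eq_fun do rewrite big_cons; apply: field_measurableD; first by apply: mF; rewrite mem_head.
by apply: IH => j jt; apply: mF; rewrite inE jt orbT.
Qed.

Lemma field_measurable_comp s (phi : R -> R) Y : measurable_fun setT phi ->
  field_measurable s Y -> field_measurable s (phi \o Y).
Proof. exact: measurableT_comp. Qed.

End FieldMeasurability.

Section Mixing.
Context (d : nat) (dO : measure_display) (Omega : measurableType dO)
  (R : realType) (P : probability Omega R) (X : lattice d -> {RV P >-> R})
  (T : {fset lattice d}).
Implicit Types (s : seq (lattice d)) (Y V : Omega -> R).

Lemma prob_cov_le1 (A B : set Omega) : measurable A -> measurable B ->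
  `|fine (P (A `&` B)) - fine (P A) * fine (P B)| <= 1.
Proof.
move=> mA mB.
have p01 C : measurable C -> 0 <= fine (P C) <= 1.
  move=> mC; rewrite fine_ge0//= -lee_fin fineK ?probability_le1//.
  exact: fin_num_measure.
have := p01 _ mA; have := p01 _ mB; have := p01 _ (measurableI _ _ mA mB).
by move=> /andP[? ?] /andP[? ?] /andP[? ?]; rewrite ler_norml; apply/andP; split; nra.
Qed.

Lemma alpha_coef_ub (A B : set (set Omega)) a b : A `<=` measurable -> B `<=` measurable ->
  A a -> B b -> `|fine (P (a `&` b)) - fine (P a) * fine (P b)| <= alpha_coef P A B.
Proof.
move=> mA mB Aa Bb; apply: sup_upper_bound; last by exists a, b.
split; first by exists `|fine (P (a `&` b)) - fine (P a) * fine (P b)|, a, b.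
by exists 1 => _ [a' [b' [Aa' Bb' ->]]]; apply: prob_cov_le1; [exact: mA|exact: mB].
Qed.

Lemma sup_le_bound (S : set R) c : 0 <= c -> (forall x, S x -> x <= c) -> sup S <= c.
Proof.
move=> c0 Sc; have [->|/set0P S0] := eqVneq S set0; first by rewrite sup0.
exact: ge_sup.
Qed.

Lemma sigma_fieldE U : sigma_field X U `<=` @measurable dO Omega.
Proof.
apply: smallest_sub; first exact: sigma_algebra_measurable.
by move=> _ [i _ [B mB <-]]; exact: (measurable_funPT (X i)).
Qed.

Lemma alpha_coef_le1 (U1 U2 : {fset lattice d}) :
  alpha_coef P (sigma_field X U1) (sigma_field X U2) <= 1.
Proof.
by apply: sup_le_bound => // _ [a [b [Aa Bb ->]]]; apply: prob_cov_le1;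
  [exact: sigma_fieldE Aa|exact: sigma_fieldE Bb].
Qed.

Lemma alpha_mixing_itv q l : 0 <= alpha_mixing X T q l <= 1.
Proof.
rewrite /alpha_mixing le_max lexx/= ge_max ler01/=.
by apply: sup_le_bound => // _ [U1 [U2 [_ _ _ _ ->]]]; exact: alpha_coef_le1.
Qed.

Lemma alpha_mixing_ub q l (U1 U2 : {fset lattice d}) : U1 != fset0 -> U2 != fset0 ->
  (U1 `<=` T)%fset -> (U2 `<=` T)%fset -> (#|` U1| <= q)%N -> (l <= dist U1 U2)%N ->
  alpha_coef P (sigma_field X U1) (sigma_field X U2) <= alpha_mixing X T q l.
Proof.
move=> h1 h2 h3 h4 h5 h6; rewrite /alpha_mixing le_max; apply/orP; right.
apply: ub_le_sup; last by exists U1, U2; rewrite h1 h2 h3 h4.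
by exists 1 => _ [V1 [V2 [_ _ _ _ ->]]]; exact: alpha_coef_le1.
Qed.

Lemma alpha_mixing_homo q l l' : (l <= l')%N -> alpha_mixing X T q l' <= alpha_mixing X T q l.
Proof.
move=> ll; rewrite {1}/alpha_mixing ge_max; apply/andP; split.
  by case/andP: (alpha_mixing_itv q l).
apply: sup_le_bound; first by case/andP: (alpha_mixing_itv q l).
move=> _ [U1 [U2 [/andP[h1 h2] /andP[h3 h4] h5 h6 ->]]].
by apply: alpha_mixing_ub => //; exact: leq_trans h6.
Qed.

Lemma separated_alpha q l (s1 s2 : seq (lattice d)) Y V :
  (0 < size s1 <= q)%N -> (0 < size s2)%N -> {subset s1 <= T} -> {subset s2 <= T} ->
  (forall i j, i \in s1 -> j \in s2 -> (l <= maxnorm (i - j))%N) ->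
  field_measurable X s1 Y -> field_measurable X s2 V ->
  separated P (alpha_mixing X T q l) Y V.
Proof.
move=> /andP[s10 s1q] s20 s1T s2T sep mY mV A B mA mB.
have ne (s : seq (lattice d)) : (0 < size s)%N -> [fset x in s]%fset != fset0.
  by case: s => // x s _; apply/fset0Pn; exists x; rewrite !inE eqxx.
apply: (le_trans (@alpha_coef_ub _ _ _ _ (@sigma_fieldE _) (@sigma_fieldE _)
   (sigma_field_preimage mY mA) (sigma_field_preimage mV mB))).
apply: alpha_mixing_ub; rewrite ?ne//.
- by apply/fsubsetP => x; rewrite inE; exact: s1T.
- by apply/fsubsetP => x; rewrite inE; exact: s2T.
- by apply: leq_trans s1q; rewrite card_fseq size_undup.
- have [i [j [+ + ->]]] := dist_attained (ne _ s10) (ne _ s20).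
  by rewrite !inE; exact: sep.
Qed.

End Mixing.

(** * Moments and covariances of products of field variables *)

Section MomentsAndCovariances.
Context (d : nat) (dO : measure_display) (Omega : measurableType dO)
  (R : realType) (P : probability Omega R) (X : lattice d -> {RV P >-> R})
  (T : {fset lattice d}) (k : nat) (r : \bar R) (K : R).
Hypotheses (hr : ((k + 2)%N%:R%:E <= r)%E) (K1 : 1 <= K)
  (Xmaj : forall i, i \in T -> majorant P r K (fun w => 1 + `|X i w|)).
Implicit Types (s J : seq (lattice d)) (Y V : Omega -> R).

Let r1 : (1%:E <= r)%E.
Proof. by apply: le_trans hr; rewrite lee_fin ler1n addn2. Qed.

Definition prodX J w := \prod_(j <- J) (1 + `|X j w|).

(** The number k+2 accommodates a product of k+2 factors, and also k+1 factors together with one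
    mean over a shell. *)
Definition sum_const := scale_const r k.+2%:R K.

Lemma scale_const_ge c K' : 1 <= c -> 0 <= K' -> K' <= scale_const r c K'.
Proof.
move=> c1 K0; rewrite /scale_const; case: r r1 => [r'| |]// h; rewrite ler_peMl//.
rewrite -[leLHS](powRr0 c) ler_powR//; rewrite lee_fin in h; exact: le_trans h.
Qed.

Lemma scale_const_le c c' : 1 <= c -> c <= c' -> scale_const r c K <= scale_const r c' K.
Proof.
move=> c1 cc; have K0 : 0 <= K by exact: le_trans K1.
have c0 : 0 <= c by exact: le_trans c1.
rewrite /scale_const; case: r r1 => [r'| |]// h; rewrite ler_wpM2r//.
apply: ge0_ler_powR; rewrite ?nnegrE ?(le_trans c0 cc)//.
by rewrite lee_fin in h; exact: le_trans h.
Qed.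

Lemma sum_const_ge1 : 1 <= sum_const.
Proof.
apply: (le_trans K1); apply: scale_const_ge; first by rewrite ler1n.
exact: le_trans K1.
Qed.

Lemma majorant_sum (I : eqType) (s : seq I) (xi : I -> Omega -> R) : (0 < size s <= k.+2)%N ->
  (forall i, i \in s -> majorant P r K (xi i)) ->
  majorant P r sum_const (fun w => \sum_(i <- s) xi i w).
Proof.
move=> /andP[s0 sk] H; have := majorant_mean r1 s0 H.
have s1 : (1 : R) <= (size s)%:R by rewrite ler1n.
move=> /(majorant_scale s1).
have -> : (fun w => (size s)%:R * ((size s)%:R^-1 * \sum_(i <- s) xi i w)) =
    (fun w => \sum_(i <- s) xi i w).
  by apply/funext => w; rewrite mulrA divff ?mul1r// pnatr_eq0 -lt0n.
by apply: majorant_le; apply: scale_const_le => //; rewrite ler_nat.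
Qed.

Lemma prodX_ge1 J w : 1 <= prodX J w.
Proof.
rewrite /prodX; elim: J => [|j J IH]; first by rewrite big_nil.
by rewrite big_cons -[leLHS]mulr1; apply: ler_pM => //; rewrite lerDl.
Qed.

Lemma prodX_ge0 J w : 0 <= prodX J w.
Proof. exact: le_trans ler01 (prodX_ge1 _ _). Qed.

Lemma prodX_cat J1 J2 w : prodX (J1 ++ J2) w = prodX J1 w * prodX J2 w.
Proof. by rewrite /prodX big_cat. Qed.

Lemma prodX_le J w S : (forall j, j \in J -> 1 + `|X j w| <= S) -> prodX J w <= S ^+ size J.
Proof.
rewrite /prodX; elim: J => [|j J IH] H; first by rewrite big_nil.
rewrite big_cons exprS; apply: ler_pM.
- by rewrite addr_ge0.
- exact: prodX_ge0.
- by apply: H; rewrite mem_head.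
- by apply: IH => i iJ; apply: H; rewrite inE iJ orbT.
Qed.

Lemma measR_prodX J : measR (prodX J).
Proof.
rewrite /prodX; elim: J => [|j J IH]; first by under eq_fun do rewrite big_nil; exact: measurable_cst.
under eq_fun do rewrite big_cons; apply: measurable_funM => //; apply: measurable_funD => //.
by apply: measurableT_comp => //; exact: (measurable_funPT (X j)).
Qed.

Definition moment_const := sum_const `^ (1 + k.+2%:R).

Lemma moment_const_ge1 : 1 <= moment_const.
Proof. by rewrite -[leLHS](powRr0 sum_const) ler_powR ?sum_const_ge1// addr_ge0. Qed.

Lemma le_sum_seq (I : eqType) (s : seq I) (F : I -> R) j : (forall i, 0 <= F i) ->
  j \in s -> F j <= \sum_(i <- s) F i.
Proof.
move=> F0 js; rewrite (big_rem j)//= lerDl.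
by apply: sumr_ge0.
Qed.

(** A product of factors at least 1 is bounded by a power of their sum, and the sum is again a
    majorant. *)
Lemma prodX_moment J : {subset J <= T} -> (size J <= k.+2)%N ->
  integrableR P (prodX J) /\ Ex P (prodX J) <= moment_const.
Proof.
move=> JT Jk; have [J0|J0] := posnP (size J).
  move: J0 {JT Jk}; case: J => // _.
  have E w : 1 = prodX [::] w by rewrite /prodX big_nil.
  split; first by apply: (eq_integrableR E); exact: integrableR_cst.
  by rewrite -(eq_Ex _ E) Ex_cst moment_const_ge1.
have maj := @majorant_sum _ J (fun j w => 1 + `|X j w|).
have {}maj : majorant P r sum_const (fun w => \sum_(j <- J) (1 + `|X j w|)).
  by apply: maj; [rewrite J0|move=> j jJ; apply: Xmaj; exact: JT].
have sr : ((size J)%:R%:E <= r)%E.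
  by apply: le_trans hr; rewrite lee_fin ler_nat addn2.
have [i1 E1] := majorant_pow sum_const_ge1 (ler0n R (size J)) sr maj.
have le w : prodX J w <= (\sum_(j <- J) (1 + `|X j w|)) `^ (size J)%:R.
  rewrite powR_mulrn; last by apply: sumr_ge0 => j _; rewrite addr_ge0.
  by apply: prodX_le => j jJ; apply: (le_sum_seq (F := fun j => 1 + `|X j w|)) => // i; rewrite addr_ge0.
have ip : integrableR P (prodX J).
  apply: integrableR_le i1; first exact: measR_prodX.
  by move=> w; rewrite ger0_norm ?prodX_ge0.
split => //; apply: (le_trans (Ex_le ip i1 le)); apply: (le_trans E1).
by rewrite ler_powR ?sum_const_ge1// lerD2l ler_nat.
Qed.

Definition cov_const := davydov_const sum_const k.+1%:R.

Lemma davydov_const_ge0 (K' p : R) : 0 <= K' -> 0 <= davydov_const K' p.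
Proof. by move=> K0; rewrite addr_ge0// mulr_ge0 ?powR_ge0// addr_ge0// mulr_ge0. Qed.

Lemma cov_const_ge0 : 0 <= cov_const.
Proof. by apply: davydov_const_ge0; exact: le_trans ler01 sum_const_ge1. Qed.

Notation alpha l := (alpha_mixing X T k.+1 l).

(** Both variables are bounded by powers of one [xi]. Since [xi] is at least 1, the exponent of the
    second may be raised to k+1 - |J1|, so that the mixing exponent is the same for all sizes. [V]
    may be measurable with respect to many sites; only its bound is restricted to [J2]. *)
Lemma cov_prodX l J1 J2 s b1 b2 Y V : (0 < size J1)%N -> (size J1 + size J2 <= k.+1)%N ->
  (0 < size s)%N -> {subset J1 <= T} -> {subset J2 <= T} -> {subset s <= T} ->
  (forall i j, i \in J1 -> j \in s -> (l <= maxnorm (i - j))%N) ->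
  field_measurable X J1 Y -> field_measurable X s V -> 0 <= b1 -> 0 <= b2 ->
  (forall w, `|Y w| <= b1 * prodX J1 w) -> (forall w, `|V w| <= b2 * prodX J2 w) ->
  `|cov P Y V| <= b1 * b2 * (cov_const * alpha l `^ rexp r k.+1%:R).
Proof.
move=> J10 Jk s0 J1T J2T sT sep mY mV b10 b20 Yb Vb.
pose xi w := \sum_(j <- J1 ++ J2) (1 + `|X j w|).
have maj : majorant P r sum_const xi.
  apply: (@majorant_sum _ (J1 ++ J2) (fun j w => 1 + `|X j w|)).
    by rewrite size_cat addn_gt0 J10/= (leq_trans Jk).
  by move=> j; rewrite mem_cat => /orP[/J1T|/J2T]; exact: Xmaj.
have [_ xi1 _] := maj.
have xiJ J w : {subset J <= J1 ++ J2} -> prodX J w <= xi w ^+ size J.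
  move=> sub; apply: prodX_le => j /sub jJ.
  by apply: (le_sum_seq (F := fun j => 1 + `|X j w|)) => // i; rewrite addr_ge0.
have pq : (size J1)%:R + (k.+1 - size J1)%:R = k.+1%:R :> R.
  by rewrite -natrD subnKC// (leq_trans _ Jk)// leq_addr.
have pqr : (((size J1)%:R + (k.+1 - size J1)%:R)%:E <= r)%E.
  by rewrite pq; apply: le_trans hr; rewrite lee_fin ler_nat addn2.
have := davydov r1 sum_const_ge1 (ler0n R (size J1)) (ler0n R (k.+1 - size J1)) b10 b20 pqr maj
  (alpha_mixing_itv X T k.+1 l) (field_measurable_measR mY) (field_measurable_measR mV).
rewrite pq; apply.
- move=> w; apply: (le_trans (Yb w)); rewrite ler_wpM2l// powR_mulrn ?(le_trans ler01)//.
  by apply: xiJ => j jJ; rewrite mem_cat jJ.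
- move=> w; apply: (le_trans (Vb w)); rewrite ler_wpM2l//.
  apply: (@le_trans _ _ (xi w ^+ size J2)).
    by apply: xiJ => j jJ; rewrite mem_cat jJ orbT.
  rewrite -powR_mulrn ?(le_trans ler01)// ler_powR// ler_nat.
  by rewrite leq_subRL ?(leq_trans _ Jk)// leq_addr.
- apply: separated_alpha mY mV => //; rewrite J10/=; apply: leq_trans Jk; exact: leq_addr.
Qed.

(** The mean over [s'] joins the sum defining [xi] as one further summand, indexed by [None],
    however many sites it involves. Its power [delta] adds just [delta] to the exponent. *)
Lemma cov_prodX_mean l delta J s b1 b2 Y V : size J = k.+1 -> 0 <= delta ->
  ((k.+1%:R + delta)%:E <= r)%E ->
  (0 < size s)%N -> {subset J <= T} -> {subset s <= T} ->
  forall s', {subset s' <= s} -> (0 < size s')%N ->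
  (forall i j, i \in J -> j \in s -> (l <= maxnorm (i - j))%N) ->
  field_measurable X J Y -> field_measurable X s V -> 0 <= b1 -> 0 <= b2 ->
  (forall w, `|Y w| <= b1 * prodX J w) ->
  (forall w, `|V w| <= b2 * ((size s')%:R^-1 * \sum_(i <- s') (1 + `|X i w|)) `^ delta) ->
  `|cov P Y V| <= b1 * b2 *
    (davydov_const sum_const (k.+1%:R + delta) * alpha l `^ rexp r (k.+1%:R + delta)).
Proof.
move=> Jk d0 dr s0 JT sT s' ss' s'0 sep mY mV b10 b20 Yb Vb.
pose mean w := (size s')%:R^-1 * \sum_(i <- s') (1 + `|X i w|).
have mmaj : majorant P r K mean.
  by apply: (majorant_mean r1) => // i /ss'/sT; exact: Xmaj.
pose xi w := \sum_(o <- None :: map Some J) (if o is Some j then 1 + `|X j w| else mean w).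
have maj : majorant P r sum_const xi.
  apply: (@majorant_sum _ (None :: map Some J)
    (fun o w => if o is Some j then 1 + `|X j w| else mean w)).
    by rewrite /= size_map Jk.
  by move=> [j|]; rewrite inE//= => /mapP[i iJ [->]]; apply: Xmaj; exact: JT.
have [_ xi1 _] := maj; have [_ mean1 _] := mmaj.
have xiE w : xi w = mean w + \sum_(j <- J) (1 + `|X j w|).
  by rewrite /xi big_cons big_map.
have S0 w : 0 <= \sum_(j <- J) (1 + `|X j w|) by apply: sumr_ge0 => j _; rewrite addr_ge0.
have m0 w : 0 <= mean w by exact: le_trans (mean1 w).
have := davydov r1 sum_const_ge1 (ler0n R k.+1) d0 b10 b20 dr maj
  (alpha_mixing_itv X T k.+1 l) (field_measurable_measR mY) (field_measurable_measR mV).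
apply.
- move=> w; apply: (le_trans (Yb w)); rewrite ler_wpM2l// powR_mulrn ?(le_trans ler01)//.
  rewrite -Jk; apply: prodX_le => j jJ; rewrite xiE; apply: ler_wpDl => //.
  by apply: (le_sum_seq (F := fun j => 1 + `|X j w|)) => // i; rewrite addr_ge0.
- move=> w; apply: (le_trans (Vb w)); rewrite ler_wpM2l//.
  by apply: ge0_ler_powR => //; [exact: m0|exact: le_trans (xi1 w)|rewrite xiE lerDl].
- by apply: separated_alpha mY mV => //; rewrite Jk leqnn.
Qed.

End MomentsAndCovariances.

Lemma leq_expn a b e : (a <= b)%N -> (a ^ e <= b ^ e)%N.
Proof. by move=> ab; elim: e => // e IH; rewrite !expnS leq_mul. Qed.

(** * Sums over distances weighted by a decreasing rate *)

Section DistanceSums.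
Context (R : realType) (d N L : nat) (w : nat -> R).
Hypotheses (d0 : (0 < d)%N) (w0 : forall l, 0 <= w l)
  (w_anti : forall l l', (l <= l')%N -> w l' <= w l).

(** At least half of the indices l with m < l <= L satisfy 2l >= L. *)
Lemma upper_half_sum m (F : nat -> R) c : (m < L)%N -> 0 <= c -> (forall l, 0 <= F l) ->
  (forall l, (m < l <= L)%N -> (L <= 2 * l)%N -> c <= F l) ->
  (L - m)%N%:R * c <= 2 * \sum_(m.+1 <= l < L.+1) F l.
Proof.
move=> mL c0 F0 Fc; pose a := maxn m.+1 (uphalf L).
have uL : (L <= 2 * uphalf L <= L.+1)%N by rewrite uphalfE; lia.
have aL : (a <= L)%N by rewrite /a geq_max mL/=; clear -uL mL; lia.
have ma : (m.+1 <= a)%N by rewrite leq_maxl.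
rewrite (@big_cat_nat _ _ _ a)//=; last exact: leqW.
have H : (L.+1 - a)%N%:R * c <= \sum_(a <= l < L.+1) F l.
  rewrite mulr_natl -sumr_const_nat; apply: ler_sum_nat => l /andP[al lL].
  apply: Fc; first by rewrite (leq_trans ma al) -ltnS.
  have : (uphalf L <= l)%N by apply: leq_trans al; exact: leq_maxr.
  by move=> ul; case/andP: uL => + _; clear -ul; lia.
have n2 : (L - m <= 2 * (L.+1 - a))%N by rewrite /a /maxn; case: ifP; clear -uL mL; lia.
apply: (@le_trans _ _ (2 * ((L.+1 - a)%N%:R * c))).
  by rewrite mulrA ler_wpM2r// -natrM ler_nat.
rewrite ler_wpM2l//; apply: (le_trans H); rewrite lerDr.
by apply: sumr_ge0.
Qed.

Definition tail_sum q l : R := \sum_(l.+1 <= l' < L.+1) l'%:R ^+ (d * q - 1) * w l'.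
(** Order of the total weight over the positions of q further sites when the scale starts at [l]:
    the scale stays [l], with l^(dq) positions, or ends at some l' > l, with l'^(dq-1) positions.
    For q = 0 the scale cannot grow and the tail is absent. *)
Definition far_sum q l : R := l%:R ^+ (d * q) * w l + (0 < q)%N%:R * tail_sum q l.

Lemma tail_sum_ge0 q l : 0 <= tail_sum q l.
Proof. by apply: sumr_ge0 => l' _; rewrite mulr_ge0// exprn_ge0. Qed.

Lemma far_sum_ge0 q l : 0 <= far_sum q l.
Proof. by apply: addr_ge0; [rewrite mulr_ge0// exprn_ge0|rewrite mulr_ge0// tail_sum_ge0]. Qed.

Lemma half_pow_le l e : (L <= 2 * l)%N -> L%:R ^+ e / 2 ^+ e <= l%:R ^+ e :> R.
Proof.
move=> Ll; rewrite ler_pdivrMr ?exprn_gt0// -exprMn.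
by apply: lerXn2r; rewrite ?nnegrE// mulrC -natrM ler_nat.
Qed.

Lemma tail_sum_ge q m : (m < L)%N ->
  (L - m)%N%:R * (L%:R ^+ (d * q.+1 - 1) * w L) <= 2 ^+ (d * q.+1) * tail_sum q.+1 m.
Proof.
move=> mL; have D1 : (d * q.+1 = (d * q.+1 - 1).+1)%N by clear -d0; lia.
set D := (d * q.+1 - 1)%N in D1 *.
have := @upper_half_sum m (fun l => l%:R ^+ D * w l) (L%:R ^+ D / 2 ^+ D * w L) mL.
move=> /(_ _ _ _)/le_trans H.
rewrite D1 exprSr -mulrA.
have -> : (L - m)%:R * (L%:R ^+ D * w L) = 2 ^+ D * ((L - m)%:R * (L%:R ^+ D / 2 ^+ D * w L)) :> R.
  by field.
rewrite ler_wpM2l ?exprn_ge0//; apply: H => //.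
- by rewrite mulr_ge0// divr_ge0// exprn_ge0.
- by move=> l; rewrite mulr_ge0// exprn_ge0.
- move=> l /andP[_ lL] Ll; apply: ler_pM => //.
  + exact: half_pow_le.
  + exact: w_anti.
Qed.

Lemma natr_le_pow (a : nat) : (N <= a ^ d)%N -> N%:R <= a%:R ^+ d :> R.
Proof. by move=> Na; rewrite -natrX ler_nat. Qed.

(** The last shell may contain all N sites. Since N is at most (2(L-m))^d, one of its d factors of
    order L - m is compensated by the number of terms of the tail sum comparable to the one at [L],
    the others by powers of L. *)
Lemma tail_near q m : (m < L)%N -> (N <= (2 * (L - m)) ^ d)%N ->
  N%:R * (L%:R ^+ (d * q) * w L) <= 2 ^+ (d + d * q.+1) * tail_sum q.+1 m.
Proof.
move=> mL NL; rewrite exprD -mulrA.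
apply: le_trans (ler_wpM2l (exprn_ge0 _ (ler0n R 2)) (tail_sum_ge q mL)).
have -> : (d * q.+1 - 1 = (d - 1) + d * q)%N by clear -d0; lia.
rewrite exprD -!mulrA !mulrA ler_wpM2r//= ler_wpM2r ?exprn_ge0//.
apply: (le_trans (natr_le_pow NL)); rewrite natrM exprMn -!mulrA ler_wpM2l ?exprn_ge0//.
rewrite -{1}(prednK d0) exprS -subn1 ler_wpM2l//.
by apply: lerXn2r; rewrite ?nnegrE// ler_nat leq_subr.
Qed.

(** Starting from [l], the tail may have too few terms to absorb the last shell. If 2l >= L, the
    term at scale [l] itself dominates; otherwise L - l is at least of order L and the tail
    suffices. *)
Lemma tail_far q l : (l < L)%N -> (N <= (2 * L) ^ d)%N ->
  N%:R * (L%:R ^+ (d * q) * w L) <= 2 ^+ (d + d * q.+1).+1 * far_sum q.+1 l.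
Proof.
move=> lL NL.
have N1 : N%:R * (L%:R ^+ (d * q) * w L) <= 2 ^+ d * (L%:R ^+ (d * q.+1) * w L).
  rewrite mulnS exprD !mulrA ler_wpM2r// ler_wpM2r ?exprn_ge0//.
  by apply: (le_trans (natr_le_pow NL)); rewrite natrM exprMn.
apply: (le_trans N1); rewrite /far_sum mul1r -addnS exprD -mulrA ler_wpM2l ?exprn_ge0//.
have [Ll|lL2] := leqP L (2 * l)%N.
  apply: (@le_trans _ _ (2 ^+ (d * q.+1) * (l%:R ^+ (d * q.+1) * w l))).
    rewrite mulrA -exprMn; apply: ler_pM; rewrite ?exprn_ge0//; last exact: w_anti (ltnW lL).
    by apply: lerXn2r; rewrite ?nnegrE ?mulr_ge0// -natrM ler_nat.
  apply: ler_pM; rewrite ?exprn_ge0 ?mulr_ge0 ?exprn_ge0//; last by rewrite lerDl tail_sum_ge0.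
  by rewrite ler_weXn2l// ler1n.
rewrite exprS; apply: (@le_trans _ _ (2 * (2 ^+ (d * q.+1) * tail_sum q.+1 l))); last first.
  by rewrite -mulrA ler_wpM2l// ler_wpM2l ?exprn_ge0// lerDr mulr_ge0// exprn_ge0.
apply: le_trans (ler_wpM2l _ (tail_sum_ge q lL)) => //.
have {1}-> : (d * q.+1 = (d * q.+1 - 1).+1)%N by clear -d0; lia.
rewrite exprS -!mulrA [leRHS]mulrA ler_wpM2r ?mulr_ge0 ?exprn_ge0//.
by rewrite -natrM ler_nat; clear -lL2; lia.
Qed.

Lemma pow_tail_le q l : l%:R ^+ d * ((0 < q)%N%:R * tail_sum q l) <= tail_sum q.+1 l.
Proof.
case: q => [|q]; first by rewrite mul0r mulr0 tail_sum_ge0.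
rewrite mul1r /tail_sum mulr_sumr; apply: ler_sum_nat => l' /andP[ll' _].
rewrite mulrA ler_wpM2r//.
have -> : (d * q.+2 - 1 = d + (d * q.+1 - 1))%N by clear -d0; lia.
rewrite exprD ler_wpM2r ?exprn_ge0//.
by apply: lerXn2r; rewrite ?nnegrE// ler_nat ltnW.
Qed.

(** After exchanging the two sums, the inner one has at most l'' terms, each at most l''^(d-1),
    where l'' is the final scale. *)
Lemma sum_far_le q l : \sum_(l.+1 <= l' < L.+1) l'%:R ^+ d.-1 * far_sum q l' <= 2 * tail_sum q.+1 l.
Proof.
have H1 : \sum_(l.+1 <= l' < L.+1) l'%:R ^+ d.-1 * (l'%:R ^+ (d * q) * w l') = tail_sum q.+1 l.
  apply: eq_bigr => l' _; rewrite mulrA -exprD; congr (_ ^+ _ * _); clear -d0; lia.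
rewrite mulr2n mulrDl !mul1r -{1}H1.
under eq_bigr do rewrite mulrDr.
rewrite big_split/= lerD2l; case: q H1 => [|q] _.
  by rewrite big1 ?tail_sum_ge0// => l' _; rewrite mul0r mulr0.
rewrite (eq_big_nat _ _ (F2 := fun l' => \sum_(l.+1 <= l'' < L.+1)
    (if (l' < l'')%N then l'%:R ^+ d.-1 * (l''%:R ^+ (d * q.+1 - 1) * w l'') else 0))); last first.
  move=> l' /andP[ll' _]; rewrite mul1r /tail_sum mulr_sumr (big_nat_widenl _ l.+1); last exact: leqW.
  by rewrite big_mkcond.
rewrite exchange_big/=; apply: ler_sum_nat => l'' /andP[ll'' l''L].
rewrite -big_mkcond/=.
have -> : \sum_(l.+1 <= i < L.+1 | (i < l'')%N) i%:R ^+ d.-1 * (l''%:R ^+ (d * q.+1 - 1) * w l'') =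
    \sum_(l.+1 <= i < l'') i%:R ^+ d.-1 * (l''%:R ^+ (d * q.+1 - 1) * w l'').
  by rewrite (big_nat_widen l.+1 l'' L.+1)//; exact: ltnW.
apply: (@le_trans _ _ (\sum_(l.+1 <= i < l'') l''%:R ^+ d.-1 * (l''%:R ^+ (d * q.+1 - 1) * w l''))).
  apply: ler_sum_nat => i /andP[_ il]; rewrite ler_wpM2r ?mulr_ge0 ?exprn_ge0//.
  by apply: lerXn2r; rewrite ?nnegrE// ler_nat ltnW.
rewrite sumr_const_nat -[X in X <= _]mulr_natl.
have -> : (d * q.+2 - 1 = (1 + d.-1) + (d * q.+1 - 1))%N by clear -d0; lia.
rewrite !exprD expr1 -!mulrA ler_wpM2r ?mulr_ge0 ?exprn_ge0//.
by rewrite ler_nat leq_subr.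
Qed.

(** Only the term at [L] differs. There the size of the shell is at most 2^(d+1) (L-m) L^(d-1), the
    power [delta] of the additional factor is at most the factor itself, and L-m copies of the last
    term are bounded by the sum over the upper half of the indices. *)
Lemma shell_powR_le m delta : (m < L)%N -> (N <= (2 * (L - m)) ^ d)%N -> 0 <= delta <= 1 ->
  \sum_(m.+1 <= l < L.+1) ((l ^ d.-1)%N%:R + (l == L)%:R * N%:R) `^ delta * w l <=
  4 ^+ d.+2 * \sum_(m.+1 <= l < L.+1) (l ^ d.-1)%N%:R `^ delta * w l.
Proof.
move=> mL NL /andP[dl0 dl1].
pose F l : R := (l ^ d.-1)%N%:R `^ delta * w l.
have F0 l : 0 <= F l by rewrite mulr_ge0 ?powR_ge0.
have LF : (L - m)%N%:R * (F L / 2 ^+ d) <= 2 * \sum_(m.+1 <= l < L.+1) F l.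
  apply: upper_half_sum => //; first by rewrite divr_ge0// exprn_ge0.
  move=> l /andP[_ lL] Ll; rewrite /F mulrAC; apply: ler_pM => //.
  - rewrite ler_pdivrMr ?exprn_gt0//.
    apply: (@le_trans _ _ ((l ^ d.-1)%N%:R `^ delta * (2 ^+ d.-1) `^ delta)).
      rewrite -powRM//; apply: ge0_ler_powR; rewrite ?nnegrE ?mulr_ge0//.
      by rewrite -natrX -natrM ler_nat -expnMn leq_expn// mulnC.
    rewrite ler_wpM2l ?powR_ge0//.
    rewrite -[leRHS]powRr1 ?exprn_ge0//.
    apply: (@le_trans _ _ ((2 ^+ d) `^ delta)).
      by apply: ge0_ler_powR; rewrite ?nnegrE ?exprn_ge0// ler_weXn2l ?ler1n ?leq_pred.
    by rewrite ler_powR// exprn_ege1// ler1n.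
  - exact: w_anti.
have NF : ((L ^ d.-1)%N%:R + N%:R) `^ delta * w L <= 2 ^+ d.+1 * ((L - m)%N%:R * F L).
  have Lm1 : 1 <= (L - m)%N%:R :> R by rewrite ler1n subn_gt0.
  rewrite /F !mulrA ler_wpM2r//.
  have NL' : (L ^ d.-1)%N%:R + N%:R <= (2 ^+ d.+1 * (L - m)%N%:R) * (L ^ d.-1)%N%:R :> R.
    rewrite -natrX -natrD -!natrM ler_nat expnS.
    apply: (@leq_trans (L ^ d.-1 + 2 ^ d * (L - m) * L ^ d.-1)).
      rewrite leq_add2l; apply: (leq_trans NL); rewrite expnMn -mulnA leq_mul2l; apply/orP; right.
      by rewrite -{1}(prednK d0) expnS leq_mul2l leq_expn ?orbT ?leq_subr.
    rewrite -[X in (X + _)%N]mul1n -mulnDl leq_mul2r; apply/orP; right.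
    have : (0 < 2 ^ d * (L - m))%N by rewrite muln_gt0 expn_gt0 subn_gt0 mL.
    by rewrite -mulnA; clear; lia.
  apply: (@le_trans _ _ (((2 ^+ d.+1 * (L - m)%N%:R) * (L ^ d.-1)%N%:R) `^ delta)).
    by apply: ge0_ler_powR; rewrite ?nnegrE ?addr_ge0 ?mulr_ge0 ?exprn_ge0.
  rewrite powRM ?mulr_ge0 ?exprn_ge0// ler_wpM2r ?powR_ge0//.
  rewrite -[leRHS]powRr1 ?mulr_ge0 ?exprn_ge0// ler_powR//.
  by rewrite -[leLHS]mulr1 ler_pM// exprn_ege1// ler1n.
rewrite big_nat_recr//= eqxx mul1r.
have SF : \sum_(m.+1 <= i < L) ((i ^ d.-1)%N%:R + (i == L)%:R * N%:R) `^ delta * w i <=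
    \sum_(m.+1 <= l < L.+1) F l.
  rewrite [leRHS]big_nat_recr//= -[leLHS]addr0; apply: lerD => //.
  by apply: ler_sum_nat => i /andP[_ iL]; rewrite ltn_eqF// mul0r addr0.
apply: (le_trans (lerD SF NF)).
have S0 : 0 <= \sum_(m.+1 <= l < L.+1) F l by apply: sumr_ge0.
set S := \sum_(m.+1 <= l < L.+1) F l in LF SF S0 *.
have E4 : 4 ^+ d = 2 ^+ d * 2 ^+ d :> R by rewrite -exprMn; congr (_ ^+ _); rewrite -natrM.
have : 2 ^+ d * 2 ^+ d * ((L - m)%N%:R * (F L / 2 ^+ d)) <= 2 ^+ d * 2 ^+ d * (2 * S).
  by rewrite ler_wpM2l// mulr_ge0// exprn_ge0.
have p1 : 1 <= 2 ^+ d * 2 ^+ d :> R by rewrite -E4 exprn_ege1// ler1n.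
have -> : 2 ^+ d * 2 ^+ d * ((L - m)%N%:R * (F L / 2 ^+ d)) = 2 ^+ d * ((L - m)%N%:R * F L) by field.
move=> H; have pS : S <= 2 ^+ d * 2 ^+ d * S by rewrite ler_peMl.
rewrite 2!(exprS 4) E4 [2 ^+ d.+1]exprS; move: H pS; set p := 2 ^+ d * 2 ^+ d.
set A := 2 ^+ d * ((L - m)%N%:R * F L) => H pS.
have -> : 2 * 2 ^+ d * ((L - m)%N%:R * F L) = 2 * A by rewrite /A; ring.
have -> : 4 * (4 * p) * S = 2 * (p * (2 * S)) + (p * S + 11 * (p * S)) by ring.
rewrite addrC; apply: lerD; first by rewrite ler_wpM2l.
by rewrite (le_trans pS)// lerDl !mulr_ge0// (le_trans _ p1).
Qed.

End DistanceSums.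

Ltac nonneg := repeat first [ assumption | exact: ler0n | exact: ler01 | exact: powR_ge0
  | exact: holder_ge0 | exact: normr_ge0 | exact: prodX_ge0 | exact: invr_ge0
  | apply: exprn_ge0 | apply: mulr_ge0 | apply: addr_ge0 | (apply: ltW; assumption) ].

(** * Expansion with coefficients independent of the function *)

Section PolynomialGrowth.
Context (d : nat) (dO : measure_display) (Omega : measurableType dO)
  (R : realType) (P : probability Omega R) (X : lattice d -> {RV P >-> R})
  (T : {fset lattice d}) (k : nat) (r : \bar R) (K : R).
Hypotheses (hr : ((k + 2)%N%:R%:E <= r)%E) (K1 : 1 <= K)
  (Xmaj : forall i, i \in T -> majorant P r K (fun w => 1 + `|X i w|)).
Implicit Types (s J : seq (lattice d)) (Y V : Omega -> R).

Definition total w := 1 + \sum_(i <- T) `|X i w|.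

Lemma total_ge1 w : 1 <= total w.
Proof. by rewrite lerDl; apply: sumr_ge0. Qed.

Lemma total_ge0 w : 0 <= total w.
Proof. exact: le_trans (total_ge1 w). Qed.

(** Qualitative bookkeeping of integrability: the constant may depend on [T] and on the functions
    involved, and never enters an estimate. *)
Definition poly_growth n Y := measR Y /\ exists C, forall w, `|Y w| <= C * total w ^+ n.

Lemma poly_growth_pos n Y : poly_growth n Y ->
  exists2 C, 0 <= C & forall w, `|Y w| <= C * total w ^+ n.
Proof.
move=> [_ [C HC]]; exists `|C| => // w; apply: (le_trans (HC w)).
by rewrite ler_wpM2r ?exprn_ge0 ?total_ge0// ler_norm.
Qed.

Lemma poly_growth_le n n' Y : (n <= n')%N -> poly_growth n Y -> poly_growth n' Y.
Proof.
move=> nn gY; have [C C0 HC] := poly_growth_pos gY; split; first by case: gY.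
exists C => w; apply: (le_trans (HC w)); rewrite ler_wpM2l//.
by rewrite ler_weXn2l ?total_ge1.
Qed.

Lemma poly_growth_cst c : poly_growth 0 (fun=> c).
Proof. by split; [exact: measurable_cst|exists `|c| => w; rewrite expr0 mulr1]. Qed.

Lemma poly_growthM n n' Y V : poly_growth n Y -> poly_growth n' V ->
  poly_growth (n + n') (fun w => Y w * V w).
Proof.
move=> gY gV; have [C C0 HC] := poly_growth_pos gY; have [C' C'0 HC'] := poly_growth_pos gV.
split; first by apply: measurable_funM; [case: gY|case: gV].
by exists (C * C') => w; rewrite normrM exprD mulrACA; apply: ler_pM.
Qed.

Lemma poly_growthD n Y V : poly_growth n Y -> poly_growth n V ->
  poly_growth n (fun w => Y w + V w).
Proof.
move=> [mY [C HC]] [mV [C' HC']]; split; first exact: measurable_funD.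
exists (C + C') => w; rewrite mulrDl; apply: (le_trans (ler_normD _ _)); exact: lerD.
Qed.

Lemma poly_growthB n Y V : poly_growth n Y -> poly_growth n V ->
  poly_growth n (fun w => Y w - V w).
Proof.
move=> [mY [C HC]] [mV [C' HC']]; split; first exact: measurable_funB.
exists (C + C') => w; rewrite mulrDl; apply: (le_trans (ler_normB _ _)); exact: lerD.
Qed.

Lemma poly_growth_sum n (I : eqType) (s : seq I) (F : I -> Omega -> R) :
  (forall i, i \in s -> poly_growth n (F i)) -> poly_growth n (fun w => \sum_(i <- s) F i w).
Proof.
elim: s => [|i s IH] gF.
  by under eq_fun do rewrite big_nil; apply: (@poly_growth_le 0) => //; exact: poly_growth_cst.
under eq_fun do rewrite big_cons; apply: poly_growthD; first by apply: gF; rewrite mem_head.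
by apply: IH => j js; apply: gF; rewrite inE js orbT.
Qed.

Lemma abs_le_total i w : i \in T -> `|X i w| <= total w.
Proof.
move=> iT; apply: ler_wpDl => //; exact: (le_sum_seq (F := fun i => `|X i w|)).
Qed.

Lemma poly_growth_X i : i \in T -> poly_growth 1 (X i).
Proof.
move=> iT; split; first exact: (measurable_funPT (X i)).
by exists 1 => w; rewrite mul1r expr1; exact: abs_le_total.
Qed.

Lemma poly_growth_exp n u Y : poly_growth n Y -> poly_growth (n * u) (fun w => Y w ^+ u).
Proof.
move=> gY; have [C C0 HC] := poly_growth_pos gY; split; first by apply: measurable_funX; case: gY.
exists (C ^+ u) => w; rewrite normrX exprM -exprMn; apply: lerXn2r (HC w).
  by rewrite nnegrE.
by rewrite nnegrE mulr_ge0// exprn_ge0// total_ge0.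
Qed.

Lemma prodX_le_total J w : {subset J <= T} -> prodX X J w <= (2 * total w) ^+ size J.
Proof.
move=> JT; apply: prodX_le => j /JT jT; rewrite mulr2n mulrDl mul1r.
by apply: lerD; [exact: total_ge1|exact: abs_le_total].
Qed.

Lemma poly_growth_prodX b J Y : measR Y -> {subset J <= T} ->
  (forall w, `|Y w| <= b * prodX X J w) -> poly_growth (size J) Y.
Proof.
move=> mY JT Yb; split => //; exists (`|b| * 2 ^+ size J) => w; apply: (le_trans (Yb w)).
rewrite -mulrA -exprMn; apply: (@le_trans _ _ (`|b| * prodX X J w)).
  by rewrite ler_wpM2r ?prodX_ge0 ?ler_norm.
by rewrite ler_wpM2l// prodX_le_total.
Qed.

(** [total] is at most the number of sites times the mean of the majorants 1 + |X_i|, whose power of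
    order k+2 is integrable. *)
Lemma poly_growth_integrable n Y : (n <= k + 2)%N -> poly_growth n Y -> integrableR P Y.
Proof.
move=> nk gY; have [C C0 HC] := poly_growth_pos (poly_growth_le nk gY).
have r1 : (1%:E <= r)%E by apply: le_trans hr; rewrite lee_fin ler1n addn2.
have [T0|T0] := posnP (size T).
  apply: (@integrableR_bounded _ _ _ P Y C); first by case: gY.
  by move=> w; have := HC w; rewrite /total (size0nil T0) big_nil addr0 expr1n mulr1.
have mmaj := @majorant_mean _ _ _ P r r1 _ T K (fun i w => 1 + `|X i w|) T0 Xmaj.
have [im _] := majorant_pow K1 (ler0n R (k + 2)) hr mmaj.
have n0 : (0 : R) < (size T)%:R by rewrite ltr0n.
apply: (integrableR_le _ _ (integrableRZ (C * (size T)%:R ^+ (k + 2)) im)); first by case: gY.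
move=> w; apply: (le_trans (HC w)); rewrite -mulrA ler_wpM2l//.
rewrite powR_mulrn; last first.
  rewrite mulr_ge0 ?invr_ge0 ?(ltW n0)//; apply: sumr_ge0 => i _; exact: addr_ge0.
rewrite -exprMn mulrA divff ?gt_eqF// mul1r; apply: lerXn2r.
- by rewrite nnegrE total_ge0.
- by rewrite nnegrE; apply: sumr_ge0 => i _; exact: addr_ge0.
rewrite big_split/= lerD2r big_const_seq count_predT iter_addr_0 ler1n.
by [].
Qed.

End PolynomialGrowth.

Section Expansions.
Context (d : nat) (dO : measure_display) (Omega : measurableType dO)
  (R : realType) (P : probability Omega R) (X : lattice d -> {RV P >-> R})
  (T : {fset lattice d}) (k : nat) (r : \bar R) (K : R) (h : R).
Hypotheses (hr : ((k + 2)%N%:R%:E <= r)%E) (K1 : 1 <= K)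
  (Xmaj : forall i, i \in T -> majorant P r K (fun w => 1 + `|X i w|))
  (k0 : (0 < k)%N) (h0 : 0 < h).
Implicit Types (s t J : seq (lattice d)) (Y Z V : Omega -> R) (f : R -> R).

Notation growth := (poly_growth X T).

Definition scaled_sum s (w : Omega) : R := h * \sum_(i <- s) X i w.

Lemma growth_integrable n Y : (n <= k + 2)%N -> growth n Y -> integrableR P Y.
Proof. exact: (poly_growth_integrable hr K1 Xmaj). Qed.

Lemma scaled_sum_cons j s w : scaled_sum (j :: s) w = scaled_sum s w + h * X j w.
Proof. by rewrite /scaled_sum big_cons mulrDr addrC. Qed.

Lemma scaled_sum_perm s s' : perm_eq s s' -> scaled_sum s = scaled_sum s'.
Proof. by move=> ss; apply/funext => w; rewrite /scaled_sum (perm_big _ ss). Qed.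

Lemma field_measurable_scaled_sum s : field_measurable X s (scaled_sum s).
Proof.
apply: field_measurableM; first exact: field_measurable_cst.
by apply: field_measurable_sum => i; exact: field_measurable_X.
Qed.

Lemma field_measurable_deriv s f j : smooth_class k f -> (j <= k)%N ->
  field_measurable X s (fun w => derive1n j f (scaled_sum s w)).
Proof.
move=> fk jk; apply: field_measurable_comp; last exact: field_measurable_scaled_sum.
by apply: continuous_measurable_fun; exact: (smooth_continuous fk).
Qed.

Lemma growth_scaled_sum s : {subset s <= T} -> growth 1 (scaled_sum s).
Proof.
move=> sT; apply: (@poly_growthM _ _ _ _ _ X T 0 1); first exact: poly_growth_cst.
by apply: poly_growth_sum => i /sT; exact: poly_growth_X.
Qed.

Lemma growth_deriv s f j : smooth_class k f -> (j <= k)%N -> {subset s <= T} ->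
  growth (k - j) (fun w => derive1n j f (scaled_sum s w)).
Proof.
move=> fk jk sT; split.
  by apply: (@field_measurable_measR _ _ _ _ _ X s); exact: field_measurable_deriv.
have [C HC] := smooth_growth k0 fk jk.
have [C' C'0 HC'] := poly_growth_pos (growth_scaled_sum sT).
exists (`|C| * (1 + C') ^+ (k - j)) => w; apply: (le_trans (HC _)).
rewrite -mulrA -exprMn; apply: (@le_trans _ _ (`|C| * (1 + `|scaled_sum s w|) ^+ (k - j))).
  by rewrite ler_wpM2r ?exprn_ge0 ?addr_ge0 ?ler_norm.
rewrite ler_wpM2l//; apply: lerXn2r; rewrite ?nnegrE ?addr_ge0//.
  by rewrite mulr_ge0 ?total_ge0// addr_ge0.
by rewrite mulrDl mul1r lerD ?total_ge1//; have := HC' w; rewrite expr1.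
Qed.

Lemma telescope_sums (g : R -> R) s s0 w :
  g (scaled_sum (s ++ s0) w) - g (scaled_sum s0 w) =
  \sum_(i < size s) (g (scaled_sum (drop i s ++ s0) w) - g (scaled_sum (drop i.+1 s ++ s0) w)).
Proof.
pose F i := - g (scaled_sum (drop i s ++ s0) w).
rewrite (eq_bigr (fun i : 'I_(size s) => F i.+1 - F i)) => [|i _]; last by rewrite /F opprK addrC.
rewrite -(big_mkord xpredT (fun i => F i.+1 - F i)) telescope_sumr// /F drop_size drop0 opprK.
by rewrite cat0s addrC.
Qed.

Definition mean_deriv f j := Ex P (fun w => derive1n j f (scaled_sum T w)).

(* The coefficients may depend on the functional [Phi], but not on [f]. *)
Definition expandable (Phi E : (R -> R) -> R) := exists c : nat -> R,
  forall f, smooth_class k f -> `|Phi f - \sum_(j < k.+1) c j * mean_deriv f j| <= E f.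

Lemma expandable_le Phi Phi' E E' : (forall f, smooth_class k f -> Phi f = Phi' f) ->
  (forall f, smooth_class k f -> E' f <= E f) -> expandable Phi' E' -> expandable Phi E.
Proof.
move=> eP lE [c Hc]; exists c => f fk; rewrite eP//; apply: (le_trans (Hc f fk)); exact: lE.
Qed.

Lemma expandable_sum (n : nat) (Phi E : 'I_n -> (R -> R) -> R) :
  (forall i, expandable (Phi i) (E i)) ->
  expandable (fun f => \sum_i Phi i f) (fun f => \sum_i E i f).
Proof.
move=> /choice[c Hc]; exists (fun j => \sum_i c i j) => f fk.
rewrite (eq_bigr (fun j : 'I_k.+1 => \sum_i c i j * mean_deriv f j)) => [|j _].
  rewrite exchange_big -sumrB; apply: (le_trans (ler_norm_sum _ _ _)).
  by apply: ler_sum => i _; exact: Hc.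
by rewrite mulr_suml.
Qed.

Lemma expandableD Phi Phi' E E' : expandable Phi E -> expandable Phi' E' ->
  expandable (fun f => Phi f + Phi' f) (fun f => E f + E' f).
Proof.
move=> [c Hc] [c' Hc']; exists (fun j => c j + c' j) => f fk.
rewrite (eq_bigr (fun j : 'I_k.+1 => c j * mean_deriv f j + c' j * mean_deriv f j)); last first.
  by move=> j _; rewrite mulrDl.
rewrite big_split/= opprD addrACA; apply: (le_trans (ler_normD _ _)).
by apply: lerD; [exact: Hc|exact: Hc'].
Qed.

Lemma expandableN Phi E : expandable Phi E -> expandable (fun f => - Phi f) E.
Proof.
move=> [c Hc]; exists (fun j => - c j) => f fk.
rewrite (eq_bigr (fun j : 'I_k.+1 => - (c j * mean_deriv f j))); last by move=> j _; rewrite mulNr.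
by rewrite sumrN -opprD normrN; exact: Hc.
Qed.

Lemma expandable_mean c o : (o <= k)%N -> expandable (fun f => c * mean_deriv f o) (fun=> 0).
Proof.
move=> ok; exists (fun j => c * (j == o)%:R) => f fk.
rewrite (bigD1 (Ordinal (ok : o < k.+1)%N))//= eqxx mulr1 big1 ?addr0 ?subrr ?normr0// => j.
by rewrite -val_eqE/= => /negbTE ->; rewrite mulr0 mul0r.
Qed.

Lemma expandable_small Phi E : (forall f, smooth_class k f -> `|Phi f| <= E f) -> expandable Phi E.
Proof.
move=> H; exists (fun=> 0) => f fk; rewrite big1 ?subr0; first exact: H.
by move=> j _; rewrite mul0r.
Qed.

(** * Induction on the order of the derivative *)

Section Induction.
Variables (m L : nat) (delta kap : R).
Hypotheses (m0 : (0 < m)%N) (mL : (m < L)%N) (d0 : (0 < d)%N) (TL : (#|` T| <= (2 * L) ^ d)%N)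
  (delta01 : 0 <= delta <= 1) (delta_r : ((k.+1%:R + delta)%:E <= r)%E).

Notation alpha l := (alpha_mixing X T k.+1 l).
Notation KM := (moment_const k r K).
Notation KC := (cov_const k r K).
Notation A f := (holder k.-1 1 f).
Notation B f := (holder k 1 f).

Definition weight l := alpha l `^ rexp r k.+1%:R.
Definition weight_delta l := alpha l `^ rexp r (k.+1%:R + delta).
(* Up to a constant, the number of sites at distance [l] from a small set, when distances
   larger than [L] are replaced by [L]. *)
Definition shell l : R := (l ^ d.-1)%N%:R + (l == L)%:R * #|` T|%:R.
Definition mid f := A f `^ (1 - delta) * B f `^ delta * h `^ delta *
  \sum_(m.+1 <= l < L.+1) shell l `^ delta * weight_delta l.

(* [err q l f] bounds, up to powers of [h], the error for E[Y f^(k-q)(S)] when all deleted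
   sites are within distance [l] of an earlier one. *)
Fixpoint err q l f : R :=
  if q is q'.+1 then
    kap * (l%:R ^+ d * err q' l f + \sum_(l.+1 <= l' < L.+1) shell l' * err q' l' f)
  else if (l == m)%N then kap * (B f * h * m%:R ^+ d + mid f) else A f * weight l.

(** Up to this factor, l^d bounds the number of sites within distance l of at most k+1 sites, as
    2l+1 <= 3l. *)
Definition size_const : nat := (k.+1 * 3 ^ d)%N.

(* In E[Y f^(o)(S)], [J] is the list of sites on which [Y] depends, [t] the list of deleted
   sites and [s] the list of remaining ones. The last field says that [Y] is almost
   centered given the remaining sites; the base scale [m] carries no such information. *)
Record state o l b J s t Y : Prop := State {
  state_size : size J = o.+1;
  state_J : {subset J <= T};
  state_perm : perm_eq (s ++ t) T;
  state_meas : field_measurable X J Y;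
  state_b : 0 <= b;
  state_bound : forall w, `|Y w| <= b * prodX X J w;
  state_scale : (m <= l <= L)%N;
  state_deleted : (size t <= o.+1 * size_const * l ^ d)%N;
  state_mix : (m < l)%N -> forall V J' kp, {subset J' <= T} -> (size J' + o < k.+1)%N ->
    field_measurable X s V -> 0 <= kp -> (forall w, `|V w| <= kp * prodX X J' w) ->
    `|Ex P (fun w => Y w * V w)| <= b * kp * weight l }.

Hypothesis kap1 : 1 <= kap.

Lemma weight_ge0 l : 0 <= weight l. Proof. exact: powR_ge0. Qed.

Lemma shell_ge0 l : 0 <= shell l. Proof. by rewrite addr_ge0// mulr_ge0. Qed.

Lemma mid_ge0 f : 0 <= mid f.
Proof.
rewrite /mid !mulr_ge0 ?powR_ge0//; apply: sumr_ge0 => l _.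
by rewrite mulr_ge0 ?powR_ge0.
Qed.

Lemma err_ge0 q l f : 0 <= err q l f.
Proof.
have kap0 : 0 <= kap by exact: le_trans kap1.
elim: q l => [|q IH] l /=.
  case: ifP => _; last by rewrite mulr_ge0 ?holder_ge0 ?weight_ge0.
  by rewrite mulr_ge0// addr_ge0 ?mid_ge0// !mulr_ge0 ?holder_ge0 ?(ltW h0)// exprn_ge0.
rewrite mulr_ge0// addr_ge0//; first by rewrite mulr_ge0// exprn_ge0.
by apply: sumr_ge0 => l' _; rewrite mulr_ge0 ?shell_ge0.
Qed.

Lemma err_homo q q' l f : (0 < l)%N -> (q <= q')%N -> err q l f <= err q' l f.
Proof.
move=> l0; elim: q' => [|q' IH]; first by rewrite leqn0 => /eqP ->.
rewrite leq_eqVlt => /orP[/eqP -> //|]; rewrite ltnS => /IH /le_trans; apply => /=.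
have ld : 1 <= l%:R ^+ d :> R by rewrite exprn_ege1// ler1n.
have S0 : 0 <= \sum_(l.+1 <= l' < L.+1) shell l' * err q' l' f.
  by apply: sumr_ge0 => l' _; rewrite mulr_ge0 ?shell_ge0 ?err_ge0.
apply: (@le_trans _ _ (l%:R ^+ d * err q' l f)); first by rewrite ler_peMl// err_ge0.
rewrite -[leLHS]mul1r; apply: ler_pM => //; first by rewrite mulr_ge0 ?exprn_ge0 ?err_ge0.
by rewrite lerDl.
Qed.

Lemma err0_near f : B f * h <= err 0 m f.
Proof.
rewrite /= eqxx; have md : 1 <= m%:R ^+ d :> R by rewrite exprn_ege1// ler1n.
have Bh : 0 <= B f * h by rewrite mulr_ge0 ?holder_ge0// ltW.
rewrite -[leLHS]mul1r; apply: ler_pM => //; rewrite -[leLHS]addr0 lerD ?mid_ge0//.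
by rewrite ler_peMr.
Qed.

Lemma err0_far l f : (m < l)%N -> A f * weight l <= err 0 l f.
Proof. by move=> ml /=; rewrite gtn_eqF. Qed.

Lemma prodX_nseq v j w : prodX X (nseq v j) w = (1 + `|X j w|) ^+ v.
Proof. by rewrite /prodX big_nseq; elim: v => //= v ->; rewrite exprS. Qed.

Lemma exp_le_prodX v j w : `|X j w| ^+ v <= prodX X (nseq v j) w.
Proof. by rewrite prodX_nseq lerXn2r ?nnegrE ?addr_ge0// lerDr. Qed.

Lemma subset_cat_nseq J v j : {subset J <= T} -> j \in T -> {subset J ++ nseq v j <= T}.
Proof. by move=> JT jT i; rewrite mem_cat => /orP[/JT //|/nseqP[->]]. Qed.

Definition taylor_rem o n f j s w := derive1n o f (scaled_sum (j :: s) w) -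
  \sum_(v < n.+1) (h * X j w) ^+ v / v`!%:R * derive1n (o + v) f (scaled_sum s w).

Lemma taylor_rem_le o n f j s w : (o + n = k)%N -> smooth_class k f ->
  `|taylor_rem o n f j s w| <= `|h * X j w| ^+ n * Num.min (2 * A f) (B f * `|h * X j w|).
Proof.
move=> onk fk; have ok : (o <= k)%N by rewrite -onk leq_addr.
have := smooth_taylor (scaled_sum s w) (h * X j w) k0 fk ok.
by rewrite /taylor_rem scaled_sum_cons -onk addKn.
Qed.

Lemma growth_taylor_rem o n f j s : (o + n = k)%N -> smooth_class k f ->
  {subset s <= T} -> j \in T -> growth n (taylor_rem o n f j s).
Proof.
move=> onk fk sT jT.
have jsT : {subset j :: s <= T} by move=> i; rewrite inE => /orP[/eqP ->|/sT].
have ok : (o <= k)%N by rewrite -onk leq_addr.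
apply: poly_growthB.
  by have := growth_deriv fk ok jsT; rewrite -onk addKn.
apply: poly_growth_sum => v _; have vn : (v <= n)%N by rewrite -ltnS.
have ov : (o + v <= k)%N by rewrite -onk leq_add2l.
move: (nat_of_ord v) vn ov => {}v vn ov.
have -> : n = (1 * v + 0 + (k - (o + v)))%N by rewrite -onk; lia.
apply: poly_growthM; last exact: growth_deriv.
apply: poly_growthM; last exact: poly_growth_cst.
apply: poly_growth_exp; apply: (@poly_growthM _ _ _ _ _ X T 0 1); first exact: poly_growth_cst.
exact: poly_growth_X.
Qed.

Lemma field_measurable_taylor_rem o n f j s : (o + n = k)%N -> smooth_class k f ->
  field_measurable X (j :: s) (taylor_rem o n f j s).
Proof.
move=> onk fk; have ok : (o <= k)%N by rewrite -onk leq_addr.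
apply: field_measurableB; first exact: field_measurable_deriv.
rewrite (_ : (fun _ => _) = (fun w => \sum_(v <- index_enum 'I_n.+1) (h * X j w) ^+ v / v`!%:R *
  derive1n (o + v) f (scaled_sum s w)))//.
elim: (index_enum _) => [|v vs IH]; first by under eq_fun do rewrite big_nil; exact: field_measurable_cst.
under eq_fun do rewrite big_cons; apply: field_measurableD => //.
apply: field_measurableM.
  apply: field_measurableM; last exact: field_measurable_cst.
  apply: field_measurable_exp; apply: field_measurableM; first exact: field_measurable_cst.
  by apply: field_measurable_X; rewrite mem_head.
apply: (@field_measurable_sub _ _ _ _ _ X s); first by move=> i si; rewrite inE si orbT.
by apply: field_measurable_deriv => //; rewrite -onk leq_add2l -ltnS.
Qed.

(** Taylor expansion in h X_j turns the increment of f^(o) into states of larger order, to which the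
    induction hypothesis applies, and a remainder. To see that Z X_j^(v+1) inherits the mixing
    property, X_j^(v+1) is moved into the test variable; this is why [Z] is tested against functions
    of j :: s. [Z] will be the centered variable Y - E[Y], or the constant E[Y]. *)
Lemma child_expandable o n l b Z J j s t :
  (forall o' l b J s t Y, (o < o' <= k)%N -> state o' l b J s t Y ->
    expandable (fun f => Ex P (fun w => Y w * derive1n o' f (scaled_sum s w)))
      (fun f => b * h ^+ (k - o') * err (k - o') l f)) ->
  (o + n.+1 = k)%N -> size J = o.+1 -> {subset J <= T} -> j \in T -> perm_eq (s ++ t) T ->
  field_measurable X J Z -> 0 <= b -> (forall w, `|Z w| <= b * prodX X J w) ->
  (m <= l <= L)%N -> (size t <= o.+2 * size_const * l ^ d)%N ->
  ((m < l)%N -> forall V J' kp, {subset J' <= T} -> (size J' + o < k.+1)%N ->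
    field_measurable X (j :: s) V -> 0 <= kp -> (forall w, `|V w| <= kp * prodX X J' w) ->
    `|Ex P (fun w => Z w * V w)| <= b * kp * weight l) ->
  expandable (fun f => Ex P (fun w => Z w *
      (derive1n o f (scaled_sum (j :: s) w) - derive1n o f (scaled_sum s w))))
    (fun f => (k.+2%:R + KM) * b * h ^+ n.+1 * err n l f).
Proof.
move=> IH onk Js JT jT pst mZ b0 Zb lmL ts mix.
have sT : {subset s <= T} by move=> i si; rewrite -(perm_mem pst) mem_cat si.
have jJT v := @subset_cat_nseq J v j JT jT.
have l0 : (0 < l)%N by case/andP: lmL => ml _; exact: leq_trans ml.
pose coef v : R := h ^+ v.+1 / v.+1`!%:R.
pose Y v w := Z w * (coef v * X j w ^+ v.+1).
have coef0 v : 0 <= coef v by rewrite divr_ge0// exprn_ge0// ltW.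
have coef_le v : coef v <= h ^+ v.+1.
  by rewrite ler_pdivrMr ?ltr0n ?fact_gt0// ler_peMr ?exprn_ge0 ?(ltW h0)// ler1n fact_gt0.
have mX : field_measurable X [:: j] (X j) by apply: field_measurable_X; rewrite mem_head.
have mcX v : field_measurable X [:: j] (fun w => coef v * X j w ^+ v.+1).
  by apply: field_measurableM; [exact: field_measurable_cst|exact: field_measurable_exp].
have cX_le v w : `|coef v * X j w ^+ v.+1| <= h ^+ v.+1 * prodX X (nseq v.+1 j) w.
  rewrite normrM normrX ger0_norm//; apply: ler_pM => //; exact: exp_le_prodX.
have gZ : growth o.+1 Z by rewrite -Js; apply: poly_growth_prodX Zb => //; exact: field_measurable_measR mZ.
have gY v : growth (o.+1 + v.+1) (Y v).
  apply: poly_growthM => //.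
  have := poly_growthM (poly_growth_cst X T (coef v)) (poly_growth_exp v.+1 (poly_growth_X X jT)).
  by rewrite add0n mul1n.
have split_f f : smooth_class k f -> Ex P (fun w => Z w *
      (derive1n o f (scaled_sum (j :: s) w) - derive1n o f (scaled_sum s w))) =
    \sum_(v < n.+1) Ex P (fun w => Y v w * derive1n (o + v.+1) f (scaled_sum s w))
    + Ex P (fun w => Z w * taylor_rem o n.+1 f j s w).
  move=> fk; rewrite -Ex_sum; last first.
    move=> v; have vn := ltn_ord v; have ov : (o + v.+1 <= k)%N by rewrite -onk leq_add2l.
    apply: (@growth_integrable (o.+1 + v.+1 + (k - (o + v.+1)))); first by clear -onk ov; lia.
    apply: poly_growthM => //; exact: growth_deriv.
  rewrite -ExD.
  - apply: eq_Ex => w; rewrite /taylor_rem [\sum_(v < n.+2) _]big_ord_recl expr0 fact0 divr1 mul1r addn0.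
    have -> : \sum_(i < n.+1) (h * X j w) ^+ lift ord0 i / (lift ord0 i)`!%:R *
        derive1n (o + lift ord0 i) f (scaled_sum s w) =
      \sum_(i < n.+1) coef i * X j w ^+ i.+1 * derive1n (o + i.+1) f (scaled_sum s w).
      by apply: eq_bigr => v _; rewrite lift0 exprMn /coef; congr (_ * _); rewrite mulrAC.
    have -> : \sum_(v < n.+1) Y v w * derive1n (o + v.+1) f (scaled_sum s w) =
        Z w * \sum_(i < n.+1) coef i * X j w ^+ i.+1 * derive1n (o + i.+1) f (scaled_sum s w).
      by rewrite mulr_sumr; apply: eq_bigr => v _; rewrite /Y !mulrA.
    by ring.
  - apply: integrableR_sum => v; have vn := ltn_ord v.
    have ov : (o + v.+1 <= k)%N by rewrite -onk leq_add2l.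
    apply: (@growth_integrable (o.+1 + v.+1 + (k - (o + v.+1)))); first by clear -onk ov; lia.
    apply: poly_growthM => //; exact: growth_deriv.
  - apply: (@growth_integrable (o.+1 + n.+1)); first by clear -onk; lia.
    apply: poly_growthM => //; exact: growth_taylor_rem.
have child v : (v < n.+1)%N ->
    expandable (fun f => Ex P (fun w => Y v w * derive1n (o + v.+1) f (scaled_sum s w)))
      (fun f => b * h ^+ n.+1 * err n l f).
  move=> vn; have st : state (o + v.+1) l (b * h ^+ v.+1) (J ++ nseq v.+1 j) s t (Y v).
    split => //.
    - by rewrite size_cat size_nseq Js addSn.
    - apply: field_measurableM.
        by apply: field_measurable_sub mZ => i iJ; rewrite mem_cat iJ.
      by apply: field_measurable_sub (mcX v) => i; rewrite inE mem_cat => /eqP ->; rewrite inE eqxx orbT.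
    - by rewrite mulr_ge0// exprn_ge0// ltW.
    - by move=> w; rewrite normrM prodX_cat mulrACA; apply: ler_pM.
    - apply: (leq_trans ts); rewrite -!mulnA leq_mul2r; apply/orP; right.
      by rewrite addnS !ltnS leq_addr.
    - move=> ml V J' kp J'T J'k mV kp0 Vb.
      have -> : (fun w => Y v w * V w) = (fun w => Z w * (coef v * X j w ^+ v.+1 * V w)).
        by apply/funext => w; rewrite /Y -[LHS]mulrA.
      have -> : b * h ^+ v.+1 * kp * weight l = b * (h ^+ v.+1 * kp) * weight l by rewrite mulrA.
      apply: (mix ml _ (nseq v.+1 j ++ J')).
      + by move=> i; rewrite mem_cat => /orP[/nseqP[->]|/J'T].
      + by rewrite size_cat size_nseq; clear -J'k; lia.
      + apply: field_measurableM.
          by apply: field_measurable_sub (mcX v) => i; rewrite inE => /eqP ->; rewrite inE eqxx.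
        by apply: field_measurable_sub mV => i si; rewrite inE si orbT.
      + by rewrite mulr_ge0// exprn_ge0// ltW.
      + by move=> w; rewrite normrM prodX_cat mulrACA; apply: ler_pM.
  have ok : (o < o + v.+1 <= k)%N by clear -vn onk; lia.
  apply: expandable_le (IH _ _ _ _ _ _ _ ok st) => // f _.
  have -> : (k - (o + v.+1) = n - v)%N by clear -vn onk; lia.
  have -> : n.+1 = (v.+1 + (n - v))%N by clear -vn; lia.
  rewrite exprD mulrA ler_wpM2l ?mulr_ge0 ?exprn_ge0 ?(ltW h0)//.
  by apply: err_homo => //; exact: leq_subr.
have small : expandable (fun f => Ex P (fun w => Z w * taylor_rem o n.+1 f j s w))
    (fun f => (2 + KM) * (b * h ^+ n.+1 * err n l f)).
  apply: expandable_small => f fk.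
  have bh0 : 0 <= b * h ^+ n.+1 by rewrite mulr_ge0// exprn_ge0// ltW.
  have KM1 := moment_const_ge1 hr K1.
  have remw w := taylor_rem_le j s w onk fk.
  have hX w : `|h * X j w| = h * `|X j w| by rewrite normrM gtr0_norm.
  (* Above scale [m] the remainder itself is a test variable for the mixing property. At scale [m]
     it is estimated absolutely and gains a factor [h] through the Lipschitz bound of the last
     derivative. *)
  have [ml|lm] := ltnP m l.
    apply: (le_trans (mix ml (taylor_rem o n.+1 f j s) (nseq n.+1 j) (2 * A f * h ^+ n.+1) _ _ _ _ _)).
    - by move=> i /nseqP[->].
    - by rewrite size_nseq; clear -onk; lia.
    - exact: field_measurable_taylor_rem.
    - by nonneg.
    - move=> w; apply: (le_trans (remw w)); rewrite hX exprMn.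
      apply: (@le_trans _ _ (h ^+ n.+1 * `|X j w| ^+ n.+1 * (2 * A f))).
        by rewrite ler_wpM2l ?ge_min ?lexx// mulr_ge0 ?exprn_ge0 ?(ltW h0).
      rewrite mulrC -mulrA !mulrA -!mulrA ler_wpM2l// ler_wpM2l ?holder_ge0//.
      by rewrite ler_wpM2l ?exprn_ge0 ?(ltW h0)// exp_le_prodX.
    - have H1 : A f * weight l <= err n l f.
        by apply: (le_trans (err0_far f ml)); exact: err_homo.
      have -> : b * (2 * A f * h ^+ n.+1) * weight l = 2 * (b * h ^+ n.+1 * (A f * weight l)) by ring.
      apply: ler_pM => //; first by nonneg.
        by rewrite lerDl (le_trans ler01).
      by rewrite ler_wpM2l.
  have lE : l = m by apply/eqP; rewrite eqn_leq lm; case/andP: lmL.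
  (* There are (o+1) + (n+2) = k+2 factors, which is the number of moments that are assumed. *)
  have J2T : {subset J ++ nseq n.+2 j <= T} by exact: jJT.
  have J2s : (size (J ++ nseq n.+2 j) <= k.+2)%N by rewrite size_cat size_nseq Js; clear -onk; lia.
  have [ip Ep] := prodX_moment hr K1 Xmaj J2T J2s.
  have Bh0 : 0 <= b * (B f * h ^+ n.+2) by nonneg.
  apply: (@le_trans _ _ (Ex P (fun w => b * (B f * h ^+ n.+2) * prodX X (J ++ nseq n.+2 j) w))).
    apply: Ex_normr_le.
    - apply: measurable_funM; first by case: gZ.
      by have [] := growth_taylor_rem onk fk sT jT.
    - move=> w; rewrite normrM prodX_cat mulrACA; apply: ler_pM => //.
      apply: (le_trans (remw w)).
      apply: (@le_trans _ _ (`|h * X j w| ^+ n.+1 * (B f * `|h * X j w|))).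
        by rewrite ler_wpM2l ?exprn_ge0// ge_min lexx orbT.
      rewrite mulrCA -exprSr hX exprMn mulrA; apply: ler_wpM2l; first by nonneg.
      exact: exp_le_prodX.
    - exact: integrableRZ.
  rewrite ExZ//.
  have H1 : B f * h <= err n l f.
    by rewrite lE; apply: (le_trans (err0_near f)); apply: err_homo; rewrite -?lE.
  apply: (@le_trans _ _ (b * h ^+ n.+1 * (B f * h) * KM)).
    have -> : b * (B f * h ^+ n.+2) = b * h ^+ n.+1 * (B f * h) by rewrite exprSr; ring.
    by rewrite ler_wpM2l//; nonneg.
  rewrite mulrC; apply: ler_pM.
  - exact: le_trans KM1.
  - by nonneg.
  - by rewrite lerDr.
  - by rewrite ler_wpM2l.
apply: expandable_le (expandableD (expandable_sum (fun v : 'I_n.+1 => child v (ltn_ord v))) small).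
  exact: split_f.
move=> f _; have bE : (k.+2%:R + KM) * b * h ^+ n.+1 * err n l f =
  (k.+2%:R + KM) * (b * h ^+ n.+1 * err n l f) by rewrite !mulrA.
rewrite bE; have : 0 <= b * h ^+ n.+1 * err n l f.
  by apply: mulr_ge0; [nonneg|exact: err_ge0].
move: (b * h ^+ n.+1 * err n l f) => e e0.
rewrite sumr_const card_ord (_ : e *+ n.+1 = n.+1%:R * e); last by rewrite mulr_natl.
rewrite -mulrDl ler_wpM2r// addrA lerD2r -natrD ler_nat.
by clear -onk; lia.
Qed.

Notation sc := size_const.
Notation clip i J := (minn L (seq_dist i J)).

Definition shell_const : R := (k.+1 * (2 * d * 3 ^ d.-1))%N%:R.

Lemma triple_exp l e : (0 < l)%N -> ((2 * l).+1 ^ e <= 3 ^ e * l ^ e)%N.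
Proof. by move=> l0; rewrite -expnMn leq_expn//; clear -l0; lia. Qed.

Lemma uniq_part s t : perm_eq (s ++ t) T -> uniq s.
Proof. by move=> pst; have := fset_uniq T; rewrite -(perm_uniq pst) cat_uniq => /andP[]. Qed.

Lemma size_part s t : perm_eq (s ++ t) T -> (size s + size t = #|` T|)%N.
Proof. by move=> pst; rewrite -size_cat (perm_size pst). Qed.

Lemma card_le_size_const : (#|` T| <= sc * L ^ d)%N.
Proof.
apply: (leq_trans TL); rewrite expnMn leq_mul2r; apply/orP; right.
by apply: (@leq_trans (3 ^ d)); [exact: leq_expn|rewrite leq_pmull].
Qed.

(** Below [L] clipping has no effect and balls are counted; at [l] = [L] every site counts, and [TL]
    bounds their number. *)
Lemma count_near J s t l : (0 < size J <= k.+1)%N -> perm_eq (s ++ t) T -> (m <= l <= L)%N ->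
  (count (fun i => clip i J <= l) s <= sc * l ^ d)%N.
Proof.
move=> /andP[J0 Jk] pst /andP[ml lL]; have l0 : (0 < l)%N by exact: leq_trans ml.
move: lL; rewrite leq_eqVlt => /orP[/eqP ->|lL].
  apply: (leq_trans (count_size _ _)); apply: leq_trans card_le_size_const.
  by rewrite -(size_part pst) leq_addr.
rewrite (eq_count (a2 := fun i => (seq_dist i J <= l)%N)); last first.
  by move=> i; rewrite geq_min leqNgt lL.
apply: (leq_trans (count_seq_dist_le _ J0 (uniq_part pst))).
by rewrite -mulnA leq_mul// triple_exp.
Qed.

Lemma count_shell J s t l : (0 < size J <= k.+1)%N -> perm_eq (s ++ t) T -> (0 < l)%N ->
  (count (fun i => clip i J == l) s)%:R <= shell_const * shell l.
Proof.
move=> /andP[J0 Jk] pst l0.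
have c1 : 1 <= shell_const by rewrite ler1n !muln_gt0 d0 expn_gt0.
have [lL|Ll|->] := ltngtP l L.
- rewrite /shell ltn_eqF// mul0r addr0 -natrM ler_nat.
  rewrite (eq_count (a2 := fun i => seq_dist i J == l)); last first.
    by move=> i; rewrite /minn; case: ltnP => // Li; rewrite !gtn_eqF// (ltn_trans lL).
  apply: (leq_trans (count_seq_dist_eq J0 l0 (uniq_part pst))).
  rewrite -!mulnA leq_mul// !leq_mul2l triple_exp//.
  by rewrite !orbT.
- rewrite (eq_count (a2 := pred0)) ?count_pred0 ?mulr_ge0 ?shell_ge0 ?(le_trans ler01)//.
  by move=> i; rewrite ltn_eqF// (leq_ltn_trans _ Ll) ?geq_minl.
apply: (@le_trans _ _ (#|` T|)%:R).
  by rewrite ler_nat (leq_trans (count_size _ _))// -(size_part pst) leq_addr.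
rewrite /shell eqxx mul1r -[leLHS]mul1r; apply: ler_pM => //.
by rewrite lerDr.
Qed.

(** Origin of the recursion for [err]: among the sites to be deleted, O(l^d) keep the scale [l], and
    a number of order [shell l'] raise it to l'. *)
Lemma sum_by_scale J s t l (F : nat -> R) : (0 < size J <= k.+1)%N -> perm_eq (s ++ t) T ->
  (m <= l <= L)%N -> (forall l, 0 <= F l) ->
  \sum_(i <- s) F (maxn l (clip i J)) <=
  sc%:R * l%:R ^+ d * F l + shell_const * \sum_(l.+1 <= l' < L.+1) shell l' * F l'.
Proof.
move=> Jk pst mlL F0.
apply: (@le_trans _ _ (\sum_(i <- s) ((clip i J <= l)%N%:R * F l +
    \sum_(l.+1 <= l' < L.+1) (clip i J == l')%:R * F l'))).
  apply: ler_sum => i _; case: (leqP (clip i J) l) => il.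
    rewrite mul1r lerDl; apply: sumr_ge0 => l' _; exact: mulr_ge0.
  rewrite mul0r add0r (bigD1_seq (clip i J)) ?iota_uniq//=; last first.
    by rewrite mem_index_iota il ltnS geq_minl.
  rewrite eqxx mul1r lerDl; apply: sumr_ge0 => l' _; exact: mulr_ge0.
rewrite big_split/= exchange_big/=; apply: lerD.
  rewrite -mulr_suml ler_wpM2r// -natr_sum -natrX -natrM ler_nat.
  by have := count_near Jk pst mlL; rewrite -sum1_count big_mkcond.
rewrite mulr_sumr ler_sum_nat// => l' /andP[ll' _].
rewrite -mulr_suml mulrA ler_wpM2r// -natr_sum.
have := @count_shell J s t l' Jk pst (leq_ltn_trans (leq0n _) ll').
by rewrite -sum1_count big_mkcond.
Qed.

(** The three summands bound Y - E[Y] against a test variable: 1 for Y and [KM] for its mean when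
    the scale is unchanged, [KC] for the covariance when it grows. *)
Definition mean_const : R := 1 + KM + KC.
Definition davydov_delta := davydov_const (sum_const k r K) (k.+1%:R + delta).

Lemma KM_ge1 : 1 <= KM. Proof. exact: moment_const_ge1. Qed.
Lemma KM_ge0 : 0 <= KM. Proof. exact: le_trans KM_ge1. Qed.
Lemma KC_ge0 : 0 <= KC. Proof. exact: cov_const_ge0. Qed.

Lemma Ex_prodX_le J b Y : {subset J <= T} -> (size J <= k.+2)%N -> 0 <= b -> measR Y ->
  (forall w, `|Y w| <= b * prodX X J w) -> integrableR P Y /\ `|Ex P Y| <= b * KM.
Proof.
move=> JT Jk b0 mY Yb; have [iJ EJ] := prodX_moment hr K1 Xmaj JT Jk.
split; first exact: integrableR_le mY Yb (integrableRZ b iJ).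
apply: (le_trans (Ex_normr_le mY Yb (integrableRZ b iJ))).
by rewrite ExZ// ler_wpM2l.
Qed.

(** With g = f^(o), E[Y g(S_s)] is E[Y] E[g(S_T)], minus E[Y] times the mean of g(S_T) - g(S_s),
    plus the covariance of Y and g(S_s). The first is a term of the expansion; the other two are
    telescoped over [t] and over [s], and [child_expandable] applies to each increment. *)
Lemma step_expandable o n l b J s t Y :
  (forall o' l b J s t Y, (o < o' <= k)%N -> state o' l b J s t Y ->
    expandable (fun f => Ex P (fun w => Y w * derive1n o' f (scaled_sum s w)))
      (fun f => b * h ^+ (k - o') * err (k - o') l f)) ->
  (o + n.+1 = k)%N -> state o l b J s t Y ->
  (forall i j, (i < j < size s)%N -> (seq_dist (nth 0%R s i) J <= seq_dist (nth 0%R s j) J)%N) ->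
  (k.+2%:R + KM) * ((k.+1%:R * KM + mean_const) * sc%:R + mean_const * shell_const) <= kap ->
  expandable (fun f => Ex P (fun w => Y w * derive1n o f (scaled_sum s w)))
    (fun f => b * h ^+ n.+1 * err n.+1 l f).
Proof.
move=> IH onk [Js JT pst mY b0 Yb mlL tl mix] sorted_s kapE.
have ok : (o <= k)%N by rewrite -onk leq_addr.
have sT : {subset s <= T} by move=> i si; rewrite -(perm_mem pst) mem_cat si.
have tT : {subset t <= T} by move=> i si; rewrite -(perm_mem pst) mem_cat si orbT.
have KM1 := KM_ge1; have KM0 := KM_ge0; have KC0 := KC_ge0.
have J2k : (size J <= k.+2)%N by rewrite Js; clear -ok; lia.
have [iY EYb] := Ex_prodX_le JT J2k b0 (field_measurable_measR mY) Yb.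
set EY := Ex P Y in EYb *.
have gY : growth o.+1 Y by rewrite -Js; apply: poly_growth_prodX Yb => //; exact: field_measurable_measR mY.
have mix_mean : (m < l)%N -> forall V J' kp, {subset J' <= T} -> (size J' + o < k.+1)%N ->
    measR V -> 0 <= kp -> (forall w, `|V w| <= kp * prodX X J' w) ->
    integrableR P V /\ `|EY| * `|Ex P V| <= b * kp * KM * weight l.
  move=> ml V J' kp J'T J'k mV kp0 Vb.
  have J'k2 : (size J' <= k.+2)%N by clear -J'k; lia.
  have [iV EVb] := Ex_prodX_le J'T J'k2 kp0 mV Vb.
  split => //.
  have EYw : `|EY| <= b * weight l.
    have := mix ml (fun=> 1) [::] 1; rewrite mulr1.
    have -> : Ex P (fun w => Y w * 1) = EY by apply: eq_Ex => w; rewrite mulr1.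
    apply=> //; first exact: field_measurable_cst.
    by move=> w; rewrite normr1 mul1r prodX_ge1.
  apply: (@le_trans _ _ (b * weight l * (kp * KM))); first exact: ler_pM.
  by rewrite le_eqVlt; apply/orP; left; apply/eqP; ring.
(* The deleted sites are put back one at a time, with the constant [EY] as coefficient. No new site
   is deleted, so the scale stays [l]; the decay of [EY] comes from testing the mixing property of Y
   with V = 1. *)
have child_t i : (i < size t)%N ->
    expandable (fun f => EY * Ex P (fun w => derive1n o f (scaled_sum (drop i t ++ s) w) -
        derive1n o f (scaled_sum (drop i.+1 t ++ s) w)))
      (fun f => (k.+2%:R + KM) * (b * KM) * h ^+ n.+1 * err n l f).
  move=> it; have jt : nth 0 t i \in T by apply: tT; exact: mem_nth.
  have pst' : perm_eq ((drop i.+1 t ++ s) ++ take i.+1 t) T.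
    apply: perm_trans pst; rewrite -[X in perm_eq _ (_ ++ X)](cat_take_drop i.+1 t).
    by rewrite -catA perm_catC -catA perm_cat2l.
  have dT : {subset drop i.+1 t ++ s <= T}.
    by move=> x; rewrite mem_cat => /orP[/mem_drop/tT|/sT].
  apply: expandable_le (child_expandable IH onk Js JT jt pst' (Z := fun=> EY) (b := b * KM) _ _ _ mlL _ _).
  - move=> f fk; rewrite -ExZ; first by apply: eq_Ex => w; rewrite (drop_nth 0 it).
    apply: (@growth_integrable (k - o)); first by clear; lia.
    apply: poly_growthB; apply: growth_deriv => //.
    by move=> x; rewrite mem_cat => /orP[/mem_drop/tT|/sT].
  - by move=> f fk.
  - exact: field_measurable_cst.
  - exact: mulr_ge0.
  - by move=> w; apply: (le_trans EYb); rewrite ler_peMr ?mulr_ge0// prodX_ge1.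
  - apply: (@leq_trans (size t)); first by rewrite size_take_min geq_minr.
    by apply: (leq_trans tl); rewrite -!mulnA leq_mul2r leqnSn orbT.
  - move=> ml V J' kp J'T J'k mV kp0 Vb.
    have [iV EV] := mix_mean ml V J' kp J'T J'k (field_measurable_measR mV) kp0 Vb.
    rewrite ExZ// normrM; apply: (le_trans EV).
    by rewrite le_eqVlt; apply/orP; left; apply/eqP; ring.
pose l' i := maxn l (clip (nth 0 s i) J).
have C20 : 0 <= mean_const by exact: addr_ge0 (addr_ge0 ler01 KM0) KC0.
have child_s i : (i < size s)%N ->
    expandable (fun f => Ex P (fun w => (Y w - EY) * (derive1n o f (scaled_sum (drop i s) w) -
        derive1n o f (scaled_sum (drop i.+1 s) w))))
      (fun f => (k.+2%:R + KM) * (b * mean_const) * h ^+ n.+1 * err n (l' i) f).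
  move=> it; have jt : nth 0 s i \in T by apply: sT; exact: mem_nth.
  have pst' : perm_eq (drop i.+1 s ++ (t ++ take i.+1 s)) T.
    apply: perm_trans pst; rewrite -[X in perm_eq _ (X ++ _)](cat_take_drop i.+1 s).
    by rewrite catA perm_catC catA.
  have dT : {subset drop i s <= T} by move=> x /mem_drop/sT.
  have mZ : field_measurable X J (fun w => Y w - EY).
    by apply: field_measurableB => //; exact: field_measurable_cst.
  have ll' : (m <= l' i <= L)%N.
    case/andP: mlL => ml lL; rewrite leq_max ml/= geq_max lL/=; exact: geq_minl.
  have l'0 : (0 < l' i)%N by case/andP: ll' => + _; exact: leq_trans.
  apply: expandable_le (child_expandable IH onk Js JT jt pst' mZ (b := b * mean_const) _ _ ll' _ _).
  - by move=> f fk; rewrite (drop_nth 0 it).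
  - by move=> f fk.
  - exact: mulr_ge0.
  - move=> w; apply: (le_trans (ler_normB _ _)).
    apply: (@le_trans _ _ (b * prodX X J w + b * KM * prodX X J w)).
      apply: lerD => //; apply: (le_trans EYb); rewrite ler_peMr ?prodX_ge1// mulr_ge0//.
    rewrite -mulrDl ler_wpM2r ?prodX_ge0// -{1}[b]mulr1 -mulrDr ler_wpM2l//.
    by rewrite lerDl.
  (* As [s] is sorted, the sites of [s] deleted so far are no farther from [J] than the present one
     and are counted by [count_near]; adding them to [t] turns the factor o+1 into o+2. From
     distance [L] on, the bound on the whole of [T] suffices. *)
  - have [dL|Ld] := ltnP (seq_dist (nth 0 s i) J) L; last first.
      have -> : l' i = L.
        by rewrite /l' (minn_idPl Ld); apply/maxn_idPr; case/andP: mlL.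
      apply: (@leq_trans #|` T|).
        by have := size_part pst'; clear; lia.
      by apply: (leq_trans card_le_size_const); rewrite leq_mul2r leq_pmull ?orbT.
    rewrite size_cat -(addn1 o.+1) mulnDl mulnDl mul1n.
    have l'E : l' i = maxn l (seq_dist (nth 0 s i) J) by rewrite /l' (minn_idPr (ltnW dL)).
    apply: leq_add.
      by apply: (leq_trans tl); rewrite leq_mul2l leq_expn ?orbT// leq_maxl.
    apply: (@leq_trans (count (fun x => clip x J <= l' i)%N s)); last first.
      by apply: (count_near (t := t)) => //; rewrite Js.
    rewrite -[X in count _ X](cat_take_drop i.+1 s) count_cat.
    apply: leq_trans (leq_addr _ _); rewrite -{1}(count_predT (take i.+1 s)).
    rewrite (eq_in_count (a2 := fun x => clip x J <= l' i)%N)// => x xs.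
    have [c ci xE] : exists2 c, (c <= i)%N & x = nth 0%R s c.
      have xi : (index x (take i.+1 s) < i.+1)%N.
        by move: xs; rewrite -index_mem => /leq_trans; apply; rewrite size_take_min geq_minl.
      by exists (index x (take i.+1 s)); rewrite // -(nth_take 0 xi) nth_index.
    rewrite /=; symmetry; rewrite geq_min l'E !leq_max; apply/orP; right; apply/orP; right.
    move: ci; rewrite xE leq_eqVlt => /orP[/eqP -> //|ci].
    by apply: sorted_s; rewrite ci.
  - move=> ml' V J' kp J'T J'k mV kp0 Vb.
    have mV' := field_measurable_measR mV.
    rewrite -(drop_nth 0 it) in mV.
    have J'k2 : (size J' <= k.+2)%N by clear -J'k; lia.
    have [iV EVb] := Ex_prodX_le J'T J'k2 kp0 mV' Vb.
    have JJT : {subset J ++ J' <= T} by move=> x; rewrite mem_cat => /orP[/JT|/J'T].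
    have iYV : integrableR P (fun w => Y w * V w).
      have [] // := @Ex_prodX_le (J ++ J') (b * kp) (fun w => Y w * V w) JJT.
      - by rewrite size_cat Js; clear -J'k; lia.
      - exact: mulr_ge0.
      - by apply: measurable_funM => //; exact: field_measurable_measR mY.
      - by move=> w; rewrite normrM prodX_cat mulrACA; apply: ler_pM.
    have -> : Ex P (fun w => (Y w - EY) * V w) = cov P Y V.
      rewrite /cov -ExZ// -ExB//; last exact: integrableRZ.
      by apply: eq_Ex => w; rewrite mulrBl.
    (* If the scale is unchanged, the decay is that of the given state. If it grows, all sites of
       [drop i s] are at distance at least [l' i] from [J], and the covariance inequality
       applies. *)
    have [l'l|l'l] := eqVneq (l' i) l.
      rewrite l'l in ml' *.
      have [_ EV] := mix_mean ml' V J' kp J'T J'k mV' kp0 Vb.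
      have mVs : field_measurable X s V by apply: field_measurable_sub mV => x /mem_drop.
      have EYV := mix ml' V J' kp J'T J'k mVs kp0 Vb.
      apply: (le_trans (ler_normB _ _)); rewrite normrM.
      apply: (le_trans (lerD EYV EV)).
      have -> : b * mean_const * kp * weight l =
          b * kp * weight l + b * kp * KM * weight l + b * kp * weight l * KC.
        by rewrite /mean_const; ring.
      by rewrite lerDl !mulr_ge0 ?weight_ge0.
    have ll : (l < l' i)%N by rewrite ltn_neqAle eq_sym l'l leq_maxl.
    have dl' : (l' i <= seq_dist (nth 0%R s i) J)%N.
      move: ll; rewrite /l' /maxn; case: ifP => [_ _|_]; last by rewrite ltnn.
      exact: geq_minr.
    apply: (@le_trans _ _ (b * kp * (KC * weight (l' i)))).
      apply: (cov_prodX hr K1 Xmaj (J1 := J) (J2 := J') (s := drop i s)) => //.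
      - by rewrite Js.
      - by rewrite Js; clear -J'k; lia.
      - by rewrite size_drop subn_gt0.
      - move=> x y xJ ys; rewrite maxnorm_sym; apply: leq_trans (seq_dist_le _ xJ).
        apply: (leq_trans dl').
        have [c cs ->] : exists2 c, (c < size (drop i s))%N & y = nth 0%R (drop i s) c.
          by exists (index y (drop i s)); [rewrite index_mem|rewrite nth_index].
        rewrite nth_drop; case: c cs => [|c] cs; first by rewrite addn0.
        move: cs; rewrite size_drop => cs; apply: sorted_s; clear -cs; lia.
    have -> : b * mean_const * kp * weight (l' i) = b * kp * (KC * weight (l' i)) +
        b * kp * (1 + KM) * weight (l' i) by rewrite /mean_const; ring.
    by rewrite lerDl !mulr_ge0 ?weight_ge0 ?addr_ge0.
have Phi_split f : smooth_class k f -> Ex P (fun w => Y w * derive1n o f (scaled_sum s w)) =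
    EY * mean_deriv f o +
    (- (\sum_(i < size t) EY * Ex P (fun w => derive1n o f (scaled_sum (drop i t ++ s) w) -
        derive1n o f (scaled_sum (drop i.+1 t ++ s) w))) +
    \sum_(i < size s) Ex P (fun w => (Y w - EY) * (derive1n o f (scaled_sum (drop i s) w) -
        derive1n o f (scaled_sum (drop i.+1 s) w)))).
  move=> fk; set g := derive1n o f.
  have ig u : {subset u <= T} -> integrableR P (fun w => g (scaled_sum u w)).
    move=> uT; apply: (@growth_integrable (k - o)); first by clear; lia.
    exact: growth_deriv.
  have igd u v : {subset u <= T} -> {subset v <= T} ->
      integrableR P (fun w => g (scaled_sum u w) - g (scaled_sum v w)).
    by move=> uT vT; apply: integrableRB; apply: ig.
  have iYg u : {subset u <= T} -> integrableR P (fun w => (Y w - EY) * g (scaled_sum u w)).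
    move=> uT; apply: (@growth_integrable (o.+1 + (k - o))); first by clear -ok; lia.
    apply: poly_growthM; last exact: growth_deriv.
    apply: poly_growthB => //.
    by apply: (poly_growth_le (leq0n _)); exact: poly_growth_cst.
  have iYgd u v : {subset u <= T} -> {subset v <= T} ->
      integrableR P (fun w => (Y w - EY) * (g (scaled_sum u w) - g (scaled_sum v w))).
    move=> uT vT; apply: (eq_integrableR _ (integrableRB (iYg u uT) (iYg v vT))).
    by move=> w; rewrite mulrBr.
  have dsT i : {subset drop i s <= T} by move=> x /mem_drop/sT.
  have dtT i : {subset drop i t ++ s <= T} by move=> x; rewrite mem_cat => /orP[/mem_drop/tT|/sT].
  rewrite -mulr_sumr -Ex_sum => [|i]; last exact: igd.
  rewrite -Ex_sum => [|i]; last exact: iYgd.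
  have -> : (fun w => \sum_(i < size t) (g (scaled_sum (drop i t ++ s) w) - g (scaled_sum (drop i.+1 t ++ s) w)))
      = fun w => g (scaled_sum T w) - g (scaled_sum s w).
    apply/funext => w; rewrite -telescope_sums (@scaled_sum_perm (t ++ s) T)//.
    by rewrite (perm_trans _ pst)// perm_catC.
  have -> : (fun w => \sum_(i < size s) (Y w - EY) * (g (scaled_sum (drop i s) w) - g (scaled_sum (drop i.+1 s) w)))
      = fun w => (Y w - EY) * (g (scaled_sum s w) - g (h * 0)).
    apply/funext => w; rewrite -mulr_sumr.
    have := telescope_sums g s [::] w; rewrite cats0 /scaled_sum big_nil => ->.
    by congr (_ * _); apply: eq_bigr => i _; rewrite !cats0.
  have igs := ig s sT; have iYgs := iYg s sT.
  have igT : integrableR P (fun w => g (scaled_sum T w)) by exact: ig.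
  rewrite ExB//.
  (* The constant g(h * 0) left when all sites are deleted drops out, because Y - E[Y] is
     centered. *)
  have -> : Ex P (fun w => (Y w - EY) * (g (scaled_sum s w) - g (h * 0))) =
      Ex P (fun w => Y w * g (scaled_sum s w)) - EY * Ex P (fun w => g (scaled_sum s w)).
    move: (g (h * 0)) => c0; rewrite -ExZ//.
    have iYs : integrableR P (fun w => Y w * g (scaled_sum s w)).
      apply: (eq_integrableR _ (integrableRD iYgs (integrableRZ EY igs))).
      by move=> w; ring.
    have iEs := integrableRZ EY igs.
    have iY0 := integrableRZ c0 (integrableRB iY (integrableR_cst P EY)).
    rewrite -ExB//.
    have E0 : Ex P (fun w => c0 * (Y w - EY)) = 0.
      rewrite ExZ; last exact: integrableRB iY (integrableR_cst P EY).
      by rewrite ExB// ?Ex_cst ?subrr ?mulr0//; exact: integrableR_cst.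
    rewrite -[RHS]subr0 -E0 -ExB//; last exact: integrableRB.
    by apply: eq_Ex => w; ring.
  by rewrite /mean_deriv -/g; ring.
have exp_t := expandableN (expandable_sum (fun i : 'I_(size t) => child_t i (ltn_ord i))).
have exp_s := expandable_sum (fun i : 'I_(size s) => child_s i (ltn_ord i)).
apply: expandable_le Phi_split _ (expandableD (expandable_mean EY ok) (expandableD exp_t exp_s)).
move=> f fk; rewrite add0r sumr_const card_ord.
have Jk1 : (0 < size J <= k.+1)%N by rewrite Js.
have l0 : (0 < l)%N by case/andP: mlL => + _; exact: leq_trans.
rewrite -mulr_sumr.
have S1 : \sum_(i < size s) err n (l' i) f <= sc%:R * l%:R ^+ d * err n l f +
    shell_const * \sum_(l.+1 <= l' < L.+1) shell l' * err n l' f.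
  have := sum_by_scale (F := fun l => err n l f) Jk1 pst mlL (fun l => err_ge0 n l f).
  by rewrite (big_nth 0) big_mkord.
set S := \sum_(l.+1 <= l' < L.+1) _ in S1 *.
set e := err n l f in S1 *.
have S0 : 0 <= S by apply: sumr_ge0 => l'' _; rewrite mulr_ge0 ?shell_ge0 ?err_ge0.
have e0 : 0 <= e by exact: err_ge0.
have ld0 : 0 <= l%:R ^+ d :> R by exact: exprn_ge0.
have bh0 : 0 <= b * h ^+ n.+1 by rewrite mulr_ge0// exprn_ge0// ltW.
have tR : (size t)%:R <= k.+1%:R * sc%:R * l%:R ^+ d :> R.
  rewrite -natrX -!natrM ler_nat; apply: (leq_trans tl).
  by rewrite !leq_mul2r; apply/orP; right; apply/orP; right; rewrite ltnS.
have k20 : 0 <= k.+2%:R + KM by rewrite addr_ge0.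
have sc0 : 0 <= sc%:R :> R by [].
have shc0 : 0 <= shell_const by [].
have k10 : 0 <= k.+1%:R :> R by [].
apply: (@le_trans _ _ ((b * h ^+ n.+1) * ((k.+2%:R + KM) * (KM * ((size t)%:R * e) + mean_const *
    (sc%:R * l%:R ^+ d * e + shell_const * S))))).
  rewrite -[X in X + _]mulr_natl.
  have -> : (size t)%:R * ((k.+2%:R + KM) * (b * KM) * h ^+ n.+1 * e) =
    (b * h ^+ n.+1) * ((k.+2%:R + KM) * (KM * ((size t)%:R * e))) by ring.
  move: S1; move: (sc%:R * l%:R ^+ d * e + shell_const * S) => U S1.
  have -> : b * h ^+ n.+1 * ((k.+2%:R + KM) * (KM * ((size t)%:R * e) + mean_const * U)) =
      (b * h ^+ n.+1) * ((k.+2%:R + KM) * (KM * ((size t)%:R * e))) +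
      b * h ^+ n.+1 * ((k.+2%:R + KM) * mean_const) * U by ring.
  have -> : (k.+2%:R + KM) * (b * mean_const) * h ^+ n.+1 =
    b * h ^+ n.+1 * ((k.+2%:R + KM) * mean_const) by ring.
  by rewrite lerD2l ler_wpM2l//; apply: mulr_ge0 => //; exact: mulr_ge0.
rewrite ler_wpM2l//=.
have kap0 : 0 <= kap by exact: le_trans kap1.
apply: (@le_trans _ _ ((k.+2%:R + KM) * ((k.+1%:R * KM + mean_const) * sc%:R + mean_const * shell_const) *
   (l%:R ^+ d * e + S))).
  rewrite -[leRHS]mulrA; apply: ler_wpM2l => //.
  apply: (@le_trans _ _ (KM * (k.+1%:R * sc%:R * l%:R ^+ d * e) + mean_const * (sc%:R * l%:R ^+ d * e + shell_const * S))).
    by rewrite lerD2r ler_wpM2l// ler_wpM2r.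
  have -> : ((k.+1%:R * KM + mean_const) * sc%:R + mean_const * shell_const) * (l%:R ^+ d * e + S) =
    KM * (k.+1%:R * sc%:R * l%:R ^+ d * e) + mean_const * (sc%:R * l%:R ^+ d * e + shell_const * S) +
    ((k.+1%:R * KM + mean_const) * sc%:R * S + mean_const * shell_const * (l%:R ^+ d * e)) by ring.
  by rewrite lerDl; nonneg.
by rewrite ler_wpM2r// addr_ge0// mulr_ge0.
Qed.

Lemma deriv_diff_le f s u w : smooth_class k f -> {subset u <= T} ->
  `|derive1n k f (scaled_sum (u ++ s) w) - derive1n k f (scaled_sum s w)| <=
  B f * h * \sum_(i <- u) (1 + `|X i w|).
Proof.
move=> [_ fk] uT; apply: (le_trans (holder_lip _ _ fk)).
rewrite /scaled_sum big_cat/= mulrDr addrK normrM gtr0_norm// -mulrA ler_wpM2l ?holder_ge0//.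
rewrite ler_wpM2l ?(ltW h0)//; apply: (le_trans (ler_norm_sum _ _ _)).
by apply: ler_sum => i _; rewrite lerDr.
Qed.

Lemma Ex_sumX_le (u J : seq (lattice d)) b c Y V : {subset J <= T} -> {subset u <= T} ->
  (size J <= k.+1)%N -> 0 <= b -> 0 <= c -> measR Y -> measR V ->
  (forall w, `|Y w| <= b * prodX X J w) ->
  (forall w, `|V w| <= c * \sum_(i <- u) (1 + `|X i w|)) ->
  `|Ex P (fun w => Y w * V w)| <= b * c * (KM * (size u)%:R).
Proof.
move=> JT uT Jk b0 c0 mY mV Yb Vb.
have term i : i \in u -> integrableR P (prodX X (J ++ [:: i])) /\ Ex P (prodX X (J ++ [:: i])) <= KM.
  move=> iu; apply: (prodX_moment hr K1 Xmaj); last by rewrite size_cat addn1.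
  by move=> x; rewrite mem_cat inE => /orP[/JT //|/eqP ->]; exact: uT.
pose F w := \sum_(i <- u) prodX X (J ++ [:: i]) w.
have [iF EF] : integrableR P F /\ Ex P F <= KM * (size u)%:R.
  rewrite /F; elim: u uT term {Vb F} => [|i u IH] uT term.
    under eq_fun do rewrite big_nil; split; first exact: integrableR_cst.
    by rewrite Ex_cst mulr0.
  have [||iF EF] := IH.
  - by move=> x xu; apply: uT; rewrite inE xu orbT.
  - by move=> x xu; apply: term; rewrite inE xu orbT.
  have [i1 E1] := term i (mem_head _ _).
  under eq_fun do rewrite big_cons; split; first exact: integrableRD.
  by rewrite ExD// mulrS mulrDr mulr1 lerD.
apply: (@le_trans _ _ (Ex P (fun w => b * c * F w))).
  apply: Ex_normr_le; [exact: measurable_funM| |exact: integrableRZ].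
  move=> w; rewrite normrM.
  have -> : F w = prodX X J w * \sum_(i <- u) (1 + `|X i w|).
    by rewrite /F mulr_sumr; apply: eq_bigr => i _; rewrite prodX_cat /prodX big_seq1.
  by rewrite mulrACA; apply: ler_pM.
by rewrite ExZ// ler_wpM2l// mulr_ge0.
Qed.

Lemma powR_interpolate (x a c : R) : 0 <= x -> x <= a -> x <= c ->
  x <= a `^ (1 - delta) * c `^ delta.
Proof.
move=> x0 xa xc; have [->|xn0] := eqVneq x 0; first by rewrite mulr_ge0 ?powR_ge0.
have /andP[dl0 dl1] := delta01.
have {1}-> : x = x `^ (1 - delta) * x `^ delta.
  by rewrite -powRD ?subrK ?powRr1// xn0 implybT.
by apply: ler_pM; rewrite ?powR_ge0//; apply: ge0_ler_powR; rewrite ?subr_ge0 ?nnegrE//; exact: (le_trans x0).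
Qed.

Lemma cov_diff Y V1 V2 : integrableR P V1 -> integrableR P V2 ->
  integrableR P (fun w => Y w * V1 w) -> integrableR P (fun w => Y w * V2 w) ->
  cov P Y V1 - cov P Y V2 = cov P Y (fun w => V1 w - V2 w).
Proof.
move=> i1 i2 iY1 iY2; rewrite /cov ExB//.
have -> : Ex P (fun w => Y w * (V1 w - V2 w)) = Ex P (fun w => Y w * V1 w) - Ex P (fun w => Y w * V2 w).
  by rewrite -ExB//; apply: eq_Ex => w; rewrite mulrBr.
by ring.
Qed.

Lemma perm_filter_split (a a1 a2 : pred (lattice d)) s :
  (forall i, a1 i = a i && ~~ a2 i) -> (forall i, a2 i -> a i) ->
  perm_eq (seq.filter a s) (seq.filter a1 s ++ seq.filter a2 s).
Proof.
move=> a1E a2a; rewrite perm_sym perm_catC.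
have -> : seq.filter a2 s = seq.filter a2 (seq.filter a s).
  by rewrite -filter_predI; apply: eq_filter => i /=; case: (boolP (a2 i)) => // /a2a ->.
have -> : seq.filter a1 s = seq.filter (predC a2) (seq.filter a s).
  by rewrite -filter_predI; apply: eq_filter => i /=; rewrite a1E andbC.
exact: permEl (perm_filterC a2 _).
Qed.

Definition base_const : R := KM ^+ 2 * k.+3%:R * sc%:R + 2 * shell_const * davydov_delta.

(** Mixing is of no help for these sites: E[YV] and E[Y]E[V] are bounded separately by the size of
    the increment, to which O(m^d) sites contribute. *)
Lemma near_cov_le b J s t Y f (u := [seq i <- s | (clip i J <= m)%N]) (v := [seq i <- s | (m < clip i J)%N]) :
  state k m b J s t Y -> smooth_class k f ->
  `|cov P Y (fun w => derive1n k f (scaled_sum (u ++ v) w) - derive1n k f (scaled_sum v w))| <=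
    b * (2 * KM ^+ 2 * sc%:R) * (B f * h * m%:R ^+ d).
Proof.
move=> [Js JT pst mY b0 Yb mlL tl _] fk; set V := fun w => _ - _.
have sT : {subset s <= T} by move=> i si; rewrite -(perm_mem pst) mem_cat si.
have uT : {subset u <= T} by move=> i; rewrite mem_filter => /andP[_ /sT].
have vT : {subset v <= T} by move=> i; rewrite mem_filter => /andP[_ /sT].
have mV : measR V.
  by apply: measurable_funB; apply: (field_measurable_measR (s := u ++ v));
     [|apply: (@field_measurable_sub _ _ _ _ _ X v); first by move=> i iv; rewrite mem_cat iv orbT];
     apply: field_measurable_deriv fk _.
have Bh0 : 0 <= B f * h by rewrite mulr_ge0 ?holder_ge0 ?(ltW h0).
have Vb w : `|V w| <= B f * h * \sum_(i <- u) (1 + `|X i w|) by exact: deriv_diff_le.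
have Jk : (size J <= k.+1)%N by rewrite Js.
have su : (size u)%:R <= sc%:R * m%:R ^+ d :> R.
  rewrite -natrX -natrM ler_nat size_filter; apply: (count_near (t := t)) => //.
  by rewrite Js leqnn.
have E1 := Ex_sumX_le JT uT Jk b0 Bh0 (field_measurable_measR mY) mV Yb Vb.
have E2 : `|Ex P V| <= B f * h * (KM * (size u)%:R).
  have := @Ex_sumX_le u [::] 1 (B f * h) (fun=> 1) V _ uT _ ler01 Bh0 (@measurable_cst _ _ _ _ _ _) mV _ Vb.
  rewrite mul1r; have -> : Ex P (fun w => 1 * V w) = Ex P V by apply: eq_Ex => w; rewrite mul1r.
  by apply => // w; rewrite normr1 mul1r prodX_ge1.
have [_ E3] := Ex_prodX_le JT (leqW Jk) b0 (field_measurable_measR mY) Yb.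
apply: (le_trans (ler_normB _ _)); rewrite normrM.
apply: (@le_trans _ _ (b * (B f * h) * (KM * (size u)%:R) + b * KM * (B f * h * (KM * (size u)%:R)))).
  by apply: lerD => //; exact: ler_pM.
have KM1 := KM_ge1; have KM0 := KM_ge0.
have -> : b * (B f * h) * (KM * (size u)%:R) + b * KM * (B f * h * (KM * (size u)%:R)) =
  b * (B f * h) * ((KM + KM ^+ 2) * (size u)%:R) by ring.
have -> : b * (2 * KM ^+ 2 * sc%:R) * (B f * h * m%:R ^+ d) =
  b * (B f * h) * (2 * KM ^+ 2 * (sc%:R * m%:R ^+ d)) by ring.
apply: ler_wpM2l; first exact: mulr_ge0.
apply: ler_pM => //; first by rewrite addr_ge0// exprn_ge0.
by rewrite mulr2n mulrDl mul1r lerD2r expr2 ler_peMr.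
Qed.

(** The shell is removed as a whole: interpolation puts the increment, of size h times the number of
    sites times their mean, to the power [delta], so that only the power [delta] of that number is
    paid. Removing the sites singly would cost the number itself. *)
Lemma shell_cov_le b J s t Y f l (u := [seq i <- s | clip i J == l.+1]) (v := [seq i <- s | (l.+1 < clip i J)%N]) :
  state k m b J s t Y -> smooth_class k f ->
  `|cov P Y (fun w => derive1n k f (scaled_sum (u ++ v) w) - derive1n k f (scaled_sum v w))| <=
    b * (2 * shell_const * davydov_delta) *
      (A f `^ (1 - delta) * B f `^ delta * h `^ delta * (shell l.+1 `^ delta * weight_delta l.+1)).
Proof.
move=> [Js JT pst mY b0 Yb mlL tl _] fk; set V := fun w => _ - _.
have /andP[dl0 dl1] := delta01.
have sT : {subset s <= T} by move=> i si; rewrite -(perm_mem pst) mem_cat si.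
have uT : {subset u <= T} by move=> i; rewrite mem_filter => /andP[_ /sT].
have vT : {subset v <= T} by move=> i; rewrite mem_filter => /andP[_ /sT].
have uvT : {subset u ++ v <= T} by move=> i; rewrite mem_cat => /orP[/uT|/vT].
have mV : field_measurable X (u ++ v) V.
  apply: field_measurableB; first exact: field_measurable_deriv.
  apply: (@field_measurable_sub _ _ _ _ _ X v); first by move=> i iv; rewrite mem_cat iv orbT.
  exact: field_measurable_deriv.
have sc1 : 1 <= shell_const by rewrite ler1n !muln_gt0 d0 expn_gt0.
have dd0 : 0 <= davydov_delta.
  by apply: davydov_const_ge0; exact: le_trans ler01 (sum_const_ge1 hr K1).
have RHS0 : 0 <= b * (2 * shell_const * davydov_delta) *
      (A f `^ (1 - delta) * B f `^ delta * h `^ delta * (shell l.+1 `^ delta * weight_delta l.+1)).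
  by repeat first [exact: powR_ge0 | assumption | exact: ler0n | apply: mulr_ge0]; exact: le_trans sc1.
have [u0|u0] := posnP (size u).
  have -> : cov P Y V = 0.
    rewrite /cov (@eq_Ex _ _ _ P _ (fun=> 0)) => [|w]; last by rewrite /V (size0nil u0) cat0s subrr mulr0.
    by rewrite (@eq_Ex _ _ _ P V (fun=> 0)) ?Ex_cst ?mulr0 ?subrr// => w; rewrite /V (size0nil u0) cat0s subrr.
  by rewrite normr0.
have Bh0 : 0 <= B f * h by rewrite mulr_ge0 ?holder_ge0 ?(ltW h0).
pose n : R := (size u)%:R.
have n0 : 0 < n by rewrite ltr0n.
have Vb w : `|V w| <= (2 * A f) `^ (1 - delta) * (B f * h * n) `^ delta *
    ((size u)%:R^-1 * \sum_(i <- u) (1 + `|X i w|)) `^ delta.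
  have S0 : 0 <= \sum_(i <- u) (1 + `|X i w|) by apply: sumr_ge0 => i _; exact: addr_ge0.
  rewrite -mulrA -powRM; [|by apply: mulr_ge0 => //; exact: ltW|by rewrite mulr_ge0 ?invr_ge0].
  apply: powR_interpolate => //.
    rewrite mulr_natl mulr2n; apply: (le_trans (ler_normB _ _)); apply: lerD; exact: smooth_bounded.
  rewrite -mulrA [n * _]mulrA divff ?gt_eqF// mul1r; exact: deriv_diff_le.
apply: (le_trans (cov_prodX_mean hr K1 Xmaj (l := l.+1) (s' := u) (s := u ++ v) Js dl0 delta_r _ JT uvT _ u0 _ mY mV b0 _ Yb Vb)).
- by rewrite size_cat (leq_trans u0)// leq_addr.
- by move=> i iu; rewrite mem_cat iu.
- move=> i j iJ; rewrite mem_cat !mem_filter -andb_orl => /andP[jl js].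
  rewrite maxnorm_sym; apply: leq_trans (seq_dist_le _ iJ).
  have : (l.+1 <= clip j J)%N by case/orP: jl => [/eqP ->//|/ltnW].
  by move=> /leq_trans; apply; exact: geq_minr.
- by rewrite mulr_ge0 ?powR_ge0.
rewrite -/davydov_delta -/(weight_delta l.+1).
have A0 : 0 <= A f by exact: holder_ge0.
have B0 : 0 <= B f by exact: holder_ge0.
have p2 : (2 * A f) `^ (1 - delta) <= 2 * A f `^ (1 - delta).
  rewrite powRM// ler_wpM2r ?powR_ge0// -[leRHS]powRr1// ler_powR ?ler1n//.
  by rewrite gerBl.
have pn : (B f * h * n) `^ delta <= B f `^ delta * h `^ delta * (shell_const * shell l.+1 `^ delta).
  rewrite powRM// ?(ltW n0)// powRM ?(ltW h0)// ler_wpM2l ?mulr_ge0 ?powR_ge0//.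
  apply: (@le_trans _ _ ((shell_const * shell l.+1) `^ delta)).
    apply: ge0_ler_powR; rewrite ?nnegrE ?(ltW n0) ?mulr_ge0 ?shell_ge0 ?(le_trans _ sc1)//.
    rewrite /n /u size_filter; apply: (count_shell (t := t)) => //; by rewrite Js leqnn.
  rewrite powRM ?shell_ge0 ?(le_trans _ sc1)// ler_wpM2r ?powR_ge0//.
  by rewrite -[leRHS]powRr1 ?(le_trans _ sc1)// ler_powR.
have -> : b * (2 * shell_const * davydov_delta) *
    (A f `^ (1 - delta) * B f `^ delta * h `^ delta * (shell l.+1 `^ delta * weight_delta l.+1)) =
  b * ((2 * A f `^ (1 - delta)) * (B f `^ delta * h `^ delta * (shell_const * shell l.+1 `^ delta))) *
    (davydov_delta * weight_delta l.+1) by ring.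
apply: ler_wpM2r; first by rewrite mulr_ge0 ?powR_ge0.
apply: ler_wpM2l => //; apply: ler_pM => //; exact: powR_ge0.
Qed.

(** At order [k] nothing is left to expand. Above scale [m] the mixing property is applied to
    f^(k)(S) directly. At scale [m] the covariance with Y is telescoped over the near sites and then
    over the shells, while the deleted sites change the mean of f^(k) by a Lipschitz error. *)
Lemma base_expandable l b J s t Y : state k l b J s t Y -> base_const <= kap ->
  expandable (fun f => Ex P (fun w => Y w * derive1n k f (scaled_sum s w))) (fun f => b * err 0 l f).
Proof.
move=> st kapE; have [Js JT pst mY b0 Yb mlL tl mix] := st.
have [ml|lm] := ltnP m l.
  apply: expandable_small => f fk; rewrite /= gtn_eqF// mulrA.
  apply: (mix ml _ [::] (A f)) => //.
  - exact: field_measurable_deriv.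
  - exact: holder_ge0.
  - by move=> w; rewrite /prodX big_nil mulr1; exact: smooth_bounded.
have lE : l = m by apply/eqP; rewrite eqn_leq lm; case/andP: mlL.
rewrite lE in st mlL tl *.
have sT : {subset s <= T} by move=> i si; rewrite -(perm_mem pst) mem_cat si.
have tT : {subset t <= T} by move=> i si; rewrite -(perm_mem pst) mem_cat si orbT.
have KM1 := KM_ge1; have KM0 := KM_ge0.
have Jk : (size J <= k.+1)%N by rewrite Js.
have mYR := field_measurable_measR mY.
have [iY EYb] := Ex_prodX_le JT (leqW Jk) b0 mYR Yb.
pose EY := Ex P Y.
have small : expandable (fun f => Ex P (fun w => Y w * derive1n k f (scaled_sum s w)) - EY * mean_deriv f k)
    (fun f => b * err 0 m f).
  apply: expandable_small => f fk; set g := derive1n k f.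
  have gm u : {subset u <= T} -> measR (fun w => g (scaled_sum u w)).
    by move=> uT; apply: (field_measurable_measR (s := u)); exact: field_measurable_deriv.
  have ig u : {subset u <= T} -> integrableR P (fun w => g (scaled_sum u w)).
    by move=> uT; apply: integrableR_bounded (gm u uT) _ => w; exact: smooth_bounded.
  have iYg u : {subset u <= T} -> integrableR P (fun w => Y w * g (scaled_sum u w)).
    move=> uT; have gY : growth k.+1 Y by rewrite -Js; exact: poly_growth_prodX Yb.
    apply: (@growth_integrable (k.+1 + (k - k))); first by rewrite subnn addn0 addn2.
    by apply: poly_growthM => //; exact: growth_deriv.
  pose c u := cov P Y (fun w => g (scaled_sum u w)).
  have c_diff u v : {subset u ++ v <= T} -> c (u ++ v) - c v =
      cov P Y (fun w => g (scaled_sum (u ++ v) w) - g (scaled_sum v w)).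
    move=> uvT; have vT : {subset v <= T} by move=> x xv; apply: uvT; rewrite mem_cat xv orbT.
    by rewrite cov_diff; auto.
  have c_perm u v : perm_eq u v -> c u = c v by move=> uv; rewrite /c (scaled_sum_perm uv).
  pose part l := [seq i <- s | (l < clip i J)%N].
  pose sh l := [seq i <- s | clip i J == l].
  have partT l' : {subset part l' <= T} by move=> x; rewrite mem_filter => /andP[_ /sT].
  have shT l' : {subset sh l' <= T} by move=> x; rewrite mem_filter => /andP[_ /sT].
  have part_sh l' : perm_eq (part l') (sh l'.+1 ++ part l'.+1).
    apply: perm_filter_split => i; last exact: ltnW.
    by rewrite -leqNgt eq_sym eqn_leq.
  pose near := [seq i <- s | (clip i J <= m)%N].
  have nearT : {subset near <= T} by move=> x; rewrite mem_filter => /andP[_ /sT].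
  have catT u v : {subset u <= T} -> {subset v <= T} -> {subset u ++ v <= T}.
    by move=> uT vT x; rewrite mem_cat => /orP[/uT|/vT].
  have s_part : perm_eq s (near ++ part m).
    rewrite -[X in perm_eq X _](filter_predT s); apply: perm_filter_split => //= i.
    by rewrite -leqNgt.
  have part_L : part L = [::].
    rewrite -(filter_pred0 s); apply: eq_filter => i /=; apply: negbTE; rewrite -leqNgt.
    exact: geq_minl.
  (* With no site left the derivative is constant, so the telescoping ends at covariance 0. *)
  have c0 : c [::] = 0.
    rewrite /c; have -> : (fun w => g (scaled_sum [::] w)) = fun=> g (h * 0).
      by apply/funext => w; rewrite /scaled_sum big_nil.
    rewrite /cov.
    have -> : Ex P (fun w => Y w * g (h * 0)) = Ex P (fun w => g (h * 0) * Y w).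
      by apply: eq_Ex => w; rewrite mulrC.
    by rewrite ExZ// Ex_cst mulrC subrr.
  have cE : c s = (c (near ++ part m) - c (part m)) +
      \sum_(m <= l' < L) (c (sh l'.+1 ++ part l'.+1) - c (part l'.+1)).
    rewrite (eq_big_nat _ _ (F2 := fun l' => - c (part l'.+1) - - c (part l'))); last first.
      by move=> l' _; rewrite -(c_perm _ _ (part_sh l')) opprK addrC.
    rewrite telescope_sumr ?(ltnW mL)// part_L c0 oppr0 sub0r opprK subrK.
    exact: c_perm.
  have E1 : Ex P (fun w => Y w * g (scaled_sum s w)) - EY * mean_deriv f k =
      c s + EY * (Ex P (fun w => g (scaled_sum s w)) - mean_deriv f k).
    by rewrite /c /cov -/EY; ring.
  have E2 : `|Ex P (fun w => g (scaled_sum s w)) - mean_deriv f k| <=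
      B f * h * (KM * (k.+1%:R * sc%:R * m%:R ^+ d)).
    rewrite distrC /mean_deriv -/g -ExB; [|exact: ig|exact: ig].
    have Bh0 : 0 <= B f * h by rewrite mulr_ge0 ?holder_ge0 ?(ltW h0).
    have mV : measR (fun w => g (scaled_sum T w) - g (scaled_sum s w)).
      by apply: measurable_funB; apply: gm.
    have Vb w : `|g (scaled_sum T w) - g (scaled_sum s w)| <= B f * h * \sum_(i <- t) (1 + `|X i w|).
      rewrite (@scaled_sum_perm T (t ++ s)); first exact: deriv_diff_le.
      by rewrite perm_sym perm_catC.
    have := @Ex_sumX_le t [::] 1 (B f * h) (fun=> 1) _ _ tT _ ler01 Bh0 (@measurable_cst _ _ _ _ _ _) mV _ Vb.
    rewrite mul1r; under eq_Ex do rewrite mul1r.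
    move=> /(_ _ _ _)/le_trans; apply => //.
    - by move=> w; rewrite normr1 mul1r prodX_ge1.
    - do 2!apply: ler_wpM2l => //.
      by rewrite -natrX -!natrM ler_nat.
  rewrite E1; apply: (le_trans (ler_normD _ _)); rewrite normrM.
  apply: (@le_trans _ _ ((b * (2 * KM ^+ 2 * sc%:R) * (B f * h * m%:R ^+ d) +
      b * (2 * shell_const * davydov_delta) * mid f) +
      b * KM * (B f * h * (KM * (k.+1%:R * sc%:R * m%:R ^+ d))))).
    apply: lerD; last exact: ler_pM.
    rewrite cE; apply: (le_trans (ler_normD _ _)); apply: lerD.
      rewrite c_diff; last exact: catT.
      exact: near_cov_le st fk.
    apply: (le_trans (ler_norm_sum _ _ _)).
    rewrite /mid big_add1/= !mulr_sumr; apply: ler_sum => l' _.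
    rewrite c_diff; last exact: catT.
    exact: shell_cov_le st fk.
  rewrite /= eqxx.
  have Bhm0 : 0 <= B f * h * m%:R ^+ d by nonneg; exact: ltW.
  have mid0 := mid_ge0 f.
  apply: (@le_trans _ _ (b * (base_const * (B f * h * m%:R ^+ d + mid f)))); last first.
    by rewrite ler_wpM2l// ler_wpM2r// addr_ge0.
  have -> : b * (base_const * (B f * h * m%:R ^+ d + mid f)) =
     (b * (2 * KM ^+ 2 * sc%:R) * (B f * h * m%:R ^+ d) +
      b * (2 * shell_const * davydov_delta) * mid f) +
      b * KM * (B f * h * (KM * (k.+1%:R * sc%:R * m%:R ^+ d))) +
      b * (KM ^+ 2 * k.+3%:R * sc%:R * mid f + 2 * shell_const * davydov_delta * (B f * h * m%:R ^+ d)).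
    by rewrite /base_const -[k.+3]addn2 natrD -[k.+1]addn1 !natrD; ring.
  rewrite lerDl mulr_ge0// addr_ge0//.
    by nonneg.
  have dd0 : 0 <= davydov_delta.
    by apply: davydov_const_ge0; exact: le_trans ler01 (sum_const_ge1 hr K1).
  by apply: mulr_ge0 => //; apply: mulr_ge0 => //; exact: mulr_ge0.
apply: expandable_le (expandableD (expandable_mean EY (leqnn k)) small).
- by move=> f _; rewrite addrC subrK.
- by move=> f _; rewrite add0r.
Qed.

Definition kap_const : R := 1 + base_const +
  (k.+2%:R + KM) * ((k.+1%:R * KM + mean_const) * sc%:R + mean_const * shell_const).

(** Sorting [s] by the distance to [J] alters neither the sum nor the state, and provides the order
    of deletion that the step requires. *)
Lemma state_expandable n o l b J s t Y : kap_const <= kap -> (o + n = k)%N -> state o l b J s t Y ->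
  expandable (fun f => Ex P (fun w => Y w * derive1n o f (scaled_sum s w)))
    (fun f => b * h ^+ n * err n l f).
Proof.
move=> kapE; elim/ltn_ind: n o l b J s t Y => n IH o l b J s t Y onk st.
have KM0 := KM_ge0; have KC0 := KC_ge0.
have C20 : 0 <= mean_const by exact: addr_ge0 (addr_ge0 ler01 KM0) KC0.
have b10 : 0 <= base_const.
  have dd0 : 0 <= davydov_delta.
    by apply: davydov_const_ge0; exact: le_trans ler01 (sum_const_ge1 hr K1).
  by apply: addr_ge0; [nonneg|apply: mulr_ge0 => //; exact: mulr_ge0].
have s10 : 0 <= (k.+2%:R + KM) * ((k.+1%:R * KM + mean_const) * sc%:R + mean_const * shell_const).
  by apply: mulr_ge0; first exact: addr_ge0; apply: addr_ge0; [apply: mulr_ge0 => //; apply: addr_ge0 => //; exact: mulr_ge0|exact: mulr_ge0].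
case: n IH onk => [|n] IH onk.
  rewrite addn0 in onk; rewrite onk in st *.
  apply: expandable_le (base_expandable st _) => //.
  - by move=> f _; rewrite expr0 mulr1.
  - by apply: le_trans kapE; rewrite /kap_const -addrA addrCA lerDl addr_ge0.
pose s' := sort (fun i j => seq_dist i J <= seq_dist j J)%N s.
have ss' : perm_eq s s' by rewrite perm_sym; apply: permEl; exact: perm_sort.
have st' : state o l b J s' t Y.
  case: st => ? ? ? ? ? ? ? ? mix; split => //.
    by apply: perm_trans (_ : perm_eq (s ++ t) T) => //; rewrite perm_cat2r perm_sym.
  move=> ml V J' kp J'T J'k mV kp0 Vb; apply: (mix ml _ J') => //.
  by apply: field_measurable_sub mV => x; rewrite (perm_mem ss').
apply: (expandable_le (Phi' := fun f => Ex P (fun w => Y w * derive1n o f (scaled_sum s' w)))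
  (E' := fun f => b * h ^+ n.+1 * err n.+1 l f)) => //.
  by move=> f _; rewrite (scaled_sum_perm ss').
apply: (step_expandable _ onk st').
- move=> o' l' b' J' s1 t1 Y1 /andP[lto leo] st1; apply: (IH (k - o')%N) st1.
    by clear -lto onk leo; lia.
  by rewrite subnKC.
- move=> i j /andP[ij js].
  have srt : sorted (fun i j => seq_dist i J <= seq_dist j J)%N s'.
    by apply: sort_sorted => x y; exact: leq_total.
  apply: (sorted_ltn_nth _ 0 srt) => //; first by move=> y x z; exact: leq_trans.
  by rewrite inE (ltn_trans ij).
- by apply: le_trans kapE; rewrite /kap_const lerDr addr_ge0.
Qed.

(** Each summand of the scaled sum is a state of order 0 at scale [m] without deleted sites. *)
Lemma sum_variable_expandable : kap_const <= kap ->
  expandable (fun f => Ex P (fun w => scaled_sum T w * f (scaled_sum T w)))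
    (fun f => #|` T|%:R * (h ^+ k.+1 * err k m f)).
Proof.
move=> kapE; pose Y j w := h * X (nth 0 T j) w.
have child (j : 'I_(size T)) : expandable
    (fun f => Ex P (fun w => Y j w * derive1n 0 f (scaled_sum T w))) (fun f => h ^+ k.+1 * err k m f).
  have jT : nth 0 T j \in T by exact: mem_nth.
  have st : state 0 m h [:: nth 0 T j] T [::] (Y j).
    split => //=.
    - by move=> i; rewrite inE => /eqP ->.
    - by rewrite cats0.
    - apply: field_measurableM; first exact: field_measurable_cst.
      by apply: field_measurable_X; rewrite mem_head.
    - exact: ltW.
    - move=> w; rewrite normrM gtr0_norm// ler_wpM2l ?(ltW h0)//.
      by rewrite /prodX big_seq1 lerDr.
    - by rewrite leqnn ltnW.
    - by rewrite ltnn.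
  by have := state_expandable kapE (add0n k) st; rewrite exprS.
apply: expandable_le (expandable_sum child) => f fk.
  rewrite -Ex_sum.
    apply: eq_Ex => w; rewrite -mulr_suml; congr (_ * _).
    by rewrite /scaled_sum mulr_sumr (big_nth 0) big_mkord.
  move=> j; apply: (@growth_integrable (1 + k)); first by rewrite addn2 add1n.
  have jT : nth 0 T j \in T by exact: mem_nth.
  apply: poly_growthM.
    apply: (@poly_growthM _ _ _ _ _ X T 0 1); first exact: poly_growth_cst.
    exact: poly_growth_X.
  by have := growth_deriv fk (leq0n k) (fun i iT => iT); rewrite subn0.
by rewrite sumr_const card_ord mulr_natl.
Qed.

(** * Solution of the recursion for the errors *)

Hypothesis TLm : (#|` T| <= (2 * (L - m)) ^ d)%N.

Notation tail := (tail_sum d L weight).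
Notation far := (far_sum d L weight).

Lemma rexp_ge0 (a : R) : 0 < a -> (a%:E <= r)%E -> 0 <= rexp r a.
Proof.
case: r hr => [r'| |]//= _ a0; rewrite lee_fin => ar.
by rewrite divr_ge0 ?subr_ge0// (le_trans (ltW a0)).
Qed.

Lemma weight_anti l l' : (l <= l')%N -> weight l' <= weight l.
Proof.
move=> ll; have /andP[? _] := alpha_mixing_itv X T k.+1 l.
have /andP[? _] := alpha_mixing_itv X T k.+1 l'.
apply: ge0_ler_powR => //; last exact: alpha_mixing_homo.
apply: rexp_ge0 => //; apply: le_trans hr.
by rewrite lee_fin ler_nat addn2 ltnW.
Qed.

Lemma weight_delta_anti l l' : (l <= l')%N -> weight_delta l' <= weight_delta l.
Proof.
move=> ll; have /andP[? _] := alpha_mixing_itv X T k.+1 l.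
have /andP[? _] := alpha_mixing_itv X T k.+1 l'; have /andP[dl0 _] := delta01.
apply: ge0_ler_powR => //; last exact: alpha_mixing_homo.
by apply: rexp_ge0 => //; rewrite ltr_wpDr.
Qed.

Fixpoint far_const q : R :=
  if q is q'.+1 then kap * (far_const q' * (3 + 2 ^+ (d + d * q).+1)) else 1.

Fixpoint near_const q : R :=
  if q is q'.+1 then kap * (near_const q' + far_const q' * (2 + 2 ^+ (d + d * q))) else kap.

Lemma far_const_ge0 q : 0 <= far_const q.
Proof. by elim: q => //= q IH; rewrite !mulr_ge0 ?addr_ge0 ?exprn_ge0 ?(le_trans _ kap1). Qed.

Lemma near_const_ge0 q : 0 <= near_const q.
Proof.
elim: q => /= [|q IH]; first exact: le_trans kap1.
by rewrite mulr_ge0 ?addr_ge0 ?mulr_ge0 ?far_const_ge0 ?addr_ge0 ?exprn_ge0 ?(le_trans _ kap1).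
Qed.

(** The additional sites of the last shell contribute one term at [L], where the tail is empty. Its
    bound [c] is left open, because it is obtained differently for [l] = [m] and for larger [l]. *)
Lemma shell_far_le q l c : (l < L)%N ->
  #|` T|%:R * (L%:R ^+ (d * q) * weight L) <= c ->
  \sum_(l.+1 <= l' < L.+1) shell l' * far q l' <= 2 * tail q.+1 l + c.
Proof.
move=> lL Tc; rewrite /shell.
under eq_bigr do rewrite mulrDl natrX.
rewrite big_split/=; apply: lerD; first exact: (sum_far_le L d0 weight_ge0).
rewrite (bigD1_seq L) ?iota_uniq ?mem_index_iota ?lL ?ltnSn//= big1 ?addr0 => [|l' /negbTE ->]; last first.
  by rewrite !mul0r.
by rewrite eqxx mul1r /far_sum /tail_sum big_geq// mulr0 addr0.
Qed.

(** Once the scale exceeds [m], every leaf of the recursion is [holder k.-1 1 f] times the weight at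
    the final scale, and [far_sum] reproduces itself under the recursion. *)
Lemma err_far q l f : (m < l <= L)%N -> err q l f <= far_const q * (A f * far q l).
Proof.
have kap0 : 0 <= kap by exact: le_trans kap1.
have A0 : 0 <= A f by exact: holder_ge0.
elim: q l => [|q IH] l /andP[ml lL].
  by rewrite /= gtn_eqF// mul1r /far_sum muln0 expr0 mul1r mul0r addr0.
have fc0 := far_const_ge0 q.
rewrite [leLHS]/= [far_const _]/= -!mulrA ler_wpM2l//.
have farS : 0 <= far q.+1 l by exact: (far_sum_ge0 d L weight_ge0).
have tS : tail q.+1 l <= far q.+1 l.
  by rewrite /far_sum mul1r lerDr mulr_ge0 ?weight_ge0// exprn_ge0.
have E1 : l%:R ^+ d * err q l f <= far_const q * A f * far q.+1 l.
  apply: (@le_trans _ _ (far_const q * A f * (l%:R ^+ d * far q l))).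
    rewrite [leRHS]mulrCA ler_wpM2l ?exprn_ge0//.
    by rewrite -mulrA; apply: IH; rewrite ml.
  apply: ler_wpM2l; first exact: mulr_ge0.
  rewrite /far_sum mulrDr mul1r; apply: lerD; last exact: (pow_tail_le L d0 weight_ge0).
  by rewrite mulrA -exprD mulnS.
have E2 : \sum_(l.+1 <= l' < L.+1) shell l' * err q l' f <=
    far_const q * A f * ((2 + 2 ^+ (d + d * q.+1).+1) * far q.+1 l).
  move: lL; rewrite leq_eqVlt => /orP[/eqP lL|lL].
    by rewrite big_geq; [nonneg|rewrite lL].
  apply: (@le_trans _ _ (far_const q * A f * \sum_(l.+1 <= l' < L.+1) shell l' * far q l')).
    rewrite mulr_sumr; apply: ler_sum_nat => l' /andP[ll' l'L].
    rewrite [leRHS]mulrCA ler_wpM2l ?shell_ge0// -mulrA; apply: IH.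
    by rewrite (ltn_trans ml ll') -ltnS.
  apply: ler_wpM2l; first exact: mulr_ge0.
  apply: (le_trans (shell_far_le lL (tail_far d0 weight_ge0 weight_anti q lL TL))).
  by rewrite [leRHS]mulrDl lerD2r ler_wpM2l.
apply: (le_trans (lerD E1 E2)).
rewrite le_eqVlt; apply/orP; left; apply/eqP; ring.
Qed.

(** If the scale never leaves [m], each order costs m^d and the leaf is the base error. Otherwise
    its first growth leads to [err_far], and only the seminorm of order k-1 appears. *)
Lemma err_near q f : err q m f <=
  near_const q * ((B f * h * m%:R ^+ d + mid f) * m%:R ^+ (d * q) + (0 < q)%N%:R * (A f * tail q m)).
Proof.
have kap0 : 0 <= kap by exact: le_trans kap1.
have A0 : 0 <= A f by exact: holder_ge0.
elim: q => [|q IH].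
  by rewrite /= eqxx muln0 expr0 mulr1 mul0r addr0.
have fc0 := far_const_ge0 q; have nc0 := near_const_ge0 q.
rewrite [leLHS]/= [near_const _]/= -[leRHS]mulrA ler_wpM2l//.
set Q := B f * h * m%:R ^+ d + mid f in IH *.
have Q0 : 0 <= Q.
  by apply: addr_ge0; [|exact: mid_ge0]; nonneg; exact: ltW.
have tS : 0 <= tail q.+1 m by exact: (tail_sum_ge0 d L weight_ge0).
have E1 : m%:R ^+ d * err q m f <= near_const q * (Q * m%:R ^+ (d * q.+1) + A f * tail q.+1 m).
  apply: (@le_trans _ _ (near_const q * (m%:R ^+ d * (Q * m%:R ^+ (d * q) + (0 < q)%N%:R * (A f * tail q m))))).
    by rewrite mulrCA ler_wpM2l ?exprn_ge0.
  apply: ler_wpM2l => //; rewrite mulrDr; apply: lerD.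
    by rewrite mulrCA -exprD mulnS.
  rewrite [X in _ * X]mulrCA [leLHS]mulrCA ler_wpM2l//.
  exact: (pow_tail_le L d0 weight_ge0).
have E2 : \sum_(m.+1 <= l' < L.+1) shell l' * err q l' f <=
    far_const q * A f * ((2 + 2 ^+ (d + d * q.+1)) * tail q.+1 m).
  apply: (@le_trans _ _ (far_const q * A f * \sum_(m.+1 <= l' < L.+1) shell l' * far q l')).
    rewrite mulr_sumr; apply: ler_sum_nat => l' /andP[ll' l'L].
    rewrite [leRHS]mulrCA ler_wpM2l ?shell_ge0// -mulrA; apply: err_far.
    by rewrite ll' -ltnS.
  apply: ler_wpM2l; first exact: mulr_ge0.
  apply: (le_trans (shell_far_le mL (tail_near d0 weight_ge0 weight_anti q mL TLm))).
  by rewrite [leRHS]mulrDl.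
apply: (le_trans (lerD E1 E2)); rewrite mul1r.
have -> : (near_const q + far_const q * (2 + 2 ^+ (d + d * q.+1))) * (Q * m%:R ^+ (d * q.+1) + A f * tail q.+1 m) =
  near_const q * (Q * m%:R ^+ (d * q.+1) + A f * tail q.+1 m) +
    far_const q * A f * ((2 + 2 ^+ (d + d * q.+1)) * tail q.+1 m) +
  far_const q * ((2 + 2 ^+ (d + d * q.+1)) * (Q * m%:R ^+ (d * q.+1))) by ring.
by rewrite lerDl; nonneg.
Qed.

End Induction.

End Expansions.

(** * Identification of the coefficients *)

Section CumulantExpansion.
Context (dO : measure_display) (Omega : measurableType dO) (R : realType)
  (P : probability Omega R) (W : Omega -> R) (k : nat).
Hypotheses (k0 : (0 < k)%N) (mW : measR W) (W0 : Ex P W = 0)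
  (iW : forall p, (p <= k)%N -> integrableR P (fun w => W w ^+ p)).
Implicit Types (f : R -> R).

Notation mu q := (Ex P (fun w => W w ^+ q)).

Lemma moment0 : mu 0%N = 1.
Proof. by under eq_Ex do rewrite expr0; rewrite Ex_cst. Qed.

Lemma cumulant_rec n : mu n.+1 = \sum_(j < n.+1) 'C(n, j)%:R * cumulant P W j.+1 * mu (n - j)%N.
Proof. exact: (cumulant_of_recursion (mu := fun q => mu q) moment0). Qed.

Lemma cumulant1 : cumulant P W 1 = 0.
Proof.
have := cumulant_rec 0; rewrite big_ord1 subnn moment0 mulr1 bin0 mul1r => <-.
by rewrite -[RHS]W0; apply: eq_Ex => w; rewrite expr1.
Qed.

Lemma mean_top_deriv_le f : smooth_class k f ->
  `|Ex P (fun w => derive1n k f (W w))| <= holder k.-1 1 f.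
Proof.
move=> fk; rewrite -[leRHS](Ex_cst P); apply: Ex_normr_le; last exact: integrableR_cst.
  apply: (@measurableT_comp _ _ _ _ _ _ (derive1n k f)) mW.
  by apply: continuous_measurable_fun; exact: (smooth_continuous fk).
by move=> w; exact: smooth_bounded.
Qed.

(* Testing on monomials yields the recursion between moments and cumulants for
   [c j * j`!]. *)
Lemma cumulant_expansion (c : nat -> R) (E : (R -> R) -> R) e :
  (forall f, smooth_class k f -> `|Ex P (fun w => W w * f (W w)) -
     \sum_(j < k.+1) c j * Ex P (fun w => derive1n j f (W w))| <= E f) ->
  (forall p, (p < k)%N -> E (fun x => x ^+ p) <= 0) -> E (fun x => x ^+ k) <= k`!%:R * e ->
  forall f, smooth_class k f ->
  `|Ex P (fun w => W w * f (W w)) - (\sum_(1 <= j < k) cumulant P W j.+1 / j`!%:R *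
       Ex P (fun w => derive1n j f (W w)) +
     cumulant P W k.+1 / k`!%:R * Ex P (fun w => derive1n k f (W w)))| <= E f + e * holder k.-1 1 f.
Proof.
move=> HE E0 Ek.
have monomial p : (p <= k)%N ->
    `|mu p.+1 - \sum_(j < p.+1) 'C(p, j)%:R * (c j * j`!%:R) * mu (p - j)%N| <= E (fun x => x ^+ p).
  move=> pk; have := HE _ (smooth_exp R k0 pk).
  have -> : Ex P (fun w => W w * W w ^+ p) = mu p.+1 by apply: eq_Ex => w; rewrite exprS.
  have -> // : \sum_(j < k.+1) c j * Ex P (fun w => derive1n j (fun x => x ^+ p) (W w)) =
    \sum_(j < p.+1) 'C(p, j)%:R * (c j * j`!%:R) * mu (p - j)%N.
  have T j : c j * Ex P (fun w => derive1n j (fun x => x ^+ p) (W w)) =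
      'C(p, j)%:R * (c j * j`!%:R) * mu (p - j)%N.
    rewrite derive1n_exp ExZ; last by apply: iW; apply: leq_trans pk; exact: leq_subr.
    by rewrite -bin_ffact natrM; ring.
  rewrite -(big_mkord xpredT (fun j => c j * Ex P (fun w => derive1n j (fun x => x ^+ p) (W w)))).
  rewrite (@big_cat_nat _ _ _ p.+1)//= [X in _ + X]big_nat [X in _ + X]big1 ?addr0.
    by rewrite big_mkord; apply: eq_bigr => j _; exact: T.
  by move=> j /andP[pj _]; rewrite T bin_small// !mul0r.
(* The recursion of the moments with c_j j! and the one with the cumulants agree in all earlier
   terms, hence in the last one, whose coefficient is E[W^0] = 1. *)
have cE j : (j < k)%N -> c j * j`!%:R = cumulant P W j.+1.
  elim/ltn_ind: j => p IH pk; have := monomial p (ltnW pk).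
  move=> /le_trans/(_ (E0 p pk)); rewrite normr_le0 subr_eq0 cumulant_rec !big_ord_recr/=.
  rewrite subnn moment0 binn !mul1r !mulr1 (eq_bigr (fun j : 'I_p => 'C(p, j)%:R * (c j * j`!%:R) * mu (p - j)%N)).
    by move=> /eqP/addrI ->.
  by move=> j _; rewrite IH// (ltn_trans _ pk).
have ck : `|c k - cumulant P W k.+1 / k`!%:R| <= e.
  have kf : 0 < k`!%:R :> R by rewrite ltr0n fact_gt0.
  have := le_trans (monomial k (leqnn k)) Ek.
  rewrite cumulant_rec !big_ord_recr/= subnn moment0 binn !mul1r !mulr1.
  rewrite (eq_bigr (fun j : 'I_k => 'C(k, j)%:R * (c j * j`!%:R) * mu (k - j)%N)); last first.
    by move=> j _; rewrite cE.
  rewrite opprD addrACA subrr add0r distrC => H.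
  rewrite -(ler_pM2l kf) (le_trans _ H)// -{1}(ger0_norm (ltW kf)) -normrM mulrBr.
  rewrite [c k * _]mulrC [_ * (_ / _)]mulrCA divff ?mulr1//; exact: lt0r_neq0.
move=> f fk; have mean_k := mean_top_deriv_le fk.
apply: (@le_trans _ _ (`|Ex P (fun w => W w * f (W w)) -
     \sum_(j < k.+1) c j * Ex P (fun w => derive1n j f (W w))| +
   `|(c k - cumulant P W k.+1 / k`!%:R) * Ex P (fun w => derive1n k f (W w))|)).
  rewrite (_ : _ - _ = (Ex P (fun w => W w * f (W w)) -
     \sum_(j < k.+1) c j * Ex P (fun w => derive1n j f (W w))) +
   (c k - cumulant P W k.+1 / k`!%:R) * Ex P (fun w => derive1n k f (W w))); first exact: ler_normD.
  rewrite -(big_mkord xpredT (fun j => c j * Ex P (fun w => derive1n j f (W w)))).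
  (* The term j = 0 is absent from the expansion since W is centered and its first cumulant
     vanishes. *)
  have c0 : c 0%N = 0 by have := cE 0%N k0; rewrite fact0 mulr1 cumulant1.
  rewrite big_nat_recr//= [\sum_(0 <= i < k) _]big_ltn// c0 mul0r add0r.
  rewrite (eq_big_nat _ _ (F2 := fun j => c j * Ex P (fun w => derive1n j f (W w)))).
    by ring.
  move=> j /andP[j0 jk]; rewrite -cE// mulfK// pnatr_eq0 -lt0n fact_gt0//.
apply: lerD; first exact: HE.
by rewrite normrM; apply: ler_pM.
Qed.

End CumulantExpansion.

Section NormalizedSum.
Context (d : nat) (dO : measure_display) (Omega : measurableType dO)
  (R : realType) (P : probability Omega R) (X : lattice d -> {RV P >-> R})
  (T : {fset lattice d}) (k : nat) (r : \bar R) (K : R).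
Hypotheses (hr : ((k + 2)%N%:R%:E <= r)%E) (K1 : 1 <= K)
  (Xmaj : forall i, i \in T -> majorant P r K (fun w => 1 + `|X i w|))
  (k0 : (0 < k)%N) (d0 : (0 < d)%N) (X0 : forall i, i \in T -> Ex P (X i) = 0).
Variables (m L : nat) (delta c : R).
Hypotheses (m0 : (0 < m)%N) (mL : (m < L)%N) (TLm : (#|` T| <= (2 * (L - m)) ^ d)%N)
  (delta01 : 0 <= delta <= 1) (delta_r : ((k.+1%:R + delta)%:E <= r)%E)
  (c1 : 1 <= c) (sigma0 : 0 < sigma X T)
  (sigma_c : (sigma X T)^-1 <= c * #|` T|%:R `^ (- 2^-1)) (T0 : (0 < #|` T|)%N).

Notation N := (#|` T|%:R : R).
Notation W := (normalized_sum X T).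
Notation A f := (holder k.-1 1 f).
Notation B f := (holder k 1 f).
Notation alpha l := (alpha_mixing X T k.+1 l).

Definition error_bound f : R :=
  B f * N `^ (- (k%:R / 2)) * m%:R ^+ (d * k.+1)
  + A f `^ (1 - delta) * B f `^ delta * N `^ (- ((k%:R - 1 + delta) / 2)) * m%:R ^+ (d * k)
    * \sum_(m.+1 <= l < L.+1) l%:R `^ (d%:R * delta - delta) * alpha l `^ rexp r (k%:R + 1 + delta)
  + A f * N `^ (- ((k%:R - 1) / 2))
    * \sum_(m.+1 <= l < L.+1) l%:R ^+ (d * k - 1) * alpha l `^ rexp r (k%:R + 1).

(** The factor c^(k+2) comes from replacing at most k+2 powers of 1/sigma by powers of c N^(-1/2),
    and 4^(d+2) from [shell_powR_le]. *)
Definition main_const : R :=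
  near_const d (kap_const d k r K delta) k * c ^+ k.+2 * 4 ^+ d.+2.

Let h := (sigma X T)^-1.
Let h0 : 0 < h. Proof. by rewrite invr_gt0. Qed.
Let TL : (#|` T| <= (2 * L) ^ d)%N.
Proof. by apply: (leq_trans TLm); apply: leq_expn; rewrite leq_mul2l leq_subr orbT. Qed.
Let kap1 : 1 <= kap_const d k r K delta.
Proof.
have KM0 := KM_ge0 hr K1; have KC0 := KC_ge0 hr K1.
have dd0 : 0 <= davydov_delta k r K delta.
  by apply: davydov_const_ge0; exact: le_trans ler01 (sum_const_ge1 hr K1).
rewrite /kap_const -addrA lerDl; apply: addr_ge0.
  by apply: addr_ge0; [nonneg|apply: mulr_ge0 => //; exact: mulr_ge0].
have C20 : 0 <= mean_const k r K by exact: addr_ge0 (addr_ge0 ler01 KM0) KC0.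
apply: mulr_ge0; first exact: addr_ge0.
by apply: addr_ge0; apply: mulr_ge0 => //; apply: addr_ge0 => //; exact: mulr_ge0.
Qed.

Lemma normalized_sumE : W = scaled_sum X h T.
Proof. by []. Qed.

Lemma normalized_sum_growth p : (p <= k.+2)%N -> integrableR P (fun w => W w ^+ p).
Proof.
move=> pk; apply: (growth_integrable hr K1 Xmaj (n := 1 * p)); first by rewrite mul1n addn2.
by apply: poly_growth_exp; rewrite normalized_sumE; exact: growth_scaled_sum.
Qed.

Lemma normalized_sum_mean : Ex P W = 0.
Proof.
rewrite normalized_sumE /scaled_sum.
have iX i : i \in T -> integrableR P (X i).
  by move=> iT; apply: (growth_integrable hr K1 Xmaj (n := 1)); [rewrite addn2|exact: poly_growth_X].
under eq_Ex do rewrite (big_nth 0) big_mkord.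
rewrite ExZ; last by apply: integrableR_sum => i; apply: iX; exact: mem_nth.
rewrite Ex_sum; last by move=> i; apply: iX; exact: mem_nth.
by rewrite big1 ?mulr0// => i _; apply: X0; exact: mem_nth.
Qed.

Lemma card_gt0 : 0 < N. Proof. by rewrite ltr0n. Qed.

Lemma card_powR_exp j : (N `^ (- 2^-1)) ^+ j = N `^ (- (j%:R / 2)).
Proof. by rewrite -powR_mulrn ?powR_ge0// -powRrM; congr (_ `^ _); ring. Qed.

Lemma sigma_exp j : h ^+ j <= c ^+ j * N `^ (- (j%:R / 2)).
Proof.
rewrite -card_powR_exp -exprMn; apply: lerXn2r => //; rewrite nnegrE ?(ltW h0)//.
by rewrite mulr_ge0 ?powR_ge0// (le_trans _ c1).
Qed.

Lemma card_mul_powR (a : R) : N * N `^ a = N `^ (1 + a).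
Proof. by rewrite [RHS]powRD ?powRr1// (gt_eqF card_gt0) implybT. Qed.

(** As h is at most c N^(-1/2), the common factor N h^(k+1) is of order N^(-(k-1)/2); a further h or
    h^delta lowers the exponent by 1/2 or delta/2. *)
Lemma total_error_le f : N * (h ^+ k.+1 * err X T k r h m L delta (kap_const d k r K delta) k m f) <=
  main_const * error_bound f.
Proof.
set kap := kap_const d k r K delta.
have A0 : 0 <= A f by exact: holder_ge0.
have B0 : 0 <= B f by exact: holder_ge0.
have nc0 : 0 <= near_const d kap k by exact: near_const_ge0.
have E1 := err_near X hr h0 delta mL d0 TL kap1 TLm k f.
have /andP[dl0 dl1] := delta01.
have h0' := ltW h0; have c0 : 0 <= c by exact: le_trans c1.
have cexp j : (j <= k.+2)%N -> c ^+ j <= c ^+ k.+2 by move=> jk; rewrite ler_weXn2l.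
have N1 : N * h ^+ k.+2 <= c ^+ k.+2 * N `^ (- (k%:R / 2)).
  apply: (@le_trans _ _ (N * (c ^+ k.+2 * N `^ (- (k.+2%:R / 2))))).
    by rewrite ler_wpM2l// sigma_exp.
  rewrite mulrCA card_mul_powR (_ : 1 + _ = - (k%:R / 2))//.
  by rewrite -addn2 natrD; field.
have N2 : N * h ^+ k.+1 <= c ^+ k.+2 * N `^ (- ((k%:R - 1) / 2)).
  apply: (@le_trans _ _ (N * (c ^+ k.+1 * N `^ (- (k.+1%:R / 2))))).
    by rewrite ler_wpM2l// sigma_exp.
  rewrite mulrCA card_mul_powR (_ : 1 + _ = - ((k%:R - 1) / 2)).
    by rewrite ler_wpM2r ?powR_ge0 ?cexp.
  by rewrite -addn1 natrD; field.
have N3 : N * h ^+ k.+1 * h `^ delta <= c ^+ k.+2 * N `^ (- ((k%:R - 1 + delta) / 2)).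
  have hd : h `^ delta <= c * N `^ (- (delta / 2)).
    apply: (@le_trans _ _ ((c * N `^ (- 2^-1)) `^ delta)).
      by apply: ge0_ler_powR; rewrite ?nnegrE ?mulr_ge0 ?powR_ge0.
    rewrite powRM ?powR_ge0// -powRrM mulNr mulrC [_ * c `^ _]mulrC [2^-1 * _]mulrC.
    by rewrite ler_wpM2r ?powR_ge0// -[leRHS]powRr1// ler_powR.
  apply: (@le_trans _ _ ((N * (c ^+ k.+1 * N `^ (- (k.+1%:R / 2)))) * (c * N `^ (- (delta / 2))))).
    apply: ler_pM => //; rewrite ?powR_ge0 ?mulr_ge0 ?exprn_ge0//.
    by rewrite ler_wpM2l// sigma_exp.
  rewrite [N * _]mulrCA card_mul_powR mulrACA -exprSr -powRD; last by rewrite (gt_eqF card_gt0) implybT.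
  rewrite (_ : 1 + _ + _ = - ((k%:R - 1 + delta) / 2))//.
  by rewrite -addn1 natrD; field.
rewrite /main_const /error_bound.
set S1 := \sum_(m.+1 <= l < L.+1) l%:R `^ _ * _.
set S2 := \sum_(m.+1 <= l < L.+1) l%:R ^+ _ * _.
have wd0 l : 0 <= weight_delta X T k r delta l by exact: powR_ge0.
have S10 : 0 <= S1 by apply: sumr_ge0 => l _; rewrite mulr_ge0 ?powR_ge0.
have S20 : 0 <= S2 by apply: sumr_ge0 => l _; rewrite mulr_ge0 ?exprn_ge0 ?powR_ge0.
have tailE : tail_sum d L (weight X T k r) k m = S2.
  by apply: eq_bigr => l _; rewrite /weight natr1.
have midE : mid X T k r h m L delta f <= A f `^ (1 - delta) * B f `^ delta * h `^ delta * (4 ^+ d.+2 * S1).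
  rewrite /mid ler_wpM2l//; first by nonneg.
  apply: (le_trans (shell_powR_le d0 wd0 (weight_delta_anti X T hr delta01 delta_r) mL TLm delta01)).
  rewrite ler_wpM2l ?exprn_ge0//; apply: ler_sum_nat => l /andP[ml _].
  rewrite /weight_delta natr1 ler_wpM2r ?powR_ge0//.
  rewrite natrX -powR_mulrn// -powRrM (_ : d.-1%:R * delta = d%:R * delta - delta)//.
  by rewrite -subn1 natrB//; ring.
apply: (@le_trans _ _ (near_const d kap k * (N * h ^+ k.+1 * ((B f * h * m%:R ^+ d +
     A f `^ (1 - delta) * B f `^ delta * h `^ delta * (4 ^+ d.+2 * S1)) * m%:R ^+ (d * k) + A f * S2)))).
  rewrite [leLHS]mulrA [leRHS]mulrCA ler_wpM2l ?mulr_ge0 ?exprn_ge0//.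
  apply: (le_trans E1); rewrite ler_wpM2l// k0 mul1r tailE lerD2r ler_wpM2r ?exprn_ge0//.
  by rewrite lerD2l.
rewrite -(mulrA (near_const d kap k)) -[leRHS]mulrA ler_wpM2l//.
have p4 : 1 <= 4 ^+ d.+2 :> R by rewrite exprn_ege1// ler1n.
have ck0 : 0 <= c ^+ k.+2 by exact: exprn_ge0.
have mE : m%:R ^+ (d * k.+1) = m%:R ^+ d * m%:R ^+ (d * k) :> R by rewrite mulnS exprD.
have T1 : N * h ^+ k.+2 * (B f * m%:R ^+ (d * k.+1)) <=
    c ^+ k.+2 * 4 ^+ d.+2 * (B f * N `^ (- (k%:R / 2)) * m%:R ^+ (d * k.+1)).
  apply: (@le_trans _ _ (c ^+ k.+2 * N `^ (- (k%:R / 2)) * (B f * m%:R ^+ (d * k.+1)))).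
    by rewrite ler_wpM2r// mulr_ge0// exprn_ge0.
  have -> : c ^+ k.+2 * N `^ (- (k%:R / 2)) * (B f * m%:R ^+ (d * k.+1)) =
     c ^+ k.+2 * (B f * N `^ (- (k%:R / 2)) * m%:R ^+ (d * k.+1)) by ring.
  apply: ler_wpM2r; first by nonneg.
  by rewrite ler_peMr.
have T2 : N * h ^+ k.+1 * h `^ delta * (A f `^ (1 - delta) * B f `^ delta * m%:R ^+ (d * k) * (4 ^+ d.+2 * S1)) <=
    c ^+ k.+2 * 4 ^+ d.+2 * (A f `^ (1 - delta) * B f `^ delta * N `^ (- ((k%:R - 1 + delta) / 2)) * m%:R ^+ (d * k) * S1).
  apply: (@le_trans _ _ (c ^+ k.+2 * N `^ (- ((k%:R - 1 + delta) / 2)) * (A f `^ (1 - delta) * B f `^ delta * m%:R ^+ (d * k) * (4 ^+ d.+2 * S1)))).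
    by apply: ler_wpM2r => //; nonneg.
  by rewrite le_eqVlt; apply/orP; left; apply/eqP; ring.
have T3 : N * h ^+ k.+1 * (A f * S2) <= c ^+ k.+2 * 4 ^+ d.+2 * (A f * N `^ (- ((k%:R - 1) / 2)) * S2).
  apply: (@le_trans _ _ (c ^+ k.+2 * N `^ (- ((k%:R - 1) / 2)) * (A f * S2))).
    by apply: ler_wpM2r => //; exact: mulr_ge0.
  have -> : c ^+ k.+2 * N `^ (- ((k%:R - 1) / 2)) * (A f * S2) =
     c ^+ k.+2 * (A f * N `^ (- ((k%:R - 1) / 2)) * S2) by ring.
  apply: ler_wpM2r; first by nonneg.
  by rewrite ler_peMr.
rewrite [leRHS]mulrDr [X in _ <= X + _]mulrDr.
apply: le_trans (lerD (lerD T1 T2) T3).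
rewrite [h ^+ k.+2]exprSr mE le_eqVlt; apply/orP; left; apply/eqP; ring.
Qed.

Lemma main_expansion f : smooth_class k f ->
  `|Ex P (fun w => W w * f (W w)) - (\sum_(1 <= j < k) cumulant P W j.+1 / j`!%:R *
       Ex P (fun w => derive1n j f (W w)) +
     cumulant P W k.+1 / k`!%:R * Ex P (fun w => derive1n k f (W w)))| <=
  2 * main_const * error_bound f.
Proof.
have := sum_variable_expandable hr K1 Xmaj k0 h0 m0 mL d0 TL delta01 delta_r kap1 (lexx _).
move=> /(expandable_le (fun f _ => erefl) (fun f _ => total_error_le f))[cf Hcf].

set S1 := \sum_(m.+1 <= l < L.+1) l%:R `^ (d%:R * delta - delta) * alpha l `^ rexp r (k%:R + 1 + delta).
set S2 := \sum_(m.+1 <= l < L.+1) l%:R ^+ (d * k - 1) * alpha l `^ rexp r (k%:R + 1).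
have S10 : 0 <= S1 by apply: sumr_ge0 => l _; rewrite mulr_ge0 ?powR_ge0.
have S20 : 0 <= S2 by apply: sumr_ge0 => l _; rewrite mulr_ge0 ?exprn_ge0 ?powR_ge0.
have C0 : 0 <= main_const.
  rewrite /main_const; apply: mulr_ge0; last exact: exprn_ge0.
  by apply: mulr_ge0; [exact: near_const_ge0|apply: exprn_ge0; exact: le_trans c1].
pose u := N `^ (- (k%:R / 2)) * m%:R ^+ (d * k.+1).
pose v := N `^ (- ((k%:R - 1 + delta) / 2)) * m%:R ^+ (d * k) * S1.
pose t := N `^ (- ((k%:R - 1) / 2)) * S2.
have u0 : 0 <= u by nonneg.
have v0 : 0 <= v by rewrite /v; nonneg.
have t0 : 0 <= t by rewrite /t; nonneg.
have errE g : error_bound g = B g * u + A g `^ (1 - delta) * B g `^ delta * v + A g * t.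
  by rewrite /error_bound -/S1 -/S2 /u /v /t; ring.
(* For x^k the seminorm of order [k] vanishes, but it enters to the power [delta] and 0^0 = 1: the
   middle term survives exactly when [delta] is 0, and is then a multiple of the seminorm of order
   k-1. *)
pose e := main_const * ((delta == 0)%:R * v + t).
have mW : measR W.
  by have [] := growth_scaled_sum X h (fun i (iT : i \in T) => iT).
have E0 p : (p < k)%N -> main_const * error_bound (fun x => x ^+ p) <= 0.
  move=> pk; have pk' : (p <= k.-1)%N by rewrite -ltnS prednK.
  rewrite errE; have [-> _] := holder_exp R (ltnW pk); have [-> _] := holder_exp R pk'.
  rewrite !mul0r add0r addr0; suff -> : (0 : R) `^ (1 - delta) * 0 `^ delta = 0 by rewrite mul0r mulr0.
  have [->|dn] := eqVneq delta 0; last by rewrite [X in _ * X]powR0 ?mulr0.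
  by rewrite subr0 powRr1// mul0r.
have Ek : main_const * error_bound (fun x => x ^+ k) <= k`!%:R * e.
  rewrite errE; have [-> _] := holder_exp R (leqnn k); have [Ak _] := holder_exp_pred R k0.
  set a := A _ in Ak *; have a0 : 0 <= a by exact: holder_ge0.
  rewrite mul0r add0r /e [leRHS]mulrCA ler_wpM2l// mulrDr; apply: lerD; last by rewrite ler_wpM2r.
  have [dl|dn] := eqVneq delta 0.
    by rewrite dl subr0 powRr1// powRr0 mulr1 mul1r ler_wpM2r.
  by rewrite [X in _ * X * _]powR0// mulr0 !mul0r mulr0.
have iW p : (p <= k)%N -> integrableR P (fun w => W w ^+ p).
  by move=> pk; apply: normalized_sum_growth; apply: (leq_trans pk); rewrite ltnW.
move=> fk; have := cumulant_expansion k0 mW normalized_sum_mean iW Hcf E0 Ek fk.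
move=> /le_trans; apply.
rewrite -mulrA mulr2n mulrDl mul1r lerD2l /e -mulrA ler_wpM2l// errE.
have A0 : 0 <= A f by exact: holder_ge0.
have B0 : 0 <= B f by exact: holder_ge0.
rewrite [_ * A f]mulrC mulrDr -addrA; apply: ler_wpDl; first exact: mulr_ge0.
rewrite lerD2r; have [dl|dn] := eqVneq delta 0.
  by rewrite dl subr0 powRr1// powRr0 mulr1 mul1r.
by rewrite mul0r mulr0; nonneg.
Qed.

End NormalizedSum.

(** * Genograms and admissible tuples *)

Section Ancestors.
Variable (G : genodata).
Hypothesis isG : is_genogram G.
Notation n := (size G).
Notation anc := (ancestors G).

Lemma par1 : par G 1 = 0%N. Proof. by case: isG => _ []. Qed.
Lemma par0 : par G 0 = 0%N. Proof. exact: par1. Qed.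

Lemma par_lt j : (0 < j <= n)%N -> (par G j < j)%N.
Proof.
move=> /andP[j0 jn]; have [->|j1] := eqVneq j 1%N; first by rewrite par1.
case: isG => _ [_ H] _ _ _; have /andP[//] : (1 <= par G j < j)%N.
by apply: H; rewrite jn andbT; case: j j0 j1 {jn} => [|[|j]].
Qed.

Lemma par_gt0 j : (1 < j <= n)%N -> (0 < par G j)%N.
Proof. by move=> jn; case: isG => _ [_ H] _ _ _; case/andP: (H j jn). Qed.

Lemma iter_par_le t j : (j <= n)%N -> (0 < iter t (par G) j)%N -> (iter t (par G) j + t <= j)%N.
Proof.
move=> jn; elim: t => [|t IH]; first by rewrite /= addn0.
rewrite iterS => it0.
have jt0 : (0 < iter t (par G) j)%N by case: (iter t (par G) j) it0 => //; rewrite par0.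
have le := IH jt0; have jtn : (iter t (par G) j <= n)%N.
  by apply: leq_trans (leq_trans le jn); exact: leq_addr.
have := par_lt (j := iter t (par G) j); rewrite jt0 jtn => /(_ isT).
by clear -le; lia.
Qed.

Lemma ancestorsP l j : (j <= n)%N -> l \in anc j <-> (0 < l)%N /\ exists t, l = iter t.+1 (par G) j.
Proof.
move=> jn; rewrite /ancestors mem_filter mem_iota; split.
  move=> /andP[/trajectP[t tj ->] /andP[l0 _]]; split => //; exists t; by rewrite iterSr.
move=> [l0 [t lE]]; have := @iter_par_le t.+1 j jn; rewrite -lE => /(_ l0) ltj.
apply/andP; split; last by clear -ltj l0; lia.
apply/trajectP; exists t; first by clear -ltj l0; lia.
by rewrite lE iterSr.
Qed.

Lemma anc_lt l j : l \in anc j -> (0 < l < j)%N.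
Proof. by rewrite mem_filter mem_iota => /andP[_]; case: j => [|j]; lia. Qed.

Lemma anc_par j : (1 < j <= n)%N -> par G j \in anc j.
Proof.
move=> jn; apply/ancestorsP; first by case/andP: jn.
by split; [exact: par_gt0|exists 0%N].
Qed.

Lemma anc_trans j l p : (j <= n)%N -> l \in anc j -> p \in anc l -> p \in anc j.
Proof.
move=> jn lj; have ln : (l <= n)%N by have := anc_lt lj; clear -jn; lia.
move: lj => /(ancestorsP _ jn)[_ [t ->]] in ln *; move=> /(ancestorsP _ ln)[p0 [t' pE]].
apply/ancestorsP => //; split => //; exists (t' + t.+1)%N.
by rewrite pE -addSn iterD.
Qed.

Lemma anc_linear j l p : (j <= n)%N -> l \in anc j -> p \in anc j -> (p < l)%N -> p \in anc l.
Proof.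
move=> jn lj pj pl; have ln : (l <= n)%N by have := anc_lt lj; clear -jn; lia.
have /(ancestorsP _ jn)[l0 [t lE]] := lj; have /(ancestorsP _ jn)[p0 [t' pE]] := pj.
apply/ancestorsP => //; split => //.
have [tt|tt] := leqP t' t.
  have lp : l = iter (t - t') (par G) p by rewrite pE -iterD addnS subnK.
  have pn : (p <= n)%N by have := anc_lt pj; clear -jn; lia.
  have := @iter_par_le (t - t') p pn; rewrite -lp => /(_ l0).
  by move: pl; clear; lia.
exists (t' - t.+1)%N; rewrite pE lE -iterD; congr (iter _ (par G) j); move: tt; clear; lia.
Qed.

Lemma anc_root j : (1 < j <= n)%N -> 1%N \in anc j.
Proof.
elim/ltn_ind: j => j IH jn; have pj := anc_par jn; have := anc_lt pj => /andP[p0 pltj].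
have /andP[j1 jn'] := jn.
have [<-//|p1] := eqVneq (par G j) 1%N.
apply: (anc_trans jn' pj); apply: IH => //; move: p0 p1 pltj jn'; clear; lia.
Qed.

Lemma gidx_lt j : (1 < j)%N -> (gidx G j < j)%N.
Proof.
move=> j1; rewrite /gidx gtn_max j1/= big_seq_cond.
elim/big_ind: _ => [|a b ha hb|l /andP[/anc_lt/andP[_]//]]; first exact: ltnW.
by rewrite gtn_max ha.
Qed.

Lemma gidx_max j l : l \in anc j -> 1 <= sid G l -> (l <= gidx G j)%N.
Proof.
move=> lj sl; rewrite /gidx leq_max; apply/orP; right.
by rewrite (big_rem l)//= sl leq_maxl.
Qed.

Lemma bigmaxn_attained (s : seq nat) (p : pred nat) : \max_(l <- s | p l) l = 0%N \/
  (\max_(l <- s | p l) l \in s /\ p (\max_(l <- s | p l) l)).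
Proof.
elim: s => [|a s IH]; first by rewrite big_nil; left.
rewrite big_cons; case: ifP => pa; last first.
  by case: IH => [->|[ms pm]]; [left|right; rewrite inE ms orbT].
rewrite /maxn; case: ifP => _; last by right; rewrite mem_head.
by case: IH => [->|[ms pm]]; [left|right; rewrite inE ms orbT].
Qed.

Lemma gidx_attained j : gidx G j = 1%N \/ (gidx G j \in anc j /\ 1 <= sid G (gidx G j)).
Proof.
rewrite /gidx; have [->|[h1 h2]] := bigmaxn_attained (anc j) (fun l => 1 <= sid G l); first by left.
rewrite /maxn; case: ifP => _; last by left.
by right.
Qed.

Lemma sid_ge j : (1 < j <= n)%N -> -1 <= sid G j.
Proof. by move=> jn; case: isG => _ _ [_ H _ _] _ _; exact: H. Qed.

(** Going up from a vertex with identifier -1, a nonnegative identifier is met at the latest at a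
    child of the root; hence u(j) is not the root. *)
Lemma uidxP j : (1 < j <= n)%N -> sid G j = -1 ->
  [/\ uidx G j \in anc j, (1 < uidx G j)%N & 0 <= sid G (uidx G j)].
Proof.
move=> jn sj.
have [c [cj c1 sc]] : exists c, [/\ c \in j :: anc j, (1 < c)%N & 0 <= sid G c].
  move: {sj} jn; elim/ltn_ind: j => j IH jn; have pj := anc_par jn; have := anc_lt pj => /andP[p0 pltj].
  have /andP[j1 jn'] := jn.
  have [pj1|p1] := eqVneq (par G j) 1%N.
    exists j; rewrite mem_head; split => //; case: isG => _ _ [_ _ H _] _ _; exact: H.
  have [|c [cp c1 sc]] := IH _ pltj; first by move: p0 p1 pltj jn'; clear; lia.
  exists c; split => //; rewrite inE; apply/orP; right.
  by move: cp; rewrite inE => /orP[/eqP ->//|]; exact: anc_trans.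
have cu : (c <= uidx G j)%N by rewrite /uidx (big_rem c)//= sc leq_maxl.
have [u0|[]] := bigmaxn_attained (j :: anc j) (fun l => 0 <= sid G l).
  by move: cu; rewrite /uidx u0 leqn0 => /eqP c0; rewrite c0 in c1.
rewrite -/(uidx G j) inE => /orP[/eqP ->|uj su]; first by rewrite sj.
by split => //; exact: leq_trans cu.
Qed.

End Ancestors.

(** * Constraint sets along an admissible tuple *)

Section Admissible.
Context (d : nat) (prec : rel (lattice d)) (T : {fset lattice d}) (m : nat).
Hypothesis prec_irr : irreflexive prec.
Implicit Types (i : lattice d) (S : {fset lattice d}).

Lemma in_nbhd i S : i \in nbhd T m S = (i \in T) && (dist1 i S <= m)%N.
Proof. by rewrite in_fset /= !inE. Qed.

Lemma nbhd_s_sub s S : (nbhd_s prec T m s S `<=` T)%fset.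
Proof.
apply/fsubsetP => i; rewrite !inE => /orP[/andP[//]|]; by move=> /andP[/andP[_ ->]].
Qed.

Lemma in_nbhd_s i s S : i \in nbhd_s prec T m s S = (i \in nbhd T m S) ||
  [&& i \in T, i \notin nbhd T m S & (rk prec T m i S <= s)%N].
Proof.
rewrite /nbhd_s in_fsetU; congr (_ || _); rewrite [LHS]in_fset /= inE /= in_fsetD.
by rewrite -andbA andbCA.
Qed.

Lemma rk_gt0 i S : (0 < rk prec T m i S)%N. Proof. by []. Qed.

(** All sites ranked before [i], and [i] itself, are ranked before [i']. *)
Lemma dist1_lt_rk i i' S : i \in T -> i \notin nbhd T m S -> (dist1 i S < dist1 i' S)%N ->
  (rk prec T m i S < rk prec T m i' S)%N.
Proof.
move=> iT iN ii'; rewrite /rk ltnS; move: (nbhd T m S) iN => NS iN.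
apply: fproper_ltn_card; rewrite fproperE; apply/andP; split.
  apply/fsubsetP => y; rewrite !in_fset /= !inE /= => /andP[yT yi]; rewrite yT/=.
  apply/orP; left; case/orP: yi => [/ltn_trans|/andP[/eqP -> _]]; [exact|exact: ii'].
apply/fsubsetPn; exists i; rewrite !in_fset /= !inE /= iN iT/= ?ii'//.
by rewrite ltnn eqxx prec_irr.
Qed.

Lemma Drec_le1 G x f j : (j <= 1)%N -> Drec prec T m G x f j = fset0.
Proof. by case: f => //= f ->. Qed.

Lemma Drec_fuel G x f j : is_genogram G -> (j <= f)%N ->
  Drec prec T m G x f j = Drec prec T m G x j j.
Proof.
move=> isG; elim/ltn_ind: f j => f IH j jf.
have [j1|j1] := leqP j 1; first by rewrite !Drec_le1.
case: f IH jf => [|f] IH jf; first by case: j jf j1.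
case: j j1 jf => // j j1 jf /=; rewrite leqNgt j1/=.
have gj := @gidx_lt G j.+1 j1.
have -> : Drec prec T m G x f (gidx G j.+1) = Drec prec T m G x j (gidx G j.+1).
  move: jf; rewrite ltnS leq_eqVlt => /orP[/eqP ->//|jf].
  rewrite (IH f _ (gidx G j.+1))//; last exact: leq_trans (ltnW jf).
  by rewrite (IH j)//; exact: ltnW.
by [].
Qed.

Lemma Drec_sub G x f j : (Drec prec T m G x f j `<=` T)%fset.
Proof.
elim: f j => [|f IH] j /=; first exact: fsub0set.
case: ifP => _; first exact: fsub0set.
by case: ifP => _ //; rewrite fsubUset nbhd_s_sub/=.
Qed.

Lemma Brec_sub G x f j : (Brec prec T m G x f j `<=` T)%fset.
Proof.
elim: f j => [|f IH] j /=; first exact: fsubset_refl.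
case: ifP => _; first exact: fsubset_refl.
by case: ifP => _ //; rewrite fsubUset nbhd_s_sub/= Drec_sub.
Qed.

Definition admissible G x := all (fun j => nth 0 x j \in
  (Bset prec T m G (take j x) j.+1 `\` Dset prec T m G (take j x) j.+1)%fset) (iota 0 (size x)).

Section Tuple.
Variables (G : genodata) (x : seq (lattice d)).
Hypotheses (isG : is_genogram G) (sx : size x = size G) (adm : admissible G x).
Notation n := (size G).
Notation anc := (ancestors G).
Notation pt j := (nth 0 x j.-1).
Notation anp j := (anc_points G x j).
Notation DD j := (Drec prec T m G x j j).

Lemma anc_points_take p j : (j <= p.+1)%N -> anc_points G (take p x) j = anp j.
Proof.
move=> jp; rewrite /anc_points (_ : [seq nth 0 (take p x) l.-1 | l <- anc j] = [seq pt l | l <- anc j])//.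
by apply/eq_in_map => l /anc_lt lj; apply: nth_take; move: lj jp; clear; lia.
Qed.

Lemma Drec_take p f j : (j <= p.+1)%N ->
  Drec prec T m G (take p x) f j = Drec prec T m G x f j.
Proof.
elim: f j => //= f IH j jp; case: ifP => // /negbT; rewrite -ltnNge => j1.
by rewrite anc_points_take// IH// (leq_trans (ltnW (gidx_lt G j1))).
Qed.

Lemma DD_step j : (1 < j)%N -> DD j = (if (1 <= sid G j)%R then
  nbhd_s prec T m `|sid G j - 1|%N (anp j) `|` DD (gidx G j) else DD (gidx G j))%fset.
Proof.
case: j => // j j1 /=; rewrite leqNgt j1/=.
by rewrite (Drec_fuel _ isG)// -ltnS; exact: gidx_lt.
Qed.

Lemma DD_gidx_sub j : (1 < j)%N -> (DD (gidx G j) `<=` DD j)%fset.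
Proof. by move=> j1; rewrite (DD_step j1); case: ifP => // _; exact: fsubsetUr. Qed.

(** D_b contains D_g(b), and iterating g from [b] meets every ancestor with a positive
    identifier. *)
Lemma DD_anc_sub b c : (b <= n)%N -> c \in anc b -> 1 <= sid G c -> (DD c `<=` DD b)%fset.
Proof.
elim/ltn_ind: b => b IH bn cb sc; have := anc_lt cb => /andP[c0 cltb].
have b1 : (1 < b)%N by apply: leq_trans cltb.
have cg := gidx_max cb sc; move: cg; rewrite leq_eqVlt => /orP[/eqP ->|cg]; first exact: DD_gidx_sub.
have [g1|[gb sg]] := gidx_attained G b; first by rewrite g1 ltnS leqNgt c0 in cg.
apply: fsubset_trans (DD_gidx_sub b1); apply: IH => //; first exact: gidx_lt.
  by apply: leq_trans bn; apply: ltnW; exact: gidx_lt.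
exact: anc_linear gb cb cg.
Qed.

Lemma admissibleP j : (0 < j <= n)%N ->
  [/\ pt j \in Bset prec T m G (take j.-1 x) j, pt j \notin DD j & pt j \in T].
Proof.
move=> /andP[j0 jn]; move: adm => /allP/(_ j.-1); rewrite mem_iota add0n sx prednK// jn => /(_ isT).
rewrite in_fsetD /Dset Drec_take; last by rewrite prednK.
move=> /andP[jD jB]; split => //.
by move: jB => /(fsubsetP (Brec_sub _ _ _ _)).
Qed.

Lemma Bset_nonneg f u j : (u <= f)%N -> (1 < u <= j)%N -> 0 <= sid G u ->
  Brec prec T m G (take j.-1 x) f u =
  (nbhd_s prec T m `|sid G u|%N (anp u) `|` DD (gidx G u))%fset.
Proof.
case: f => [|f] /= uf /andP[u1 uj] su; first by case: u uf u1 uj su.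
rewrite leqNgt u1/= su anc_points_take; last by move: u1 uj; clear; lia.
rewrite /Dset Drec_take//; apply: leq_trans (ltnW (gidx_lt G u1)) _; move: u1 uj; clear; lia.
Qed.

Lemma anp_neq0 j : (1 < j <= n)%N -> anp j != fset0.
Proof.
move=> jn; apply/fset0Pn; exists (pt 1); rewrite /anc_points in_fset /=; apply/mapP.
by exists 1%N => //; exact: anc_root.
Qed.

Lemma anp_dist i j : (1 < j <= n)%N -> exists2 c, c \in anc j & dist1 i (anp j) = maxnorm (i - pt c).
Proof.
move=> jn; have [y + ->] := dist1_attained i (anp_neq0 jn).
by rewrite /anc_points in_fset /= => /mapP[c cj ->]; exists c.
Qed.

Lemma dist_anp_le i j c : c \in anc j -> (dist1 i (anp j) <= maxnorm (i - pt c))%N.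
Proof. by move=> cj; apply: dist1_le; rewrite /anc_points in_fset /=; apply/mapP; exists c. Qed.

(** Apart from the common set D_g(j) and the neighbourhood, B_j and D_j consist of the sites of rank
    at most s_j and at most s_j - 1, so that only rank s_j is left. *)
Lemma positive_rank j : (1 < j <= n)%N -> 1 <= sid G j ->
  [/\ pt j \in T, pt j \notin nbhd T m (anp j) & (rk prec T m (pt j) (anp j))%:Z = sid G j].
Proof.
move=> jn sj; have /andP[j1 jn'] := jn.
have jn0 : (0 < j <= n)%N by rewrite (ltnW j1).
have [jB jD jT] := admissibleP jn0.
move: jB; rewrite /Bset (@Bset_nonneg j j)//; [|by rewrite j1/=|exact: le_trans sj].
move: jD; rewrite DD_step// sj in_fsetU negb_or => /andP[jD1 jD2].
rewrite in_fsetU (negbTE jD2) orbF.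
move: jD1; rewrite !in_nbhd_s negb_or => /andP[jN].
rewrite (negbTE jN) jT/= -ltnNge => r1 r2.
by split => //; move: r1 r2 sj; clear; lia.
Qed.

Lemma zero_near j : (1 < j <= n)%N -> sid G j = 0 -> (dist1 (pt j) (anp j) <= m)%N.
Proof.
move=> jn sj; have /andP[j1 jn'] := jn.
have jn0 : (0 < j <= n)%N by rewrite (ltnW j1).
have [jB jD jT] := admissibleP jn0.
move: jB; rewrite /Bset (@Bset_nonneg j j)//; [|by rewrite j1/=|by rewrite sj].
move: jD; rewrite DD_step// sj in_fsetU => /negbTE -> /=.
by rewrite orbF in_nbhd_s [(_ <= 0)%N]leqNgt rk_gt0 !andbF orbF in_nbhd => /andP[].
Qed.

(** B_j is the set of u(j). If s_u(j) is positive, D_j contains D_u(j), because u(j) is then one of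
    the positive ancestors of j. The point is thus constrained like that of u(j). *)
Lemma neg_near j : (1 < j <= n)%N -> sid G j = -1 ->
  (dist1 (pt j) (anp (uidx G j)) <= m)%N \/
  (1 <= sid G (uidx G j) /\ rk prec T m (pt j) (anp (uidx G j)) = rk prec T m (pt (uidx G j)) (anp (uidx G j))
   /\ pt j \notin nbhd T m (anp (uidx G j))).
Proof.
move=> jn sj; have /andP[j1 jn'] := jn.
have jn0 : (0 < j <= n)%N by rewrite (ltnW j1).
have [uj u1 su] := uidxP isG jn sj; have := anc_lt uj => /andP[_ ultj].
have [jB jD jT] := admissibleP jn0.
set u := uidx G j in uj u1 su ultj *.
have un : (1 < u <= n)%N by rewrite u1; apply: leq_trans jn'; exact: ltnW.
have Bu : Bset prec T m G (take j.-1 x) j = (nbhd_s prec T m `|sid G u|%N (anp u) `|` DD (gidx G u))%fset.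
  rewrite -(@Bset_nonneg j.-1 u j)//; [|by move: ultj; clear; lia|by rewrite u1 ltnW].
  rewrite /Bset -{2}(prednK (ltnW j1)) /= leqNgt j1/= sj//.
clearbody u.
have subu : pt j \notin DD (gidx G u).
  have [->|[gu sg]] := gidx_attained G u; first by rewrite Drec_le1.
  apply: contra jD; apply: (fsubsetP (DD_anc_sub jn' _ sg)).
  exact: (anc_trans isG jn' uj).
move: jB; rewrite Bu in_fsetU (negbTE subu) orbF in_nbhd_s => jB.
have [su1|su1] := boolP (1 <= sid G u).
  right; split => //; have : pt j \notin DD u by apply: contra jD; apply: (fsubsetP (DD_anc_sub jn' uj su1)).
  rewrite (DD_step u1) su1 in_fsetU negb_or in_nbhd_s negb_or => /andP[/andP[jN]].
  have [_ _ ru] := positive_rank un su1.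
  move: jB; rewrite (negbTE jN) jT/= => r1; rewrite -ltnNge => r2 _.
  have rj : (rk prec T m (pt j) (anp u))%:Z = sid G u by move: r1 r2 su1; clear; move: (sid G u) (rk prec T m (pt j) (anp u)); clear; lia.
  by split => //; apply/eqP; rewrite -eqz_nat rj ru.
left; have su0 : sid G u = 0 by move: su su1; clear; lia.
by move: jB; rewrite su0 [(_ <= 0)%N]leqNgt rk_gt0 !andbF orbF in_nbhd => /andP[].
Qed.

Lemma anc_points_par a c : (1 < a <= n)%N -> (1 < c <= n)%N -> par G a = par G c -> anp a = anp c.
Proof.
move=> an cn ac; rewrite /anc_points; apply/fsetP => i; rewrite !in_fset /=.
have anc_sub b b' : (1 < b <= n)%N -> (1 < b' <= n)%N -> par G b = par G b' -> {subset anc b <= anc b'}.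
  move=> /andP[_ bn] /andP[_ bn'] bb l /(ancestorsP isG _ bn)[l0 [t lE]].
  by apply/(ancestorsP isG _ bn'); split => //; exists t; rewrite lE !iterSr bb.
by apply/mapP/mapP => -[l la ->]; exists l => //; [exact: (anc_sub a)|exact: (anc_sub c)].
Qed.

(** Labels are given depth first: a vertex that has a child is followed at once by one of its
    children. *)
Lemma next_child c : (1 < c <= n)%N -> par G (par G c).+1 = par G c.
Proof.
move=> cn; have p0 := par_gt0 isG cn; have pc : (par G c < c)%N.
  by apply: (par_lt isG); case/andP: cn => c1 ->; rewrite (ltnW c1).
set p := par G c in p0 pc *; have pn : (1 <= p < n)%N.
  by rewrite p0 (leq_trans pc)//; case/andP: cn.
case: isG => _ _ _ H _; rewrite H//; apply/eqP; rewrite eqn_leq; apply/andP; split.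
  by rewrite big_nat_cond; apply/bigmax_leqP_seq => l _ /andP[/andP[_]]; rewrite ltnS.
rewrite (big_rem p)/=; last by rewrite mem_index_iota p0 ltnS leqnn.
case: ifP => [_|/negP[]]; first exact: leq_maxl.
apply/hasP; exists c => //; rewrite mem_iota pc/=.
by case/andP: cn => _ cn; move: pc cn pn; clear; lia.
Qed.

Hypothesis pos : exists2 j, (1 <= j <= n)%N & 1 <= sid G j.

(* A vertex whose point is farthest from the points of its ancestors, among those
   with a positive identifier, can be chosen to follow its parent in the labeling:
   otherwise the next child of that parent has a larger identifier, hence a larger
   rank and a larger distance. *)
Lemma farthest_vertex : exists c, [/\ (1 < c <= n)%N, par G c = c.-1, 1 <= sid G c &
  forall j, (1 < j <= n)%N -> 1 <= sid G j ->
    (dist1 (pt j) (anp j) <= dist1 (pt c) (anp c))%N].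
Proof.
have [j0 j0n sj0] := pos.
have sid1 : sid G 1 = 0 by case: isG => _ _ [].
have j01 : (1 < j0)%N by case: j0 j0n sj0 => [|[|]]//; rewrite sid1.
pose cand := [seq j <- iota 2 n.-1 | 1 <= sid G j].
have candP j : j \in cand = (1 < j <= n)%N && (1 <= sid G j).
  by rewrite mem_filter mem_iota andbC; congr (_ && _); case/andP: j0n => _; move: j01; clear; lia.
have [c cc cmax] : exists2 c, c \in cand & forall j, j \in cand -> (dist1 (pt j) (anp j) <= dist1 (pt c) (anp c))%N.
  have : j0 \in cand by rewrite candP j01 sj0 andbT; case/andP: j0n.
  elim: cand {candP} (j0) => // a s IH b _; case: s IH => [|a' s] IH.
    by exists a; [rewrite mem_head|move=> j; rewrite inE => /eqP ->].
  have [c cs cm] := IH a' (mem_head _ _).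
  have [ac|ca] := leqP (dist1 (pt a) (anp a)) (dist1 (pt c) (anp c)).
    by exists c; [rewrite inE cs orbT|move=> j; rewrite inE => /orP[/eqP ->//|]; exact: cm].
  exists a; first by rewrite mem_head.
  by move=> j; rewrite inE => /orP[/eqP ->//|/cm/leq_trans]; apply; exact: ltnW.
move: cc; rewrite candP => /andP[cn sc].
have cm j : (1 < j <= n)%N -> 1 <= sid G j -> (dist1 (pt j) (anp j) <= dist1 (pt c) (anp c))%N.
  by move=> jn sj; apply: cmax; rewrite candP jn.
have [pc|pc] := eqVneq (par G c) c.-1; first by exists c.
set p := par G c in pc; have pp := next_child cn; rewrite -/p in pp.
have p0 : (0 < p)%N by exact: par_gt0.
have ltpc : (p < c)%N by apply: (par_lt isG); case/andP: cn => c1 ->; rewrite (ltnW c1).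
have ltp1c : (p.+1 < c)%N by move: pc ltpc; clear; lia.
have p1n : (1 < p.+1 <= n)%N by case/andP: cn => _ cn; move: p0 ltp1c cn; clear; lia.
have [sp1 s_lt] : 0 <= sid G p.+1 /\ sid G c < sid G p.+1.
  have nc : p.+1 != c by move: ltp1c; clear; lia.
  case: isG => _ _ [_ _ _ sib] _ order; have [sp _ snc] := sib _ _ p1n cn nc pp.
  split => //; rewrite lt_neqAle eq_sym snc/= leNgt; apply/negP => sp_lt.
  by have := order _ _ cn p1n (esym pp) sp_lt; move: ltp1c; clear; lia.
have sp : 1 <= sid G p.+1 by exact: le_trans (ltW s_lt).
exists p.+1; split => // j jn sj; apply: (leq_trans (cm j jn sj)).
have pcE : anp p.+1 = anp c by exact: anc_points_par.
have [cT cN rc] := positive_rank cn sc; have [pT pN rp] := positive_rank p1n sp.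
rewrite pcE in pN rp *; rewrite leqNgt; apply/negP => lt_d.
have := dist1_lt_rk pT pN lt_d; move: s_lt; rewrite -rp -rc; clear; lia.
Qed.

(** Positive identifiers are covered by [far], and identifier 0 puts the point within [m] of an
    ancestor. With identifier -1 the point is either within [m] of the ancestors of u(b), or no
    farther from them than the point of u(b), having the same rank. *)
Lemma covered l b : (m <= l)%N -> (forall j, (1 < j <= n)%N -> 1 <= sid G j ->
    (dist1 (pt j) (anp j) <= l)%N) -> (1 < b <= n)%N ->
  exists2 c, (0 < c < b)%N & (maxnorm (pt b - pt c)%R <= l)%N.
Proof.
move=> ml far bn; have [sb|sb] := boolP (0 <= sid G b).
  have [c cb dE] := anp_dist (pt b) bn; exists c; first exact: anc_lt cb.
  rewrite -dE; have [sb1|sb1] := boolP (1 <= sid G b); first exact: far.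
  by apply: leq_trans ml; apply: zero_near => //; move: sb sb1; clear; lia.
have sb1 : sid G b = -1 by have := sid_ge isG bn; move: sb; clear; lia.
have [ub u1 su] := uidxP isG bn sb1; have := anc_lt ub => /andP[_ ultb].
have un : (1 < uidx G b <= n)%N by rewrite u1; case/andP: bn => _; apply: leq_trans; exact: ltnW.
have [c cu dE] := anp_dist (pt b) un; exists c.
  have := anc_lt cu => /andP[-> cltu]; exact: ltn_trans ultb.
rewrite -dE; have [le_m|[su1 [rE bN]]] := neg_near bn sb1; first exact: leq_trans ml.
have b0n : (0 < b <= n)%N by case/andP: bn => /ltnW ->.
have [uT uN _] := positive_rank un su1.
apply: leq_trans (far _ un su1); rewrite leqNgt; apply/negP => lt_d.
by have := dist1_lt_rk uT uN lt_d; rewrite rE ltnn.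
Qed.

(** Along the chain [b] descends from [c], so D_b contains D_c, which includes the neighbourhood of
    the ancestors of [c] and all sites ranked before the point of [c]. Hence the point of [b] has at
    least that rank and at least that distance. *)
Lemma chain_separated c b : (1 < c <= n)%N -> 1 <= sid G c -> (c <= b <= n)%N ->
  (forall t, (c < t <= b)%N -> par G t = t.-1) -> forall a, a \in anc c ->
  (dist1 (pt c) (anp c) <= maxnorm (pt b - pt a)%R)%N.
Proof.
move=> cn sc /andP[cb bn] chain a ac; apply: leq_trans (dist_anp_le (pt b) ac).
move: cb; rewrite leq_eqVlt => /orP[/eqP <-//|cb].
have ancb : c \in anc b.
  elim: b bn cb chain => // b IH bn; rewrite ltnS leq_eqVlt => /orP[/eqP cb|cb] chain.
    subst b.
    have {1}<- : par G c.+1 = c by rewrite chain// leqnn.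
    by apply: (anc_par isG); case/andP: cn => /ltnW c1 _; rewrite bn ltnS c1.
  apply: (@anc_trans _ isG _ b) => //.
    have {1}<- : par G b.+1 = b by rewrite chain// leqnn ltnS ltnW.
    by apply: (anc_par isG); rewrite bn andbT ltnS; apply: leq_trans cb; case/andP: cn => /ltnW.
  apply: IH => //; first exact: ltnW.
  by move=> t /andP[ct tb]; apply: chain; rewrite ct ltnW.
have c1 : (1 < c)%N by case/andP: cn.
have b0n : (0 < b <= n)%N by rewrite bn (leq_trans _ cb).
have [_ bD bT] := admissibleP b0n.
have bDc : pt b \notin DD c by apply: contra bD; apply: (fsubsetP (DD_anc_sub bn ancb sc)).
have [cT cN rc] := positive_rank cn sc.
move: bDc; rewrite (DD_step c1) sc in_fsetU negb_or in_nbhd_s negb_or => /andP[/andP[bN]].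
rewrite bT bN/= -ltnNge => r1 _; rewrite leqNgt; apply/negP => lt_d.
have := dist1_lt_rk bT bN lt_d; move: r1 rc; clear.
move: (sid G c) (rk prec T m (pt b) _) (rk prec T m (pt c) _); clear; lia.
Qed.

End Tuple.
End Admissible.

Lemma predn_lt a b s t : (0 < a)%N -> (a <= t < b)%N -> (b <= s.+1)%N -> (t.-1 < s)%N.
Proof. lia. Qed.

(** * Expectations attached to genograms *)

Section GenogramExpectation.
Context (d : nat) (dO : measure_display) (Omega : measurableType dO)
  (R : realType) (P : probability Omega R) (X : lattice d -> {RV P >-> R})
  (T : {fset lattice d}) (k : nat) (r : \bar R) (K : R).
Hypotheses (hr : ((k + 2)%N%:R%:E <= r)%E) (K1 : 1 <= K)
  (Xmaj : forall i, i \in T -> majorant P r K (fun w => 1 + `|X i w|)).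
Notation KM := (moment_const k r K).
Notation KC := (cov_const k r K).
Notation alpha l := (alpha_mixing X T k.+1 l).

Section Chain.
Variable x : seq (lattice d).
Hypotheses (xT : {subset x <= T}) (xk : (size x <= k.+1)%N).
Notation Ys := [seq (X i : Omega -> R) | i <- x].
Notation pt t := (nth 0 x t.-1).

Definition points a b := [seq pt t | t <- index_iota a b].

Lemma points_cat a b c : (a <= b <= c)%N -> points a c = points a b ++ points b c.
Proof.
move=> /andP[ab bc]; rewrite -map_cat; congr map.
by rewrite /index_iota -{2}(subnKC ab) -iotaD; congr iota; move: ab bc; clear; lia.
Qed.

Lemma points_sub a b : (0 < a)%N -> (b <= (size x).+1)%N -> {subset points a b <= T}.
Proof.
move=> a0 bx i /mapP[t]; rewrite mem_index_iota => tab ->; apply: xT; apply: mem_nth.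
exact: predn_lt a0 tab bx.
Qed.

Lemma size_points a b : size (points a b) = (b - a)%N.
Proof. by rewrite size_map size_iota. Qed.

Lemma blockE a b w : (0 < a)%N -> (b <= (size x).+1)%N ->
  block Ys a b w = \prod_(t <- index_iota a b) X (pt t) w.
Proof.
move=> a0 bx; rewrite /block big_seq_cond [RHS]big_seq_cond; apply: eq_bigr => t.
rewrite andbT mem_index_iota => tab.
by rewrite (nth_map 0)//; exact: predn_lt a0 tab bx.
Qed.

Lemma block_le a b w : (0 < a)%N -> (b <= (size x).+1)%N ->
  `|block Ys a b w| <= prodX X (points a b) w.
Proof.
move=> a0 bx; rewrite blockE// normr_prod /prodX big_map; apply: ler_prod => t _.
by rewrite normr_ge0/= lerDr.
Qed.

Lemma block_measurable a b : (0 < a)%N -> (b <= (size x).+1)%N ->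
  field_measurable X (points a b) (block Ys a b).
Proof.
move=> a0 bx; rewrite (_ : block Ys a b = fun w => \prod_(t <- index_iota a b) X (pt t) w); last first.
  by apply/funext => w; exact: blockE.
rewrite /points; elim: (index_iota a b) => [|t s IH].
  rewrite (_ : (fun w => _) = fun=> 1); first exact: field_measurable_cst.
  by apply/funext => w; rewrite big_nil.
rewrite (_ : (fun w => _) = fun w => X (pt t) w * \prod_(t <- s) X (pt t) w); last first.
  by apply/funext => w; rewrite big_cons.
apply: field_measurableM.
  by apply: field_measurable_X; rewrite mem_head.
by apply: field_measurable_sub IH => i si; rewrite inE si orbT.
Qed.

Variable e : nat.
Hypothesis ex : (e <= (size x).+1)%N.

(** The operator D for the blocks with starting points c0 :: cs and excluded end [e]; cut points are
    more convenient for induction than the zipped list of blocks. *)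
Definition chain_op c0 cs := Dop P (block Ys c0 (head e cs))
  [seq block Ys ab.1 ab.2 | ab <- zip cs (rcons (behead cs) e)].

Lemma chain_op_cons c0 c1 cs : chain_op c0 (c1 :: cs) =
  fun w => block Ys c0 c1 w * chain_op c1 cs w - Ex P (fun w => block Ys c0 c1 w * chain_op c1 cs w).
Proof. by case: cs. Qed.

Let KM0 : 0 <= KM. Proof. exact: (le_trans ler01 (moment_const_ge1 hr K1)). Qed.

Lemma path_leq_last c0 cs : path leq c0 (rcons cs e) -> (c0 <= e)%N.
Proof. by elim: cs c0 => [|c1 cs IH] c0 /=; [rewrite andbT|move=> /andP[c01 /IH]; exact: leq_trans]. Qed.

Lemma product_mean_le a b c Y V y v : (0 < a)%N -> (a <= b <= c)%N -> (c <= (size x).+1)%N ->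
  0 <= y -> 0 <= v ->
  field_measurable X (points a b) Y -> field_measurable X (points b c) V ->
  (forall w, `|Y w| <= y * prodX X (points a b) w) ->
  (forall w, `|V w| <= v * prodX X (points b c) w) ->
  [/\ integrableR P (fun w => Y w * V w), `|Ex P (fun w => Y w * V w)| <= y * v * KM,
   forall w, `|Y w * V w| <= y * v * prodX X (points a c) w &
   field_measurable X (points a c) (fun w => Y w * V w)].
Proof.
move=> a0 abc cx y0 v0 mY mV Yb Vb.
have YVb w : `|Y w * V w| <= y * v * prodX X (points a c) w.
  by rewrite normrM (points_cat abc) prodX_cat mulrACA; apply: ler_pM.
have mYV : field_measurable X (points a c) (fun w => Y w * V w).
  rewrite (points_cat abc); apply: field_measurableM.
    by apply: field_measurable_sub mY => i si; rewrite mem_cat si.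
  by apply: field_measurable_sub mV => i si; rewrite mem_cat si orbT.
have sk : (size (points a c) <= k.+2)%N.
  by rewrite size_points (leq_trans (leq_subr _ _))// (leq_trans cx)// ltnS.
by have [] := Ex_prodX_le hr K1 Xmaj (points_sub a0 cx) sk (mulr_ge0 y0 v0) (field_measurable_measR mYV) YVb.
Qed.

(** Each centering costs a factor 1 + [KM]; the outermost one makes the mean vanish. *)
Lemma chain_op_props c0 cs : (0 < c0)%N -> path leq c0 (rcons cs e) ->
  [/\ field_measurable X (points c0 e) (chain_op c0 cs),
    forall w, `|chain_op c0 cs w| <= (1 + KM) ^+ (size cs).+1 * prodX X (points c0 e) w &
    Ex P (chain_op c0 cs) = 0].
Proof.
elim: cs c0 => [|c1 cs IH] c0 c00 pth.
  have c0e := path_leq_last pth.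
  have mY := block_measurable c00 ex.
  have Yb w : `|block Ys c0 e w| <= 1 * prodX X (points c0 e) w by rewrite mul1r; exact: block_le.
  have sk : (size (points c0 e) <= k.+2)%N by rewrite size_points (leq_trans (leq_subr _ _))// (leq_trans ex)// ltnS.
  have [iY EY] := Ex_prodX_le hr K1 Xmaj (points_sub c00 ex) sk ler01 (field_measurable_measR mY) Yb.
  rewrite /chain_op /=; split.
  - by apply: field_measurableB => //; exact: field_measurable_cst.
  - move=> w; rewrite expr1 mulrDl; apply: (le_trans (ler_normB _ _)); apply: lerD => //.
    by rewrite mul1r in EY; apply: (le_trans EY); rewrite ler_peMr// prodX_ge1.
  - by rewrite ExB ?Ex_cst ?subrr//; exact: integrableR_cst.
have /andP[c01 pth1] : (c0 <= c1)%N && path leq c1 (rcons cs e) by [].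
have c1e := path_leq_last pth1.
have c10 : (0 < c1)%N by exact: leq_trans c01.
have [mR Rb R0] := IH c1 c10 pth1.
have c1x : (c1 <= (size x).+1)%N by exact: leq_trans ex.
have pe0 : 0 <= (1 + KM) ^+ (size cs).+1 by rewrite exprn_ge0// addr_ge0.
have Yb w : `|block Ys c0 c1 w| <= 1 * prodX X (points c0 c1) w by rewrite mul1r; exact: block_le.
have c01e : (c0 <= c1 <= e)%N by rewrite c01.
have [iZ EZ Zb mZ] := product_mean_le c00 c01e ex ler01 pe0 (block_measurable c00 c1x) mR Yb Rb.
rewrite chain_op_cons; split.
- by apply: field_measurableB => //; exact: field_measurable_cst.
- move=> w; rewrite mul1r in EZ Zb; apply: (le_trans (ler_normB _ _)).
  rewrite [leRHS](_ : _ = (1 + KM) ^+ (size cs).+1 * prodX X (points c0 e) w +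
     (1 + KM) ^+ (size cs).+1 * KM * prodX X (points c0 e) w); last by rewrite [_ ^+ (size _).+1]exprS /=; ring.
  apply: lerD => //; apply: (le_trans EZ); rewrite ler_peMr ?prodX_ge1// mulr_ge0//.
- by rewrite ExB ?Ex_cst ?subrr//; exact: integrableR_cst.
Qed.

Variables (lo c l : nat).
Hypotheses (lo0 : (0 < lo)%N) (sep : forall t t', (lo <= t < c)%N -> (c <= t' < e)%N ->
  (l <= maxnorm (pt t - pt t')%R)%N).
Notation w l := (alpha l `^ rexp r k.+1%:R).

(** Induction on the cuts before [c]. Expanding the outermost centering gives two expectations, one
    with the next block absorbed into [V], one with that block alone; both still have the cut [c].
    At [c] the operator is centered, so the expectation is a covariance between the points before
    and after [c]. The left end [a] varies because [V] grows in this way. *)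
Lemma chain_op_separated c0 cs a V v : (lo <= a < c0)%N -> path ltn c0 (rcons cs e) -> c \in c0 :: cs ->
  field_measurable X (points a c0) V -> 0 <= v ->
  (forall w, `|V w| <= v * prodX X (points a c0) w) ->
  `|Ex P (fun w => V w * chain_op c0 cs w)| <= v * ((1 + KM) ^+ (size cs).+1 * (KC * w l)).
Proof.
have path_leq b s : path ltn b s -> path leq b s by apply: sub_path => ? ?; exact: ltnW.
have KM1 := moment_const_ge1 hr K1.
have KCw0 : 0 <= KC * w l by rewrite mulr_ge0 ?powR_ge0// (cov_const_ge0 hr K1).
have pe0 q : 0 <= (1 + KM) ^+ q by rewrite exprn_ge0// addr_ge0.
have at_c : forall a c0 cs V v, c0 = c -> (lo <= a < c0)%N -> path ltn c0 (rcons cs e) ->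
    field_measurable X (points a c0) V -> 0 <= v -> (forall w, `|V w| <= v * prodX X (points a c0) w) ->
    `|Ex P (fun w => V w * chain_op c0 cs w)| <= v * ((1 + KM) ^+ (size cs).+1 * (KC * w l)).
  move=> {}a {}c0 {}cs {}V {}v c0c /andP[loa ac0] pth mV v0 Vb; rewrite c0c in ac0 pth mV Vb *.
  have c00 : (0 < c)%N by exact: leq_ltn_trans ac0.
  have a0 : (0 < a)%N by exact: leq_trans loa.
  have [mR Rb R0] := chain_op_props c00 (path_leq _ _ pth).
  have ce : (c < e)%N.
    move: pth; case: (cs) => [|c1 cs'] /=; first by rewrite andbT.
    by move=> /andP[cc1 /path_leq/path_leq_last]; exact: leq_trans.
  have -> : Ex P (fun w => V w * chain_op c cs w) = cov P V (chain_op c cs).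
    by rewrite /cov R0 mulr0 subr0.
  rewrite [leRHS]mulrA; apply: (cov_prodX hr K1 Xmaj (l := l) (J1 := points a c) (J2 := points c e) (s := points c e)) => //.
  - by rewrite size_points subn_gt0.
  - by rewrite !size_points; move: (size x) ac0 ce ex xk a0; clear; lia.
  - by rewrite size_points subn_gt0.
  - by apply: points_sub => //; rewrite (leq_trans (ltnW ce)).
  - exact: points_sub.
  - exact: points_sub.
  - move=> i j /mapP[t]; rewrite mem_index_iota => /andP[ta tc] -> /mapP[t'].
    rewrite mem_index_iota => tce ->; apply: sep => //; by rewrite tc (leq_trans loa).
elim: cs c0 a V v => [|c1 cs IH] c0 a V v loac0 pth cin mV v0 Vb.
  have c0c : c0 = c by move: cin; rewrite inE => /eqP.
  exact: (at_c _ _ [::] _ _ c0c loac0 pth mV v0 Vb).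
have [c0c|c0c] := eqVneq c0 c; first exact: (at_c _ _ (c1 :: cs) _ _ c0c loac0 pth mV v0 Vb).
have {}cin : c \in c1 :: cs by move: cin; rewrite inE eq_sym (negbTE c0c).
have /andP[loa ac0] := loac0.
have c00 : (0 < c0)%N by exact: leq_ltn_trans ac0.
have a0 : (0 < a)%N by exact: leq_trans loa.
have /andP[c01 pth1] : (c0 < c1)%N && path ltn c1 (rcons cs e) by [].
have c1e := path_leq_last (path_leq _ _ pth1).
have c10 : (0 < c1)%N by exact: leq_trans c01.
have c1x : (c1 <= (size x).+1)%N by exact: leq_trans ex.
have [mR Rb R0] := chain_op_props c10 (path_leq _ _ pth1).
have Zb w : `|block Ys c0 c1 w| <= 1 * prodX X (points c0 c1) w by rewrite mul1r; exact: block_le.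
have mZ := block_measurable c00 c1x.
have ac01 : (a <= c0 <= c1)%N by rewrite (ltnW ac0) (ltnW c01).
have c01e : (c0 <= c1 <= e)%N by rewrite (ltnW c01).
have ac1e : (a <= c1 <= e)%N by rewrite (ltnW (ltn_trans ac0 c01)).
have [_ _ VZb mVZ] := product_mean_le a0 ac01 c1x v0 ler01 mV mZ Vb Zb.
have [iVZR _ _ _] := product_mean_le a0 ac1e ex (mulr_ge0 v0 ler01) (pe0 (size cs).+1) mVZ mR VZb Rb.
have [iZR _ _ _] := product_mean_le c00 c01e ex ler01 (pe0 (size cs).+1) mZ mR Zb Rb.
have c0x : (c0 <= (size x).+1)%N by exact: leq_trans (ltnW c01) c1x.
have sk : (size (points a c0) <= k.+2)%N by rewrite size_points (leq_trans (leq_subr _ _))// (leq_trans c0x)// ltnS.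
have [iV EV] := Ex_prodX_le hr K1 Xmaj (points_sub a0 c0x) sk v0 (field_measurable_measR mV) Vb.
rewrite chain_op_cons; set z := Ex P (fun w => block Ys c0 c1 w * chain_op c1 cs w).
have -> : Ex P (fun w => V w * (block Ys c0 c1 w * chain_op c1 cs w - z)) =
    Ex P (fun w => V w * block Ys c0 c1 w * chain_op c1 cs w) - z * Ex P V.
  rewrite -ExZ// -ExB//; last exact: integrableRZ.
  by apply: eq_Ex => w; ring.
have H1 := IH c1 a _ (v * 1) _ pth1 cin mVZ (mulr_ge0 v0 ler01) VZb.
have H2 := IH c1 c0 _ 1 _ pth1 cin mZ ler01 Zb.
apply: (le_trans (ler_normB _ _)); rewrite normrM.
apply: (@le_trans _ _ (v * 1 * ((1 + KM) ^+ (size cs).+1 * (KC * w l)) +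
    (1 * ((1 + KM) ^+ (size cs).+1 * (KC * w l))) * (v * KM))).
  apply: lerD; first by apply: H1; rewrite loa (ltn_trans ac0).
  by apply: ler_pM => //; apply: H2; rewrite c01 (leq_trans loa)// ltnW.
rewrite [(size (_ :: _)).+1]/= [leRHS](_ : _ = v * ((1 + KM) * (1 + KM) ^+ (size cs).+1 * (KC * w l))); last by rewrite -exprS.
by rewrite le_eqVlt; apply/orP; left; apply/eqP; ring.
Qed.

End Chain.

Lemma q0_gt0 G : (0 < q0 G)%N. Proof. by rewrite /q0 leq_max. Qed.

Lemma q0_le G : (0 < size G)%N -> (q0 G <= size G)%N.
Proof.
move=> G0; rewrite /q0 geq_max G0/= big_nat_cond; apply/bigmax_leqP_seq => j _ /andP[/andP[_]].
by rewrite ltnS.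
Qed.

Lemma q0_chain G t : (q0 G < t <= size G)%N -> par G t = t.-1.
Proof.
move=> /andP[qt tG]; have t2 := leq_ltn_trans (q0_gt0 G) qt.
apply/eqP; apply: contraLR qt => pt; rewrite -leqNgt.
rewrite /q0 leq_max; apply/orP; right.
by rewrite (big_rem t) ?mem_index_iota ?t2//= pt leq_maxl.
Qed.

Lemma q0_break G : q0 G != 1%N -> par G (q0 G) != (q0 G).-1.
Proof.
rewrite /q0; have [->//|[_ h]] := bigmaxn_attained (index_iota 2 (size G).+1) (fun j => par G j != j.-1).
by rewrite /maxn; case: ifP.
Qed.

Lemma qs_path G : (0 < size G)%N -> path ltn (q0 G) (rcons (qs G) (size G).+1).
Proof.
move=> G0; have qG := q0_le G0.
apply: (@subseq_path _ _ (fun y x z => @ltn_trans y x z) _ _ (rcons (iota (q0 G).+1 (size G - q0 G)) (size G).+1)).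
  by rewrite -!cats1 cat_subseq// filter_subseq.
have := iota_ltn_sorted (q0 G) (size G - q0 G).+2.
rewrite -[_.+2]addn1 iotaD /= cats1.
by rewrite (_ : (q0 G + (size G - q0 G).+1 = (size G).+1)%N)// addnS subnKC.
Qed.

Lemma Dstar_lastE G (x : seq (lattice d)) : Dstar_last P G [seq (X i : Omega -> R) | i <- x] =
  if qs G is c1 :: cs then Ex P (fun w => block [seq (X i : Omega -> R) | i <- x] (q0 G) c1 w *
      chain_op x (size G).+1 c1 cs w)
  else Ex P (block [seq (X i : Omega -> R) | i <- x] (q0 G) (size G).+1).
Proof. by rewrite /Dstar_last; case: (qs G) => //= c1 [|c2 cs]. Qed.

Definition genogram_const : R := (1 + KM) ^+ k.+2 * (1 + KC).

Let KM1 : 1 <= KM. Proof. exact: (moment_const_ge1 hr K1). Qed.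
Let KC0 : 0 <= KC. Proof. exact: (cov_const_ge0 hr K1). Qed.

Lemma genogram_const_ge1 : 1 <= genogram_const.
Proof.
rewrite -[leLHS]mulr1; apply: ler_pM => //; last by rewrite lerDl.
by rewrite exprn_ege1// lerDl (le_trans _ KM1).
Qed.

Section Bounds.
Variables (G : genodata) (x : seq (lattice d)).
Hypotheses (xT : {subset x <= T}) (xk : (size x <= k.+1)%N) (Gx : size G = size x)
  (G0 : (0 < size G)%N).
Notation Ys := [seq (X i : Omega -> R) | i <- x].
Notation pt t := (nth 0 x t.-1).

Let ex : ((size G).+1 <= (size x).+1)%N. Proof. by rewrite Gx. Qed.

Let qs_size : (size (qs G) <= k.+1)%N.
Proof.
rewrite (leq_trans (size_subseq (filter_subseq _ _)))// size_iota (leq_trans (leq_subr _ _))//.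
by rewrite Gx.
Qed.

Let path_leq b s : path ltn b s -> path leq b s.
Proof. by apply: sub_path => ? ?; exact: ltnW. Qed.

Lemma Dstar_last_le : `|Dstar_last P G Ys| <= genogram_const.
Proof.
have pth := qs_path G0; have q00 := q0_gt0 G; have KM0 := le_trans ler01 KM1.
have pow_le c : c * KM <= (1 + KM) ^+ k.+2 -> c * KM <= genogram_const.
  by move=> /le_trans; apply; rewrite ler_peMr ?lerDl// exprn_ge0// addr_ge0.
rewrite Dstar_lastE; have := qs_size; case: (qs G) pth => [|c1 cs] pth qk.
  have Yb w : `|block Ys (q0 G) (size G).+1 w| <= 1 * prodX X (points x (q0 G) (size G).+1) w.
    by rewrite mul1r; exact: block_le.
  have sk : (size (points x (q0 G) (size G).+1) <= k.+2)%N.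
    by rewrite size_points (leq_trans (leq_subr _ _))// Gx.
  have [_ EY] := Ex_prodX_le hr K1 Xmaj (points_sub xT q00 ex) sk ler01
    (field_measurable_measR (block_measurable q00 ex)) Yb.
  apply: (le_trans EY); apply: pow_le; rewrite mul1r exprS; apply: (@le_trans _ _ (1 + KM)).
    by rewrite lerDr.
  by rewrite ler_peMr ?exprn_ege1 ?addr_ge0// lerDl.
have /andP[c01 pth1] : (q0 G < c1)%N && path ltn c1 (rcons cs (size G).+1) by [].
have c1e := path_leq_last (path_leq pth1).
have c10 : (0 < c1)%N by exact: leq_trans c01.
have [mR Rb R0] := chain_op_props xT xk ex c10 (path_leq pth1).
have c1x : (c1 <= (size x).+1)%N by exact: leq_trans ex.
have Zb w : `|block Ys (q0 G) c1 w| <= 1 * prodX X (points x (q0 G) c1) w by rewrite mul1r; exact: block_le.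
have c01e : (q0 G <= c1 <= (size G).+1)%N by rewrite (ltnW c01).
have pe0 : 0 <= (1 + KM) ^+ (size cs).+1 by rewrite exprn_ge0// addr_ge0.
have [_ EZ _ _] := product_mean_le xT xk q00 c01e ex ler01 pe0 (block_measurable q00 c1x) mR Zb Rb.
apply: (le_trans EZ); apply: pow_le; rewrite mul1r [leRHS]exprSr; apply: ler_pM => //; last by rewrite lerDr.
by rewrite ler_weXn2l ?lerDl.
Qed.

Lemma Dstar_last_separated c l : (q0 G < c <= size G)%N -> 0 <= sid G c ->
  (forall t t', (q0 G <= t < c)%N -> (c <= t' < (size G).+1)%N ->
    (l <= maxnorm (pt t - pt t')%R)%N) ->
  `|Dstar_last P G Ys| <= genogram_const * alpha l `^ rexp r k.+1%:R.
Proof.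
move=> qc sc sep; have q00 := q0_gt0 G; have KM0 := le_trans ler01 KM1.
have cin : c \in qs G.
  rewrite mem_filter sc mem_iota; case/andP: qc => -> cG/=.
  by rewrite addSn subnKC// q0_le.
rewrite Dstar_lastE; have := qs_path G0; have := qs_size; case: (qs G) cin => // c1 cs cin qk pth.
have /andP[c01 pth1] : (q0 G < c1)%N && path ltn c1 (rcons cs (size G).+1) by [].
have c1e := path_leq_last (path_leq pth1).
have c1x : (c1 <= (size x).+1)%N by exact: leq_trans ex.
have Zb w : `|block Ys (q0 G) c1 w| <= 1 * prodX X (points x (q0 G) c1) w by rewrite mul1r; exact: block_le.
have loc1 : (q0 G <= q0 G < c1)%N by rewrite leqnn.
apply: (le_trans (chain_op_separated xT xk ex q00 sep loc1 pth1 cin (block_measurable q00 c1x) ler01 Zb)).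
rewrite mul1r mulrA ler_wpM2r ?powR_ge0//; apply: ler_pM => //.
- by apply: exprn_ge0; exact: addr_ge0.
- by rewrite ler_weXn2l ?lerDl// ltnW.
- by rewrite lerDr.
Qed.

End Bounds.

Lemma take_facts G (x : seq (lattice d)) : size G = size x -> {subset x <= T} -> (size x <= k.+1)%N ->
  (0 < size G)%N -> q0 G != 1%N ->
  [/\ size (take (q0 G).-1 G) = size (take (q0 G).-1 x), {subset take (q0 G).-1 x <= T},
     (size (take (q0 G).-1 x) <= k.+1)%N, size (take (q0 G).-1 G) = (q0 G).-1 &
     (0 < size (take (q0 G).-1 G) < size G)%N ].
Proof.
move=> Gx xT xk G0 q1; have qG := q0_le G0; have q00 := q0_gt0 G.
have qlt : ((q0 G).-1 < size G)%N by move: qG q00; clear; lia.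
split.
- by rewrite !size_take_min Gx.
- by move=> i /mem_take/xT.
- by rewrite (leq_trans _ xk)// size_take_min geq_minr.
- by rewrite size_takel// ltnW.
- by rewrite size_takel ?(ltnW qlt)// qlt andbT; move: q00 q1; case: (q0 G) => [|[]].
Qed.

Lemma EGrec_le f G x : size G = size x -> {subset x <= T} -> (size x <= k.+1)%N -> (0 < size G)%N ->
  `|EGrec P f G [seq (X i : Omega -> R) | i <- x]| <= genogram_const ^+ f.
Proof.
have C1 := genogram_const_ge1.
elim: f G x => [|f IH] G x Gx xT xk G0; first by rewrite /= normr1.
rewrite /=; case: ifP => [_|/negbT q1].
  by rewrite exprS -[leLHS]mulr1; apply: ler_pM => //; [exact: Dstar_last_le|exact: exprn_ege1].
have [h1 h2 h3 _ /andP[h4 _]] := take_facts Gx xT xk G0 q1.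
rewrite normrM exprSr -map_take; apply: ler_pM => //; first exact: IH.
exact: Dstar_last_le.
Qed.

(** [EGrec] is a product with one factor for each chain of the labeling. As [c] follows its parent,
    it does not start a chain, so it is a cut inside one; that factor is small and the others are
    bounded. The conditions on [t] and [t'] confine the separation to the chain of [c]. *)
Lemma EGrec_separated f G x c l : (size G <= f)%N -> size G = size x -> {subset x <= T} ->
  (size x <= k.+1)%N -> (1 < c <= size G)%N -> par G c = c.-1 -> 0 <= sid G c ->
  (forall t t', (0 < t < c)%N -> (forall s, (t < s <= c)%N -> par G s = s.-1) ->
     (c <= t' <= size G)%N -> (forall s, (c < s <= t')%N -> par G s = s.-1) ->
     (l <= maxnorm (nth 0%R x t.-1 - nth 0%R x t'.-1)%R)%N) ->
  `|EGrec P f G [seq (X i : Omega -> R) | i <- x]| <= genogram_const ^+ f * alpha l `^ rexp r k.+1%:R.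
Proof.
have C1 := genogram_const_ge1.
elim: f G x => [|f IH] G x Gf Gx xT xk cG pc sc sep; first by move: Gf cG; clear; lia.
have G0 : (0 < size G)%N by case/andP: cG => c1; apply: leq_trans; exact: ltnW.
have qc : q0 G != c \/ q0 G = 1%N.
  have [q1|q1] := eqVneq (q0 G) 1%N; [by right|left].
  by apply: contra_neq (q0_break q1) => ->.
have [qltc|cq] := ltnP (q0 G) c.
  have cG' : (q0 G < c <= size G)%N by rewrite qltc; case/andP: cG.
  have D := Dstar_last_separated (l := l) xT xk Gx G0 cG' sc.
  have {}D : `|Dstar_last P G [seq (X i : Omega -> R) | i <- x]| <= genogram_const * alpha l `^ rexp r k.+1%:R.
    apply: D => t t' /andP[qt tc] /andP[ct tG]; apply: sep.
    - by rewrite tc (leq_trans (q0_gt0 G)).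
    - move=> s /andP[ts sc']; apply: q0_chain; rewrite (leq_ltn_trans qt ts).
      by apply: leq_trans sc' _; case/andP: cG.
    - by rewrite ct -ltnS.
    - move=> s /andP[cs st]; apply: q0_chain; rewrite (ltn_trans qltc cs) (leq_trans st)//.
  rewrite /=; case: ifP => [_|/negbT q1].
    apply: (le_trans D); rewrite ler_wpM2r ?powR_ge0// exprS ler_peMr ?(le_trans ler01)//.
    exact: exprn_ege1.
  have [h1 h2 h3 _ /andP[h4 _]] := take_facts Gx xT xk G0 q1.
  rewrite normrM exprSr -mulrA -map_take; apply: ler_pM => //; exact: EGrec_le.
have q1 : q0 G != 1%N by apply: contraTneq cq => ->; rewrite -ltnNge; case/andP: cG.
have {}cq : (c < q0 G)%N.
  by rewrite ltn_neqAle cq andbT eq_sym; case: qc => // q1'; rewrite q1' in q1.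
have [h1 h2 h3 h4 /andP[h5 h6]] := take_facts Gx xT xk G0 q1.
have nthG s : (s < q0 G)%N -> nth (0%N, 0 : int) (take (q0 G).-1 G) s.-1 = nth (0%N, 0) G s.-1.
  have [->|s0] := posnP s; first by move=> _; apply: nth_take; move: cq cG; clear; lia.
  by move=> sq; apply: nth_take; move: s0 sq; clear; lia.
rewrite /= (negbTE q1) normrM exprSr -map_take mulrAC.
apply: ler_pM => //; last exact: Dstar_last_le.
apply: IH => //.
- by rewrite -ltnS; exact: leq_trans h6 Gf.
- by rewrite h4; case/andP: cG => ->; move: cq; clear; lia.
- by rewrite /par nthG.
- by rewrite /sid nthG.
move=> t t' tc Ht; rewrite h4 => /andP[ct t'q] Ht'.
have t'q0 : (t' < q0 G)%N by move: t'q (q0_gt0 G); clear; lia.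
rewrite !nth_take; [|move: ct t'q cG; clear; lia|move: tc cq; clear; lia].
apply: sep => //.
- move=> s /andP[ts sc']; have := Ht s; rewrite ts sc' /par nthG; first by apply.
  exact: leq_ltn_trans sc' cq.
- by rewrite ct (leq_trans (ltnW t'q0))// q0_le.
- move=> s /andP[cs st]; have := Ht' s; rewrite cs st /par nthG; first by apply.
  exact: leq_ltn_trans st t'q0.
Qed.

End GenogramExpectation.

(** * The modified cumulant *)

Section TupleSums.
Context (d : nat) (R : realType) (T : {fset lattice d}).
Implicit Types (F : seq (lattice d) -> R) (p w : seq (lattice d)).

Fixpoint tuple_sum n F : R :=
  if n is n'.+1 then \sum_(i <- T) tuple_sum n' (fun w => F (i :: w)) else F [::].

Lemma tuple_sum_le n F F' : (forall w, size w = n -> {subset w <= T} -> F w <= F' w) ->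
  tuple_sum n F <= tuple_sum n F'.
Proof.
elim: n F F' => [|n IH] F F' FF' /=; first exact: FF'.
rewrite big_seq [leRHS]big_seq; apply: ler_sum => i iT; apply: IH => w wn wT.
apply: FF' => [|j]; first by rewrite /= wn.
by rewrite inE => /orP[/eqP ->|/wT].
Qed.

Lemma eq_tuple_sum n F F' : F =1 F' -> tuple_sum n F = tuple_sum n F'.
Proof. by move=> /funext ->. Qed.

Lemma tuple_sum_sum n (I : Type) (s : seq I) (F : I -> seq (lattice d) -> R) :
  tuple_sum n (fun w => \sum_(h <- s) F h w) = \sum_(h <- s) tuple_sum n (F h).
Proof.
elim: n F => [|n IH] F //=; rewrite exchange_big/=; apply: eq_bigr => i _; exact: IH.
Qed.

Lemma tuple_sumZ n c F : tuple_sum n (fun w => c * F w) = c * tuple_sum n F.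
Proof. by elim: n F => [|n IH] F //=; rewrite mulr_sumr; apply: eq_bigr => i _; exact: IH. Qed.

Lemma tuple_sum_cst n c : tuple_sum n (fun=> c) = #|` T|%:R ^+ n * c.
Proof.
elim: n => [|n IH] /=; first by rewrite mul1r.
by rewrite IH big_const_seq count_predT iter_addr_0 exprS -[LHS]mulr_natl mulrA.
Qed.

(* [Q p i] is the condition on an entry [i] given the list [p] of the preceding ones. *)
Fixpoint check (Q : seq (lattice d) -> pred (lattice d)) p w : bool :=
  if w is i :: w' then Q p i && check Q (rcons p i) w' else true.

Lemma checkE Q p w :
  check Q p w = all (fun b => Q (p ++ take b w) (nth 0 w b)) (iota 0 (size w)).
Proof.
elim: w p => [|i w IH] p //=; rewrite cats0 IH; congr (_ && _).
have -> : iota 1 (size w) = map (addn 1) (iota 0 (size w)) by rewrite -iotaDl.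
rewrite all_map; apply: eq_all => b /=.
by rewrite cat_rcons.
Qed.

Lemma tuple_sum_check n0 Q (M : nat -> nat) p n :
  (forall q, (size q < n0)%N -> (count (Q q) T <= M (size q))%N) -> (size p + n <= n0)%N ->
  tuple_sum n (fun w => (check Q p w)%:R) <= (\prod_(b < n) M (size p + b))%:R.
Proof.
move=> HQ; elim: n p => [|n IH] p pn /=; first by rewrite big_ord0.
have lt_p : (size p < n0)%N by move: pn; clear; lia.
rewrite big_ord_recl addn0 natrM.
apply: (@le_trans _ _ (\sum_(i <- T) (Q p i)%:R * (\prod_(b < n) M (size p + b.+1)%N)%:R)).
  apply: ler_sum => i _; case: (Q p i).
    rewrite mul1r; have := IH (rcons p i); rewrite size_rcons addSnnS => /(_ pn)/le_trans; apply.
    by rewrite ler_nat; under eq_bigr do rewrite addSnnS.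
  by rewrite mul0r tuple_sum_cst mulr0.
rewrite -mulr_suml ler_wpM2r// -natr_sum ler_nat.
apply: leq_trans (HQ p lt_p); rewrite -sum1_count [leqRHS]big_mkcond/=.
by apply: leq_sum => i _; case: (Q p i).
Qed.

Lemma sum_fsub (S : {fset lattice d}) (g : lattice d -> R) : (S `<=` T)%fset ->
  \sum_(i <- S) g i = \sum_(i <- T) (i \in S)%:R * g i.
Proof.
move=> ST; rewrite (perm_big (seq.filter (mem S) T))/=; last first.
  apply: uniq_perm; [exact: fset_uniq|exact: filter_uniq (fset_uniq _)|].
  by move=> i; rewrite mem_filter; apply/idP/andP => [iS|[]//]; split=> //; exact: (fsubsetP ST).
rewrite big_filter big_mkcond; apply: eq_bigr => i _; rewrite /=.
by case: (i \in S); rewrite ?mul1r ?mul0r.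
Qed.

End TupleSums.

(** * Tuples with a distinguished pair at a given distance *)

Section PairCounting.
Context (d : nat) (T : {fset lattice d}) (d0 : (0 < d)%N).
Implicit Types (p w : seq (lattice d)).

Definition clustered (l : nat) w := all (fun b => seq_dist (nth 0%R w b) (take b w) <= l)%N (iota 1 (size w).-1).

(** The first entry has N choices, entry [j] lies on the sphere of radius [l] around entry [a], and
    each of the k-1 others is within [l] of an earlier one: the exponent is (d-1) + d(k-1) =
    dk-1. *)
Lemma count_close_pair (R : realType) k l (a j : nat) : (0 < l)%N -> (a < j <= k)%N ->
  tuple_sum (R := R) T k.+1 (fun w => ((maxnorm (nth 0 w a - nth 0 w j)%R == l) && clustered l w)%:R) <=
  #|` T|%:R * ((2 * d * 3 ^ d.-1) * (k.+1 * 3 ^ d) ^ k.-1)%N%:R * l%:R ^+ (d * k - 1).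
Proof.
move=> l0 /andP[aj jk].
pose Q p i := if size p == 0%N then true else if size p == j then maxnorm (nth 0 p a - i) == l
  else (seq_dist i p <= l)%N.
pose M b := if b == 0%N then #|` T| else if b == j then (2 * d * 3 ^ d.-1 * l ^ d.-1)%N
  else (k.+1 * 3 ^ d * l ^ d)%N.
have HQ q : (size q < k.+1)%N -> (count (Q q) T <= M (size q))%N.
  move=> qk; rewrite /Q /M; case: ifP => q0; first by rewrite count_predT.
  case: ifP => qj.
    rewrite (eq_count (a2 := fun i => maxnorm (i - nth 0%R q a)%R == l)); last first.
      by move=> i; rewrite maxnorm_sym.
    apply: (leq_trans (count_sphere _ l0 (fset_uniq T))).
    by rewrite -!mulnA !leq_mul2l triple_exp ?orbT.
  apply: (leq_trans (count_seq_dist_le _ _ (fset_uniq T))).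
    by rewrite lt0n q0.
  by rewrite -mulnA leq_mul ?triple_exp// ltnW.
have H := @tuple_sum_check d R T k.+1 Q M [::] k.+1 HQ (leqnn _).
apply: (le_trans (tuple_sum_le (F' := fun w => (check Q [::] w)%:R) _)).
  move=> w wk wT; case: eqP => //= wl; case: (boolP (clustered l w)) => // /allP cl.
  suff -> : check Q [::] w by [].
  rewrite checkE; apply/allP => b; rewrite mem_iota add0n => /andP[_ bw].
  rewrite /Q cat0s size_takel ?(ltnW bw)//; case: eqP => // b0; case: eqP => bj.
    by rewrite bj nth_take// wl eqxx.
  by apply: cl; rewrite mem_iota; move: b0 bw wk; clear; lia.
apply: (le_trans H); rewrite big_ord_recl /M/= natrM -mulrA ler_wpM2l//.
have jk' : (j.-1 < k)%N by move: aj jk; clear; lia.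
rewrite (bigD1 (Ordinal jk'))//= /bump/= add1n add0n prednK ?(leq_ltn_trans _ aj)// eqxx.
rewrite (eq_bigr (fun=> k.+1 * 3 ^ d * l ^ d)%N); last first.
  move=> i; rewrite -val_eqE/= => ij; rewrite add0n add1n /=.
  by have -> : (i.+1 == j) = false by move: ij aj; clear; lia.
have E : (l ^ (d * k - 1) = l ^ d.-1 * (l ^ d) ^ k.-1)%N.
  have k0 : (0 < k)%N by move: aj jk; clear; lia.
  rewrite -expnM -expnD -{1}(prednK k0) mulnS; congr (_ ^ _)%N; move: d0; clear; lia.
by rewrite prod_nat_const cardC1 card_ord -natrX -natrM ler_nat expnMn mulnACA E.
Qed.

End PairCounting.

Section GenogramBound.
Context (d : nat) (prec : rel (lattice d)) (dO : measure_display) (Omega : measurableType dO)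
  (R : realType) (P : probability Omega R) (X : lattice d -> {RV P >-> R})
  (T : {fset lattice d}) (k : nat) (r : \bar R) (K : R).
Hypotheses (prec_irr : irreflexive prec) (hr : ((k + 2)%N%:R%:E <= r)%E) (K1 : 1 <= K)
  (Xmaj : forall i, i \in T -> majorant P r K (fun w => 1 + `|X i w|))
  (k0 : (0 < k)%N) (d0 : (0 < d)%N).
Variables (m L : nat).
Hypotheses (m0 : (0 < m)%N) (mL : (m < L)%N) (TLm : (#|` T| <= (2 * (L - m)) ^ d)%N).
Implicit Types (w : seq (lattice d)).
Notation N := (#|` T|%:R : R).
Notation weight := (weight X T k r).
Notation gap w a j := (maxnorm (nth 0%R w a - nth 0%R w j)).

Definition pair_weight w (a j : nat) : R :=
  ((m < gap w a j)%N && clustered (gap w a j) w)%:R * weight (minn L (gap w a j)).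

(** The pair that realizes the scale depends on the genogram and on the tuple; the sum over all
    pairs is one weight that serves all genograms. *)
Definition tuple_weight w : R := \sum_(j < k.+1) \sum_(a < k.+1 | (a < j)%N) pair_weight w a j.

Definition pair_const : R := ((2 * d * 3 ^ d.-1) * (k.+1 * 3 ^ d) ^ k.-1)%N%:R +
  2 ^+ (d * k.-1) * 2 ^+ (d + d * k).

Lemma pair_weight_ge0 w a j : 0 <= pair_weight w a j.
Proof. by rewrite mulr_ge0 ?weight_ge0. Qed.

Lemma pair_weight_le w a j : pair_weight w a j <=
  \sum_(m.+1 <= l < L) ((gap w a j == l) && clustered l w)%:R * weight l + weight L.
Proof.
rewrite /pair_weight; case: ltnP => mg /=; last first.
  by rewrite mul0r addr_ge0 ?weight_ge0//; apply: sumr_ge0 => l _; rewrite mulr_ge0 ?weight_ge0.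
have [gL|Lg] := ltnP (gap w a j) L.
  rewrite (bigD1_seq (gap w a j)) ?iota_uniq ?mem_index_iota ?mg//= eqxx/=.
  rewrite -addrA lerDl addr_ge0 ?weight_ge0//.
  by apply: sumr_ge0 => l _; rewrite mulr_ge0 ?weight_ge0.
apply: (@le_trans _ _ (weight L)); last first.
  by rewrite lerDr; apply: sumr_ge0 => l _; rewrite mulr_ge0 ?weight_ge0.
by case: clustered; rewrite ?mul1r ?mul0r ?weight_ge0.
Qed.

Lemma tuple_sum_pair_weight a j : (a < j <= k)%N ->
  tuple_sum T k.+1 (fun w => pair_weight w a j) <= N * pair_const * tail_sum d L weight k m.
Proof.
move=> ajk.
have tS0 : 0 <= tail_sum d L weight k m by apply: tail_sum_ge0; exact: weight_ge0.
apply: (le_trans (tuple_sum_le (fun w _ _ => pair_weight_le w a j))).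
have -> : tuple_sum T k.+1 (fun w => \sum_(m.+1 <= l < L) ((gap w a j == l) && clustered l w)%:R * weight l + weight L) =
    \sum_(m.+1 <= l < L) weight l * tuple_sum T k.+1 (fun w => ((gap w a j == l) && clustered l w)%:R) + N ^+ k.+1 * weight L.
  rewrite (eq_tuple_sum _ _ (F' := fun w => \sum_(o <- rcons [seq Some l | l <- index_iota m.+1 L] None)
     (if o is Some l then weight l * ((gap w a j == l) && clustered l w)%:R else weight L))); last first.
    move=> w; rewrite -cats1 big_cat big_map big_seq1; congr (_ + _).
    by apply: eq_bigr => l _; rewrite mulrC.
  rewrite tuple_sum_sum -cats1 big_cat big_map big_seq1; congr (_ + _); last exact: tuple_sum_cst.
  by apply: eq_bigr => l _; exact: tuple_sumZ.
rewrite /pair_const mulrDr mulrDl; apply: lerD.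
  set C := (_ * _ ^ k.-1)%N%:R.
  apply: (@le_trans _ _ (\sum_(m.+1 <= l < L) N * C * (l%:R ^+ (d * k - 1) * weight l))).
    apply: ler_sum_nat => l /andP[ml _].
    have := count_close_pair T d0 R (leq_ltn_trans (leq0n _) ml) ajk.
    move=> /(ler_wpM2l (weight_ge0 X T k r l))/le_trans; apply.
    by rewrite le_eqVlt; apply/orP; left; apply/eqP; rewrite /C; ring.
  rewrite -mulr_sumr ler_wpM2l ?mulr_ge0// /tail_sum big_nat_recr//= lerDl.
  by rewrite mulr_ge0 ?exprn_ge0 ?weight_ge0.
(* For distances from [L] on, all N^(k+1) tuples are counted: k-1 of the factors N are bounded by
   (2L)^d, one is absorbed by the tail sum, and one remains. *)
have tn := tail_near d0 (weight_ge0 X T k r) (weight_anti X T hr) k.-1 mL TLm.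
rewrite prednK// in tn.
have NL : N <= (2 * L%:R) ^+ d.
  rewrite -natrM -natrX ler_nat (leq_trans TLm)// leq_expn// leq_mul2l leq_subr orbT//.
have Nk : N ^+ k.+1 <= N * (N * (2 * L%:R) ^+ (d * k.-1)).
  rewrite -{1}(prednK k0) !exprS ler_wpM2l// ler_wpM2l// exprM.
  by apply: lerXn2r; rewrite ?nnegrE ?exprn_ge0 ?mulr_ge0.
apply: (le_trans (ler_wpM2r (weight_ge0 X T k r L) Nk)).
rewrite exprMn -!mulrA ler_wpM2l//.
have -> : N * (2 ^+ (d * k.-1) * (L%:R ^+ (d * k.-1) * weight L)) =
  2 ^+ (d * k.-1) * (N * (L%:R ^+ (d * k.-1) * weight L)) by ring.
by rewrite ler_wpM2l ?exprn_ge0.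
Qed.

Lemma tuple_sum_tuple_weight : tuple_sum T k.+1 tuple_weight <=
  (k.+1 ^ 2)%N%:R * (N * pair_const * tail_sum d L weight k m).
Proof.
rewrite /tuple_weight tuple_sum_sum.
have B0 : 0 <= N * pair_const * tail_sum d L weight k m.
  rewrite !mulr_ge0 ?tail_sum_ge0//; last by move=> l; exact: weight_ge0.
  by rewrite addr_ge0// mulr_ge0 ?exprn_ge0.
apply: (@le_trans _ _ (\sum_(j < k.+1) k.+1%:R * (N * pair_const * tail_sum d L weight k m))).
  apply: ler_sum => j _; rewrite (eq_tuple_sum _ _ (F' := fun w => \sum_(a < k.+1) (a < j)%N%:R * pair_weight w a j)).
    rewrite tuple_sum_sum.
    apply: (@le_trans _ _ (\sum_(a < k.+1) (N * pair_const * tail_sum d L weight k m))).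
      apply: ler_sum => a _; rewrite tuple_sumZ; case: ltnP => aj; last by rewrite mul0r.
      by rewrite [true%:R * _]mul1r; apply: tuple_sum_pair_weight; rewrite aj -ltnS ltn_ord.
    by rewrite sumr_const card_ord -[X in X <= _]mulr_natl.
  by move=> w; rewrite big_mkcond; apply: eq_bigr => a _; case: ltnP; rewrite ?mul1r ?mul0r.
by rewrite sumr_const card_ord -[X in X <= _]mulr_natl mulrA -natrM.
Qed.

Definition genogram_step G p : pred (lattice d) := fun i =>
  i \in (Bset prec T m G p (size p).+1 `\` Dset prec T m G p (size p).+1)%fset.

Lemma check_admissible G w : check (genogram_step G) [::] w = admissible prec T m G w.
Proof.
rewrite checkE; apply: eq_in_all => b; rewrite mem_iota add0n => /andP[_ bw].
by rewrite /genogram_step cat0s size_takel// ltnW.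
Qed.

Lemma nested_sum_le G n p :
  `|nested_sum prec X T m G n p| <= tuple_sum T n (fun w =>
    (check (genogram_step G) p w)%:R * `|EG P G [seq (X i : Omega -> R) | i <- p ++ w]|).
Proof.
elim: n p => [|n IH] p /=; first by rewrite mul1r cats0.
have sub : (Bset prec T m G p (size p).+1 `\` Dset prec T m G p (size p).+1 `<=` T)%fset.
  by apply: fsubset_trans (fsubsetDl _ _) (Brec_sub _ _ _ _ _ _ _).
apply: (le_trans (ler_norm_sum _ _ _)); rewrite (sum_fsub _ sub); apply: ler_sum => i _.
rewrite -/(genogram_step G p i).
case: (genogram_step G p i) => /=; last by rewrite mul0r; under eq_tuple_sum do rewrite mul0r; rewrite tuple_sum_cst mulr0.
rewrite mul1r; apply: (le_trans (IH (rcons p i))); apply: tuple_sum_le => w _ _.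
by rewrite cat_rcons.
Qed.

(** The distinguished pair consists of the vertex [c] of [farthest_vertex] and an ancestor whose
    point is nearest to that of [c]. *)
Lemma EG_tuple_le G w : genograms0 k.+1 G -> size w = k.+1 -> {subset w <= T} -> admissible prec T m G w ->
  `|EG P G [seq (X i : Omega -> R) | i <- w]| <= genogram_const k r K ^+ k.+1 * tuple_weight w.
Proof.
move=> [[isG sG] pos] sw wT adm.
have sx : size w = size G by rewrite sG.
have pos' : exists2 j, (1 <= j <= size G)%N & 1 <= sid G j by rewrite sG.
have [c [cn pc sc far]] := farthest_vertex prec_irr isG sx adm pos'.
set l := dist1 (nth 0 w c.-1) (anc_points G w c) in far.
have [a ac lE] := anp_dist w isG (nth 0 w c.-1) cn.
have [cT cN _] := positive_rank isG sx adm cn sc.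
have ml : (m < l)%N by rewrite ltnNge; apply: contra cN => lm; rewrite in_nbhd cT.
have gapE : gap w a.-1 c.-1 = l by rewrite maxnorm_sym -lE.
have := anc_lt ac => /andP[a0 altc].
have clus : clustered l w.
  apply/allP => b; rewrite mem_iota => bn.
  have bn' : (1 < b.+1 <= size G)%N by rewrite sG; move: bn; rewrite sw; clear; lia.
  have [c' c'b c'l] := covered prec_irr isG sx adm (ltnW ml) far bn'.
  have c'b' : (c'.-1 < b)%N by move: c'b; clear; lia.
  have c'in : nth 0 w c'.-1 \in take b w.
    rewrite -(nth_take 0 c'b'); apply: mem_nth; rewrite size_takel//.
    by move: bn; rewrite sw; clear; lia.
  exact: leq_trans (seq_dist_le (nth 0 w b) c'in) c'l.
apply: (@le_trans _ _ (genogram_const k r K ^+ k.+1 * alpha_mixing X T k.+1 l `^ rexp r k.+1%:R)).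
  rewrite /EG sG; apply: (EGrec_separated hr K1 Xmaj (c := c)) => //.
  - by rewrite sG.
  - by rewrite sw.
  - exact: le_trans sc.
  - move=> t t' /andP[t0 tc] ht /andP[ct' t'n] ht'; rewrite maxnorm_sym.
    apply: (chain_separated prec_irr isG sx adm cn sc) => //; first by rewrite ct'.
    have cn' : (c <= size G)%N by case/andP: cn.
    move: {far l lE ml gapE clus a ac a0 altc pc sc cT cN ct' t'n ht' t'} ht cn' tc.
    elim: c {cn} => // c IH ht cn'; rewrite ltnS leq_eqVlt => /orP[/eqP tE|tc].
      have <- : par G c.+1 = t by rewrite ht ?leqnn ?tE ?ltnSn.
      by apply: (anc_par isG); rewrite cn' andbT ltnS -tE.
    have pcE : par G c.+1 = c by rewrite ht// leqnn (ltn_trans tc).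
    apply: (@anc_trans _ isG _ c) => //.
      by rewrite -{1}pcE; apply: (anc_par isG); rewrite cn' andbT ltnS (leq_trans t0)// ltnW.
    by apply: IH => // [s /andP[ts sc']|]; [apply: ht; rewrite ts leqW|exact: ltnW].
have C0 : 0 <= genogram_const k r K ^+ k.+1.
  by apply: exprn_ge0; exact: le_trans ler01 (genogram_const_ge1 hr K1).
rewrite ler_wpM2l//.
have ck : (c.-1 < k.+1)%N by rewrite -sG; move: cn; clear; lia.
have ak : (a.-1 < k.+1)%N by move: altc ck; clear; lia.
apply: (@le_trans _ _ (pair_weight w a.-1 c.-1)).
  rewrite /pair_weight gapE ml clus mul1r; apply: (weight_anti X T hr); exact: geq_minr.
have in0 (j : 'I_k.+1) : 0 <= \sum_(a < k.+1 | (a < j)%N) pair_weight w a j.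
  by apply: sumr_ge0 => a' _; exact: pair_weight_ge0.
rewrite /tuple_weight (bigD1 (Ordinal ck))//=; apply: ler_wpDr.
  by apply: sumr_ge0 => j _; exact: in0.
rewrite (bigD1 (Ordinal ak))/=; last by move: a0 altc; clear; lia.
by rewrite lerDl; apply: sumr_ge0 => a' _; exact: pair_weight_ge0.
Qed.

End GenogramBound.

(** * Number of genograms that admit a given tuple *)

Section Patterns.
Context (d : nat) (prec : rel (lattice d)) (T : {fset lattice d}) (m : nat).

Definition sign_code (s : int) : 'I_3 := if s == -1 then ord0 else if s == 0 then inord 1 else inord 2.

(* Parents and signs of the identifiers: together with an admissible tuple, they determine
   the genogram, since a positive identifier is the rank of a site. *)
Definition pattern n (H : genodata) : {ffun 'I_n -> 'I_n.+1 * 'I_3} :=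
  [ffun j : 'I_n => (inord (par H j.+1), sign_code (sid H j.+1))].

Lemma sign_code_inj s s' : -1 <= s -> -1 <= s' -> sign_code s = sign_code s' ->
  s = s' \/ (1 <= s /\ 1 <= s').
Proof.
have v1 : @inord 2 1 = 1%N :> nat by rewrite inordK.
have v2 : @inord 2 2 = 2%N :> nat by rewrite inordK.
rewrite /sign_code => s1 s1'.
by case: (s =P -1) => ?; case: (s =P 0) => ?; case: (s' =P -1) => ?; case: (s' =P 0) => ?;
  move=> /(congr1 val) /=; rewrite ?v1 ?v2 //; (try by left; congruence);
  move=> _; first [by left; lia | by right; split; lia].
Qed.

Lemma par_le n H j : genograms n H -> (par H j <= n)%N.
Proof.
move=> [isH sH]; have [jn|nj] := leqP j n.
  have [->|j0] := posnP j; first by rewrite (par0 isH).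
  by rewrite ltnW// (leq_trans _ jn)// (par_lt isH)// j0 sH.
by rewrite /par nth_default// sH; move: nj; clear; lia.
Qed.

Lemma pattern_inj n (w : seq (lattice d)) H H' : size w = n -> genograms n H -> genograms n H' ->
  admissible prec T m H w -> admissible prec T m H' w -> pattern n H = pattern n H' -> H = H'.
Proof.
move=> wn gH gH' aH aH' HH; have [isH sH] := gH; have [isH' sH'] := gH'.
have code j : (j < n)%N -> par H j.+1 = par H' j.+1 /\ sign_code (sid H j.+1) = sign_code (sid H' j.+1).
  move=> jn; have := congr1 (fun f : {ffun 'I_n -> 'I_n.+1 * 'I_3} => f (Ordinal jn)) HH.
  rewrite !ffunE /= => -[/(congr1 val) /= + ->]; rewrite !inordK ?ltnS; try exact: par_le.
  by [].
have parE : par H = par H'.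
  apply/funext => -[|j]; first by rewrite (par0 isH) (par0 isH').
  have [jn|nj] := ltnP j n; first by case: (code j jn).
  by rewrite /par !nth_default ?sH ?sH'.
have ancE j : ancestors H j = ancestors H' j by rewrite /ancestors parE.
have sidE j : (j < n)%N -> sid H j.+1 = sid H' j.+1.
  case: j => [_|j jn].
    by case: isH => _ _ [-> _ _ _] _ _; case: isH' => _ _ [-> _ _ _] _ _.
  have jH : (1 < j.+2 <= size H)%N by rewrite sH.
  have jH' : (1 < j.+2 <= size H')%N by rewrite sH'.
  have [//|[s1 s1']] := sign_code_inj (sid_ge isH jH) (sid_ge isH' jH') (proj2 (code _ jn)).
  have [_ _ <-] := positive_rank isH (etrans wn (esym sH)) aH jH s1.
  have [_ _ <-] := positive_rank isH' (etrans wn (esym sH')) aH' jH' s1'.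
  by rewrite /anc_points ancE.
apply: (@eq_from_nth _ (0%N, 0)); first by rewrite sH sH'.
move=> i; rewrite sH => iH.
have := congr1 (fun f => f i.+1) parE; have := sidE i iH; rewrite /par /sid /=.
by case: (nth _ H i) => a b; case: (nth _ H' i) => a' b' /= -> ->.
Qed.

Definition pattern_const n : nat := ((n.+1 * 3) ^ n)%N.

Lemma count_admissible n (w : seq (lattice d)) (Hs : seq genodata) : uniq Hs ->
  (forall H, H \in Hs -> genograms n H) -> size w = n ->
  (count (fun H => admissible prec T m H w) Hs <= pattern_const n)%N.
Proof.
move=> uH gH wn; rewrite -size_filter -(size_map (pattern n)).
have um : uniq (map (pattern n) [seq H <- Hs | admissible prec T m H w]).
  rewrite map_inj_in_uniq ?filter_uniq// => H H'; rewrite !mem_filter => /andP[aH HH] /andP[aH' HH'].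
  by apply: (pattern_inj wn _ _ aH aH'); exact: gH.
rewrite -(card_uniqP um) (leq_trans (max_card _))//.
by rewrite card_ffun card_prod !card_ord.
Qed.

End Patterns.

Section KappaBound.
Context (d : nat) (prec : rel (lattice d)) (dO : measure_display) (Omega : measurableType dO)
  (R : realType) (P : probability Omega R) (X : lattice d -> {RV P >-> R})
  (T : {fset lattice d}) (k : nat) (r : \bar R) (K : R).
Hypotheses (prec_irr : irreflexive prec) (hr : ((k + 2)%N%:R%:E <= r)%E) (K1 : 1 <= K)
  (Xmaj : forall i, i \in T -> majorant P r K (fun w => 1 + `|X i w|))
  (k0 : (0 < k)%N) (d0 : (0 < d)%N).
Variables (m L : nat) (c : R).
Hypotheses (m0 : (0 < m)%N) (mL : (m < L)%N) (TLm : (#|` T| <= (2 * (L - m)) ^ d)%N)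
  (c1 : 1 <= c) (sigma0 : 0 < sigma X T)
  (sigma_c : (sigma X T)^-1 <= c * #|` T|%:R `^ (- 2^-1)) (T0 : (0 < #|` T|)%N).
Notation N := (#|` T|%:R : R).
Notation weight := (weight X T k r).

Definition genogram_sum_const : R := (pattern_const k.+1)%:R * genogram_const k r K ^+ k.+1 *
  ((k.+1 ^ 2)%N%:R * pair_const d R k).

Lemma sum_Ssum_le (Hs : seq genodata) : uniq Hs -> (forall H, H \in Hs -> genograms0 k.+1 H) ->
  \sum_(H <- Hs) `|Ssum prec X T m H| <=
  genogram_sum_const * ((sigma X T)^-1 ^+ k.+1 * N) * tail_sum d L weight k m.
Proof.
move=> uH gH; set s := sigma X T.
have C0 : 0 <= genogram_const k r K ^+ k.+1.
  by apply: exprn_ge0; exact: le_trans ler01 (genogram_const_ge1 hr K1).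
have s0 : 0 <= s^-1 ^+ k.+1 by rewrite exprn_ge0// invr_ge0 ltW.
have tw0 w : 0 <= tuple_weight X T k r m L w.
  by apply: sumr_ge0 => j _; apply: sumr_ge0 => a _; exact: pair_weight_ge0.
have E1 : \sum_(H <- Hs) `|Ssum prec X T m H| <= s^-1 ^+ k.+1 *
    \sum_(H <- Hs) tuple_sum T k.+1 (fun w => (admissible prec T m H w)%:R *
      `|EG P H [seq (X i : Omega -> R) | i <- w]|).
  rewrite mulr_sumr big_seq [leRHS]big_seq; apply: ler_sum => H /gH[[_ sH] _].
  rewrite /Ssum normrM sH -exprVn -/s ger0_norm// ler_wpM2l//.
  apply: (le_trans (nested_sum_le _ _ _ _ _ _ _)); apply: tuple_sum_le => w _ _.
  by rewrite check_admissible.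
apply: (le_trans E1).
have -> : genogram_sum_const * (s^-1 ^+ k.+1 * N) * tail_sum d L weight k m =
  s^-1 ^+ k.+1 * ((pattern_const k.+1)%:R * genogram_const k r K ^+ k.+1 *
  ((k.+1 ^ 2)%N%:R * (N * pair_const d R k * tail_sum d L weight k m))) by rewrite /genogram_sum_const; ring.
rewrite ler_wpM2l// -tuple_sum_sum.
apply: le_trans (ler_wpM2l (mulr_ge0 (ler0n _ _) C0) (tuple_sum_tuple_weight X hr k0 d0 mL TLm)).
rewrite -tuple_sumZ; apply: tuple_sum_le => w wk wT.
apply: (@le_trans _ _ (\sum_(H <- Hs) (admissible prec T m H w)%:R *
  (genogram_const k r K ^+ k.+1 * tuple_weight X T k r m L w))).
  rewrite big_seq [leRHS]big_seq; apply: ler_sum => H /gH gH0.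
  case: (boolP (admissible prec T m H w)) => aH; last by rewrite !mul0r.
  rewrite !mul1r; exact: EG_tuple_le.
rewrite -mulr_suml -[leRHS]mulrA ler_wpM2r ?mulr_ge0// -natr_sum ler_nat.
have gH' H : H \in Hs -> genograms k.+1 H by move=> /gH[].
apply: leq_trans (count_admissible prec T m uH gH' wk).
by rewrite -sum1_count [leqRHS]big_mkcond/=; apply: leq_sum => H _; case: (admissible _ _ _ _ _).
Qed.

Lemma bcoef_le1 H : `|bcoef R H| <= 1.
Proof.
rewrite /bcoef normrM normrX normrN1 expr1n mul1r normr_prod.
apply: prodr_ile1 => j _; rewrite normr_ge0/= ger0_norm ?invr_ge0//.
(* A truncated difference equal to 0 has inverse 0, which satisfies the bound as well. *)
have [->|] := posnP (j.+1 - uidx H j)%N; first by rewrite invr0.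
by move=> ?; rewrite invf_le1 ?ltr0n// ler1n.
Qed.

Lemma kappa_tilde_le : `|kappa_tilde prec X T m k.+1 - cumulant P (normalized_sum X T) k.+1| <=
  k`!%:R * (genogram_sum_const * c ^+ k.+1) * (N `^ (- ((k%:R - 1) / 2)) *
    \sum_(m.+1 <= l < L.+1) l%:R ^+ (d * k - 1) * alpha_mixing X T k.+1 l `^ rexp r (k%:R + 1)).
Proof.
rewrite /kappa_tilde addrAC subrr add0r.
set F := fun H => _ : R; rewrite -/F.
(* The list of genograms with a nonzero term, and by convention the empty list if there were
   infinitely many. The estimate is uniform over all duplicate-free lists of such genograms and so
   applies to it in either case. *)
set s := finite_support _ _ _.
have us : uniq s by exact: finite_support_uniq.
have sg H : H \in s -> genograms0 k.+1 H.
  by rewrite /s; case: finite_supportP => // X' XP _ _; move=> HX; apply: XP.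
apply: (le_trans (ler_norm_sum _ _ _)).
apply: (@le_trans _ _ (k`!%:R * \sum_(H <- s) `|Ssum prec X T m H|)).
  rewrite mulr_sumr; apply: ler_sum => H _; rewrite /F /=.
  move: (Ssum prec X T m H) (bcoef R H) (bcoef_le1 H) => S b b1.
  rewrite !normrM [ `|k`!%:R| ]ger0_norm//=.
  rewrite -!mulrA ler_wpM2l// mulrA ler_piMl// mulr_ile1//.
  rewrite ger0_norm ?invr_ge0//.
  have [->|] := posnP (k.+2 - uidx H k.+1)%N; first by rewrite invr0.
  by move=> ?; rewrite invf_le1 ?ltr0n// ler1n.
rewrite -[leRHS]mulrA ler_wpM2l//; apply: (le_trans (sum_Ssum_le us sg)).
have -> : tail_sum d L weight k m = \sum_(m.+1 <= l < L.+1) l%:R ^+ (d * k - 1) * alpha_mixing X T k.+1 l `^ rexp r (k%:R + 1).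
  by apply: eq_bigr => l _; rewrite /weight natr1.
have g0 : 0 <= genogram_sum_const.
  apply: mulr_ge0.
    by apply: mulr_ge0 => //; apply: exprn_ge0; exact: le_trans ler01 (genogram_const_ge1 hr K1).
  by apply: mulr_ge0 => //; apply: addr_ge0 => //; apply: mulr_ge0; exact: exprn_ge0.
move: genogram_sum_const g0 => g g0.
rewrite -[leLHS]mulrA -[leRHS]mulrA ler_wpM2l// [leRHS]mulrA ler_wpM2r//.
  by apply: sumr_ge0 => l _; rewrite mulr_ge0 ?exprn_ge0 ?powR_ge0.
rewrite mulrC; apply: (@le_trans _ _ (N * (c ^+ k.+1 * N `^ (- (k.+1%:R / 2))))).
  by rewrite ler_wpM2l//; exact: (sigma_exp c1 sigma0 sigma_c).
rewrite mulrCA (card_mul_powR T0) (_ : 1 + _ = - ((k%:R - 1) / 2))//.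
by rewrite -addn1 natrD; field.
Qed.

End KappaBound.

(** * Dependence on the law only *)

Section LawInvariance.
Context (d : nat) (R : realType) (T : {fset lattice d})
  (dO : measure_display) (Omega : measurableType dO) (P : probability Omega R)
  (X : lattice d -> {RV P >-> R})
  (dO' : measure_display) (Omega' : measurableType dO') (P' : probability Omega' R)
  (X' : lattice d -> {RV P' >-> R}).
Hypothesis same_law : forall B, coordinate_sigma_field T B -> joint_law X B = joint_law X' B.

Definition coordinate_sets : set (set (lattice d -> R)) :=
  \bigcup_(i in [set` T]) preimage_set_system [set: lattice d -> R] (fun x => x i) measurable.

Notation config := (g_sigma_algebraType coordinate_sets).

Definition configuration dO (Omega : measurableType dO) (P : probability Omega R)
  (X : lattice d -> {RV P >-> R}) (w : Omega) : config := fun i => X i w.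

(** The two variables are one and the same measurable function of the configurations. This relation
    is preserved by all operations that enter [kappa_tilde], and related variables have equal
    expectations. *)
Definition same_function (Y : Omega -> R) (Y' : Omega' -> R) := exists g : config -> R,
  [/\ measurable_fun setT g, Y = g \o configuration X & Y' = g \o configuration X'].

Lemma measurable_configuration dO0 (Omega0 : measurableType dO0) (P0 : probability Omega0 R)
  (X0 : lattice d -> {RV P0 >-> R}) : measurable_fun setT (configuration X0).
Proof.
apply: (@measurability _ _ Omega0 config setT (configuration X0) coordinate_sets) => //.
move=> _ [_ [i /= iT [B mB <-]] <-].
by rewrite !setTI; have := measurable_funPT (X0 i) measurableT B mB; rewrite setTI.
Qed.

Lemma Ex_same_law Y Y' : same_function Y Y' -> Ex P Y = Ex P' Y'.
Proof.
move=> [g [mg -> ->]]; rewrite /Ex unlock; congr fine.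
have mY : measurable_fun setT (g \o configuration X).
  by apply: measurableT_comp => //; exact: measurable_configuration.
have mY' : measurable_fun setT (g \o configuration X').
  by apply: measurableT_comp => //; exact: measurable_configuration.
(* Change of variables along the configuration maps, for the positive and negative parts separately,
   so that it holds for every measurable variable. *)
have nonneg (f : R -> \bar R) : measurable_fun setT f -> (forall y, 0 <= f y)%E ->
    (\int[P]_w f ((g \o configuration X) w) = \int[P']_w f ((g \o configuration X') w))%E.
  move=> mf f0.
  have := ge0_integral_pushforward mY P measurableT mf (fun y _ => f0 y).
  rewrite preimage_setT => <-.
  have := ge0_integral_pushforward mY' P' measurableT mf (fun y _ => f0 y).
  rewrite preimage_setT => <-.
  apply: eq_measure_integral => B mB _; rewrite /pushforward.
  have := same_law (B := g @^-1` B); rewrite /joint_law; apply.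
  by have := mg measurableT B mB; rewrite setTI.
rewrite integralE [RHS]integralE; congr (_ - _)%E.
  have mp : measurable_fun setT ((@EFin R)^\+)%E by apply: measurable_funepos; exact/measurable_EFinP.
  have H := nonneg _ mp (fun y => funepos_ge0 _ y).
  by apply: (eq_trans _ (eq_trans H _)); apply: eq_integral => x _; rewrite !funeposE.
have mn : measurable_fun setT ((@EFin R)^\-)%E by apply: measurable_funeneg; exact/measurable_EFinP.
have H := nonneg _ mn (fun y => funeneg_ge0 _ y).
by apply: (eq_trans _ (eq_trans H _)); apply: eq_integral => x _; rewrite !funenegE.
Qed.

Lemma same_X i : i \in T -> same_function (X i) (X' i).
Proof.
move=> iT; exists (fun x => x i); split => //.
by move=> _ B mB; apply: sub_gen_smallest; exists i => //; exists B.
Qed.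

Lemma same_cst c : same_function (fun=> c) (fun=> c).
Proof. by exists (fun=> c); split => //; exact: measurable_cst. Qed.

Lemma sameM Y Y' Z Z' : same_function Y Y' -> same_function Z Z' ->
  same_function (fun w => Y w * Z w) (fun w => Y' w * Z' w).
Proof.
move=> [g [mg -> ->]] [f [mf -> ->]]; exists (fun x => g x * f x).
by split => //; exact: measurable_funM.
Qed.

Lemma sameD Y Y' Z Z' : same_function Y Y' -> same_function Z Z' ->
  same_function (fun w => Y w + Z w) (fun w => Y' w + Z' w).
Proof.
move=> [g [mg -> ->]] [f [mf -> ->]]; exists (fun x => g x + f x).
by split => //; exact: measurable_funD.
Qed.

Lemma same_sub c Y Y' : same_function Y Y' -> same_function (fun w => Y w - c) (fun w => Y' w - c).
Proof. by move=> H; apply: sameD => //; exact: same_cst. Qed.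

Lemma same_exp Y Y' q : same_function Y Y' -> same_function (fun w => Y w ^+ q) (fun w => Y' w ^+ q).
Proof.
move=> H; elim: q => [|q IH]; first exact: same_cst.
under eq_fun do rewrite exprS; under [X in same_function _ X]eq_fun do rewrite exprS.
exact: sameM.
Qed.

Lemma same_field_sum : same_function (field_sum X T) (field_sum X' T).
Proof.
have H (s : seq (lattice d)) : {subset s <= T} ->
    same_function (fun w => \sum_(i <- s) X i w) (fun w => \sum_(i <- s) X' i w).
  elim: s => [|i s IH] sT.
    have -> : (fun w => \sum_(i <- [::]) X i w) = fun=> 0 by apply/funext => w; rewrite big_nil.
    have -> : (fun w => \sum_(i <- [::]) X' i w) = fun=> 0 by apply/funext => w; rewrite big_nil.
    exact: same_cst.
  have -> : (fun w => \sum_(i <- i :: s) X i w) = fun w => X i w + \sum_(i <- s) X i w.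
    by apply/funext => w; rewrite big_cons.
  have -> : (fun w => \sum_(i <- i :: s) X' i w) = fun w => X' i w + \sum_(i <- s) X' i w.
    by apply/funext => w; rewrite big_cons.
  apply: sameD; first by apply: same_X; apply: sT; rewrite mem_head.
  by apply: IH => j js; apply: sT; rewrite inE js orbT.
exact: H.
Qed.

Lemma sigma_same_law : sigma X T = sigma X' T.
Proof.
rewrite /sigma /sigma2 /variance !covariance.unlock; congr Num.sqrt.
have E := Ex_same_law same_field_sum; rewrite /Ex in E; rewrite -E.
apply: (@Ex_same_law (fun w => (field_sum X T w - fine 'E_P[field_sum X T]) * (field_sum X T w - fine 'E_P[field_sum X T]))
  (fun w => (field_sum X' T w - fine 'E_P[field_sum X T]) * (field_sum X' T w - fine 'E_P[field_sum X T]))).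
by apply: sameM; apply: same_sub; exact: same_field_sum.
Qed.

Lemma cumulant_same_law j :
  cumulant P (normalized_sum X T) j = cumulant P' (normalized_sum X' T) j.
Proof.
rewrite !cumulantE; congr (cumulant_of _ _); apply/funext => q; apply: Ex_same_law.
apply: same_exp; rewrite /normalized_sum -sigma_same_law; apply: sameM; first exact: same_cst.
exact: same_field_sum.
Qed.

Lemma same_block (ix : seq (lattice d)) a b : {subset ix <= T} ->
  same_function (block [seq (X i : Omega -> R) | i <- ix] a b)
    (block [seq (X' i : Omega' -> R) | i <- ix] a b).
Proof.
move=> ixT; rewrite /block; elim: (index_iota a b) => [|t s IH].
  have -> : (fun w => \prod_(t <- [::]) nth (fun=> 0) [seq (X i : Omega -> R) | i <- ix] t.-1 w) = fun=> 1.
    by apply/funext => w; rewrite big_nil.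
  have -> : (fun w => \prod_(t <- [::]) nth (fun=> 0) [seq (X' i : Omega' -> R) | i <- ix] t.-1 w) = fun=> 1.
    by apply/funext => w; rewrite big_nil.
  exact: same_cst.
under eq_fun do rewrite big_cons; under [X in same_function _ X]eq_fun do rewrite big_cons.
apply: sameM => //; have [ti|it] := ltnP t.-1 (size ix).
  by rewrite !(nth_map 0)//; apply: same_X; apply: ixT; exact: mem_nth.
by rewrite !nth_default ?size_map//; exact: same_cst.
Qed.

Lemma same_Dop (I : Type) (F : I -> Omega -> R) (F' : I -> Omega' -> R) Y Y' (s : seq I) :
  (forall i, same_function (F i) (F' i)) -> same_function Y Y' ->
  same_function (Dop P Y (map F s)) (Dop P' Y' (map F' s)).
Proof.
move=> FF; elim: s Y Y' => [|i s IH] Y Y' YY /=; first by rewrite (Ex_same_law YY); exact: same_sub.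
have H := sameM YY (IH _ _ (FF i)).
by rewrite (Ex_same_law H); exact: same_sub.
Qed.

Lemma Dstar_last_same_law G (ix : seq (lattice d)) : {subset ix <= T} ->
  Dstar_last P G [seq (X i : Omega -> R) | i <- ix] = Dstar_last P' G [seq (X' i : Omega' -> R) | i <- ix].
Proof.
move=> ixT; rewrite /Dstar_last.
case: (zip _ _) => [|ab s] /=; first by apply: Ex_same_law; exact: same_block.
apply: Ex_same_law; apply: sameM; first exact: same_block.
by apply: same_Dop => [i|]; exact: same_block.
Qed.

Lemma EGrec_same_law f G (ix : seq (lattice d)) : {subset ix <= T} ->
  EGrec P f G [seq (X i : Omega -> R) | i <- ix] = EGrec P' f G [seq (X' i : Omega' -> R) | i <- ix].
Proof.
elim: f G ix => //= f IH G ix ixT; rewrite (Dstar_last_same_law _ ixT).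
by rewrite -!map_take IH// => i /mem_take/ixT.
Qed.

Lemma nested_sum_same_law prec m G n (ix : seq (lattice d)) : {subset ix <= T} ->
  nested_sum prec X T m G n ix = nested_sum prec X' T m G n ix.
Proof.
elim: n ix => [|n IH] ix ixT /=; first exact: EGrec_same_law.
rewrite big_seq [RHS]big_seq; apply: eq_bigr => i iB; apply: IH => j.
rewrite mem_rcons inE => /orP[/eqP ->|/ixT//].
move: iB; rewrite in_fsetD => /andP[_]; exact: (fsubsetP (Brec_sub _ _ _ _ _ _ _)).
Qed.

Lemma kappa_tilde_same_law prec m k1 : kappa_tilde prec X T m k1 = kappa_tilde prec X' T m k1.
Proof.
rewrite /kappa_tilde cumulant_same_law; congr (_ + _).
have SS H : Ssum prec X T m H = Ssum prec X' T m H.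
  by rewrite /Ssum sigma_same_law nested_sum_same_law.
have -> : (fun H => (k1.-1)`!%:R * bcoef R H / (k1.+1 - uidx H k1)%N%:R * Ssum prec X T m H) =
  (fun H => (k1.-1)`!%:R * bcoef R H / (k1.+1 - uidx H k1)%N%:R * Ssum prec X' T m H).
  by apply/funext => H; rewrite SS.
by apply: eq_bigr => H _; rewrite SS.
Qed.

End LawInvariance.

(** * Variance, cut-off distance and proof of the theorem *)

Lemma limn_einf_gt0 (R : realType) (u : nat -> R) : (0 < limn_einf (fun n => (u n)%:E))%E ->
  exists2 e : R, 0 < e & \forall n \near \oo, e <= u n.
Proof.
rewrite limn_einf_lim (cvg_lim _ (@cvg_einfs_sup R _))// => /ereal_sup_gt[_ [n0 _ <-]].
rewrite /einfs/= => inf0.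
have infu n : (n0 <= n)%N -> (ereal_inf (sdrop (fun n => (u n)%:E) n0) <= (u n)%:E)%E.
  by move=> nn; apply: ereal_inf_lbound; exists n.
case: (ereal_inf _) inf0 infu => [e| |]//; last first.
  by move=> _ /(_ n0 (leqnn _)); rewrite leye_eq.
by rewrite lte_fin => e0 H; exists e => //; exists n0 => // n /H; rewrite lee_fin.
Qed.

Lemma Lcut_gt (R : realType) d m N : (m < Lcut R d m N)%N.
Proof. by rewrite /Lcut addn1 ltn_addr. Qed.

(** L - m is 1 + floor(N^(1/d) / 2), which exceeds N^(1/d) / 2. The estimates use no other property
    of the cut-off than this and m < L. *)
Lemma card_le_Lcut (R : realType) d m N : (0 < d)%N -> (N <= (2 * (Lcut R d m N - m)) ^ d)%N.
Proof.
move=> d0; rewrite /Lcut -addnA addnC addnK add1n.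
set x := (N%:R : R) `^ d%:R^-1.
have x0 : 0 <= x by exact: powR_ge0.
have /andP[_ xt] := truncn_itv (divr_ge0 x0 (ler0n R 2)).
rewrite -(ler_nat R) natrX natrM.
have -> : N%:R = x ^+ d.
  by rewrite -powR_mulrn// /x -powRrM mulVf ?powRr1// pnatr_eq0 -lt0n.
rewrite lerXn2r ?nnegrE ?mulr_ge0//.
by rewrite mulrC -ler_pdivrMr// ltW.
Qed.

Section FieldBounds.
Context (d : nat) (dO : measure_display) (Omega : measurableType dO)
  (R : realType) (P : probability Omega R) (X : lattice d -> {RV P >-> R}).

Lemma sigma_inv_le T e : 0 < e -> (0 < #|` T|)%N -> e <= sigma2 X T / #|` T|%:R ->
  0 < sigma X T /\ (sigma X T)^-1 <= Num.max 1 (Num.sqrt e)^-1 * #|` T|%:R `^ (- 2^-1).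
Proof.
move=> e0 T0; rewrite ler_pdivlMr ?ltr0n// => eN.
have N0 : 0 < #|` T|%:R :> R by rewrite ltr0n.
have eN0 : 0 < e * #|` T|%:R by rewrite mulr_gt0.
have s2 : 0 < sigma2 X T by exact: lt_le_trans eN.
have s0 : 0 < sigma X T by rewrite sqrtr_gt0.
split => //; apply: (@le_trans _ _ ((Num.sqrt e)^-1 * #|` T|%:R `^ (- 2^-1))); last first.
  by rewrite ler_wpM2r ?powR_ge0// le_max lexx orbT.
rewrite powRN powR12_sqrt ?(ltW N0)// -invfM -sqrtrM ?(ltW e0)// lef_pV2 ?posrE ?sqrtr_gt0//.
by rewrite ler_sqrt// ltW.
Qed.

End FieldBounds.

Theorem propositionE6 (R : realType) (d : nat) (hd : (0 < d)%N)
  (prec : rel (lattice d)) (hprec : strict_total_order prec)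
  (T : nat -> {fset lattice d})
  (hT0 : forall n, T n != fset0)
  (hTmono : forall n, (T n `<=` T n.+1)%fset)
  (hTinf : (fun n => #|` T n|) @ \oo --> \oo)
  (dO : nat -> measure_display) (Omega : forall n, measurableType (dO n))
  (P : forall n, probability (Omega n) R)
  (X : forall n, lattice d -> {RV (P n) >-> R})
  (hL2 : forall n i, i \in T n -> (X n i : Omega n -> R) \in Lfun (P n) 2%:E)
  (hmean : forall n i, i \in T n -> ('E_(P n)[X n i] = 0)%E)
  (k : nat) (hk : (1 <= k)%N)
  (r : \bar R) (hr : ((k + 2)%N%:R%:E <= r)%E)
  (hvar : (0 < limn_einf (fun n => (sigma2 (X n) (T n) / #|` T n|%:R)%:E))%E)
  (hmom : (ereal_sup [set y | exists n i, i \in T n /\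
             y = 'N[P n]_r[EFin \o X n i]] < +oo)%E) :
  let card n : R := #|` T n|%:R in
  let W n := normalized_sum (X n) (T n) in
  let alpha n l : R := alpha_mixing (X n) (T n) k.+1 l in
  let L n m := Lcut R d m #|` T n| in
  let kt n m := kappa_tilde prec (X n) (T n) m k.+1 in
  [/\ forall delta : R, 0 <= delta <= 1 -> (delta%:E < r - 1 - k%:R%:E)%E ->
      exists C : R, \forall n \near \oo,
      forall f : R -> R, holder_space k.-1 1 f -> holder_space k 1 f ->
      forall m : nat, (0 < m)%N ->
        `| Ex (P n) (fun w => W n w * f (W n w))
           - (\sum_(1 <= j < k)
                cumulant (P n) (W n) j.+1 / j`!%:R
                * Ex (P n) (fun w => derive1n j f (W n w))
              + kt n m / k`!%:R * Ex (P n) (fun w => derive1n k f (W n w))) |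
        <= C * (holder k 1 f * card n `^ (- (k%:R / 2))
                  * m%:R ^+ (d * k.+1)
                + holder k.-1 1 f `^ (1 - delta) * holder k 1 f `^ delta
                  * card n `^ (- ((k%:R - 1 + delta) / 2)) * m%:R ^+ (d * k)
                  * \sum_(m.+1 <= l < (L n m).+1)
                      l%:R `^ (d%:R * delta - delta)
                      * alpha n l `^ rexp r (k%:R + 1 + delta)
                + holder k.-1 1 f * card n `^ (- ((k%:R - 1) / 2))
                  * \sum_(m.+1 <= l < (L n m).+1)
                      l%:R ^+ (d * k - 1) * alpha n l `^ rexp r (k%:R + 1)),
      exists C : R, \forall n \near \oo, forall m : nat, (0 < m)%N ->
        `| kt n m - cumulant (P n) (W n) k.+1 |
        <= C * (card n `^ (- ((k%:R - 1) / 2))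
                * \sum_(m.+1 <= l < (L n m).+1)
                    l%:R ^+ (d * k - 1) * alpha n l `^ rexp r (k%:R + 1)) &
      (* kt n m is a function of the joint law of the field and of m *)
      forall n m (dO' : measure_display) (Omega' : measurableType dO')
        (P' : probability Omega' R) (X' : lattice d -> {RV P' >-> R}),
      (forall B, coordinate_sigma_field (T n) B ->
         joint_law (X n) B = joint_law X' B) ->
      (0 < m)%N -> kt n m = kappa_tilde prec X' (T n) m k.+1].
Proof.
move=> card W alpha L kt.
have [prec_irr _ _] := hprec.
have r1 : (1%:E <= r)%E by apply: le_trans hr; rewrite lee_fin ler1n addn2.
set M := fine (ereal_sup [set y | exists n i, i \in T n /\ y = 'N[P n]_r[EFin \o X n i]])%E.
have M0 : 0 <= M.
  apply: fine_ge0; have /fset0Pn[i iT] := hT0 0%N.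
  apply: le_trans (Lnorm_ge0 (P 0%N) r (EFin \o X 0%N i)) _.
  by apply: ereal_sup_ubound; exists 0%N, i.
have NM n i : i \in T n -> ('N[P n]_r[EFin \o X n i] <= M%:E)%E.
  move=> iT; have NS : ('N[P n]_r[EFin \o X n i] <= ereal_sup [set y | exists n i, i \in T n /\ y = 'N[P n]_r[EFin \o X n i]])%E.
    by apply: ereal_sup_ubound; exists n, i.
  rewrite fineK// ge0_fin_numE//; exact: le_trans (Lnorm_ge0 (P n) r (EFin \o X n i)) NS.
(* One constant serves all n and all sites, which makes the implied constants independent of n. *)
set K := Num.max 1 (norm_const r M).
have K1 : 1 <= K by rewrite le_max lexx.
have Xmaj n i : i \in T n -> majorant (P n) r K (fun w => 1 + `|X n i w|).
  move=> iT; apply: majorant_le (majorant_of_norm r1 M0 (NM n i iT)).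
  by rewrite le_max lexx orbT.
have T0 n : (0 < #|` T n|)%N by rewrite cardfs_gt0.
have X0 n i : i \in T n -> Ex (P n) (X n i) = 0 by move=> iT; rewrite /Ex hmean.
have [e e0 var_e] := limn_einf_gt0 hvar.
set c := Num.max 1 (Num.sqrt e)^-1.
have c1 : 1 <= c by rewrite le_max lexx.
have mL n m : (m < L n m)%N by exact: Lcut_gt.
have TL n m : (#|` T n| <= (2 * (L n m - m)) ^ d)%N by exact: card_le_Lcut.
have kappa_le n m : e <= sigma2 (X n) (T n) / #|` T n|%:R ->
    `|kt n m - cumulant (P n) (W n) k.+1| <= k`!%:R * (genogram_sum_const d k r K * c ^+ k.+1) *
      (card n `^ (- ((k%:R - 1) / 2)) * \sum_(m.+1 <= l < (L n m).+1)
         l%:R ^+ (d * k - 1) * alpha n l `^ rexp r (k%:R + 1)).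
  move=> en; have [s0 sc] := sigma_inv_le e0 (T0 n) en.
  exact: (kappa_tilde_le prec_irr hr K1 (Xmaj n) hk hd (mL n m) (TL n m) c1 s0 sc (T0 n)).
split.
- move=> delta delta01 delta_r.
  have kr : ((k.+1%:R + delta)%:E <= r)%E.
    move: delta_r hr; clear; case: r => [s| |]; [|by move=> *; exact: leey|by rewrite leeNy_eq].
    by rewrite -!EFinB lte_fin !lee_fin -natr1 => h _; lra.
  exists (2 * main_const d k r K delta c + `|genogram_sum_const d k r K * c ^+ k.+1|).
  apply: filterS var_e => n en f f1 f2 m m0.
  have [s0 sc] := sigma_inv_le e0 (T0 n) en.
  have fk : smooth_class k f by [].
  have main := main_expansion hr K1 (Xmaj n) hk hd (X0 n) m0 (mL n m) (TL n m) delta01 kr c1 s0 sc (T0 n) fk.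
  have kap := kappa_le n m en.
  have A0 : 0 <= holder k.-1 1 f by exact: holder_ge0.
  have B0 : 0 <= holder k 1 f by exact: holder_ge0.
  have EA : `|Ex (P n) (fun w => derive1n k f (W n w))| <= holder k.-1 1 f.
    apply: (mean_top_deriv_le (P n) hk _ fk).
    have /integrable_measR := normalized_sum_growth hr K1 (Xmaj n) (isT : (1 <= k.+2)%N).
    by under eq_fun do rewrite expr1.
  set s := \sum_(1 <= j < k) _ in main *.
  set D := kt n m - cumulant (P n) (W n) k.+1 in kap.
  have -> : kt n m / k`!%:R = cumulant (P n) (W n) k.+1 / k`!%:R + D / k`!%:R by rewrite /D; ring.
  move: (D) kap => {}D kap.
  rewrite [X in s + X]mulrDl addrA opprD addrA (le_trans (ler_normB _ _))// [leRHS]mulrDl.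
  apply: lerD; first exact: main.
  set t1 := holder k 1 f * _ * _; set t2 := _ * \sum_(_ <= _ < _) _ `^ _ * _.
  set t3 := _ * \sum_(_ <= _ < _) _ ^+ _ * _.
  have t10 : 0 <= t1 by rewrite !mulr_ge0 ?powR_ge0// exprn_ge0.
  have t20 : 0 <= t2.
    rewrite mulr_ge0//; first by rewrite !mulr_ge0 ?powR_ge0// exprn_ge0.
    by apply: sumr_ge0 => l _; rewrite mulr_ge0 ?powR_ge0.
  set g := genogram_sum_const d k r K * c ^+ k.+1 in kap *; clearbody g.
  apply: (@le_trans _ _ (`|g| * t3)); last by rewrite ler_wpM2l// lerDr addr_ge0.
  have fact0 : 0 < k`!%:R :> R by rewrite ltr0n fact_gt0.
  rewrite normrM (normrM D) [X in _ * X * _]ger0_norm ?invr_ge0 ?(ltW fact0)// mulrAC ler_pdivrMr//.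
  apply: (le_trans (ler_pM (normr_ge0 _) (normr_ge0 _) kap EA)).
  rewrite /t3 -/alpha; set S := \sum_(_ <= _ < _) _.
  have S0 : 0 <= S by apply: sumr_ge0 => l _; rewrite mulr_ge0 ?powR_ge0// exprn_ge0.
  have -> : k`!%:R * g * (card n `^ (- ((k%:R - 1) / 2)) * S) * holder k.-1 1 f =
    g * (holder k.-1 1 f * card n `^ (- ((k%:R - 1) / 2)) * S) * k`!%:R by ring.
  by rewrite ler_wpM2r ?(ltW fact0)// ler_wpM2r ?ler_norm// !mulr_ge0// powR_ge0.
- exists (k`!%:R * (genogram_sum_const d k r K * c ^+ k.+1)).
  by apply: filterS var_e => n en m _; exact: kappa_le.
- by move=> n m dO' Omega' P' X' XX _; exact: kappa_tilde_same_law.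
Qed.
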